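(* Let $m\in\mathbb{R}$ and let $\Omega\subseteq\mathbb{R}^2$ be a nonempty open set. Let $\xi_0\in\mathbb{R}^2\setminus\{0\}$ and let $s_0:=\tan(\mathrm{Arg}(\xi_0))\in\mathbb{R}\cup\{\infty\}$ be the slope of the direction $\xi_0$. Let $f\in\mathcal{D}'(\Omega)$ be a real-valued distribution and let $x_0\in\operatorname{sing\,supp}(f)$. Then the two points $(x_0,\pm\xi_0)$ are not in the Sobolev wavefront set of order $m$ of $f$, i.e. $(x_0,\pm\xi_0)\notin \mathrm{WF}_m(f)$, if and only if there exists $r_0>0$ such that $$\int_{0}^{1}\int_{s_0-r_0}^{s_0+r_0}\int_{B_{r_0}(x_0)}\left|\mathcal{SH}_{\psi}f(a,s,t)\right|^2a^{-2m-3}\,dt\,ds\,da<\infty\quad\text{if } |s_0|<2,$$ and $$\int_{0}^{1}\int_{\frac1{s_0}-r_0}^{\frac1{s_0}+r_0}\int_{B_{r_0}(x_0)}\left|\mathcal{SH}^{(v)}_{\psi}f(a,s,t)\right|^2a^{-2m-3}\,dt\,ds\,da<\infty\quad\text{if } |s_0|>\tfrac12 .$$ If $f$ cannot be regarded as a tempered distribution on $\mathbb{R}^2$, then $f$ in both integrals is understood to be replaced by $\varphi f$, where $\varphi\in\mathcal{D}(\Omega)$ takes value $1$ in a neighborhood of $x_0$.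
   Context: Notation. $\mathcal{D}(\Omega)$ is the space of compactly supported $C^\infty$ functions on $\Omega$ and $\mathcal{D}'(\Omega)$ its dual (distributions). $B_{r}(x_0):=\{t\in\mathbb{R}^2: |t-x_0|<r\}$. The Fourier transform is $\widehat f(\xi)=\int f(x)e^{-2\pi i x\cdot\xi}dx$, extended to tempered distributions. $\mathrm{Arg}(\xi)$ is the principal angle of $\xi\in\mathbb{R}^2\setminus\{0\}$, identified with a complex number. When $s_0=\infty$, $1/s_0:=0$. Shearlets. Fix $\psi_1,\psi_2$ with: (C1) $\psi_1\in L^2(\mathbb{R})$, $\int_0^\infty|\widehat{\psi_1}(a)|^2\frac{da}{a}=\int_0^\infty|\widehat{\psi_1}(-a)|^2\frac{da}{a}=1$, $\widehat{\psi_1}\in\mathcal{D}(\mathbb{R})$, $\operatorname{supp}\widehat{\psi_1}\subseteq[-2,-\frac12]\cup[\frac12,2]$; (C2) $\|\widehat{\psi_2}\|_{L^2}=1$, $\widehat{\psi_2}\in\mathcal{D}(\mathbb{R})$, $\operatorname{supp}\widehat{\psi_2}\subseteq[-1,1]$. Define $\psi\in L^2(\mathbb{R}^2)$ by $\widehat\psi(\xi_1,\xi_2)=\widehat{\psi_1}(\xi_1)\widehat{\psi_2}(\xi_2/\xi_1)$ for $\xi_1\ne0$. For $a>0$, $s\in\mathbb{R}$, $t\in\mathbb{R}^2$ let $M_{as}:=\begin{bmatrix}a&-\sqrt a\,s\\0&\sqrt a\end{bmatrix}$ and $\psi_{ast}:=a^{-3/4}\psi(M_{as}^{-1}(\cdot-t))$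 (a Schwartz function). With $J(x,y):=(y,x)$, let $\psi^{(v)}_{ast}:=a^{-3/4}\psi(M_{as}^{-1}J(\cdot-t))$. The horizontal and vertical continuous shearlet transforms of a tempered distribution $f$ are $\mathcal{SH}_\psi f(a,s,t):=\langle f,\psi_{ast}\rangle$ and $\mathcal{SH}^{(v)}_\psi f(a,s,t):=\langle f,\psi^{(v)}_{ast}\rangle$, where $\langle\cdot,\cdot\rangle$ is the (sesquilinear) pairing extending the $L^2$ inner product, conjugate-linear in the second argument. Singular support and Sobolev wavefront set. For $f\in\mathcal{D}'(\Omega)$, a point $x_0\in\Omega$ is not in $\operatorname{sing\,supp}(f)$ if there is $\varphi\in\mathcal{D}(\Omega)$ with $\varphi=1$ near $x_0$ and $\varphi f\in C^\infty(\Omega)$. For $\xi_0\in\mathbb{R}^2\setminus\{0\}$ and $0<\epsilon<\pi/2$ let $V_{\xi_0,\epsilon}:=\{(r\cos\theta,r\sin\theta): r>0,\ |\theta-\mathrm{Arg}(\xi_0)|<\epsilon\}$. For $x_0\in\operatorname{sing\,supp}(f)$, $\xi_0\in\mathbb{R}^2\setminus\{0\}$ and $m\in\mathbb{R}$, $(x_0,\xi_0)\notin \mathrm{WF}_m(f)$ means that there exist $\varphi\in\mathcal{D}(\Omega)$ and $0<\epsilon<\pi/2$ with $\varphi=1$ in a neighborhood of $x_0$ and $\int_{V_{\xi_0,\epsilon}}(1+|\xi|^2)^m|\widehat{\varphi f}(\xi)|^2d\xi<\infty$. *)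

(* Defs.v *)
(* MathComp-Analysis; C is R[i] from mathcomp-real-closed, R^2 is R * R with
   the product Lebesgue measure. *)
From HB Require Import structures.
From mathcomp Require Import all_boot all_order all_algebra.
From mathcomp Require Import all_classical all_reals all_analysis.
From mathcomp Require Import complex.
Set Implicit Arguments.
Unset Strict Implicit.
Unset Printing Implicit Defensive.
Import Order.TTheory GRing.Theory Num.Theory.
Import numFieldNormedType.Exports.
Local Open Scope classical_set_scope.
Local Open Scope ring_scope.
Local Open Scope complex_scope.
Local Notation Re := complex.Re.
Local Notation Im := complex.Im.
Local Notation normc := ComplexField.Normc.normc.

Section complex_functions.
Context {R : realType}.

Definition abs2 (z : R[i]) : R := Re z ^+ 2 + Im z ^+ 2.

(* e^{i x} *)
Definition cis (x : R) : R[i] := cos x +i* sin x.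

Definition cintegral d (T : measurableType d) (mu : {measure set T -> \bar R})
    (D : set T) (u : T -> R[i]) : R[i] :=
  Rintegral mu D (fun x => Re (u x)) +i* Rintegral mu D (fun x => Im (u x)).

Definition cintegrable d (T : measurableType d)
    (mu : {measure set T -> \bar R}) (D : set T) (u : T -> R[i]) : Prop :=
  mu.-integrable D (fun x => (Re (u x))%:E) /\
  mu.-integrable D (fun x => (Im (u x))%:E).

Definition L2 d (T : measurableType d) (mu : {measure set T -> \bar R})
    (u : T -> R[i]) : Prop :=
  [/\ measurable_fun setT (fun x => Re (u x)),
      measurable_fun setT (fun x => Im (u x)) &
      (\int[mu]_x (abs2 (u x))%:E < +oo)%E].

End complex_functions.

(* V is R or R * R below. *)
Section test_functions.
Context {R : realType} {V : normedModType R}.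
Implicit Types (Om K : set V) (u phi eta : V -> R[i]) (vs : seq V).

(* Iterated directional derivative along the vectors in vs; partial
   derivatives are those with vs made of basis vectors. *)
Definition iter_derive vs (u : V -> R) : V -> R :=
  foldr (fun v (w : V -> R^o) => (fun x => 'D_v w x) : V -> R) u vs.

Definition iter_cderive vs u (x : V) : R[i] :=
  iter_derive vs (fun y => Re (u y)) x +i* iter_derive vs (fun y => Im (u y)) x.

Definition smooth_on Om u : Prop := forall vs x, Om x ->
  differentiable (iter_derive vs (fun y => Re (u y)) : V -> R^o) x /\
  differentiable (iter_derive vs (fun y => Im (u y)) : V -> R^o) x.

Definition closed_support u : set V := closure [set x | u x != 0].

(* phi \in D(Om), as a function on the whole space *)
Definition test_function Om phi : Prop :=
  [/\ smooth_on setT phi, compact (closed_support phi) & closed_support phi `<=` Om].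

Definition schwartz eta : Prop :=
  smooth_on setT eta /\
  forall (N : nat) vs, exists c : R, forall x,
    (1 + `|x|) ^+ N * normc (iter_cderive vs eta x) <= c.

(* A finite number on Schwartz functions, hence on test functions. *)
Definition seminorm (N : nat) vs u : R :=
  sup (range (fun x => (1 + `|x|) ^+ N * normc (iter_cderive vs u x))).

(* Functionals are total on V -> C; only their values on test functions
   (resp. Schwartz functions) are meaningful. *)
Definition linear_on (Q : (V -> R[i]) -> Prop) (f : (V -> R[i]) -> R[i]) :=
  forall (c : R[i]) u eta, Q u -> Q eta ->
    f (fun x => c * u x + eta x) = c * f u + f eta.

Definition is_distribution Om (f : (V -> R[i]) -> R[i]) : Prop :=
  linear_on (test_function Om) f /\
  forall K, compact K -> K `<=` Om ->
    exists (c : R) (L : seq (seq V)), forall phi,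
      test_function Om phi -> closed_support phi `<=` K ->
      normc (f phi) <= c * \sum_(vs <- L) seminorm 0 vs phi.

Definition tempered (g : (V -> R[i]) -> R[i]) : Prop :=
  linear_on schwartz g /\
  exists (c : R) (N : nat) (L : seq (seq V)), forall eta,
    schwartz eta -> normc (g eta) <= c * \sum_(vs <- L) seminorm N vs eta.

Definition real_distribution Om (f : (V -> R[i]) -> R[i]) : Prop :=
  forall phi, test_function Om phi -> (forall x, Im (phi x) = 0) ->
    Im (f phi) = 0.

Definition mul_distr phi (f : (V -> R[i]) -> R[i]) : (V -> R[i]) -> R[i] :=
  fun eta => f (fun x => phi x * eta x).

(* phi \in D(Om) and phi = 1 in a neighborhood of x0 *)
Definition cutoff Om (x0 : V) phi : Prop :=
  test_function Om phi /\ \forall x \near x0, phi x = 1.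

Definition extends Om (g f : (V -> R[i]) -> R[i]) : Prop :=
  forall phi, test_function Om phi -> g phi = f phi.

(* g is f viewed as a tempered distribution when that is possible, and
   otherwise g is a localization of f at x0. *)
Definition tempered_version Om (x0 : V) (f g : (V -> R[i]) -> R[i]) : Prop :=
  (tempered g /\ extends Om g f) \/
  (~ (exists h, tempered h /\ extends Om h f) /\
   exists2 phi, cutoff Om x0 phi & g = mul_distr phi f).

(* <g, u>, conjugate-linear in u; g u itself is the bilinear pairing. *)
Definition pairing (g : (V -> R[i]) -> R[i]) u : R[i] := g (fun x => (u x)^*).

End test_functions.

Section fourier.
Context {R : realType}.

Definition leb1 : {measure set (measurableTypeR R) -> \bar R} :=
  @lebesgue_measure R.

Definition leb2 :
    {measure set (measurableTypeR R * measurableTypeR R)%type -> \bar R} :=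
  (@lebesgue_measure R \x @lebesgue_measure R)%E.

Definition dot (x y : R * R) : R := x.1 * y.1 + x.2 * y.2.

Definition enorm (x : R * R) : R := Num.sqrt (dot x x).

Definition eball (r : R) (x0 : R * R) : set (R * R) :=
  [set t | enorm (t - x0) < r].

Definition fourier1 (u : R -> R[i]) (xi : R) : R[i] :=
  cintegral leb1 setT (fun x => u x * cis (- (2 * pi * (x * xi)))).

Definition fourier2 (u : R * R -> R[i]) (xi : R * R) : R[i] :=
  cintegral leb2 setT (fun x => u x * cis (- (2 * pi * dot x xi))).

(* The functional f is integration over D against the function h, on all
   functions satisfying Q. *)
Definition represents d (T : measurableType d)
    (mu : {measure set T -> \bar R}) (D : set T) (Q : (T -> R[i]) -> Prop)
    (f : (T -> R[i]) -> R[i]) (h : T -> R[i]) : Prop :=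
  forall eta, Q eta -> cintegrable mu D (fun x => h x * eta x) /\
    f eta = cintegral mu D (fun x => h x * eta x).

Definition schwartz1 : (R -> R[i]) -> Prop := @schwartz R R^o.
Definition schwartz2 : (R * R -> R[i]) -> Prop := @schwartz R (R^o * R^o)%type.

Definition regular1 (u : R -> R[i]) (eta : R -> R[i]) : R[i] :=
  cintegral leb1 setT (fun x => u x * eta x).

Definition regular2 (u : R * R -> R[i]) (eta : R * R -> R[i]) : R[i] :=
  cintegral leb2 setT (fun x => u x * eta x).

(* Fourier transform of tempered distributions, by duality *)
Definition fourier_distr1 (g : (R -> R[i]) -> R[i]) (eta : R -> R[i]) : R[i] :=
  g (fourier1 eta).

Definition fourier_distr2 (g : (R * R -> R[i]) -> R[i])
  (eta : R * R -> R[i]) : R[i] := g (fourier2 eta).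

(* The Fourier transform of the function u, in the sense of tempered
   distributions (for u in L^2, the Plancherel one), is the function v. *)
Definition is_fourier1 (u v : R -> R[i]) : Prop :=
  represents leb1 setT schwartz1 (regular1 u) u /\
  represents leb1 setT schwartz1 (fourier_distr1 (regular1 u)) v.

Definition is_fourier2 (u v : R * R -> R[i]) : Prop :=
  represents leb2 setT schwartz2 (regular2 u) u /\
  represents leb2 setT schwartz2 (fourier_distr2 (regular2 u)) v.

End fourier.

Section wavefront.
Context {R : realType}.
Implicit Types (Om : set (R * R)) (f : (R * R -> R[i]) -> R[i]).

(* Principal angle, in ]-pi, pi] *)
Definition Arg (xi : R * R) : R :=
  if 0 <= xi.2 then acos (xi.1 / enorm xi) else - acos (xi.1 / enorm xi).

(* tan (Arg xi), with +oo standing for the unsigned infinite slope *)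
Definition slope (xi : R * R) : \bar R :=
  if cos (Arg xi) == 0 then +oo%E else (tan (Arg xi))%:E.

(* 1 / s, with 1 / oo = 0 *)
Definition slope_inv (s : \bar R) : R :=
  if s is r%:E then r^-1 else 0.

Definition cone (xi0 : R * R) (eps : R) : set (R * R) :=
  [set xi | exists r theta : R,
    [/\ 0 < r, `|theta - Arg xi0| < eps & xi = (r * cos theta, r * sin theta)]].

Definition sing_supp Om f : set (R * R) :=
  [set x0 | Om x0 /\ ~ exists phi g : R * R -> R[i],
    [/\ cutoff (V := (R^o * R^o)%type) Om x0 phi,
        smooth_on (V := (R^o * R^o)%type) Om g &
        represents leb2 Om (test_function (V := (R^o * R^o)%type) Om)
          (mul_distr phi f) g]].

(* h is the Fourier transform of phi f, a function since phi f is compactly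
   supported. *)
Definition sobolev_microregular (m : R) Om f (x0 xi0 : R * R) : Prop :=
  exists (phi : R * R -> R[i]) (eps : R) (h : R * R -> R[i]),
    [/\ cutoff (V := (R^o * R^o)%type) Om x0 phi,
        0 < eps < pi / 2,
        represents leb2 setT schwartz2 (fourier_distr2 (mul_distr phi f)) h &
        (\int[leb2]_(xi in cone xi0 eps)
           ((1 + enorm xi ^+ 2) `^ m * abs2 (h xi))%:E < +oo)%E].

Definition WF (m : R) Om f : set ((R * R) * (R * R)) :=
  [set p | [/\ sing_supp Om f p.1, p.2 != 0 &
               ~ sobolev_microregular m Om f p.1 p.2]].

End wavefront.

Section shearlets.
Context {R : realType}.

(* psi1h and psi2h are the Fourier transforms of psi1 and psi2. *)
Definition shearlet_C1 (psi1 psi1h : R -> R[i]) : Prop :=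
  [/\ L2 leb1 psi1 /\ is_fourier1 psi1 psi1h,
      (\int[leb1]_(a in `]0%R, +oo[) (abs2 (psi1h a) / a)%:E = 1)%E,
      (\int[leb1]_(a in `]0%R, +oo[) (abs2 (psi1h (- a)) / a)%:E = 1)%E,
      test_function (V := R^o) setT psi1h &
      closed_support (V := R^o) psi1h `<=` `[-2, - 2^-1] `|` `[2^-1, 2]].

Definition shearlet_C2 (psi2 psi2h : R -> R[i]) : Prop :=
  [/\ is_fourier1 psi2 psi2h,
      (\int[leb1]_x (abs2 (psi2h x))%:E = 1)%E,
      test_function (V := R^o) setT psi2h &
      closed_support (V := R^o) psi2h `<=` `[-1, 1]].

(* Continuity selects, in the L^2 class of psi, the representative whose
   pointwise values enter the shearlets below.  The values of the Fourier
   transform on the null set xi.1 = 0 are irrelevant. *)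
Definition shearlet_psi (psi1h psi2h : R -> R[i]) (psi : R * R -> R[i]) : Prop :=
  [/\ L2 leb2 psi,
      continuous (fun x : R * R => Re (psi x)),
      continuous (fun x : R * R => Im (psi x)) &
      is_fourier2 psi (fun xi => psi1h xi.1 * psi2h (xi.2 / xi.1))].

Definition shear_mx (a s : R) : 'M[R]_2 :=
  \matrix_(i < 2, j < 2)
    if i == 0 then (if j == 0 then a else - (Num.sqrt a * s))
    else (if j == 0 then 0 else Num.sqrt a).

Definition mx_act (A : 'M[R]_2) (x : R * R) : R * R :=
  (A 0 0 * x.1 + A 0 1 * x.2, A 1 0 * x.1 + A 1 1 * x.2).

Definition swap (x : R * R) : R * R := (x.2, x.1).

Definition shearlet (psi : R * R -> R[i]) (a s : R) (t x : R * R) : R[i] :=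
  (a `^ (- (3 / 4)))%:C * psi (mx_act (invmx (shear_mx a s)) (x - t)).

Definition vshearlet (psi : R * R -> R[i]) (a s : R) (t x : R * R) : R[i] :=
  (a `^ (- (3 / 4)))%:C * psi (mx_act (invmx (shear_mx a s)) (swap (x - t))).

Definition SH (psi : R * R -> R[i]) (g : (R * R -> R[i]) -> R[i])
    (a s : R) (t : R * R) : R[i] :=
  pairing (V := (R^o * R^o)%type) g (shearlet psi a s t).

Definition SHv (psi : R * R -> R[i]) (g : (R * R -> R[i]) -> R[i])
    (a s : R) (t : R * R) : R[i] :=
  pairing (V := (R^o * R^o)%type) g (vshearlet psi a s t).

(* Integral of |S(a, s, t)|^2 a^(-2m-3) over a in ]0, 1[, s at distance less
   than r from s1, and t in the ball of radius r around x0 *)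
Definition shearlet_integral (m : R) (S : R -> R -> R * R -> R[i])
    (s1 : R) (x0 : R * R) (r : R) : \bar R :=
  (\int[leb1]_(a in `]0%R, 1%R[) \int[leb1]_(s in `](s1 - r)%R, (s1 + r)%R[)
     \int[leb2]_(t in eball r x0)
       (abs2 (S a s t) * a `^ (- (2 * m) - 3))%:E)%E.

End shearlets.

(* Main.v *)
Require Import Defs.
From HB Require Import structures.
From mathcomp Require Import all_boot all_order all_algebra.
From mathcomp Require Import all_classical all_reals all_analysis.
From mathcomp Require Import measurable_realfun complex ring lra.

(* The shearlet coefficient of f at (a, s, t) pairs f with a molecule whose Fourier transform is a
   window W_{a,s} of modulus at most C a^(3/4), living where |xi| ~ 1/a and the slope of xi is
   within sqrt a of s, times a phase that translates the molecule to t.  The analysis rests on two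
   facts: a molecule is negligible (smaller than every power of a) away from t, so that only phi f
   near x0 matters; and int int |W_{a,s}(xi)|^2 a^(-2m-3) da ds is comparable to (1 + |xi|)^(2m).

   From WF_m to shearlets: for t near x0, the coefficient is the inverse Fourier transform at t of
   (phi f)^ W_{a,s}, up to a negligible error.  Bessel's inequality in t followed by Tonelli bounds
   the shearlet integral by the integral of (1 + |xi|)^(2m) |(phi f)^|^2 over a double cone.

   From shearlets to WF_m: (phi f)^ W_{a,s} is the Fourier transform of phi times the coefficients,
   plus a commutator.  W_{a,s} is Lipschitz with constant of order a^(3/4) sqrt a, so the commutator
   gains half a Sobolev order over (chi f)^ with chi = 1 on the support of phi.  As (chi f)^ has
   polynomial growth, finitely many steps, each with a smaller cone and a smaller neighborhood of
   x0, reach the order m.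

   The coefficients are never shown to be measurable in (a, s): integrals of nonnegative functions
   are suprema over simple functions, and only their monotonicity is used on such integrands. *)

Set Implicit Arguments.
Unset Strict Implicit.
Unset Printing Implicit Defensive.
Import Order.TTheory GRing.Theory Num.Theory.
Import numFieldNormedType.Exports.
Local Open Scope classical_set_scope.
Local Open Scope ring_scope.
Local Open Scope complex_scope.
Local Notation Re := complex.Re.
Local Notation Im := complex.Im.
Local Notation normc := ComplexField.Normc.normc.

(** Functionals are abstract linear maps, and two bridges connect them with functions:
    [interchange], which turns the value of g on phi times [fourier2 eta] into the integral of eta
    against the continuous function [Ftr g phi], and [kappaP], which gives Fourier inversion and
    Plancherel up to a positive constant. The windows charge both signs of the first frequency
    coordinate, which is why the points with xi0 and - xi0 are treated together. Regularity at these
    two points comes with two unrelated cutoffs; the forward direction reconciles them by splitting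
    the window into its two halves. In the bootstrap, |W|^2 is of size a^(3/2) and the square of the
    Lipschitz constant is of size a^(5/2): the quotient a is one power of the weight (1 + |xi|) in
    the energy of exponent 2m. The commutator also mixes frequencies z outside the sector into xi
    inside a narrower one; there |z - xi| is at least a fraction of |z|, and the rapid decay of the
    kernel beats the polynomial growth of the transform. *)

Section complex_numbers.
Context {R : realType}.
Implicit Types (z w : R[i]) (x y : R).

Lemma Re_mulc z w : Re (z * w) = Re z * Re w - Im z * Im w.
Proof. by case: z w => [a b] [c d]. Qed.

Lemma Im_mulc z w : Im (z * w) = Re z * Im w + Im z * Re w.
Proof. by case: z w => [a b] [c d]. Qed.

Lemma Re_addc z w : Re (z + w) = Re z + Re w.
Proof. by case: z w => [a b] [c d]. Qed.

Lemma Im_addc z w : Im (z + w) = Im z + Im w.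
Proof. by case: z w => [a b] [c d]. Qed.

Lemma Re_oppc z : Re (- z) = - Re z.
Proof. by case: z. Qed.

Lemma Im_oppc z : Im (- z) = - Im z.
Proof. by case: z. Qed.

Lemma complexP z w : Re z = Re w -> Im z = Im w -> z = w.
Proof. by case: z w => [a b] [c d] /= -> ->. Qed.

Lemma normcE z : normc z = Num.sqrt (abs2 z).
Proof. by case: z. Qed.

Lemma abs2_ge0 z : 0 <= abs2 z.
Proof. by rewrite addr_ge0 ?sqr_ge0. Qed.

Lemma abs2E z : abs2 z = normc z ^+ 2.
Proof. by rewrite normcE sqr_sqrtr ?abs2_ge0. Qed.

Lemma normc_ge0 z : 0 <= normc z.
Proof. by rewrite normcE sqrtr_ge0. Qed.

Lemma normcM z w : normc (z * w) = normc z * normc w.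
Proof. exact: ComplexField.Normc.normcM. Qed.

Lemma normcD z w : normc (z + w) <= normc z + normc w.
Proof. exact: le_normcD. Qed.

Lemma normcN z : normc (- z) = normc z.
Proof. by case: z => a b /=; rewrite !sqrrN. Qed.

Lemma normcB z w : normc (z - w) <= normc z + normc w.
Proof. by rewrite (le_trans (normcD _ _))// normcN. Qed.

Lemma normc0 : normc (0 : R[i]) = 0.
Proof. by rewrite /= expr0n/= addr0 sqrtr0. Qed.

Lemma normcC x : normc x%:C = `|x|.
Proof. by rewrite /= expr0n/= addr0 sqrtr_sqr. Qed.

Lemma normc_cis x : normc (cis x) = 1.
Proof. by rewrite /= cos2Dsin2 sqrtr1. Qed.

Lemma abs2M z w : abs2 (z * w) = abs2 z * abs2 w.
Proof. by rewrite !abs2E normcM exprMn. Qed.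

Lemma le_normc_Re z : `|Re z| <= normc z.
Proof.
rewrite normcE -sqrtr_sqr ler_sqrt ?abs2_ge0// /abs2 lerDl.
exact: sqr_ge0.
Qed.

Lemma le_normc_Im z : `|Im z| <= normc z.
Proof.
rewrite normcE -sqrtr_sqr ler_sqrt ?abs2_ge0// /abs2 lerDr.
exact: sqr_ge0.
Qed.

Lemma normc_le_ReIm z : normc z <= `|Re z| + `|Im z|.
Proof.
have h : 0 <= `|Re z| + `|Im z| by rewrite addr_ge0.
rewrite normcE -(ger0_norm h) -sqrtr_sqr ler_sqrt ?sqr_ge0// sqrrD -!normrX.
rewrite (ger0_norm (sqr_ge0 _)) (ger0_norm (sqr_ge0 _)) /abs2 lerD2r lerDl.
by rewrite mulrn_wge0// mulr_ge0.
Qed.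

Lemma cisD x y : cis (x + y) = cis x * cis y.
Proof.
apply: complexP; rewrite ?(Re_mulc, Im_mulc)/=; first exact: cosD.
by rewrite sinD addrC [X in X + _]mulrC [X in X + _]mulrC.
Qed.

Lemma cis0 : cis 0 = 1 :> R[i].
Proof. by rewrite /cis cos0 sin0. Qed.

Lemma cis_conj x : (cis x)^* = cis (- x).
Proof. by rewrite /cis cosN sinN. Qed.

End complex_numbers.

(** * Smooth complex-valued functions *)

Section smooth_calculus.
Context {R : realType} {V : normedModType R}.
Implicit Types (u w : V -> R[i]) (v x : V).

Definition cdiff u x :=
  differentiable (fun y => Re (u y) : R^o) x /\
  differentiable (fun y => Im (u y) : R^o) x.

Definition cD v u : V -> R[i] := fun x =>
  'D_v (fun y => Re (u y) : R^o) x +i* 'D_v (fun y => Im (u y) : R^o) x.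

(** Peels off the innermost derivative, so that closure properties follow by induction on n with u
    generalized. [iter_derive] adds its derivatives on the outside; [csmooth_onP] reconciles the
    two. *)
Fixpoint cCn n u := if n is n'.+1 then
  (forall x, cdiff u x) /\ forall v, cCn n' (cD v u) else True.

Definition csmooth u := forall n, cCn n u.

Lemma iter_cderiveE vs u : iter_cderive vs u = foldr cD u vs.
Proof.
elim: vs => [|v vs IH]; rewrite /iter_cderive /=.
  by apply/funext => x; case: (u x).
by rewrite -IH.
Qed.

Lemma csmoothS u : csmooth u <-> (forall x, cdiff u x) /\ forall v, csmooth (cD v u).
Proof.
split=> [su|[du sD] [|n]//=]; last by split=> // v; exact: sD.
split; first by have [H _] := su 1%N; exact: H.
by move=> v n; have [_ H] := su n.+1; exact: H.
Qed.

Lemma csmooth_foldr vs u : csmooth u -> csmooth (foldr cD u vs).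
Proof. by move=> su; elim: vs => //= v vs /csmoothS[_]; exact. Qed.

Lemma csmooth_onP u : smooth_on setT u <-> csmooth u.
Proof.
split=> [su n|su vs x _].
- elim: n u su => //= n IH u su; split=> [x|v]; first exact: (su [::] x).
  (* [rcons] puts v next to u, so that the remaining derivatives fall on [cD v u]. *)
  apply: IH => vs x _; have := su (rcons vs v) x I.
  have H : iter_cderive (rcons vs v) u = iter_cderive vs (cD v u).
    by rewrite !iter_cderiveE foldr_rcons.
  have HR : iter_derive (rcons vs v) (fun y => Re (u y)) =
            iter_derive vs (fun y => Re (cD v u y)).
    by apply/funext => y; move/(congr1 (fun g => Re (g y))) : H.
  have HI : iter_derive (rcons vs v) (fun y => Im (u y)) =
            iter_derive vs (fun y => Im (cD v u y)).
    by apply/funext => y; move/(congr1 (fun g => Im (g y))) : H.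
  by rewrite HR HI.
- have /csmoothS[/(_ x)] := csmooth_foldr vs su.
  by rewrite -iter_cderiveE.
Qed.

Lemma cCnW n u : cCn n.+1 u -> cCn n u.
Proof. by elim: n u => // n IH u [du sD]; split=> // v; exact: IH. Qed.

Lemma cD_cst v (c : R[i]) : cD v (fun=> c) = fun=> 0.
Proof.
by apply/funext => x; apply: complexP => /=; exact: derive_cst.
Qed.

Lemma cCn_cst n (c : R[i]) : cCn n (fun=> c).
Proof.
elim: n c => //= n IH c; split=> [x|v]; last by rewrite cD_cst.
by split; exact: differentiable_cst.
Qed.

Lemma cdiff_derivable u x v : cdiff u x ->
  derivable (fun y => Re (u y) : R^o) x v /\ derivable (fun y => Im (u y) : R^o) x v.
Proof. by case=> ? ?; split; exact: diff_derivable. Qed.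

Lemma cdiffD u w x : cdiff u x -> cdiff w x -> cdiff (fun y => u y + w y) x.
Proof.
move=> [ur ui] [wr wi]; split.
  under [X in differentiable X _]funext do rewrite Re_addc.
  exact: differentiableD.
under [X in differentiable X _]funext do rewrite Im_addc.
exact: differentiableD.
Qed.

Lemma cDD u w x v : cdiff u x -> cdiff w x ->
  cD v (fun y => u y + w y) x = cD v u x + cD v w x.
Proof.
move=> /(cdiff_derivable v)[ur ui] /(cdiff_derivable v)[wr wi].
apply: complexP.
  rewrite Re_addc; apply: etrans (deriveD ur wr).
  by congr ('D_v _ x); apply/funext => y; rewrite Re_addc.
rewrite Im_addc; apply: etrans (deriveD ui wi).
by congr ('D_v _ x); apply/funext => y; rewrite Im_addc.
Qed.

Lemma cdiffM u w x : cdiff u x -> cdiff w x -> cdiff (fun y => u y * w y) x.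
Proof.
move=> [ur ui] [wr wi]; split.
  under [X in differentiable X _]funext do rewrite Re_mulc.
  by apply: differentiableB; exact: differentiableM.
under [X in differentiable X _]funext do rewrite Im_mulc.
by apply: differentiableD; exact: differentiableM.
Qed.

Lemma cDM u w x v : cdiff u x -> cdiff w x ->
  cD v (fun y => u y * w y) x = cD v u x * w x + u x * cD v w x.
Proof.
move=> /(cdiff_derivable v)[ur ui] /(cdiff_derivable v)[wr wi].
apply: complexP.
  rewrite Re_addc !Re_mulc; transitivity ('D_v ((fun y => Re (u y) : R^o) * (fun y => Re (w y) : R^o) -
      (fun y => Im (u y) : R^o) * (fun y => Im (w y) : R^o)) x).
    by congr ('D_v _ x); apply/funext => y; rewrite Re_mulc.
  rewrite (deriveB (derivableM ur wr) (derivableM ui wi)).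
  rewrite (deriveM ur wr) (deriveM ui wi) /cD /GRing.scale /=.
  move: ('D_v _ x) ('D_v _ x) ('D_v _ x) ('D_v _ x) => a b c d.
  by move: (Re _) (Im _) (Re _) (Im _) => e f g h; ring.
rewrite Im_addc !Im_mulc; transitivity ('D_v ((fun y => Re (u y) : R^o) * (fun y => Im (w y) : R^o) +
    (fun y => Im (u y) : R^o) * (fun y => Re (w y) : R^o)) x).
  by congr ('D_v _ x); apply/funext => y; rewrite Im_mulc.
rewrite (deriveD (derivableM ur wi) (derivableM ui wr)).
rewrite (deriveM ur wi) (deriveM ui wr) /cD /GRing.scale /=.
move: ('D_v _ x) ('D_v _ x) ('D_v _ x) ('D_v _ x) => a b c d.
by move: (Re _) (Im _) (Re _) (Im _) => e f g h; ring.
Qed.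

Lemma cCnD n u w : cCn n u -> cCn n w -> cCn n (fun y => u y + w y).
Proof.
elim: n u w => //= n IH u w [du sDu] [dw sDw]; split=> [x|v].
  exact: cdiffD.
rewrite (_ : cD v _ = fun x => cD v u x + cD v w x).
  by apply: IH.
by apply/funext => x; rewrite cDD.
Qed.

Lemma cCnM n u w : cCn n u -> cCn n w -> cCn n (fun y => u y * w y).
Proof.
elim: n u w => // n IH u w su sw.
have [du sDu] := su; have [dw sDw] := sw; split=> [x|v].
  exact: cdiffM.
rewrite (_ : cD v _ = fun x => cD v u x * w x + u x * cD v w x).
  by apply: cCnD; apply: IH; first [exact: sDu|exact: sDw|exact: cCnW].
by apply/funext => x; rewrite cDM.
Qed.

Lemma csmoothD u w : csmooth u -> csmooth w -> csmooth (fun y => u y + w y).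
Proof. by move=> su sw n; apply: cCnD; [exact: su|exact: sw]. Qed.

Lemma csmoothM u w : csmooth u -> csmooth w -> csmooth (fun y => u y * w y).
Proof. by move=> su sw n; apply: cCnM; [exact: su|exact: sw]. Qed.

Lemma csmooth_cst (c : R[i]) : csmooth (fun=> c).
Proof. by move=> n; exact: cCn_cst. Qed.

Lemma csmoothZ (c : R[i]) u : csmooth u -> csmooth (fun y => c * u y).
Proof. by move=> su; apply: csmoothM => //; exact: csmooth_cst. Qed.

Lemma cDZ (c : R[i]) u v : (forall x, cdiff u x) ->
  cD v (fun y => c * u y) = fun x => c * cD v u x.
Proof.
move=> du; apply/funext => x; rewrite cDM ?cD_cst ?mul0r ?add0r//.
Qed.

Lemma cdiff_conj u x : cdiff u x -> cdiff (fun y => (u y)^*) x.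
Proof.
move=> [ur ui]; split.
  rewrite (_ : (fun _ => _) = (fun y => Re (u y)))//.
  by apply/funext => y; case: (u y).
rewrite (_ : (fun _ => _) = (fun y => - Im (u y))); first exact: differentiableN.
by apply/funext => y; case: (u y).
Qed.

Lemma cD_conj u x v : cdiff u x -> cD v (fun y => (u y)^*) x = (cD v u x)^*.
Proof.
move=> /(cdiff_derivable v)[ur ui]; apply: complexP => /=.
  by congr ('D_v _ x); apply/funext => y; case: (u y).
rewrite -deriveN//; congr ('D_v _ x); apply/funext => y.
by rewrite /GRing.opp/=; case: (u y).
Qed.

Lemma csmooth_conj u : csmooth u -> csmooth (fun y => (u y)^*).
Proof.
move=> su n; elim: n u su => //= n IH u /csmoothS[du sD]; split=> [x|v].
  exact: cdiff_conj.
rewrite (_ : cD v _ = fun x => (cD v u x)^*); first exact: IH.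
by apply/funext => x; rewrite cD_conj.
Qed.

(** The pairs of complementary subsequences of [vs], with multiplicity: they index the terms of the
    Leibniz formula [foldr_cDM]. *)
Fixpoint splits (vs : seq V) : seq (seq V * seq V) :=
  if vs is v :: vs' then
    [seq (v :: p.1, p.2) | p <- splits vs'] ++ [seq (p.1, v :: p.2) | p <- splits vs']
  else [:: ([::], [::])].

Lemma cD_sum (I : Type) (s : seq I) (F : I -> V -> R[i]) v x :
  (forall i x, cdiff (F i) x) ->
  cD v (fun y => \sum_(i <- s) F i y) x = \sum_(i <- s) cD v (F i) x.
Proof.
move=> sF.
suff [] : cD v (fun y => \sum_(i <- s) F i y) x = \sum_(i <- s) cD v (F i) x /\
   cdiff (fun y => \sum_(i <- s) F i y) x by [].
elim: s => [|i s [IH1 IH2]].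
  rewrite big_nil (_ : (fun y => \sum_(_ <- _) _) = (fun=> 0)).
    by rewrite cD_cst; split=> //; split; exact: differentiable_cst.
  by apply/funext => y; rewrite big_nil.
rewrite big_cons (_ : (fun y => \sum_(_ <- _) _) =
  (fun y => F i y + \sum_(i <- s) F i y)).
  rewrite cDD// IH1; split=> //; exact: cdiffD.
by apply/funext => y; rewrite big_cons.
Qed.

Lemma foldr_cDM vs u w : csmooth u -> csmooth w ->
  foldr cD (fun y => u y * w y) vs =
  fun x => \sum_(p <- splits vs) foldr cD u p.1 x * foldr cD w p.2 x.
Proof.
move=> su sw; elim: vs => [|v vs IH] /=.
  by apply/funext => x; rewrite big_seq1.
apply/funext => x; rewrite IH cD_sum; last first.
  move=> p y; apply: cdiffM; last by have /csmoothS[] := csmooth_foldr p.2 sw.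
  by have /csmoothS[] := csmooth_foldr p.1 su.
rewrite big_cat !big_map /= -big_split/=; apply: eq_bigr => p _.
rewrite cDM//; last by have /csmoothS[] := csmooth_foldr p.2 sw.
by have /csmoothS[] := csmooth_foldr p.1 su.
Qed.

Lemma foldr_cDD vs u w : csmooth u -> csmooth w ->
  foldr cD (fun y => u y + w y) vs = fun x => foldr cD u vs x + foldr cD w vs x.
Proof.
move=> su sw; elim: vs => [//|v vs IH] /=.
apply/funext => x; rewrite IH cDD//; last by have /csmoothS[] := csmooth_foldr vs sw.
by have /csmoothS[] := csmooth_foldr vs su.
Qed.

Lemma foldr_cDZ vs (c : R[i]) u : csmooth u ->
  foldr cD (fun y => c * u y) vs = fun x => c * foldr cD u vs x.
Proof.
move=> su; elim: vs => [//|v vs IH] /=.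
by rewrite IH cDZ//; have /csmoothS[] := csmooth_foldr vs su.
Qed.

Lemma cD_dirD u x v1 v2 : cdiff u x -> cD (v1 + v2) u x = cD v1 u x + cD v2 u x.
Proof.
by move=> [ur ui]; apply: complexP; rewrite ?(Re_addc, Im_addc)/= !deriveE// linearD.
Qed.

Lemma cD_dirZ u x (k : R) v : cdiff u x -> cD (k *: v) u x = k%:C * cD v u x.
Proof.
move=> [ur ui]; apply: complexP; rewrite ?(Re_mulc, Im_mulc)/= !deriveE// linearZ/=.
  by rewrite mul0r subr0.
by rewrite mul0r addr0.
Qed.

End smooth_calculus.

(** * Differentiability from a quadratic remainder *)

Section quadratic_expansion.
Context {R : realType}.

(** A quadratic remainder is o(h). Characters, Fourier transforms and affine maps are all shown to
    be differentiable in this way, with an explicit differential L. *)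
Lemma diff_quadratic (V W : normedModType R) (f : V -> W) x (L : V -> W) (c C : R) :
  linear L -> (forall h, `|L h| <= c * `|h|) ->
  (forall h, `|f (x + h) - f x - L h| <= C * `|h| ^+ 2) ->
  differentiable f x /\ 'd f x = L :> (V -> W).
Proof.
move=> lL cL fL.
pose LL : {linear V -> W} := HB.pack L (GRing.isLinear.Build R V W *:%R L lL).
have cLL : continuous LL.
  apply: bounded_linear_continuous; rewrite /bounded_near; exists `|c|; split=> // M cM.
  apply/nbhs_ballP; exists 1 => //= h; rewrite -ball_normE/= sub0r normrN => h1.
  rewrite (le_trans (cL h))// (@le_trans _ _ (`|c| * `|h|))//.
    by rewrite ler_wpM2r// ler_norm.
  by rewrite (@le_trans _ _ `|c|)// ?ler_piMr// ltW.
have e : f \o shift x = cst (f x) + LL +o_ 0 id.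
  apply/eqaddoP => eps eps0.
  apply/nbhs_ballP; exists (eps / (`|C| + 1)); first by rewrite /= divr_gt0// ltr_wpDl.
  move=> h; rewrite -ball_normE/= sub0r normrN => hC.
  rewrite -[(_ - _) h]/(f (h + x) - (f x + L h)) opprD addrA (addrC h).
  rewrite (le_trans (fL h))// expr2 mulrA ler_wpM2r//.
  rewrite (@le_trans _ _ ((`|C| + 1) * `|h|))//.
    by rewrite ler_wpM2r// (le_trans (ler_norm C))// lerDl.
  by rewrite mulrC -ler_pdivlMr ?ltr_wpDl// ltW.
have d := diff_unique cLL e; split=> //.
by apply/diff_locallyP; rewrite d.
Qed.

Lemma cdiff_quadratic (V : normedModType R) (u : V -> R[i]) x (L : V -> R[i]) (c C : R) :
  (forall (k : R) g h, L (k *: g + h) = k%:C * L g + L h) ->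
  (forall h, normc (L h) <= c * `|h|) ->
  (forall h, normc (u (x + h) - u x - L h) <= C * `|h| ^+ 2) ->
  cdiff u x /\ forall v, cD v u x = L v.
Proof.
move=> lL cL uL.
have [dr er] : differentiable (fun y => Re (u y) : R^o) x /\
    'd (fun y => Re (u y) : R^o) x = (fun h => Re (L h) : R^o) :> (V -> R^o).
  apply: (@diff_quadratic _ _ _ _ _ c C).
  - by move=> k g h; rewrite lL Re_addc Re_mulc/= mul0r subr0.
  - by move=> h; exact: le_trans (le_normc_Re _) (cL h).
  - move=> h; apply: le_trans (uL h); apply: le_trans (le_normc_Re _).
    by rewrite !(Re_addc, Re_oppc).
have [di ei] : differentiable (fun y => Im (u y) : R^o) x /\
    'd (fun y => Im (u y) : R^o) x = (fun h => Im (L h) : R^o) :> (V -> R^o).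
  apply: (@diff_quadratic _ _ _ _ _ c C).
  - by move=> k g h; rewrite lL Im_addc Im_mulc/= mul0r addr0.
  - by move=> h; exact: le_trans (le_normc_Im _) (cL h).
  - move=> h; apply: le_trans (uL h); apply: le_trans (le_normc_Im _).
    by rewrite !(Im_addc, Im_oppc).
split=> // v; apply: complexP; rewrite /cD/= deriveE//.
  by rewrite er.
by rewrite ei.
Qed.

End quadratic_expansion.

(** * Chain rule and reciprocals *)

Section composition.
Context {R : realType}.

Lemma cdiff_comp (U V : normedModType R) (A : U -> V) (L : U -> V) (u : V -> R[i]) x :
  differentiable A x -> 'd A x = L :> (U -> V) -> cdiff u (A x) ->
  cdiff (u \o A) x /\ forall v, cD v (u \o A) x = cD (L v) u (A x).
Proof.
move=> dA eA [ur ui].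
have dr : differentiable ((fun y => Re (u y) : R^o) \o A) x by exact: differentiable_comp.
have di : differentiable ((fun y => Im (u y) : R^o) \o A) x by exact: differentiable_comp.
split; first by split.
move=> v; apply: complexP.
  apply: (@etrans _ _ ('d ((fun y => Re (u y) : R^o) \o A) x v)).
    exact: deriveE.
  by rewrite diff_comp//= eA -deriveE.
apply: (@etrans _ _ ('d ((fun y => Im (u y) : R^o) \o A) x v)).
  exact: deriveE.
by rewrite diff_comp//= eA -deriveE.
Qed.

(** The differential of A is the constant L, so a derivative of u \o A is again a derivative of u
    composed with A. *)
Lemma csmooth_comp_affine (U V : normedModType R) (A : U -> V) (L : U -> V) (u : V -> R[i]) :
  (forall x, differentiable A x /\ 'd A x = L :> (U -> V)) -> csmooth u ->
  csmooth (u \o A).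
Proof.
move=> hA su n; elim: n u su => //= n IH u /csmoothS[du sD]; split=> [x|v].
  by have [dA eA] := hA x; have [] := cdiff_comp dA eA (du _).
rewrite (_ : cD v _ = cD (L v) u \o A); first exact: IH.
apply/funext => x; have [dA eA] := hA x.
by have [_ ->] := cdiff_comp dA eA (du _).
Qed.

Lemma foldr_cD_comp_affine (U V : normedModType R) (A : U -> V) (L : U -> V) (u : V -> R[i]) vs :
  (forall x, differentiable A x /\ 'd A x = L :> (U -> V)) -> csmooth u ->
  foldr cD (u \o A) vs = foldr cD u (map L vs) \o A.
Proof.
move=> hA su; elim: vs => //= v vs ->.
apply/funext => x; have [dA eA] := hA x.
have [|_ ->//] := cdiff_comp (u := foldr cD u (map L vs)) dA eA.
by have /csmoothS[] := csmooth_foldr (map L vs) su.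
Qed.

(** A derivative of h(u(x)) is a derivative of u times h'(u(x)): induction on the order, for all h
    at once. *)
Lemma csmooth_comp_real (V : normedModType R) (h : R -> R[i]) (u : V -> R) :
  csmooth (V := R^o) h -> csmooth (fun x => (u x)%:C) -> csmooth (fun x => h (u x)).
Proof.
move=> sh su n; elim: n h sh => // n IH h sh.
have [dh sDh] := (csmoothS _).1 sh; have [du sDu] := (csmoothS _).1 su.
have E x : cdiff (fun x => h (u x)) x /\ forall v, cD v (fun x => h (u x)) x =
    cD v (fun x => (u x)%:C) x * cD (V := R^o) 1 h (u x).
  have [dr _] := du x.
  have [|d e] := @cdiff_comp V R^o (u : V -> R^o) _ (h : R^o -> R[i]) x dr erefl.
    exact: dh.
  split=> // v; rewrite e -deriveE//.
  rewrite -[X in cD X]mulr1 (cD_dirZ (V := R^o) ('D_v (u : V -> R^o) x) 1 (dh _)).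
  congr (_ * _); apply: complexP => //=.
  by rewrite derive_cst.
split=> [x|v]; first by have [] := E x.
rewrite (_ : cD v _ = fun x => cD v (fun x => (u x)%:C) x * cD (V := R^o) 1 h (u x)).
  apply: cCnM; [exact: sDu|apply: IH; exact: sDh].
by apply/funext => x; have [_ ->] := E x.
Qed.

(** The derivative of 1/u is - D u times (1/u)^2, whose factors 1/u are covered by the induction
    hypothesis one order lower. *)
Lemma csmooth_inv (V : normedModType R) (u : V -> R) : (forall x, u x != 0) ->
  csmooth (fun x => (u x)%:C) -> csmooth (fun x => ((u x)^-1)%:C).
Proof.
move=> u0 su; have [du sDu] := (csmoothS _).1 su.
have d x : differentiable (fun x => (u x)^-1 : R^o) x.
  by have [dr _] := du x; exact: differentiableV.
elim=> // n IH; split=> [x|v].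
  by split=> //=; exact: differentiable_cst.
rewrite (_ : cD v _ = fun x => ((-1)%:C * cD v (fun x => (u x)%:C) x) *
   (((u x)^-1)%:C * ((u x)^-1)%:C)).
  apply: cCnM; last exact: cCnM.
  apply: cCnM; first exact: cCn_cst.
  exact: sDu.
apply/funext => x; have [/(diff_derivable (v:=v)) dr _] := du x.
apply: complexP.
  rewrite [LHS](deriveV (u0 x) dr) !(Re_mulc, Im_mulc)/= /GRing.scale/= derive_cst.
  by move: ('D_v _ x) => a; field; exact: u0.
rewrite [LHS]derive_cst !(Re_mulc, Im_mulc)/= derive_cst.
by move: ('D_v _ x) => a; ring.
Qed.

End composition.

(** * Taylor bounds for the exponential *)

Section trigonometry.
Context {R : realType}.

(** M bounds df only within distance |b - a| of a, and may thus depend on that distance: this is how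
    the linear bounds [sin_le] and [cos_le] yield the quadratic ones. *)
Lemma le_lipschitz (f df : R -> R) (M a b : R) :
  (forall x : R, is_derive x 1 f (df x)) ->
  (forall x, `|x - a| <= `|b - a| -> `|df x| <= M) ->
  `|f b - f a| <= M * `|b - a|.
Proof.
move=> fd dM.
have H (c d : R) : c <= d -> (forall x, c <= x <= d -> `|df x| <= M) ->
    `|f d - f c| <= M * `|d - c|.
  rewrite le_eqVlt => /predU1P[->|cd] HM; first by rewrite !subrr normr0 mulr0.
  have [|e /andP[ce ed] ->] := @MVT R f df c d cd (fun x _ => fd x).
    by apply: continuous_subspaceT => x; apply: differentiable_continuous; apply/derivable1_diffP.
  rewrite normrM ler_wpM2r// HM//.
  by rewrite !bnd_simp in ce ed; rewrite !ltW.
have [ab|/ltW ba] := leP a b.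
  apply: H => // x /andP[ax xb]; apply: dM; rewrite !ger0_norm ?subr_ge0//.
  by rewrite lerD2r.
rewrite distrC (distrC b); apply: H => // x /andP[bx xa]; apply: dM.
rewrite distrC (distrC b) !ger0_norm ?subr_ge0// lerD2l lerN2//.
Qed.

Lemma sin_le (x : R) : `|sin x| <= `|x|.
Proof.
rewrite -[sin x]subr0 -(sin0 R) -[in leRHS](subr0 x) -[leRHS]mul1r.
by apply: (@le_lipschitz sin cos) => // y _; exact: cos_max.
Qed.

Lemma cos_le (x : R) : `|cos x - 1| <= `|x|.
Proof.
rewrite -(cos0 R) -[in leRHS](subr0 x) -[leRHS]mul1r.
apply: (@le_lipschitz cos (fun x => - sin x)) => // y _; rewrite normrN.
exact: sin_max.
Qed.

Lemma sin_quad (x : R) : `|sin x - x| <= x ^+ 2.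
Proof.
have -> : sin x - x = (sin x - x) - (sin 0 - 0) by rewrite sin0 !subr0.
have -> : x ^+ 2 = `|x| * `|x - 0| by rewrite subr0 -normrM -expr2 ger0_norm ?sqr_ge0.
apply: (@le_lipschitz (fun x => sin x - x) (fun x => cos x - 1)) => // y.
by rewrite !subr0; exact: le_trans (cos_le y).
Qed.

Lemma cos_quad (x : R) : `|cos x - 1| <= x ^+ 2.
Proof.
have -> : x ^+ 2 = `|x| * `|x - 0| by rewrite subr0 -normrM -expr2 ger0_norm ?sqr_ge0.
rewrite -(cos0 R).
apply: (@le_lipschitz cos (fun x => - sin x)) => // y.
by rewrite !subr0 normrN; exact: le_trans (sin_le y).
Qed.

Lemma cis_lip (x : R) : normc (cis x - 1) <= 2 * `|x|.
Proof.
rewrite (le_trans (normc_le_ReIm _))// !(Re_addc, Im_addc, Re_oppc, Im_oppc)/= oppr0 addr0.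
by rewrite mulr_natl mulr2n lerD// ?sin_le ?cos_le.
Qed.

Lemma cis_quad (x : R) : normc (cis x - 1 - (0 +i* x)) <= 2 * x ^+ 2.
Proof.
rewrite (le_trans (normc_le_ReIm _))// !(Re_addc, Im_addc, Re_oppc, Im_oppc)/= !oppr0 !addr0.
by rewrite mulr_natl mulr2n lerD// ?sin_quad ?cos_quad.
Qed.

End trigonometry.

(** * Integration *)

Section lower_integral.
Context d (T : measurableType d) (R : realType) (mu : {measure set T -> \bar R}).
Local Open Scope ereal_scope.
Import HBNNSimple.

(* Neither function needs to be measurable: the integral of a nonnegative
   function is a supremum over simple functions below it. *)
Lemma ge0_le_integral_any (D E : set T) (f g : T -> \bar R) :
  D `<=` E -> (forall x, D x -> 0 <= f x) -> (forall x, E x -> 0 <= g x) ->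
  (forall x, D x -> f x <= g x) ->
  \int[mu]_(x in D) f x <= \int[mu]_(x in E) g x.
Proof.
move=> DE f0 g0 fg; rewrite !ge0_integralE//.
apply: le_ereal_sup => _ [h /= hf <-]; exists h => //= x; apply: (le_trans (hf x)).
rewrite /patch; case: ifPn => [/set_mem Dx|_].
  by rewrite mem_set ?fg//; exact: DE.
by case: ifPn => // /set_mem /g0.
Qed.

Lemma ge0_integral_le_add (D : set T) (h X E : T -> \bar R) :
  measurable D -> measurable_fun D h -> measurable_fun D E ->
  (forall x, D x -> 0 <= h x) -> (forall x, D x -> 0 <= X x) -> (forall x, D x -> 0 <= E x) ->
  (forall x, D x -> h x <= X x + E x) ->
  \int[mu]_(x in D) h x <= \int[mu]_(x in D) X x + \int[mu]_(x in D) E x.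
Proof.
move=> mD mh mE h0 X0 E0 hXE.
pose k x := maxe (h x - E x) 0.
have mk : measurable_fun D k.
  by apply: measurable_maxe => //; exact: emeasurable_funB.
have k0 x : D x -> 0 <= k x by rewrite /k le_max lexx orbT.
apply: (@le_trans _ _ (\int[mu]_(x in D) k x + \int[mu]_(x in D) E x)); last first.
  apply: leeD2r; apply: ge0_le_integral_any => // x Dx.
  rewrite /k ge_max X0// andbT.
  have := hXE _ Dx; have := E0 _ Dx.
  case: (E x) => [e| |] // _.
    by move=> H; rewrite leeBlDr.
  by rewrite addeNy ?leNye//.
rewrite -ge0_integralD//; apply: ge0_le_integral => //.
  by apply: emeasurable_funD.
move=> x Dx; have := h0 _ Dx; have := E0 _ Dx; rewrite /k.
case: (E x) => [e| |]//= _; last first.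
  by rewrite addeNy max_r ?leNye// add0e leey.
case: (h x) => [r| |]//= _.
  by rewrite -EFinB -[0]/(0%:E) -EFin_max -EFinD lee_fin -lerBlDr le_max lexx.
Qed.

End lower_integral.

(** * Measurability on the plane *)

Section measurable_plane.
Context {R : realType}.
Local Notation T1 := (measurableTypeR R).
Local Notation T2 := (measurableTypeR R * measurableTypeR R)%type.

(** Connects the product topology with the product sigma-algebra: U is the countable union of the
    squares with rational center and half-side 1 / (n + 1) that it contains. *)
Lemma open_measurable2 (U : set T2) : open (U : set (R^o * R^o)) -> measurable U.
Proof.
move=> oU.
pose B (i : rat * rat * nat) : set T2 :=
  `](ratr i.1.1 - i.2.+1%:R^-1), (ratr i.1.1 + i.2.+1%:R^-1)[ `*`
  `](ratr i.1.2 - i.2.+1%:R^-1), (ratr i.1.2 + i.2.+1%:R^-1)[.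
have -> : U = \bigcup_i (if `[< B i `<=` U >] then B i else set0).
  apply/seteqP; split => [x Ux|x [i _]]; last by case: asboolP => // BU Bx; exact: BU.
  have /nbhs_ballP[e /= e0 xe] := oU x Ux.
  have [N /= Ne] : exists N : nat, N.+1%:R^-1 < e / 2.
    have := @near_infty_natSinv_lt R (PosNum (divr_gt0 e0 (ltr0n _ 2))).
    by case=> N _ H; exists N; exact: (H N (leqnn N)).
  have N0 : 0 < N.+1%:R^-1 :> R by rewrite invr_gt0.
  have rx (e1 y : R) : 0 < e1 -> exists q : rat, `|y - ratr q| < e1.
    move=> e10; have yy : y - e1 < y + e1 by rewrite ltrBlDr -addrA ltrDl addr_gt0.
    have [q] := rat_in_itvoo yy.
    by rewrite in_itv/= => /andP[q1 q2]; exists q; rewrite ltr_norml; apply/andP; split; lra.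
  have [q1 hq1] := rx _ x.1 N0; have [q2 hq2] := rx _ x.2 N0.
  exists (q1, q2, N) => //=; rewrite /B/=.
  move: (N.+1%:R^-1) N0 Ne hq1 hq2 => d d0 de.
  rewrite !ltr_norml => /andP[a' b'] /andP[c' d'].
  case: asboolP => [_|].
    by split; rewrite /= in_itv/=; apply/andP; split; lra.
  case=> y []; rewrite /= !in_itv/= => /andP[a b] /andP[c f]; apply: xe.
  by split; rewrite /ball/= ltr_norml; apply/andP; split; lra.
apply: countable_bigcupT_measurable => [|i]; first exact: countableP.
case: ifP => // _.
by apply: measurableX; exact: measurable_itv.
Qed.

Lemma continuous_measurable_fun2 (u : R * R -> R) :
  continuous (u : R^o * R^o -> R^o) -> measurable_fun (setT : set T2) (u : T2 -> T1).
Proof.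
move=> cu; apply: (measurability _ (RGenOInfty.measurableE R)) => //.
move=> _ [_ [r ->] <-]; rewrite setTI.
by apply: open_measurable2; move/continuousP : cu; apply; exact: interval_open.
Qed.

(** [powR] is identified with the inverse at nonnegative arguments only, hence the detour through
    1/u = u (u^2)^(-1), which also holds where u = 0. *)
Lemma measurable_inv_fun d (T : measurableType d) (D : set T) (u : T -> R) :
  measurable_fun D u -> measurable_fun D (fun x => (u x)^-1).
Proof.
move=> mu.
have -> : (fun x => (u x)^-1) = (fun x => u x * (u x ^+ 2) `^ (-1)).
  apply/funext => x; have [->|u0] := eqVneq (u x) 0; first by rewrite invr0 mul0r.
  by rewrite powR_inv1 ?sqr_ge0// expr2 invfM mulrA mulfV// mul1r.
apply: measurable_funM => //.
apply: (@measurableT_comp _ _ _ _ _ _ (fun y => y `^ (-1)) D (fun x => u x ^+ 2)).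
  exact: measurable_powR.
exact: measurable_funX.
Qed.

End measurable_plane.

Definition image_measure d d' (U : measurableType d) (T : measurableType d')
    (R : realType) (m : {measure set U -> \bar R}) (F : U -> T)
    (mF : measurable_fun setT F) : {measure set T -> \bar R} :=
  measure_function_pushforward__canonical__measure_function_Measure m mF.

(** * Linear changes of variables *)

Section scaling_maps.
Context {R : realType}.
Local Notation T1 := (measurableTypeR R).
Local Notation T2 := (measurableTypeR R * measurableTypeR R)%type.

(** For a linear map, k is the inverse of the absolute determinant. Stated on preimages, the
    property composes, so the maps in use are assembled from diagonal, swap and shear maps. *)
Definition rescales (F : T2 -> T2) (k : R) := [/\ 0 <= k, measurable_fun setT F &
  forall A, measurable A -> leb2 (F @^-1` A) = (k%:E * leb2 A)%E].

Lemma rescales_comp F G k l : rescales F k -> rescales G l -> rescales (F \o G) (k * l).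
Proof.
move=> [k0 mF eF] [l0 mG eG]; split; [exact: mulr_ge0|exact: measurableT_comp|move=> A mA].
have mFA : measurable (F @^-1` A) by rewrite -[X in measurable X]setTI; exact: mF.
rewrite comp_preimage (eG _ mFA) (eF _ mA) muleA -EFinM.
by rewrite [l * k]mulrC.
Qed.

(** |a| times the image measure agrees with Lebesgue measure on half-open intervals, which determine
    it. *)
Lemma lebesgue_affine (a b : R) (A : set T1) : a != 0 -> measurable A ->
  lebesgue_measure ((fun x : T1 => a * x + b : T1) @^-1` A) = (`|a|^-1%:E * lebesgue_measure A)%E.
Proof.
move=> a0 mA.
have mf : measurable_fun setT (fun x : T1 => a * x + b : T1).
  by apply: measurable_funD => //; exact: measurable_funM.
have na0 : 0 < `|a| by rewrite normr_gt0.
pose nu : {measure set T1 -> \bar R} := mscale (NngNum (ltW na0)) (image_measure lebesgue_measure mf).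
have H : forall X, ocitv X -> lebesgue_measure X = nu X.
  move=> _ [[c d]] _ <-; rewrite /nu/= /mscale/= /pushforward.
  have [a_gt0|] := ltP 0 a.
    have -> : (fun x => a * x + b) @^-1` `]c, d] = `](c - b) / a, (d - b) / a]%classic.
      apply/seteqP; split => x /=; rewrite !in_itv/= ltr_pdivrMr// ler_pdivlMr// => /andP[? ?];
        apply/andP; split; lra.
    rewrite !lebesgue_measure_itv/= !lte_fin ltr_pM2r ?invr_gt0// ltrD2r.
    case: ifPn => _; last by rewrite mule0.
    rewrite -!EFinB -EFinM; congr EFin; rewrite gtr0_norm//.
    by field; rewrite gt_eqF.
  rewrite le_eqVlt (negbTE a0)/= => a_lt0.
  (* For a < 0 the preimage is closed on the other side, with the same length. *)
  have -> : (fun x => a * x + b) @^-1` `]c, d] = `[(d - b) / a, (c - b) / a[%classic.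
    apply/seteqP; split => x /=; rewrite !in_itv/= ltr_ndivlMr// ler_ndivrMr// => /andP[? ?];
      apply/andP; split; lra.
  rewrite !lebesgue_measure_itv/= !lte_fin ltr_nM2r ?invr_lt0// ltrD2r.
  case: ifPn => _; last by rewrite mule0.
  rewrite -!EFinB -EFinM; congr EFin; rewrite ltr0_norm//.
  by field; rewrite lt_eqF.
have := lebesgue_measure_unique H mA.
rewrite /nu/= /mscale/= /pushforward => ->.
by rewrite muleA -EFinM mulVf ?gt_eqF// mul1e.
Qed.

Lemma rescales_diag (a b c e : R) : a != 0 -> c != 0 ->
  rescales (fun x => (a * x.1 + b, c * x.2 + e)) (`|a|^-1 * `|c|^-1).
Proof.
move=> a0 c0; pose F (x : T2) : T2 := (a * x.1 + b, c * x.2 + e).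
have mF : measurable_fun setT F.
  apply: measurable_fun_pair; apply: measurable_funD => //; apply: measurable_funM => //.
have k0 : 0 <= `|a| * `|c| by rewrite mulr_ge0.
split=> // A mA.
pose nu : {measure set T2 -> \bar R} := mscale (NngNum k0) (image_measure leb2 mF).
have H : forall X Y, measurable X -> measurable Y -> nu (X `*` Y) =
   (lebesgue_measure X * lebesgue_measure Y)%E.
  move=> X Y mX mY; rewrite /nu/= /mscale/= /pushforward.
  have -> : F @^-1` (X `*` Y) = ((fun x => a * x + b) @^-1` X) `*` ((fun x => c * x + e) @^-1` Y).
    by [].
  have mp (p q : R) Z : measurable Z -> measurable ((fun x : T1 => p * x + q : T1) @^-1` Z).
    move=> mZ; rewrite -[X in measurable X]setTI.
    by have : measurable_fun setT (fun x : T1 => p * x + q : T1);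
      [by apply: measurable_funD => //; exact: measurable_funM|exact].
  rewrite /leb2/= product_measure1E; [|exact: mp..].
  transitivity ((`|a| * `|c|)%:E * ((`|a|^-1%:E * lebesgue_measure X) *
      (`|c|^-1%:E * lebesgue_measure Y)))%E.
    by congr (_ * (_ * _))%E; exact: lebesgue_affine.
  rewrite muleACA -EFinM [LHS]muleA -EFinM mulrACA !mulfV ?normr_eq0// mul1r.
  by rewrite mul1e.
have := product_measure_unique H mA.
rewrite /nu/= /mscale/= /pushforward => E.
rewrite [leb2 A]E muleA -EFinM mulrACA mulVf ?normr_eq0// mulVf ?normr_eq0// mul1r.
by rewrite mul1e.
Qed.

Lemma rescales_swap : rescales (fun x => (x.2, x.1)) 1.
Proof.
pose F (x : T2) : T2 := (x.2, x.1).
have mF : measurable_fun setT F by apply: measurable_fun_pair.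
split=> // A mA; rewrite mul1e.
have H : forall X Y, measurable X -> measurable Y ->
    image_measure leb2 mF (X `*` Y) = (lebesgue_measure X * lebesgue_measure Y)%E.
  move=> X Y mX mY; rewrite /image_measure/= /pushforward.
  have -> : F @^-1` (X `*` Y) = Y `*` X by apply/seteqP; split=> x [].
  by rewrite /leb2/= product_measure1E// muleC.
exact/esym/(product_measure_unique H mA).
Qed.

(** On each vertical line the shear is a translation, which preserves the measure of the section. *)
Lemma rescales_shear (c : R) : rescales (fun x => (x.1, x.2 + c * x.1)) 1.
Proof.
pose F (x : T2) : T2 := (x.1, x.2 + c * x.1).
have mF : measurable_fun setT F.
  apply: measurable_fun_pair => //; apply: measurable_funD => //.
  exact: measurable_funM.
split=> // A mA; rewrite mul1e /leb2 /=.
apply: eq_integral => x _ /=.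
have -> : xsection (F @^-1` A) x = (fun y : T1 => 1 * y + c * x : T1) @^-1` (xsection A x).
  by apply/seteqP; split=> y; rewrite /xsection/= !inE/= /F/= mul1r.
rewrite lebesgue_affine ?oner_eq0//; last exact: measurable_xsection.
by rewrite normr1 invr1 mul1e.
Qed.

Lemma ge0_integral_rescales F k (f : T2 -> \bar R) : rescales F k ->
  measurable_fun setT f -> (forall x, 0 <= f x)%E ->
  (\int[leb2]_x f (F x) = k%:E * \int[leb2]_x f x)%E.
Proof.
move=> [k0 mF eF] mf f0.
rewrite -(ge0_integral_mscale leb2 measurableT (NngNum k0) mf)//.
transitivity (\int[pushforward leb2 F]_x f x)%E.
  by rewrite ge0_integral_pushforward// preimage_setT.
by apply: eq_measure_integral => A mA _ /=; rewrite /pushforward eF.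
Qed.

End scaling_maps.

(** * Measurable and integrable complex functions *)

Section complex_measurable.
Context d (T : measurableType d) (R : realType).
Implicit Types u w : T -> R[i].

Definition cmeas u := measurable_fun setT (fun x => Re (u x)) /\
  measurable_fun setT (fun x => Im (u x)).

Lemma cmeasD u w : cmeas u -> cmeas w -> cmeas (fun x => u x + w x).
Proof.
move=> [ur ui] [wr wi]; split.
  by under eq_fun do rewrite Re_addc; exact: measurable_funD.
by under eq_fun do rewrite Im_addc; exact: measurable_funD.
Qed.

Lemma cmeasM u w : cmeas u -> cmeas w -> cmeas (fun x => u x * w x).
Proof.
move=> [ur ui] [wr wi]; split.
  under eq_fun do rewrite Re_mulc.
  by apply: measurable_funB; exact: measurable_funM.
under eq_fun do rewrite Im_mulc.
by apply: measurable_funD; exact: measurable_funM.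
Qed.

Lemma cmeas_cst (c : R[i]) : cmeas (fun=> c).
Proof. by split; exact: measurable_cst. Qed.

Lemma cmeasN u : cmeas u -> cmeas (fun x => - u x).
Proof.
move=> [ur ui]; split.
  by under eq_fun do rewrite Re_oppc; exact: measurable_funN.
by under eq_fun do rewrite Im_oppc; exact: measurable_funN.
Qed.

Lemma cmeasB u w : cmeas u -> cmeas w -> cmeas (fun x => u x - w x).
Proof. by move=> mu mw; apply: cmeasD => //; exact: cmeasN. Qed.

Lemma cmeas_real (g : T -> R) : measurable_fun setT g -> cmeas (fun x => (g x)%:C).
Proof. by move=> mg; split=> //=; exact: measurable_cst. Qed.

Lemma cmeas_cis (g : T -> R) : measurable_fun setT g -> cmeas (fun x => cis (g x)).
Proof.
move=> mg; split.
  by apply: (measurableT_comp _ mg); apply: continuous_measurable_fun; exact: continuous_cos.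
by apply: (measurableT_comp _ mg); apply: continuous_measurable_fun; exact: continuous_sin.
Qed.

Lemma measurable_abs2 u : cmeas u -> measurable_fun setT (fun x => abs2 (u x)).
Proof. by move=> [ur ui]; apply: measurable_funD; exact: measurable_funX. Qed.

Lemma measurable_normc u : cmeas u -> measurable_fun setT (fun x => normc (u x)).
Proof.
move=> mu; under eq_fun do rewrite normcE.
apply: (measurableT_comp _ (measurable_abs2 mu)).
by apply: continuous_measurable_fun; exact: sqrt_continuous.
Qed.

Lemma cmeas_if (P : T -> bool) u w : measurable_fun setT P -> cmeas u -> cmeas w ->
  cmeas (fun x => if P x then u x else w x).
Proof.
move=> mP [ur ui] [wr wi]; split.
  rewrite (_ : (fun _ => _) = fun x => if P x then Re (u x) else Re (w x)).
    exact: measurable_fun_ifT.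
  by apply/funext => x; case: ifP.
rewrite (_ : (fun _ => _) = fun x => if P x then Im (u x) else Im (w x)).
  exact: measurable_fun_ifT.
by apply/funext => x; case: ifP.
Qed.

End complex_measurable.

Lemma cmeas_comp d d' (T : measurableType d) (U : measurableType d') (R : realType)
  (u : U -> R[i]) (F : T -> U) : measurable_fun setT F -> cmeas u -> cmeas (fun x => u (F x)).
Proof. by move=> mF [ur ui]; split; [exact: (measurableT_comp ur)|exact: (measurableT_comp ui)]. Qed.

Lemma ge0_integral_scale d (T : measurableType d) (R : realType)
    (mu : {measure set T -> \bar R}) (c : R) (g : T -> R) :
  0 <= c -> measurable_fun setT g -> (forall x, 0 <= g x) ->
  (\int[mu]_x (c * g x)%:E = c%:E * \int[mu]_x (g x)%:E)%E.
Proof.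
move=> c0 mg g0; under eq_integral do rewrite EFinM.
rewrite ge0_integralZl//; first exact/measurable_EFinP.
by move=> x _; rewrite lee_fin.
Qed.

Section complex_integral.
Context d (T : measurableType d) (R : realType) (mu : {measure set T -> \bar R}).
Implicit Types u w : T -> R[i].
Local Notation int := (cintegral mu setT).
Local Notation cint := (cintegrable mu setT).

Lemma integrable_scale (c : R) (p : T -> R) : mu.-integrable setT (EFin \o p) ->
  mu.-integrable setT (fun x => (c * p x)%:E).
Proof.
rewrite (_ : (fun x => (c * p x)%:E) = (fun x => c%:E * (EFin \o p) x)%E)//.
exact: integrableZl.
Qed.

Lemma cintegrableP u :
  cint u <-> cmeas u /\ (\int[mu]_x (normc (u x))%:E < +oo)%E.
Proof.
split=> [[/integrableP[mr ir] /integrableP[mi ii]]|[[mr mi] iu]].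
  have cu : cmeas u by split; exact/measurable_EFinP.
  split=> //; apply: (@le_lt_trans _ _ (\int[mu]_x (`|(Re (u x))%:E| + `|(Im (u x))%:E|))%E).
    apply: ge0_le_integral_any => // x _; rewrite ?lee_fin ?normc_ge0//.
    exact: normc_le_ReIm.
  rewrite ge0_integralD//; first exact: lte_add_pinfty.
    exact: measurableT_comp.
  exact: measurableT_comp.
split; apply/integrableP; split; rewrite ?(measurable_EFinP)//;
  apply: le_lt_trans iu; apply: ge0_le_integral_any => // x _; rewrite ?lee_fin ?normc_ge0//.
  exact: le_normc_Re.
exact: le_normc_Im.
Qed.

Lemma cint_meas u : cint u -> cmeas u.
Proof. by move=> /cintegrableP[]. Qed.

Lemma cint_lty u : cint u -> (\int[mu]_x (normc (u x))%:E < +oo)%E.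
Proof. by move=> /cintegrableP[]. Qed.

Lemma cint_normc u : cint u -> mu.-integrable setT (fun x => (normc (u x))%:E).
Proof.
move=> /cintegrableP[mu' iu]; apply/integrableP; split.
  by apply/measurable_EFinP; exact: measurable_normc.
by under eq_integral do rewrite gee0_abs ?lee_fin ?normc_ge0//.
Qed.

Lemma cint_le u (g : T -> R) : cmeas u -> mu.-integrable setT (EFin \o g) ->
  (forall x, normc (u x) <= g x) -> cint u.
Proof.
move=> cu /integrableP[mg ig] ug; apply/cintegrableP; split=> //.
apply: le_lt_trans ig; apply: ge0_le_integral_any => // x _; rewrite ?lee_fin ?normc_ge0//.
exact: le_trans (ug x) (ler_norm _).
Qed.

Lemma cint_lec u w (c : R) : cmeas u -> cint w ->
  (forall x, normc (u x) <= c * normc (w x)) -> cint u.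
Proof.
move=> cu /cint_normc iw uw; apply: (@cint_le _ (fun x => c * normc (w x))) => //.
exact: integrable_scale.
Qed.

Lemma cintD u w : cint u -> cint w -> cint (fun x => u x + w x).
Proof.
move=> [ur ui] [wr wi]; split.
  rewrite (_ : (fun _ => _) = (fun x => (Re (u x))%:E) \+ (fun x => (Re (w x))%:E))%E.
    exact: integrableD.
  by apply/funext => x; rewrite Re_addc.
rewrite (_ : (fun _ => _) = (fun x => (Im (u x))%:E) \+ (fun x => (Im (w x))%:E))%E.
  exact: integrableD.
by apply/funext => x; rewrite Im_addc.
Qed.

Lemma cintZ (c : R[i]) u : cint u -> cint (fun x => c * u x).
Proof.
move=> iu; apply: (@cint_lec _ u (normc c)) => //.
  by apply: cmeasM; [exact: cmeas_cst|exact: cint_meas].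
by move=> x; rewrite normcM.
Qed.

Lemma cintB u w : cint u -> cint w -> cint (fun x => u x - w x).
Proof.
move=> iu iw; rewrite (_ : (fun _ => _) = fun x => u x + (-1) * w x); last first.
  by apply/funext => x; rewrite mulN1r.
by apply: cintD => //; exact: cintZ.
Qed.

Lemma cintegralD u w : cint u -> cint w ->
  int (fun x => u x + w x) = int u + int w.
Proof.
move=> [ur ui] [wr wi]; apply: complexP; rewrite ?(Re_addc, Im_addc)/=.
  by rewrite -RintegralD//; apply: eq_Rintegral => x _; rewrite Re_addc.
by rewrite -RintegralD//; apply: eq_Rintegral => x _; rewrite Im_addc.
Qed.

Lemma cintegralZ (c : R[i]) u : cint u -> int (fun x => c * u x) = c * int u.
Proof.
move=> [ur ui]; apply: complexP; rewrite ?(Re_mulc, Im_mulc)/=.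
  rewrite -!RintegralZl// -RintegralB//.
  - by apply: eq_Rintegral => x _; rewrite Re_mulc.
  - exact: integrable_scale.
  - exact: integrable_scale.
rewrite -!RintegralZl// -RintegralD//.
- by apply: eq_Rintegral => x _; rewrite Im_mulc.
- exact: integrable_scale.
- exact: integrable_scale.
Qed.

Lemma cintegralB u w : cint u -> cint w ->
  int (fun x => u x - w x) = int u - int w.
Proof.
move=> iu iw; rewrite -[in RHS]mulN1r -cintegralZ// -cintegralD//; last exact: cintZ.
by congr cintegral; apply/funext => x; rewrite mulN1r.
Qed.

Lemma cintegral_conj u : cint u -> int (fun x => (u x)^*) = (int u)^*.
Proof.
move=> [ur ui]; apply: complexP => /=.
  by apply: eq_Rintegral => x _; case: (u x).
rewrite -mulN1r -RintegralZl//; apply: eq_Rintegral => x _; rewrite mulN1r.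
by case: (u x).
Qed.

Lemma cintegral0 : int (fun=> 0) = 0.
Proof. by apply: complexP; rewrite /= /Rintegral integral0. Qed.

(* The constant 2 is not optimal, but avoids choosing a phase. *)
Lemma normc_cintegral u : cint u ->
  ((normc (int u))%:E <= 2%:E * \int[mu]_x (normc (u x))%:E)%E.
Proof.
move=> iu; have [ir ii] := iu.
have H (p : R[i] -> R) : (forall z, `|p z| <= normc z) ->
    mu.-integrable setT (EFin \o (fun x => p (u x))) ->
    ((`|Rintegral mu setT (fun x => p (u x))|)%:E <= \int[mu]_x (normc (u x))%:E)%E.
  move=> pz ip; apply: (@le_trans _ _ (\int[mu]_x (`|p (u x)|)%:E)%E).
    have fi : (\int[mu]_x (`|p (u x)|)%:E)%E \is a fin_num.
      by apply: integrable_fin_num => //; exact: integrable_norm.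
    by rewrite -(fineK fi) lee_fin; exact: le_normr_Rintegral.
  by apply: ge0_le_integral_any => // x _; rewrite ?lee_fin ?normc_ge0.
apply: (@le_trans _ _ ((`|Re (int u)| + `|Im (int u)|)%:E)).
  by rewrite lee_fin normc_le_ReIm.
rewrite EFinD mule_natl mule2n; apply: leeD; apply: H => //.
  exact: le_normc_Re.
exact: le_normc_Im.
Qed.

Lemma normc_cintegral_le u (c : R) : cint u ->
  (\int[mu]_x (normc (u x))%:E <= c%:E)%E -> normc (int u) <= 2 * c.
Proof.
move=> iu ic; rewrite -lee_fin (le_trans (normc_cintegral iu))// EFinM.
by rewrite lee_wpmul2l ?lee_fin.
Qed.

End complex_integral.

(** * Fubini for complex integrals *)

Section complex_fubini.
Context d1 d2 (T1 : measurableType d1) (T2 : measurableType d2) (R : realType).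
Variables (m1 : {sigma_finite_measure set T1 -> \bar R})
          (m2 : {sigma_finite_measure set T2 -> \bar R}).

Lemma integrable_tensor (g : T1 -> R) (h : T2 -> R) :
  m1.-integrable setT (EFin \o g) -> m2.-integrable setT (EFin \o h) ->
  (m1 \x m2)%E.-integrable setT (fun z => (g z.1 * h z.2)%:E).
Proof.
move=> ig ih; have /integrableP[/measurable_EFinP mg bg] := ig.
have /integrableP[/measurable_EFinP mh bh] := ih.
have mgh : measurable_fun setT (fun z : T1 * T2 => (g z.1 * h z.2)%:E).
  apply/measurable_EFinP; apply: measurable_funM.
    exact: (measurableT_comp mg).
  exact: (measurableT_comp mh).
apply/integrable12ltyP => //=.
have ah : (\int[m2]_x `|(h x)%:E|)%E \is a fin_num.
  by rewrite ge0_fin_numE//; exact: integral_ge0.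
under eq_integral => x _.
  under eq_integral => y _ do rewrite normrM EFinM.
  rewrite ge0_integralZl//; last by apply/measurable_EFinP; exact: measurableT_comp.
  rewrite -(fineK ah); over.
rewrite ge0_integralZr//; last 2 first.
- by apply/measurable_EFinP; exact: measurableT_comp.
- by rewrite fineK//; exact: integral_ge0.
apply: lte_mul_pinfty; [exact: integral_ge0| |exact: ltry].
by rewrite ge0_fin_numE//; exact: integral_ge0.
Qed.

Lemma cint_tensor (f : T1 * T2 -> R[i]) (g : T1 -> R) (h : T2 -> R) :
  cmeas f -> m1.-integrable setT (EFin \o g) -> m2.-integrable setT (EFin \o h) ->
  (forall x y, normc (f (x, y)) <= g x * h y) -> cintegrable (m1 \x m2)%E setT f.
Proof.
move=> mf ig ih fgh; apply: (@cint_le _ _ _ _ _ (fun z => g z.1 * h z.2)) => //.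
  exact: integrable_tensor.
by move=> [x y]; exact: fgh.
Qed.

(** Every section, not just almost every one, is assumed integrable, so that the inner real-valued
    integrals can be traded for extended ones under the outer integral. *)
Lemma cfubini (f : T1 * T2 -> R[i]) : cintegrable (m1 \x m2)%E setT f ->
  (forall x, cintegrable m2 setT (fun y => f (x, y))) ->
  (forall y, cintegrable m1 setT (fun x => f (x, y))) ->
  cintegral m1 setT (fun x => cintegral m2 setT (fun y => f (x, y))) =
  cintegral m2 setT (fun y => cintegral m1 setT (fun x => f (x, y))).
Proof.
have H (p : T1 * T2 -> R) : (m1 \x m2)%E.-integrable setT (EFin \o p) ->
    (forall x, m2.-integrable setT (fun y => (p (x, y))%:E)) ->
    (forall y, m1.-integrable setT (fun x => (p (x, y))%:E)) ->
    Rintegral m1 setT (fun x => Rintegral m2 setT (fun y => p (x, y))) =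
    Rintegral m2 setT (fun y => Rintegral m1 setT (fun x => p (x, y))).
  move=> ip i2 i1; rewrite /Rintegral.
  under eq_integral => x _ do rewrite fineK ?integrable_fin_num//.
  under [in RHS]eq_integral => y _ do rewrite fineK ?integrable_fin_num//.
  by rewrite (Fubini ip).
move=> [fr fi] f2 f1; apply: complexP => /=.
  apply: (H (fun z => Re (f z))) => // x; first by have [] := f2 x.
  by have [] := f1 x.
apply: (H (fun z => Im (f z))) => // x; first by have [] := f2 x.
by have [] := f1 x.
Qed.
Lemma ge0_integral_prod_swap (f : T1 * T2 -> \bar R) : measurable_fun setT f ->
  (forall z, 0 <= f z)%E ->
  (\int[m1]_x \int[m2]_y f (x, y) = \int[m2]_y \int[m1]_x f (x, y))%E.
Proof. by move=> mf f0; exact: fubini_tonelli. Qed.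

End complex_fubini.

(* The instance of the library is shadowed by the one for subprobabilities. *)
Section sigma_finite_product.
Context d1 d2 (T1 : measurableType d1) (T2 : measurableType d2) (R : realType).
Variables (m1 : {sigma_finite_measure set T1 -> \bar R})
          (m2 : {sigma_finite_measure set T2 -> \bar R}).

Let sigma_finite_prod : sigma_finite setT (m1 \x m2)%E.
Proof.
have /sigma_finiteP[F [TF ndF Foo]] := sigma_finiteT m1.
have /sigma_finiteP[G [TG ndG Goo]] := sigma_finiteT m2.
exists (fun n => F n `*` G n).
  rewrite -setXTT TF TG predeqE => -[x y]; split.
    move=> [/= [n _ Fnx] [k _ Gky]]; exists (maxn n k) => //; split.
    - by move: x Fnx; exact/subsetPset/ndF/leq_maxl.
    - by move: y Gky; exact/subsetPset/ndG/leq_maxr.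
  by move=> [n _ []/= ? ?]; split; exists n.
move=> k; have [? ?] := Foo k; have [? ?] := Goo k.
split; first exact: measurableX.
by rewrite product_measure1E// lte_mul_pinfty// ge0_fin_numE.
Qed.

Definition sprod : {sigma_finite_measure set (T1 * T2)%type -> \bar R} :=
  HB.pack_for (SigmaFiniteMeasure.type (T1 * T2)%type R) (m1 \x m2)%E
    (Measure.on (m1 \x m2)%E)
    (Measure_isSigmaFinite.Build _ _ _ (m1 \x m2)%E sigma_finite_prod).

End sigma_finite_product.

Section plane_integral.
Context {R : realType}.
Local Notation T2 := (measurableTypeR R * measurableTypeR R)%type.
Local Notation int := (cintegral leb2 setT).
Local Notation cint := (cintegrable leb2 setT).

(** [leb2] packed with its sigma-finiteness, as Fubini for pairs of points of the plane requires. *)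
Definition sleb2 : {sigma_finite_measure set T2 -> \bar R} :=
  sprod (@lebesgue_measure R) (@lebesgue_measure R).

Lemma cfubini2 (f : T2 * T2 -> R[i]) (g h : T2 -> R) : cmeas f ->
  leb2.-integrable setT (EFin \o g) -> leb2.-integrable setT (EFin \o h) ->
  (forall x y, normc (f (x, y)) <= g x * h y) ->
  int (fun x => int (fun y => f (x, y))) = int (fun y => int (fun x => f (x, y))).
Proof.
move=> mf ig ih fgh; apply: (@cfubini _ _ T2 T2 R sleb2 sleb2).
- exact: (@cint_tensor _ _ T2 T2 R sleb2 sleb2 f g h).
- move=> x; apply: (@cint_le _ _ _ _ _ (fun y => g x * h y)) => //.
    exact: (cmeas_comp (pair1_measurable x)).
  exact: integrable_scale.
- move=> y; apply: (@cint_le _ _ _ _ _ (fun x => h y * g x)) => //.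
  + exact: (cmeas_comp (pair2_measurable y)).
  + exact: integrable_scale.
  + by move=> x; rewrite mulrC.
Qed.

Lemma cint_rescales F k (u : T2 -> R[i]) : rescales F k -> cint u -> cint (fun x => u (F x)).
Proof.
move=> sF iu; have [k0 mF _] := sF; apply/cintegrableP; split.
  exact: (cmeas_comp mF (cint_meas iu)).
rewrite (ge0_integral_rescales (f := fun x => (normc (u x))%:E) sF).
- by apply: lte_mul_pinfty => //; exact: cint_lty.
- by apply/measurable_EFinP; apply: measurable_normc; exact: cint_meas iu.
- by move=> x; rewrite lee_fin normc_ge0.
Qed.

Lemma cintegral_rescales F k (u : T2 -> R[i]) : rescales F k -> cint u ->
  int (fun x => u (F x)) = k%:C * int u.
Proof.
move=> sF iu; have [k0 mF _] := sF; have iuF := cint_rescales sF iu.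
have H (p : T2 -> R) : leb2.-integrable setT (EFin \o p) ->
    leb2.-integrable setT (EFin \o (fun x => p (F x))) ->
    Rintegral leb2 setT (fun x => p (F x)) = k * Rintegral leb2 setT p.
  move=> ip ipF; have /integrableP[mp _] := ip.
  (* The change of variables is known for nonnegative functions, so the positive and negative parts
     are treated separately. *)
  have Hp : (\int[leb2]_x (EFin \o p)^\+ (F x) = k%:E * \int[leb2]_x (EFin \o p)^\+ x)%E.
    by apply: (ge0_integral_rescales sF) => //; exact: measurable_funepos.
  have Hn : (\int[leb2]_x (EFin \o p)^\- (F x) = k%:E * \int[leb2]_x (EFin \o p)^\- x)%E.
    by apply: (ge0_integral_rescales sF) => //; exact: measurable_funeneg.
  have f1 := integrable_pos_fin_num measurableT ip.
  have f2 := integrable_neg_fin_num measurableT ip.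
  rewrite /Rintegral integralE [X in _ = _ * fine X]integralE.
  transitivity (fine (k%:E * \int[leb2]_x (EFin \o p)^\+ x -
     k%:E * \int[leb2]_x (EFin \o p)^\- x)%E); last first.
    rewrite -muleBr ?fineM// ?fin_num_adde_defr//.
    by rewrite fin_numB f1.
  rewrite -Hp -Hn; congr (fine (_ - _)%E); apply: eq_integral => x _.
    by rewrite !funeposE.
  by rewrite !funenegE.
have [ur ui] := iu; have [uFr uFi] := iuF.
apply: complexP; rewrite ?(Re_mulc, Im_mulc)/= mul0r.
  by rewrite subr0; exact: H.
by rewrite addr0; exact: H.
Qed.

End plane_integral.

(** * Fourier transform of test functions *)

Section plane.
Context {R : realType}.
Local Notation T1 := (measurableTypeR R).
Local Notation T2 := (measurableTypeR R * measurableTypeR R)%type.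
Local Notation P := (R^o * R^o)%type.
Implicit Types (x y v xi : R * R).

(** The maximum norm, that is, the norm of the normed module R^o * R^o, in which all estimates are
    made; the Euclidean [enorm] enters through the balls and weights of the statement. *)
Definition mnorm x : R := `|x : P|.

Lemma mnormE x : mnorm x = Num.max `|x.1| `|x.2|.
Proof. exact: prod_normE. Qed.

Lemma mnorm_ge0 x : 0 <= mnorm x.
Proof. exact: normr_ge0. Qed.

Lemma le_mnorm1 x : `|x.1| <= mnorm x.
Proof. by rewrite mnormE le_max lexx. Qed.

Lemma le_mnorm2 x : `|x.2| <= mnorm x.
Proof. by rewrite mnormE le_max lexx orbT. Qed.

Lemma mnorm_le x (c : R) : (mnorm x <= c) = (`|x.1| <= c) && (`|x.2| <= c).
Proof. by rewrite mnormE ge_max. Qed.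

Lemma mnormD x y : mnorm (x + y) <= mnorm x + mnorm y.
Proof. exact: ler_normD. Qed.

Lemma mnormN x : mnorm (- x) = mnorm x.
Proof. exact: normrN. Qed.

Lemma mnormB x y : mnorm (x - y) <= mnorm x + mnorm y.
Proof. exact: ler_normB. Qed.

Lemma le_dot x y : `|dot x y| <= 2 * (mnorm x * mnorm y).
Proof.
rewrite (le_trans (ler_normD _ _))// mulr_natl mulr2n !normrM.
by apply: lerD; apply: ler_pM => //; rewrite ?le_mnorm1 ?le_mnorm2.
Qed.

Lemma dotC x y : dot x y = dot y x.
Proof. by rewrite /dot mulrC [x.2 * _]mulrC. Qed.

Lemma dotDl x y v : dot (x + y) v = dot x v + dot y v.
Proof. by rewrite /dot/= !mulrDl addrACA. Qed.

Lemma dotZl (k : R) (x : P) (v : R * R) : dot (k *: x) v = k * dot x v.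
Proof. by rewrite /dot/= /GRing.scale/= -!mulrA -mulrDr. Qed.

Lemma dotNl x v : dot (- x) v = - dot x v.
Proof. by rewrite /dot/= !mulNr -opprD. Qed.

Lemma dotNr x v : dot x (- v) = - dot x v.
Proof. by rewrite dotC dotNl dotC. Qed.

Lemma dotDr x y v : dot v (x + y) = dot v x + dot v y.
Proof. by rewrite dotC dotDl !(dotC v). Qed.

Lemma measurable_mnorm : measurable_fun (setT : set T2) (mnorm : T2 -> T1).
Proof.
rewrite (_ : mnorm = fun x => Num.max `|x.1| `|x.2|).
  by apply: measurable_maxr; exact: measurableT_comp.
by apply/funext => x; exact: mnormE.
Qed.

Lemma measurable_dot d (T : measurableType d) (F G : T -> R * R) :
  measurable_fun setT (F : T -> T2) -> measurable_fun setT (G : T -> T2) ->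
  measurable_fun setT (fun z => dot (F z) (G z)).
Proof.
move=> mF mG; apply: measurable_funD; apply: measurable_funM.
- exact: (measurableT_comp measurable_fst mF).
- exact: (measurableT_comp measurable_fst mG).
- exact: (measurableT_comp measurable_snd mF).
- exact: (measurableT_comp measurable_snd mG).
Qed.

Definition ech xi x : R[i] := cis (- (2 * pi * dot x xi)).

(** The symbol of differentiation along v: by [ech_cdiff], the derivative of [ech xi] along v is
    [fac v xi] times [ech xi]. *)
Definition fac v xi : R[i] := 0 +i* (- (2 * pi * dot v xi)).

Lemma echC x xi : ech xi x = ech x xi.
Proof. by rewrite /ech dotC. Qed.

Lemma normc_ech x xi : normc (ech xi x) = 1.
Proof. exact: normc_cis. Qed.

Lemma echD xi x y : ech xi (x + y) = ech xi x * ech xi y.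
Proof. by rewrite /ech -cisD dotDl mulrDr opprD. Qed.

Lemma echDl xi x y : ech (x + y) xi = ech x xi * ech y xi.
Proof. by rewrite echC echD !(echC xi). Qed.

Lemma ech0 xi : ech xi 0 = 1.
Proof. by rewrite /ech /dot/= !mul0r addr0 mulr0 oppr0 cis0. Qed.

Lemma ech_conj xi x : (ech xi x)^* = ech xi (- x).
Proof. by rewrite /ech cis_conj dotNl mulrN. Qed.

Lemma ech_oppl xi x : ech (- xi) x = ech xi (- x).
Proof. by rewrite /ech dotNl dotNr. Qed.

Lemma cmeas_ech xi : cmeas (ech xi : T2 -> R[i]).
Proof.
apply: cmeas_cis; apply: measurable_funN; apply: measurable_funM => //.
exact: measurable_dot.
Qed.

Lemma cmeas_fac v : cmeas (fac v : T2 -> R[i]).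
Proof.
split=> /=; first exact: measurable_cst.
apply: measurable_funN; apply: measurable_funM => //; exact: measurable_dot.
Qed.

Lemma normc_fac v xi : normc (fac v xi) <= 4 * pi * mnorm v * mnorm xi.
Proof.
rewrite (le_trans (normc_le_ReIm _))//= normr0 add0r normrN normrM.
rewrite ger0_norm ?mulr_ge0 ?pi_ge0//.
rewrite [leRHS](_ : _ = 2 * pi * (2 * (mnorm v * mnorm xi))); last by ring.
by rewrite ler_wpM2l ?mulr_ge0 ?pi_ge0// le_dot.
Qed.

Lemma fac_linear (k : R) (g h : P) xi : fac (k *: g + h) xi = k%:C * fac g xi + fac h xi.
Proof.
apply: complexP; rewrite ?(Re_addc, Im_addc, Re_mulc, Im_mulc)/=; first by ring.
by rewrite (dotDl (k *: g) h) dotZl; ring.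
Qed.

Lemma ech_quad xi x h :
  normc (ech xi (x + h) - ech xi x - fac h xi * ech xi x) <=
  32 * pi ^+ 2 * mnorm xi ^+ 2 * mnorm h ^+ 2.
Proof.
rewrite echD [X in X - _ - _]mulrC -[X in _ - X - _]mul1r -!mulrBl normcM normc_ech mulr1.
rewrite /ech /fac (le_trans (cis_quad _))// sqrrN.
rewrite [leRHS](_ : _ = 2 * (2 * pi * (2 * (mnorm h * mnorm xi))) ^+ 2); last by ring.
have A : `|2 * pi * dot h xi| <= 2 * pi * (2 * (mnorm h * mnorm xi)).
  by rewrite normrM ger0_norm ?mulr_ge0 ?pi_ge0// ler_wpM2l ?mulr_ge0 ?pi_ge0// le_dot.
by rewrite ler_wpM2l// -(ger0_norm (sqr_ge0 _)) normrX lerXn2r ?nnegrE// (le_trans _ A).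
Qed.

Lemma ech_cdiff xi (x : P) : cdiff (V := P) (ech xi) x /\
  forall v, cD (V := P) v (ech xi) x = fac v xi * ech xi x.
Proof.
apply: (@cdiff_quadratic R P (ech xi) x (fun v => fac v xi * ech xi x)
  (4 * pi * mnorm xi) (32 * pi ^+ 2 * mnorm xi ^+ 2)).
- by move=> k g h; rewrite fac_linear mulrDl mulrA.
- move=> h; rewrite normcM normc_ech mulr1 (le_trans (normc_fac _ _))//.
  by rewrite mulrAC.
- by move=> h; exact: ech_quad.
Qed.

Lemma csmooth_ech xi : csmooth (V := P) (ech xi).
Proof.
have H n (c : R[i]) : cCn (V := P) n (fun x => c * ech xi x).
  elim: n c => // n IH c; split=> [x|v].
    apply: cdiffM; first by split; exact: differentiable_cst.
    by have [] := ech_cdiff xi x.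
  rewrite (_ : cD v _ = fun x => (c * fac v xi) * ech xi x); first exact: IH.
  rewrite cDZ; last by move=> x; have [] := ech_cdiff xi x.
  by apply/funext => x; have [_ ->] := ech_cdiff xi x; rewrite mulrA.
move=> n; have := H n 1.
by rewrite (_ : (fun x => _) = ech xi)//; apply/funext => x; rewrite mul1r.
Qed.

Definition facs (vs : seq P) xi : R[i] := \prod_(v <- vs) fac v xi.

Lemma foldr_ech vs xi : foldr (cD (V := P)) (ech xi) vs = fun x => facs vs xi * ech xi x.
Proof.
elim: vs => [|v vs IH] /=; first by apply/funext => x; rewrite /facs big_nil mul1r.
rewrite IH cDZ; last by move=> x; have [] := ech_cdiff xi x.
apply/funext => x; have [_ ->] := ech_cdiff xi x.
by rewrite /facs big_cons mulrA [_ * fac v xi]mulrC.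
Qed.

Definition wt x : R := 1 + mnorm x.

(** What differentiating [fourier2 u] arbitrarily often requires. Contrary to smoothness, it
    survives restriction of u to a measurable set, which the cell decompositions below rely on. *)
Definition moments (u : R * R -> R[i]) : Prop :=
  forall N, cintegrable leb2 setT (fun x => (wt x ^+ N)%:C * u x).

Lemma wt_ge1 x : 1 <= wt x.
Proof. by rewrite /wt lerDl mnorm_ge0. Qed.

Lemma wt_gt0 x : 0 < wt x.
Proof. exact: lt_le_trans ltr01 (wt_ge1 x). Qed.

Lemma mnorm_le_wt x : mnorm x <= wt x.
Proof. by rewrite /wt lerDr. Qed.

Lemma wtX_ge0 x n : 0 <= wt x ^+ n.
Proof. by rewrite exprn_ge0// ltW// wt_gt0. Qed.

Lemma wtX_ge1 x n : 1 <= wt x ^+ n.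
Proof. by rewrite exprn_ege1// wt_ge1. Qed.

Lemma wtD x y : wt (x + y) <= wt x * wt y.
Proof.
have := mnormD x y; have := mnorm_ge0 x; have := mnorm_ge0 y.
rewrite /wt; move: (mnorm _) (mnorm _) (mnorm _) => a b c b0 c0 abc.
have : 0 <= b * c by rewrite mulr_ge0.
nra.
Qed.

Lemma wtN x : wt (- x) = wt x.
Proof. by rewrite /wt mnormN. Qed.

Lemma measurable_wtX n : measurable_fun (setT : set T2) (fun x : T2 => wt x ^+ n).
Proof. by apply: measurable_funX; apply: measurable_funD => //; exact: measurable_mnorm. Qed.

Lemma normc_wt x n (z : R[i]) : normc ((wt x ^+ n)%:C * z) = wt x ^+ n * normc z.
Proof. by rewrite normcM normcC ger0_norm ?wtX_ge0. Qed.

Lemma moments_cint u : moments u -> cintegrable leb2 setT u.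
Proof.
move=> /(_ 0%N); rewrite (_ : (fun x => _) = u)//.
by apply/funext => x; rewrite expr0 mul1r.
Qed.

Lemma moments_cmeas u : moments u -> cmeas (u : T2 -> R[i]).
Proof. by move=> /moments_cint/cint_meas. Qed.

Lemma moments_le u w (c : R) k : cmeas (u : T2 -> R[i]) -> moments w ->
  (forall x, normc (u x) <= c * wt x ^+ k * normc (w x)) -> moments u.
Proof.
move=> mu mw uw N; apply: (@cint_lec _ T2 R leb2 _ (fun x => (wt x ^+ (N + k))%:C * w x) c) => //.
  by apply: cmeasM => //; apply: cmeas_real; exact: measurable_wtX.
move=> x; rewrite !normc_wt exprD.
rewrite [leRHS](_ : _ = wt x ^+ N * (c * wt x ^+ k * normc (w x))); last by ring.
by rewrite ler_wpM2l ?wtX_ge0.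
Qed.

Lemma moments_fac v u : moments u -> moments (fun x => fac v x * u x).
Proof.
move=> mu; apply: (@moments_le _ u (4 * pi * mnorm v) 1) => //.
  by apply: cmeasM; [exact: cmeas_fac|exact: moments_cmeas].
move=> x; rewrite normcM ler_wpM2r ?normc_ge0// (le_trans (normc_fac _ _))//.
by rewrite ler_wpM2l ?mulr_ge0 ?pi_ge0 ?mnorm_ge0// expr1 mnorm_le_wt.
Qed.

Lemma moments_facs vs u : moments u -> moments (fun x => facs vs x * u x).
Proof.
move=> mu; elim: vs => [|v vs IH].
  rewrite (_ : (fun x => _) = u)//.
  by apply/funext => x; rewrite /facs big_nil mul1r.
rewrite (_ : (fun x => _) = fun x => fac v x * (facs vs x * u x)).
  exact: moments_fac.
by apply/funext => x; rewrite /facs big_cons mulrA.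
Qed.

Lemma cint_ech xi u : cintegrable leb2 setT u -> cintegrable leb2 setT (fun x => u x * ech xi x).
Proof.
move=> iu; apply: (@cint_lec _ _ _ _ _ u 1) => //.
  by apply: cmeasM; [exact: cint_meas iu|exact: cmeas_ech].
by move=> x; rewrite normcM normc_ech mulr1 mul1r.
Qed.

Lemma fourier2E u xi : fourier2 u xi = cintegral leb2 setT (fun x => u x * ech xi x).
Proof. by []. Qed.

Lemma normc_fourier2 u xi (c : R) : cintegrable leb2 setT u ->
  (\int[leb2]_x (normc (u x))%:E <= c%:E)%E -> normc (fourier2 u xi) <= 2 * c.
Proof.
move=> iu uc; apply: normc_cintegral_le; first exact: cint_ech.
by under eq_integral do rewrite normcM normc_cis mulr1.
Qed.

(** Differentiation under the integral sign: the second-order remainder of the character is at most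
    a multiple of |x|^2 |h|^2, which the second moment of u integrates. *)
Lemma fourier2_cdiff u (xi : P) : moments u ->
  cdiff (V := P) (fourier2 u) xi /\
  forall v, cD (V := P) v (fourier2 u) xi = fourier2 (fun x => fac v x * u x) xi.
Proof.
move=> mu; have iu := moments_cint mu.
have i2 : cintegrable leb2 setT (fun x => (wt x ^+ 2)%:C * u x) by exact: mu.
pose c1 := fine (\int[leb2]_x (normc ((wt x ^+ 2)%:C * u x))%:E)%E.
have c1E : (\int[leb2]_x (normc ((wt x ^+ 2)%:C * u x))%:E = c1%:E)%E.
  rewrite fineK// ge0_fin_numE; last by apply: integral_ge0 => x _; rewrite lee_fin normc_ge0.
  exact: cint_lty i2.
have bound (w : R * R -> R[i]) (c : R) : 0 <= c -> cintegrable leb2 setT w ->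
    (forall x, normc (w x) <= c * (wt x ^+ 2 * normc (u x))) ->
    normc (cintegral leb2 setT w) <= 2 * (c * c1).
  move=> c0 iw wu; apply: normc_cintegral_le => //.
  rewrite EFinM -c1E -ge0_integral_scale//; last 2 first.
  - exact: measurable_normc (cint_meas i2).
  - by move=> x; rewrite normc_ge0.
  apply: ge0_le_integral_any => // x _; rewrite ?lee_fin ?mulr_ge0 ?normc_ge0//.
  by rewrite normc_wt.
have if_ v : cintegrable leb2 setT (fun x => fac v x * u x * ech xi x).
  by apply: cint_ech; apply: moments_cint; exact: moments_fac.
apply: (@cdiff_quadratic R P (fourier2 u) xi (fun v => fourier2 (fun x => fac v x * u x) xi)
  (2 * (4 * pi * c1)) (2 * (32 * pi ^+ 2 * c1))).
- move=> k g h; rewrite !fourier2E -cintegralZ// -cintegralD//; last exact: cintZ.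
  by congr cintegral; apply/funext => x; rewrite fac_linear !mulrDl !mulrA.
- move=> h; rewrite [leRHS](_ : _ = 2 * (4 * pi * mnorm h * c1)); last first.
    by rewrite -[`|h|]/(mnorm h); ring.
  apply: bound => //; first by rewrite !mulr_ge0 ?pi_ge0// mnorm_ge0.
  move=> x; rewrite !normcM normc_ech mulr1 mulrA ler_wpM2r ?normc_ge0//.
  rewrite (le_trans (normc_fac _ _))// ler_wpM2l ?mulr_ge0 ?pi_ge0 ?mnorm_ge0//.
  by rewrite (le_trans (mnorm_le_wt x))// expr2 ler_peMl ?wt_ge1// ltW// wt_gt0.
- move=> h; rewrite !fourier2E -cintegralB; [|exact: cint_ech..].
  rewrite -cintegralB//; last by apply: cintB; exact: cint_ech.
  rewrite [leRHS](_ : _ = 2 * (32 * pi ^+ 2 * mnorm h ^+ 2 * c1)); last first.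
    by rewrite -[`|h|]/(mnorm h); ring.
  apply: bound.
  + by rewrite !mulr_ge0 ?exprn_ge0 ?pi_ge0 ?mnorm_ge0.
  + by apply: cintB => //; apply: cintB; exact: cint_ech.
  move=> x; rewrite [X in normc X](_ : _ = u x * (ech x (xi + h) - ech x xi - fac h x * ech x xi)).
    rewrite normcM mulrA [leRHS]mulrC ler_wpM2l ?normc_ge0// (le_trans (ech_quad _ _ _))//.
    rewrite [leLHS](_ : _ = 32 * pi ^+ 2 * mnorm h ^+ 2 * mnorm x ^+ 2); last by ring.
    rewrite ler_wpM2l ?mulr_ge0 ?exprn_ge0 ?pi_ge0 ?mnorm_ge0//.
    by rewrite lerXn2r ?nnegrE ?mnorm_ge0 ?mnorm_le_wt// ltW// wt_gt0.
  by rewrite !(echC x) !mulrBr mulrA [u x * fac _ _]mulrC.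
Qed.

Lemma csmooth_fourier2 u : moments u -> csmooth (V := P) (fourier2 u).
Proof.
move=> mu n; elim: n u mu => // n IH u mu; split=> [x|v].
  by have [] := fourier2_cdiff x mu.
rewrite (_ : cD v _ = fourier2 (fun x => fac v x * u x)).
  by apply: IH; exact: moments_fac.
by apply/funext => x; have [_ ->] := fourier2_cdiff x mu.
Qed.

Lemma foldr_fourier2 vs u : moments u ->
  foldr (cD (V := P)) (fourier2 u) vs = fourier2 (fun x => facs vs x * u x).
Proof.
move=> mu; elim: vs => [|v vs IH] /=.
  by congr fourier2; apply/funext => x; rewrite /facs big_nil mul1r.
rewrite IH; apply/funext => x; have [_ ->] := fourier2_cdiff x (moments_facs vs mu).
by congr fourier2; apply/funext => y; rewrite /facs big_cons mulrA.
Qed.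

End plane.

(** * Compactly supported functions and decay *)

Section test_functions_plane.
Context {R : realType}.
Local Notation T1 := (measurableTypeR R).
Local Notation T2 := (measurableTypeR R * measurableTypeR R)%type.
Local Notation P := (R^o * R^o)%type.
Implicit Types (x y v xi : R * R) (u w : R * R -> R[i]).

Lemma csmooth_continuous (V : normedModType R) (u : V -> R[i]) : csmooth u ->
  continuous (fun z : V => Re (u z) : R^o) /\ continuous (fun z : V => Im (u z) : R^o).
Proof.
by move=> /csmoothS[du _]; split=> x; have [d1 d2] := du x;
  [exact: (differentiable_continuous d1)|exact: (differentiable_continuous d2)].
Qed.

Lemma csmooth_cmeas (u : P -> R[i]) : csmooth u -> cmeas (u : T2 -> R[i]).
Proof.
by move=> /csmooth_continuous[cr ci]; split; exact: continuous_measurable_fun2.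
Qed.

Definition tst u := csmooth (V := P) u /\ exists M : R, forall x, u x != 0 -> mnorm x <= M.

Lemma compact_box (x0 : P) (M : R) : compact [set x : P | mnorm (x - x0) <= M].
Proof.
have -> : [set x : P | mnorm (x - x0) <= M] =
    (`[x0.1 - M, x0.1 + M] : set R^o) `*` (`[x0.2 - M, x0.2 + M] : set R^o).
  apply/seteqP; split=> x /=; rewrite mnorm_le !ler_norml !in_itv/= -/(x.1 - x0.1) -/(x.2 - x0.2).
    by move=> /andP[/andP[a b] /andP[c d]]; split; apply/andP; split; lra.
  by move=> [/andP[a b] /andP[c d]]; apply/andP; split; apply/andP; split; lra.
by apply: compact_setX; exact: segment_compact.
Qed.

Lemma continuous_bounded_compact (V : normedModType R) (A : set V) (f : V -> R) :
  continuous (f : V -> R^o) -> compact A -> exists C, 0 <= C /\ forall z : V, A z -> `|f z| <= C.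
Proof.
move=> cf cA; have : compact ((f : V -> R^o) @` A).
  by apply: continuous_compact => //; exact: continuous_subspaceT.
move/compact_bounded => [M [Mr HM]]; exists (`|M| + 1); split; first by rewrite addr_ge0.
move=> x Ax; apply: (HM (`|M| + 1)); last by exists x.
by rewrite (le_lt_trans (ler_norm M))// ltrDl.
Qed.

Lemma csmooth_bounded_compact (V : normedModType R) (A : set V) (u : V -> R[i]) :
  csmooth u -> compact A -> exists C, 0 <= C /\ forall z : V, A z -> normc (u z) <= C.
Proof.
move=> /csmooth_continuous[cr ci] cA.
have [C1 [C10 H1]] := continuous_bounded_compact cr cA.
have [C2 [C20 H2]] := continuous_bounded_compact ci cA.
exists (C1 + C2); split; first by rewrite addr_ge0.
by move=> x Ax; rewrite (le_trans (normc_le_ReIm _))// lerD ?H1 ?H2.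
Qed.

Lemma tst_supp u : tst u -> exists2 M, 0 <= M & forall x, M < mnorm x -> u x = 0.
Proof.
move=> [_ [M HM]]; exists `|M| => // x Mx; apply/eqP; apply: contraTT Mx => /HM.
by rewrite -leNgt => /le_trans; apply; exact: ler_norm.
Qed.

Lemma tst_bounded u : tst u -> exists C, 0 <= C /\ forall x, normc (u x) <= C.
Proof.
move=> tu; have [su _] := tu; have [M M0 uM] := tst_supp tu.
have [C [C0 HC]] := csmooth_bounded_compact su (@compact_box 0 M).
exists C; split=> // x; have [xM|Mx] := leP (mnorm x) M.
  by apply: HC; rewrite /= subr0.
by rewrite (uM _ Mx) normc0.
Qed.

Lemma cD_local (V : normedModType R) (u w : V -> R[i]) (v x : V) :
  (\forall y \near x, u y = w y) -> cD v u x = cD v w x.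
Proof.
move=> uw; have [->|v0] := eqVneq v 0.
  by apply: complexP; rewrite /cD/= !derive0.
by apply: complexP; rewrite /cD/=; apply: near_eq_derive => //;
  apply: filterS uw => y ->.
Qed.

Lemma foldr_cD_local (V : normedModType R) (u w : V -> R[i]) vs (x : V) :
  (\forall y \near x, u y = w y) -> foldr cD u vs x = foldr cD w vs x.
Proof.
elim: vs x => [|v vs IH] x uw /=; first exact: nbhs_singleton uw.
apply: cD_local; have /nbhs_interior H := uw.
by apply: filterS H => y; exact: IH.
Qed.

Lemma near_mnorm_gt x (M : R) : M < mnorm x -> \forall y \near (x : P), M < mnorm y.
Proof.
move=> Mx; apply/nbhs_ballP; exists (mnorm x - M) => /=; first by rewrite subr_gt0.
move=> y; rewrite -ball_normE/= => xy.
have := ler_normB (x : P) (x - y); rewrite subKr -/(mnorm x) -/(mnorm y) => H.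
have : mnorm x <= mnorm y + `|(x : P) - y|.
  rewrite -[in leLHS](subrK (y : P) x) addrC; exact: mnormD.
by lra.
Qed.

Lemma tst_cD v u : tst u -> tst (cD (V := P) v u).
Proof.
move=> tu; have [M M0 uM] := tst_supp tu; have [su _] := tu; split.
  by have /csmoothS[_] := su; exact.
exists M => x; rewrite leNgt; apply: contraNN => Mx; apply/eqP.
rewrite (@cD_local _ _ (fun=> 0)) ?cD_cst//.
by apply: filterS (near_mnorm_gt Mx) => y; exact: uM.
Qed.

Lemma tst_foldr vs u : tst u -> tst (foldr (cD (V := P)) u vs).
Proof. by move=> tu; elim: vs => //= v vs; exact: tst_cD. Qed.

Lemma tstM u w : tst u -> csmooth (V := P) w -> tst (fun x => u x * w x).
Proof.
move=> [su [M HM]] sw; split; first exact: csmoothM.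
by exists M => x ux; apply: HM; apply: contraNN ux => /eqP ->; rewrite mul0r.
Qed.

Lemma tst_conj u : tst u -> tst (fun x => (u x)^*).
Proof.
move=> [su [M HM]]; split; first exact: csmooth_conj.
by exists M => x ux; apply: HM; apply: contraNN ux => /eqP ->; rewrite conjc0.
Qed.

Definition decay u := forall N, exists C, forall x, wt x ^+ N * normc (u x) <= C.

Lemma tst_decay u : tst u -> decay u.
Proof.
move=> tu N; have [M M0 uM] := tst_supp tu; have [C [C0 HC]] := tst_bounded tu.
exists ((1 + M) ^+ N * C) => x; have [xM|Mx] := leP (mnorm x) M.
  apply: ler_pM => //; rewrite ?wtX_ge0 ?normc_ge0//.
  by rewrite lerXn2r ?nnegrE ?(ltW (wt_gt0 x)) ?addr_ge0// lerD2l.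
by rewrite (uM _ Mx) normc0 mulr0 mulr_ge0// exprn_ge0// addr_ge0.
Qed.

Lemma integrable_oneDsqrV : lebesgue_measure.-integrable setT
  (fun x : T1 => ((oneDsqr x)^-1)%:E).
Proof.
have H0 (x : R) : 0 <= (oneDsqr x)^-1 by rewrite invr_ge0.
apply/integrableP; split.
  by apply/measurable_EFinP; apply: continuous_measurable_fun; exact: continuous_oneDsqrV.
under eq_integral do rewrite gee0_abs ?lee_fin//.
rewrite ge0_symfun_integralT//; last 2 first.
- exact: continuous_oneDsqrV.
- by move=> x /=; rewrite /oneDsqr sqrrN.
rewrite (_ : [set x | _] = `[0, +oo[%classic); last first.
  by apply/seteqP; split=> x /=; rewrite in_itv/= andbT.
by rewrite integral0y_oneDsqr -EFinM ltry.
Qed.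

(** (1 + |x|)^4 dominates (1 + x1^2)(1 + x2^2). The exponent 4 in the later constants comes from
    here. *)
Lemma integrable_wtV : leb2.-integrable setT (fun x => ((wt x ^+ 4)^-1)%:E).
Proof.
have := integrable_tensor integrable_oneDsqrV integrable_oneDsqrV.
apply: le_integrable => //.
  apply/measurable_EFinP; apply: measurable_inv_fun; exact: measurable_wtX.
move=> x _; have o0 (t : R) : 0 <= oneDsqr t by exact: ltW (lt_le_trans ltr01 (oneDsqr_ge1 _)).
rewrite /= lee_fin !ger0_norm ?mulr_ge0 ?invr_ge0 ?wtX_ge0 ?o0//.
rewrite -invfM lef_pV2 ?posrE ?mulr_gt0 ?exprn_gt0 ?wt_gt0//.
have H (t : R) : `|t| <= mnorm x -> oneDsqr t <= wt x ^+ 2.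
  move=> tx; rewrite /oneDsqr /wt -(ger0_norm (sqr_ge0 t)) normrX.
  have := mnorm_ge0 x; have := normr_ge0 t; nra.
rewrite (_ : wt x ^+ 4 = wt x ^+ 2 * wt x ^+ 2); last by rewrite -exprD.
by apply: ler_pM; rewrite ?H ?le_mnorm1 ?le_mnorm2.
Qed.

Lemma decay_moments u : cmeas (u : T2 -> R[i]) -> decay u -> moments u.
Proof.
move=> mu du N; have [C HC] := du (N + 4)%N.
apply: (@cint_le _ T2 R leb2 _ (fun x => C * (wt x ^+ 4)^-1)).
- by apply: cmeasM => //; apply: cmeas_real; exact: measurable_wtX.
- exact: (integrable_scale C integrable_wtV).
- move=> x; rewrite normc_wt ler_pdivlMr ?exprn_gt0 ?wt_gt0//.
  by rewrite mulrAC -exprD.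
Qed.

Lemma tst_cmeas u : tst u -> cmeas (u : T2 -> R[i]).
Proof. by move=> [su _]; exact: csmooth_cmeas. Qed.

Lemma tst_moments u : tst u -> moments u.
Proof. by move=> tu; apply: decay_moments; [exact: tst_cmeas|exact: tst_decay]. Qed.

Lemma tst_cint u : tst u -> cintegrable leb2 setT u.
Proof. by move=> /tst_moments/moments_cint. Qed.

(** The fundamental theorem of calculus on [- N, N], at whose endpoints w vanishes. *)
Lemma int_cD1 (w : R^o -> R[i]) (M : R) : csmooth w -> (forall z : R, M < `|z| -> w z = 0) ->
  cintegral leb1 setT (cD (V := R^o) 1 w) = 0.
Proof.
move=> sw wM.
pose N : R := `|M| + 1; have N0 : - N < N by rewrite /N -subr_gt0 opprK addr_gt0// ltr_wpDl.
have wN (x : R) : N <= `|x| -> w x = 0.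
  move=> Nx; apply: wM; apply: lt_le_trans Nx; rewrite (le_lt_trans (ler_norm M))// ltrDl//.
have H (p : R -> R) : (forall x : R^o, differentiable (p : R^o -> R^o) x) ->
    continuous (fun x : R^o => 'D_1 (p : R^o -> R^o) x : R^o) ->
    (forall x : R, N <= `|x| -> p x = 0) ->
    Rintegral leb1 setT (fun x : R^o => 'D_1 (p : R^o -> R^o) x) = 0.
  move=> dp cp pN; pose q (x : R) : R := 'D_1 (p : R^o -> R^o) (x : R^o).
  have out (x : R) : N < `|x| -> q x = 0.
    move=> Nx; rewrite /q (@near_eq_derive _ _ _ (p : R^o -> R^o) (fun=> 0) x 1) ?derive_cst ?oner_neq0//.
    apply/nbhs_ballP; exists (`|x| - N) => /=; first by rewrite subr_gt0.
    move=> y; rewrite -ball_normE/= => xy; apply: pN.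
    have := ler_normD (x - y) y; rewrite subrK; lra.
  rewrite -[LHS]/(Rintegral lebesgue_measure setT q) /Rintegral.
  rewrite (_ : (\int[lebesgue_measure]_x (q x)%:E)%E =
      (\int[lebesgue_measure]_(x in `[(- N)%R, N]) (q x)%:E)%E); last first.
    rewrite [RHS]integral_mkcond; apply: eq_integral => x _; rewrite patchE.
    case: ifPn => // /negP; rewrite inE/= in_itv/= => xN; rewrite out//.
    by rewrite ltNge ler_norml; apply/negP.
  rewrite (@continuous_FTC2 _ q p)//.
  - by rewrite (pN N) ?ler_norm// (pN (- N)) ?normrN ?ler_norm// subee.
  - exact: continuous_subspaceT.
  - split=> [x _||].
    + by apply/derivable1_diffP; exact: dp.
    + by apply: cvg_at_right_filter; exact: (differentiable_continuous (dp _)).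
    + by apply: cvg_at_left_filter; exact: (differentiable_continuous (dp _)).
  - by move=> x _; rewrite derive1E.
have /csmoothS[dw sD] := sw; have [cr ci] := csmooth_continuous (sD 1).
apply: complexP => /=; apply: H => //.
- by move=> x; have [] := dw x.
- by move=> x /wN ->.
- by move=> x; have [] := dw x.
- by move=> x /wN ->.
Qed.

End test_functions_plane.

(** * Affine maps and mean value inequalities *)

Section affine_maps.
Context {R : realType}.

Lemma affine_diff (V W : normedModType R) (A L : V -> W) (c : R) :
  linear L -> (forall h, `|L h| <= c * `|h|) -> (forall x h, A (x + h) = A x + L h) ->
  forall x, differentiable A x /\ 'd A x = L :> (V -> W).
Proof.
move=> lL cL AL x; apply: (@diff_quadratic R V W A x L c 0) => // h.
by rewrite AL [A x + _]addrC addrK subrr normr0 mul0r.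
Qed.

(** The mean value theorem on the segment from y to x, applied separately to the real and imaginary
    parts, whence the factor 2. *)
Lemma lipschitz_cD (V : normedModType R) (u : V -> R[i]) (L : R) :
  csmooth u -> (forall z v, normc (cD v u z) <= L * `|v|) ->
  forall x y, normc (u x - u y) <= 2 * (L * `|x - y|).
Proof.
move=> /csmoothS[du _] HL x y.
pose A (t : R^o) : V := y + (t : R) *: (x - y).
have dA : forall t, differentiable A t /\ 'd A t = (fun h : R^o => (h : R) *: (x - y)) :> (R^o -> V).
  apply: (@affine_diff _ _ _ _ `|x - y|).
  - by move=> k g h; rewrite scalerDl scalerA.
  - by move=> h; rewrite normrZ mulrC.
  - by move=> t h; rewrite /A scalerDl addrA.
have H t : cdiff (u \o A) t /\ cD (1 : R^o) (u \o A) t = cD (x - y) u (A t).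
  have [d1 d2] := dA t; have [c1 c2] := cdiff_comp d1 d2 (du _); split; first exact: c1.
  by rewrite c2 scale1r.
have B (t : R) : normc (cD (x - y) u (A t)) <= L * `|x - y| by exact: HL.
have A1 : A 1 = x by rewrite /A scale1r addrC subrK.
have A0 : A 0 = y by rewrite /A scale0r addr0.
have HR : `|Re (u (A 1)) - Re (u (A 0))| <= L * `|x - y| * `|1 - 0 : R|.
  apply: (@le_lipschitz R (fun t => Re (u (A t))) (fun t => Re (cD (x - y) u (A t)))).
    move=> t; have [[d1 _] e] := H t.
    apply: DeriveDef; first exact: (diff_derivable (v := (1 : R^o)) d1).
    by rewrite -e.
  by move=> t _; exact: le_trans (le_normc_Re _) (B t).
have HI : `|Im (u (A 1)) - Im (u (A 0))| <= L * `|x - y| * `|1 - 0 : R|.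
  apply: (@le_lipschitz R (fun t => Im (u (A t))) (fun t => Im (cD (x - y) u (A t)))).
    move=> t; have [[_ d1] e] := H t.
    apply: DeriveDef; first exact: (diff_derivable (v := (1 : R^o)) d1).
    by rewrite -e.
  by move=> t _; exact: le_trans (le_normc_Im _) (B t).
rewrite A1 A0 subr0 normr1 mulr1 in HR HI.
rewrite (le_trans (normc_le_ReIm _))// mulr_natl mulr2n !(Re_addc, Im_addc, Re_oppc, Im_oppc).
exact: lerD.
Qed.

(** Takes the place of a passage to the limit: it is applied to the modulus of an error shown to be
    O(1 / (n + 1)). *)
Lemma le_archi0 (x C : R) : (forall n : nat, x <= C * n.+1%:R^-1) -> x <= 0.
Proof.
move=> H; rewrite leNgt; apply/negP => x0.
have C0 : 0 < C by have := H 0%N; rewrite invr1 mulr1; exact: lt_le_trans.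
have xC : 0 < x / C by rewrite divr_gt0.
have [N _ HN] := @near_infty_natSinv_lt R (PosNum xC).
have := HN N (leqnn N); rewrite /= ltr_pdivlMr// => h.
by move: (H N); rewrite leNgt mulrC h.
Qed.

End affine_maps.

(** * Integration by parts and rapid decay of the transform *)

Section fourier_test_functions.
Context {R : realType}.
Local Notation T1 := (measurableTypeR R).
Local Notation T2 := (measurableTypeR R * measurableTypeR R)%type.
Local Notation P := (R^o * R^o)%type.
Local Notation int := (cintegral leb2 setT).
Local Notation cint := (cintegrable leb2 setT).
Implicit Types (x y v xi : R * R) (u w : R * R -> R[i]).

Lemma cintegral_prod12 (f : T2 -> R[i]) : cint f ->
  (forall x : R, cintegrable leb1 setT (fun y : R => f (x, y))) ->
  int f = cintegral leb1 setT (fun x : R => cintegral leb1 setT (fun y : R => f (x, y))).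
Proof.
have H (p : T2 -> R) : leb2.-integrable setT (EFin \o p) ->
    (forall x : R, leb1.-integrable setT (fun y : R => (p (x, y))%:E)) ->
    Rintegral leb2 setT p = Rintegral leb1 setT (fun x : R => Rintegral leb1 setT (fun y : R => p (x, y))).
  move=> ip i2; rewrite /Rintegral.
  under [in RHS]eq_integral => x _ do rewrite fineK ?integrable_fin_num//.
  by have /= -> := integral12_prod_meas1 (m1 := lebesgue_measure) (m2 := lebesgue_measure) ip.
move=> [fr fi] f2; apply: complexP => /=.
  by apply: (H (fun z => Re (f z))) => // x; have [] := f2 x.
by apply: (H (fun z => Im (f z))) => // x; have [] := f2 x.
Qed.

Lemma cintegral_prod21 (f : T2 -> R[i]) : cint f ->
  (forall y : R, cintegrable leb1 setT (fun x : R => f (x, y))) ->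
  int f = cintegral leb1 setT (fun y : R => cintegral leb1 setT (fun x : R => f (x, y))).
Proof.
have H (p : T2 -> R) : leb2.-integrable setT (EFin \o p) ->
    (forall y : R, leb1.-integrable setT (fun x : R => (p (x, y))%:E)) ->
    Rintegral leb2 setT p = Rintegral leb1 setT (fun y : R => Rintegral leb1 setT (fun x : R => p (x, y))).
  move=> ip i2; rewrite /Rintegral.
  under [in RHS]eq_integral => x _ do rewrite fineK ?integrable_fin_num//.
  by have /= -> := integral21_prod_meas1 (m1 := lebesgue_measure) (m2 := lebesgue_measure) ip.
move=> [fr fi] f2; apply: complexP => /=.
  by apply: (H (fun z => Re (f z))) => // x; have [] := f2 x.
by apply: (H (fun z => Im (f z))) => // x; have [] := f2 x.
Qed.

Lemma oneDsqr_le_wt (t : R) x : `|t| <= mnorm x -> oneDsqr t <= wt x ^+ 2.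
Proof.
move=> tx; rewrite /oneDsqr /wt -(ger0_norm (sqr_ge0 t)) normrX.
have := mnorm_ge0 x; have := normr_ge0 t; nra.
Qed.

Lemma slice1_diff (b : R) (t : R^o) : differentiable (fun t : R^o => (t, b) : P) t /\
  'd (fun t : R^o => (t, b) : P) t = (fun h : R^o => (h, 0) : P) :> (R^o -> P).
Proof.
apply: (@affine_diff _ _ _ _ _ 1).
- move=> k g h; have -> : k *: ((g, 0) : P) + ((h, 0) : P) = (k *: g + h, k * 0 + 0) by [].
  by rewrite mulr0 addr0.
- by move=> h; rewrite -[leLHS]/(mnorm (h, 0)) mnormE/= normr0 mul1r ge_max lexx/=.
- move=> x h; have -> : ((x, b) : P) + ((h, 0) : P) = (x + h, b + 0) by [].
  by rewrite addr0.
Qed.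

Lemma slice2_diff (b : R) (t : R^o) : differentiable (fun t : R^o => (b, t) : P) t /\
  'd (fun t : R^o => (b, t) : P) t = (fun h : R^o => (0, h) : P) :> (R^o -> P).
Proof.
apply: (@affine_diff _ _ _ _ _ 1).
- move=> k g h; have -> : k *: ((0, g) : P) + ((0, h) : P) = (k * 0 + 0, k *: g + h) by [].
  by rewrite mulr0 addr0.
- by move=> h; rewrite -[leLHS]/(mnorm (0, h)) mnormE/= normr0 mul1r ge_max lexx/= andbT.
- move=> x h; have -> : ((b, x) : P) + ((0, h) : P) = (b + 0, x + h) by [].
  by rewrite addr0.
Qed.

Lemma cD_coord u (x : P) v : cdiff (V := P) u x ->
  cD v u x = v.1%:C * cD ((1, 0) : P) u x + v.2%:C * cD ((0, 1) : P) u x.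
Proof.
move=> du; have E : v = (v.1 *: ((1, 0) : P) + v.2 *: ((0, 1) : P)) :> P.
  have -> : v.1 *: ((1, 0) : P) + v.2 *: ((0, 1) : P) =
    (v.1 * 1 + v.2 * 0, v.1 * 0 + v.2 * 1) by [].
  by rewrite !mulr1 !mulr0 addr0 add0r; case: v.
rewrite [X in cD X]E (cD_dirD _ _ du).
by rewrite (cD_dirZ v.1 ((1, 0) : P) du) (cD_dirZ v.2 ((0, 1) : P) du).
Qed.

(** For a coordinate direction, integrate along that coordinate first; a general direction is a
    combination of the two. *)
Lemma int_cD v u : tst u -> int (cD (V := P) v u) = 0.
Proof.
move=> tu; have [su _] := tu; have /csmoothS[du _] := su.
have [M M0 uM] := tst_supp tu.
have slice1 (w : P -> R[i]) b : tst w -> cintegrable leb1 setT (fun t : T1 => w (t, b)).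
  move=> tw; have [C HC] := tst_decay tw 2.
  apply: (@cint_le _ T1 R leb1 _ (fun t => C * (oneDsqr t)^-1)).
  - exact: (cmeas_comp (pair2_measurable b) (tst_cmeas tw)).
  - exact: (integrable_scale C integrable_oneDsqrV).
  - move=> t; rewrite ler_pdivlMr// mulrC (le_trans _ (HC (t, b)))//.
    by rewrite ler_wpM2r ?normc_ge0// oneDsqr_le_wt// (le_mnorm1 (t, b)).
have slice2 (w : P -> R[i]) b : tst w -> cintegrable leb1 setT (fun t : T1 => w (b, t)).
  move=> tw; have [C HC] := tst_decay tw 2.
  apply: (@cint_le _ T1 R leb1 _ (fun t => C * (oneDsqr t)^-1)).
  - exact: (cmeas_comp (pair1_measurable b) (tst_cmeas tw)).
  - exact: (integrable_scale C integrable_oneDsqrV).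
  - move=> t; rewrite ler_pdivlMr// mulrC (le_trans _ (HC (b, t)))//.
    by rewrite ler_wpM2r ?normc_ge0// oneDsqr_le_wt// (le_mnorm2 (b, t)).
have I1 : int (cD ((1, 0) : P) u) = 0.
  have tD := tst_cD (1, 0) tu.
  rewrite cintegral_prod21; [|exact: tst_cint|by move=> b; exact: slice1].
  rewrite -[RHS](cintegral0 leb1); congr cintegral; apply/funext => b.
  have sA := csmooth_comp_affine (slice1_diff b) su.
  rewrite -[RHS](@int_cD1 R (u \o (fun t : R^o => (t, b) : P)) M sA).
    congr cintegral; apply/funext => t /=.
    have [d1 d2] := slice1_diff b t.
    by have [_ ->] := cdiff_comp d1 d2 (du _).
  by move=> z Mz; apply: uM; apply: (lt_le_trans Mz); exact: (le_mnorm1 (z, b)).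
have I2 : int (cD ((0, 1) : P) u) = 0.
  have tD := tst_cD (0, 1) tu.
  rewrite cintegral_prod12; [|exact: tst_cint|by move=> b; exact: slice2].
  rewrite -[RHS](cintegral0 leb1); congr cintegral; apply/funext => b.
  have sA := csmooth_comp_affine (slice2_diff b) su.
  rewrite -[RHS](@int_cD1 R (u \o (fun t : R^o => (b, t) : P)) M sA).
    congr cintegral; apply/funext => t /=.
    have [d1 d2] := slice2_diff b t.
    by have [_ ->] := cdiff_comp d1 d2 (du _).
  by move=> z Mz; apply: uM; apply: (lt_le_trans Mz); exact: (le_mnorm2 (b, z)).
rewrite (_ : cD v u = fun x => v.1%:C * cD ((1, 0) : P) u x + v.2%:C * cD ((0, 1) : P) u x).
  have i1 := tst_cint (tst_cD (1, 0) tu); have i2 := tst_cint (tst_cD (0, 1) tu).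
  rewrite (cintegralD (cintZ v.1%:C i1) (cintZ v.2%:C i2)).
  rewrite (cintegralZ _ i1) (cintegralZ _ i2) I1 I2.
  by rewrite (mulr0 v.1%:C) (mulr0 v.2%:C) (addr0 (0 : R[i])).
by apply/funext => x; rewrite (cD_coord _ (du x)).
Qed.

Lemma tst_dir_bound u : tst u -> exists L, 0 <= L /\
  forall x v, normc (cD (V := P) v u x) <= L * mnorm v.
Proof.
move=> tu; have /csmoothS[du _] := tu.1.
have [C1 [C10 H1]] := tst_bounded (tst_cD (1, 0) tu).
have [C2 [C20 H2]] := tst_bounded (tst_cD (0, 1) tu).
exists (C1 + C2); split; first by rewrite addr_ge0.
move=> x v.
rewrite (cD_coord _ (du x)).
have H (w y : R) (z : R[i]) C : normc z <= C -> `|w| <= y -> normc (w%:C * z) <= C * y.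
  by move=> zC wy; rewrite normcM normcC mulrC ler_pM ?normc_ge0.
apply: (le_trans (normcD _ _)); rewrite mulrDl.
by apply: lerD; apply: H; rewrite ?le_mnorm1 ?le_mnorm2.
Qed.

Lemma tst_lipschitz u : tst u -> exists L, 0 <= L /\
  forall x y, normc (u x - u y) <= L * mnorm (x - y).
Proof.
move=> tu; have [L [L0 HL]] := tst_dir_bound tu; exists (2 * L).
split; first by rewrite mulr_ge0.
by move=> x y; have := lipschitz_cD tu.1 HL x y; rewrite mulrA.
Qed.

(** Integration by parts: the integral of the derivative of u times [ech xi] vanishes. *)
Lemma fourier2_cD v u xi : tst u ->
  fourier2 (cD (V := P) v u) xi = - fac v xi * fourier2 u xi.
Proof.
move=> tu; have [su _] := tu; have /csmoothS[du _] := su.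
have tue : tst (fun x => u x * ech xi x) by apply: tstM => //; exact: csmooth_ech.
have := int_cD v tue.
rewrite (_ : cD v _ = fun x => cD v u x * ech xi x + fac v xi * (u x * ech xi x)); last first.
  apply/funext => x; have [d1 d2] := ech_cdiff xi x.
  by rewrite cDM// d2 mulrCA.
rewrite cintegralD; [|exact/cint_ech/tst_cint/tst_cD|exact/cintZ/tst_cint].
rewrite cintegralZ; last exact: tst_cint.
by move/eqP; rewrite addr_eq0 => /eqP; rewrite mulNr.
Qed.

Lemma fac_constant_derivative v x : cdiff (V := P) (fac v) x /\
  forall g, cD (V := P) g (fac v) x = fac v g.
Proof.
have facC (a b : R * R) : fac a b = fac b a by rewrite /fac dotC.
apply: (@cdiff_quadratic R P (fac v) x (fac v) (4 * pi * mnorm v) 0).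
- by move=> k g h; rewrite !(facC v) fac_linear.
- by move=> h; exact: normc_fac.
- move=> h; rewrite !(facC v) -[X in fac (X + _)](scale1r (x : P)) fac_linear mul1r.
  by rewrite [fac x v + _]addrC addrK subrr normc0 mul0r.
Qed.

Lemma csmooth_fac v : csmooth (V := P) (fac v).
Proof.
have H := fac_constant_derivative v.
case=> [|n]; first exact: I.
split=> [x|g]; first exact: (H x).1.
rewrite (_ : cD _ _ = fun=> fac v g); first exact: cCn_cst.
by apply/funext => x; exact: (H x).2.
Qed.

Lemma tst_fac v u : tst u -> tst (fun x => fac v x * u x).
Proof.
move=> tu; rewrite (_ : (fun x => _) = fun x => u x * fac v x).
  by apply: tstM => //; exact: csmooth_fac.
by apply/funext => x; rewrite mulrC.
Qed.

Lemma tst_facs vs u : tst u -> tst (fun x => facs vs x * u x).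
Proof.
move=> tu; elim: vs => [|v vs IH].
  rewrite (_ : (fun x => _) = u)//.
  by apply/funext => x; rewrite /facs big_nil mul1r.
rewrite (_ : (fun x => _) = fun x => fac v x * (facs vs x * u x)); first exact: tst_fac.
by apply/funext => x; rewrite /facs big_cons mulrA.
Qed.

Lemma tst_fourier2_bounded u : tst u -> exists C, forall xi, normc (fourier2 u xi) <= C.
Proof.
move=> tu; have iu := tst_cint tu.
exists (2 * fine (\int[leb2]_x (normc (u x))%:E)%E) => xi.
apply: normc_fourier2 => //; rewrite fineK// ge0_fin_numE; first exact: cint_lty.
by apply: integral_ge0 => x _; rewrite lee_fin normc_ge0.
Qed.

(** Multiplying the transform by powers of [fac v] amounts, up to sign, to differentiating u. The
    powers for the two coordinate directions control the weight, the factor 2 pi being at least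
    1. *)
Lemma fourier2_decay u : tst u -> decay (fourier2 u).
Proof.
move=> tu N.
have H v n : exists C, forall xi, normc (fac v xi) ^+ n * normc (fourier2 u xi) <= C.
  have [C HC] := tst_fourier2_bounded (tst_foldr (nseq n v) tu).
  exists C => xi; have := HC xi.
  rewrite (_ : fourier2 _ xi = (- fac v xi) ^+ n * fourier2 u xi).
    rewrite normcM; congr (_ * _ <= _).
    by elim: n {HC} => [|n IH]; rewrite ?expr0 ?normcC ?normr1// !exprS normcM normcN IH.
  elim: n {HC} => [|n IH] /=; first by rewrite expr0 mul1r.
  by rewrite fourier2_cD ?IH ?mulrA -?exprS//; exact: tst_foldr.
have [C0 H0] := H 0 0%N.
have [C1 H1] := H (1, 0) N.
have [C2 H2] := H (0, 1) N.
exists (2 ^+ N * (C0 + C1 + C2)) => xi.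
have f1 : `|xi.1| <= normc (fac (1, 0) xi).
  rewrite (le_trans _ (le_normc_Im _))//= /dot/= mul1r mul0r addr0 normrN normrM ler_peMl//.
  by rewrite ger0_norm ?mulr_ge0 ?pi_ge0//; have := @pi_ge2 R; lra.
have f2 : `|xi.2| <= normc (fac (0, 1) xi).
  rewrite (le_trans _ (le_normc_Im _))//= /dot/= mul1r mul0r add0r normrN normrM ler_peMl//.
  by rewrite ger0_norm ?mulr_ge0 ?pi_ge0//; have := @pi_ge2 R; lra.
have F0 := normc_ge0 (fourier2 u xi).
have K : wt xi ^+ N <= 2 ^+ N * (1 + normc (fac (1, 0) xi) ^+ N + normc (fac (0, 1) xi) ^+ N).
  have n1 := exprn_ge0 N (normc_ge0 (fac (1, 0) xi)).
  have n2 := exprn_ge0 N (normc_ge0 (fac (0, 1) xi)).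
  have key t : 0 <= t -> wt xi <= 2 * t -> wt xi ^+ N <= 2 ^+ N * t ^+ N.
    move=> t0 wtt; rewrite -exprMn lerXn2r ?nnegrE ?(ltW (wt_gt0 _)) ?mulr_ge0//.
  have [m1|m1] := leP (mnorm xi) 1.
    rewrite (le_trans (key 1 _ _))//; first by rewrite /wt; lra.
    by rewrite expr1n ler_wpM2l ?exprn_ge0//; lra.
  have [m2|m2] := leP `|xi.1| `|xi.2|.
    rewrite (le_trans (key (normc (fac (0, 1) xi)) _ _)) ?normc_ge0//.
      have e : mnorm xi = `|xi.2| by rewrite mnormE; exact/max_idPr.
      by rewrite /wt; rewrite e in m1 *; lra.
    by rewrite ler_wpM2l ?exprn_ge0//; lra.
  rewrite (le_trans (key (normc (fac (1, 0) xi)) _ _)) ?normc_ge0//.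
    have e : mnorm xi = `|xi.1| by rewrite mnormE; exact/max_idPl/ltW.
    by rewrite /wt; rewrite e in m1 *; lra.
  by rewrite ler_wpM2l ?exprn_ge0//; lra.
rewrite (le_trans (ler_wpM2r F0 K))// -mulrA ler_wpM2l ?exprn_ge0//.
rewrite !mulrDl !lerD//.
by have := H0 xi; rewrite expr0.
Qed.

Definition sch u := csmooth (V := P) u /\ forall vs, decay (foldr (cD (V := P)) u vs).

Lemma schP u : schwartz2 u <-> sch u.
Proof.
split=> [[/csmooth_onP su du]|[/csmooth_onP su du]]; split=> //.
  by move=> vs N; have [c Hc] := du N vs; exists c => x; rewrite -iter_cderiveE; exact: Hc.
by move=> N vs; have [c Hc] := du vs N; exists c => x; rewrite iter_cderiveE; exact: Hc.
Qed.

Lemma tst_sch u : tst u -> sch u.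
Proof. by move=> tu; split=> [|vs]; [exact: tu.1|exact/tst_decay/tst_foldr]. Qed.

Lemma sch_moments u : sch u -> moments u.
Proof.
by move=> [su du]; apply: decay_moments; [exact: csmooth_cmeas|exact: (du [::])].
Qed.

Lemma sch_fourier2 u : tst u -> sch (fourier2 u).
Proof.
move=> tu; have mu := tst_moments tu; split=> [|vs]; first exact: csmooth_fourier2.
by rewrite foldr_fourier2//; apply: fourier2_decay; exact: tst_facs.
Qed.

(** Fubini for the kernel [ech], which is symmetric in its two variables. *)
Lemma multiplication_formula u w : cint u -> cint w ->
  int (fun xi => fourier2 u xi * w xi) = int (fun x => u x * fourier2 w x).
Proof.
move=> iu iw.
transitivity (int (fun xi => int (fun x => u x * w xi * ech xi x))).
  congr cintegral; apply/funext => xi; rewrite mulrC -cintegralZ; last exact: cint_ech.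
  by congr cintegral; apply/funext => x; rewrite mulrCA mulrA.
rewrite (@cfubini2 R (fun z => u z.2 * w z.1 * ech z.1 z.2)
   (fun x => normc (w x)) (fun x => normc (u x))).
- congr cintegral; apply/funext => x; rewrite -cintegralZ; last exact: cint_ech.
  by congr cintegral; apply/funext => xi; rewrite echC mulrA.
- apply: cmeasM.
    apply: cmeasM.
      exact: (cmeas_comp measurable_snd (cint_meas iu)).
    exact: (cmeas_comp measurable_fst (cint_meas iw)).
  apply: cmeas_cis; apply: measurable_funN; apply: measurable_funM => //.
  by apply: measurable_dot; [exact: measurable_snd|exact: measurable_fst].
- exact: cint_normc.
- exact: cint_normc.
- by move=> x y /=; rewrite !normcM normc_ech mulr1 mulrC.
Qed.

End fourier_test_functions.

(** * Fourier inversion and Plancherel *)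

Section fourier_inversion.
Context {R : realType}.
Local Notation T2 := (measurableTypeR R * measurableTypeR R)%type.
Local Notation P := (R^o * R^o)%type.
Local Notation int := (cintegral leb2 setT).
Local Notation cint := (cintegrable leb2 setT).
Implicit Types (x y v xi : R * R) (u w : R * R -> R[i]).

Lemma tst_comp_affine (A L : P -> P) (c b : R) u : tst u ->
  (forall x, differentiable A x /\ 'd A x = L :> (P -> P)) ->
  (forall x, mnorm x <= c * mnorm (A x) + b) -> 0 <= c -> tst (u \o A).
Proof.
move=> tu dA cA c0; split; first exact: csmooth_comp_affine dA tu.1.
have [M M0 uM] := tst_supp tu.
exists (c * M + b) => x; rewrite leNgt; apply: contraNN => Mx; apply/eqP; apply: uM.
rewrite ltNge; apply/negP => AM.
by have := cA x; have := ler_wpM2l c0 AM; lra.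
Qed.

Lemma scale_diff (c : R) (x : P) : differentiable (fun x : P => c *: x) x /\
  'd (fun x : P => c *: x) x = (fun x : P => c *: x) :> (P -> P).
Proof.
apply: (@affine_diff _ _ _ _ _ `|c|).
- by move=> k g h; rewrite scalerDr !scalerA mulrC.
- by move=> h; rewrite normrZ.
- by move=> y h; rewrite scalerDr.
Qed.

Lemma translate_diff (a : P) (x : P) : differentiable (fun x : P => x + a) x /\
  'd (fun x : P => x + a) x = (fun x : P => x) :> (P -> P).
Proof.
apply: (@affine_diff _ _ _ _ _ 1) => //.
- by move=> h; rewrite mul1r.
- by move=> y h; rewrite addrAC.
Qed.

Lemma tst_scale (c : R) u : c != 0 -> tst u -> tst (fun x => u (c *: (x : P))).
Proof.
move=> c0 tu; apply: (@tst_comp_affine _ _ `|c|^-1 0 _ tu (scale_diff c)); last by rewrite invr_ge0.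
by move=> x; rewrite addr0 /mnorm normrZ mulKf ?normr_eq0.
Qed.

Lemma tst_translate (a : P) u : tst u -> tst (fun x => u ((x : P) + a)).
Proof.
move=> tu; apply: (@tst_comp_affine _ _ 1 (mnorm a) _ tu (translate_diff a)) => //.
by move=> x; rewrite mul1r -[X in mnorm X <= _](addrK (a : P)); exact: mnormB.
Qed.

Lemma rescales_scale (c : R) : c != 0 -> rescales (fun x : P => c *: x) (`|c|^-1 ^+ 2).
Proof.
move=> c0; rewrite expr2 (_ : (fun x : P => _) = fun x => (c * x.1 + 0, c * x.2 + 0)).
  exact: rescales_diag.
by apply/funext => x; rewrite !addr0.
Qed.

Lemma rescales_translate (a : P) : rescales (fun x : P => x + a) 1.
Proof.
have := @rescales_diag R 1 a.1 1 a.2 (oner_neq0 _) (oner_neq0 _).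
rewrite normr1 invr1 mulr1.
by rewrite (_ : (fun x => _) = (fun x : P => x + a))//; apply/funext => x; rewrite !mul1r.
Qed.

Lemma rescales_opp : rescales (fun x : P => - x) 1.
Proof.
have n1 : (-1 : R) != 0 by rewrite oppr_eq0 oner_neq0.
have := @rescales_diag R (-1) 0 (-1) 0 n1 n1.
rewrite normrN normr1 invr1 mulr1.
by rewrite (_ : (fun x => _) = (fun x : P => - x))//; apply/funext => x; rewrite !mulN1r !addr0.
Qed.

Lemma cintegral_scale (c : R) u : 0 < c -> cint u ->
  int (fun x => u (c *: (x : P))) = (c^-1 ^+ 2)%:C * int u.
Proof.
move=> c0 iu; have := cintegral_rescales (rescales_scale (lt0r_neq0 c0)) iu.
by rewrite gtr0_norm.
Qed.

Lemma cintegral_translate (a : P) u : cint u -> int (fun x => u ((x : P) + a)) = int u.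
Proof. by move=> iu; rewrite (cintegral_rescales (rescales_translate a) iu) mul1r. Qed.

Lemma cintegral_opp u : cint u -> int (fun x => u (- (x : P))) = int u.
Proof. by move=> iu; rewrite (cintegral_rescales rescales_opp iu) mul1r. Qed.

Lemma fourier2_scale (c : R) u y : 0 < c -> cint u ->
  fourier2 (fun x => u (c *: (x : P))) y = (c^-1 ^+ 2)%:C * fourier2 u (c^-1 *: (y : P)).
Proof.
move=> c0 iu; rewrite !fourier2E -cintegral_scale//; last exact: cint_ech.
congr cintegral; apply/funext => x; congr (_ * _).
rewrite /ech; congr cis; congr (- (_ * _)).
by rewrite /dot /= /GRing.scale /=; field; rewrite gt_eqF.
Qed.

Lemma fourier2_translate (a : P) u xi : cint u ->
  fourier2 (fun x => u ((x : P) + a)) xi = ech xi (- a) * fourier2 u xi.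
Proof.
move=> iu; rewrite !fourier2E -[in LHS](cintegral_translate (- a)); last first.
  by apply: cint_ech; exact: (cint_rescales (rescales_translate a) iu).
rewrite -cintegralZ; last exact: cint_ech.
congr cintegral; apply/funext => x.
by rewrite subrK (echD xi (x : P) (- a)) mulrA mulrC.
Qed.

Definition ift u x := fourier2 u (- x).

Lemma iftE u x : cint u -> ift u x = int (fun xi => u (- xi) * ech x xi).
Proof.
move=> iu; rewrite /ift fourier2E -[LHS]cintegral_opp; last exact: cint_ech.
by congr cintegral; apply/funext => xi; rewrite ech_oppl opprK.
Qed.

Lemma conjc_mul (z w : R[i]) : (z * w)^* = z^* * w^*.
Proof.
by apply: complexP; rewrite ?(Re_mulc, Im_mulc); case: z w => [a b] [c d] /=; ring.
Qed.

Lemma conj_fourier2 u xi : cint u -> (fourier2 u xi)^* = ift (fun x => (u x)^*) xi.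
Proof.
move=> iu; rewrite /ift !fourier2E -cintegral_conj; last exact: cint_ech.
congr cintegral; apply/funext => x; rewrite conjc_mul; congr (_ * _).
by rewrite ech_oppl; exact: ech_conj.
Qed.

(** One constant for a whole family of error terms: an integrand below c |x| |u(x)| integrates to
    O(c). *)
Lemma moments_bound1 u : moments u -> exists C, 0 <= C /\
  forall (w : T2 -> R[i]) (c : R), cint w -> 0 <= c ->
  (forall x, normc (w x) <= c * mnorm x * normc (u x)) -> normc (int w) <= c * C.
Proof.
move=> mu; have i1 := mu 1%N.
have f1 : (\int[leb2]_x (normc ((wt x ^+ 1)%:C * u x))%:E)%E \is a fin_num.
  rewrite ge0_fin_numE; first exact: cint_lty i1.
  by apply: integral_ge0 => x _; rewrite lee_fin normc_ge0.
set I := (\int[leb2]_x _)%E in f1; exists (2 * fine I); split.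
  by rewrite mulr_ge0// fine_ge0//; apply: integral_ge0 => x _; rewrite lee_fin normc_ge0.
move=> w c iw c0 H; rewrite mulrCA; apply: normc_cintegral_le => //.
rewrite EFinM fineK// /I -ge0_integral_scale//; last 2 first.
- exact: measurable_normc (cint_meas i1).
- by move=> x; rewrite normc_ge0.
apply: ge0_le_integral_any => // x _; rewrite ?lee_fin ?mulr_ge0 ?normc_ge0//.
rewrite normc_wt expr1 (le_trans (H x))// -mulrA ler_wpM2l// ler_wpM2r ?normc_ge0//.
exact: mnorm_le_wt.
Qed.

Section kappa.
Variable k0 : R * R -> R[i].
Hypothesis tk0 : tst k0.
Hypothesis k00 : k0 0 = 1.

Let ckappa : R[i] := int (fourier2 k0).

(** The classical argument with k0(c xi), c small, in place of a Gaussian. The multiplication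
    formula moves the dilation from k0 to u, and each side is within O(c) of its limit because k0
    and u are Lipschitz and their transforms have first moments. *)
Let fourier_at0 u : tst u -> int (fourier2 u) = u 0 * ckappa.
Proof.
move=> tu; have tk := tk0; have ik := tst_cint tk; have iu := tst_cint tu.
have sFu := sch_fourier2 tu; have sFk := sch_fourier2 tk.
have iFu := moments_cint (sch_moments sFu); have iFk := moments_cint (sch_moments sFk).
have [L1 [L10 H1]] := tst_lipschitz tk; have [L2 [L20 H2]] := tst_lipschitz tu.
have [B1 [B10 HB1]] := moments_bound1 (sch_moments sFu).
have [B2 [B20 HB2]] := moments_bound1 (sch_moments sFk).
have E (c : R) : 0 < c -> int (fun xi => fourier2 u xi * k0 (c *: (xi : P))) =
    int (fun y => u (c *: (y : P)) * fourier2 k0 y).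
  move=> c0; have tkc := tst_scale (lt0r_neq0 c0) tk.
  rewrite (multiplication_formula iu (tst_cint tkc)).
  have igp : cint (fun y => u y * fourier2 k0 (c^-1 *: (y : P))).
    exact: tst_cint (tstM tu (csmooth_comp_affine (scale_diff c^-1) sFk.1)).
  have eg := cintegral_scale c0 igp.
  transitivity ((c^-1 ^+ 2)%:C * int (fun y => u y * fourier2 k0 (c^-1 *: (y : P)))).
    rewrite -cintegralZ//; congr cintegral; apply/funext => y.
    by rewrite (fourier2_scale y c0 (tst_cint tk)) mulrCA.
  rewrite -eg; congr cintegral; apply/funext => y.
  by rewrite scalerA mulVf ?gt_eqF// scale1r.
have D (c : R) : 0 < c -> normc (int (fourier2 u) - u 0 * ckappa) <= (L1 * B1 + L2 * B2) * c.
  move=> c0; have tkc := tst_scale (lt0r_neq0 c0) tk; have tuc := tst_scale (lt0r_neq0 c0) tu.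
  have i1 : cint (fun xi => fourier2 u xi * k0 (c *: (xi : P))).
    rewrite (_ : (fun _ => _) = fun xi => k0 (c *: (xi : P)) * fourier2 u xi).
      exact: tst_cint (tstM tkc sFu.1).
    by apply/funext => xi; rewrite mulrC.
  have i2 : cint (fun y => u (c *: (y : P)) * fourier2 k0 y) by exact: tst_cint (tstM tuc sFk.1).
  have e1 : normc (int (fourier2 u) - int (fun xi => fourier2 u xi * k0 (c *: (xi : P)))) <= (L1 * c) * B1.
    rewrite -cintegralB//; apply: HB1; [exact: cintB|by rewrite mulr_ge0// ltW|move=> x].
    rewrite -[X in X - _]mulr1 -mulrBr normcM mulrC ler_wpM2r ?normc_ge0//.
    rewrite -k00 (le_trans (H1 0 (c *: (x : P))))// -mulrA ler_wpM2l//.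
    by rewrite sub0r /mnorm normrN normrZ gtr0_norm.
  have e2 : normc (int (fun y => u (c *: (y : P)) * fourier2 k0 y) - u 0 * ckappa) <= (L2 * c) * B2.
    rewrite -cintegralZ// -cintegralB//; last exact: cintZ.
    apply: HB2; [by apply: cintB => //; exact: cintZ|by rewrite mulr_ge0// ltW|move=> x].
    rewrite -mulrBl normcM ler_wpM2r ?normc_ge0//.
    rewrite (le_trans (H2 (c *: (x : P)) 0))// -mulrA ler_wpM2l//.
    by rewrite subr0 /mnorm normrZ gtr0_norm.
  rewrite -(subrK (int (fun xi => fourier2 u xi * k0 (c *: (xi : P)))) (int (fourier2 u))) -addrA.
  rewrite (le_trans (normcD _ _))// [leRHS](_ : _ = L1 * c * B1 + L2 * c * B2); last by ring.
  by apply: lerD => //; rewrite E.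
have : normc (int (fourier2 u) - u 0 * ckappa) <= 0.
  apply: (@le_archi0 _ _ (L1 * B1 + L2 * B2)) => n; apply: D.
  by rewrite invr_gt0 ltr0n.
move=> H; apply/eqP; rewrite -subr_eq0; apply/eqP; apply: ComplexField.Normc.eq0_normc.
by apply/eqP; rewrite eq_le H normc_ge0.
Qed.

(** The formula at the origin, applied to a translate of u. *)
Let fourier2_ift u x : tst u -> fourier2 (ift u) x = ckappa * u x.
Proof.
move=> tu; have tux := tst_translate (x : P) tu.
have := fourier_at0 tux; rewrite add0r mulrC => <-.
have iF := moments_cint (sch_moments (sch_fourier2 tu)).
rewrite fourier2E -[LHS]cintegral_opp.
  congr cintegral; apply/funext => xi.
  rewrite fourier2_translate//; last exact: tst_cint.
  rewrite /ift opprK mulrC; congr (_ * _).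
  by rewrite -ech_oppl echC.
by apply: cint_ech; exact: (cint_rescales rescales_opp iF).
Qed.

Let plancherelC u : tst u ->
  int (fun xi => fourier2 u xi * (fourier2 u xi)^*) = ckappa * int (fun x => u x * (u x)^*).
Proof.
move=> tu; have tc := tst_conj tu; have iu := tst_cint tu.
have iF := moments_cint (sch_moments (sch_fourier2 tc)).
have iI : cint (ift (fun x => (u x)^*)) by exact: (cint_rescales rescales_opp iF).
transitivity (int (fun xi => fourier2 u xi * ift (fun x => (u x)^*) xi)).
  by congr cintegral; apply/funext => xi; congr (_ * _); exact: conj_fourier2.
rewrite multiplication_formula// -cintegralZ; last exact: tst_cint (tstM tu tc.1).
by congr cintegral; apply/funext => x; rewrite fourier2_ift// mulrCA.
Qed.

Let int_real (p : R * R -> R) : int (fun x => (p x)%:C) = (Rintegral leb2 setT p)%:C.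
Proof. by apply: complexP => //=; rewrite /Rintegral integral0. Qed.

Let mul_conj (z : R[i]) : z * z^* = (abs2 z)%:C.
Proof.
by apply: complexP; rewrite ?(Re_mulc, Im_mulc); case: z => [a b] /=; rewrite /abs2/=; ring.
Qed.

Lemma ge0_integral_gt0 (g : R * R -> R) (x0 : R * R) : continuous (g : P -> R^o) ->
  (forall x, 0 <= g x) -> 0 < g x0 -> (0 < \int[leb2]_x (g x)%:E)%E.
Proof.
move=> cg g0 gx0; have gx2 : g x0 / 2 < g x0 by lra.
have := cg x0; move/cvgrPdist_lt => /(_ (g x0 / 2)); rewrite divr_gt0// => /(_ isT).
move/nbhs_ballP => [e /= e0 He].
pose B : set T2 := `[(x0.1 - e / 2), (x0.1 + e / 2)] `*` `[(x0.2 - e / 2), (x0.2 + e / 2)].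
have mB : measurable B by apply: measurableX; exact: measurable_itv.
have B0 : leb2 B = (e * e)%:E.
  have E1 (t : R) : @lebesgue_measure R `[(t - e / 2), (t + e / 2)]%classic = e%:E.
    rewrite lebesgue_measure_itv/= lte_fin ifT; last lra.
    by rewrite -EFinB; congr EFin; lra.
  have := E1 x0.1; have := E1 x0.2; move: mB; rewrite /B.
  set B1 := (X in X `*` _); set B2 := (X in _ `*` X) => _ E2 E1'.
  transitivity (@lebesgue_measure R B1 * @lebesgue_measure R B2)%E.
    by apply: product_measure1E; exact: measurable_itv.
  by rewrite E1' E2.
apply: (@lt_le_trans _ _ (\int[leb2]_(x in B) (cst (g x0 / 2)%:E x))%E).
  by rewrite integral_cst// B0 -EFinM lte_fin mulr_gt0 ?divr_gt0 ?mulr_gt0.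
apply: ge0_le_integral_any => // x Bx; rewrite ?lee_fin ?g0//; first by rewrite divr_ge0// ltW.
have : ball (x0 : P) e x.
  move: Bx => [] /=; rewrite !in_itv/= => /andP[a b] /andP[c d].
  by split; rewrite /ball/= ltr_norml; apply/andP; split; lra.
by move/He; rewrite ltr_norml => /andP[h1 h2]; lra.
Qed.

Lemma continuous_abs2 u : csmooth (V := P) u -> continuous (fun x : P => abs2 (u x) : R^o).
Proof.
move=> /csmooth_continuous[cr ci] x.
by apply: cvgD; rewrite expr2; apply: cvgM; first [exact: cr|exact: ci].
Qed.

Lemma abs2_integrable u (C : R) : cint u -> (forall x, normc (u x) <= C) ->
  leb2.-integrable setT (fun x => (abs2 (u x))%:E).
Proof.
move=> iu uC; apply: (le_integrable _ _ _ (integrable_scale C (cint_normc iu))) => //.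
  by apply/measurable_EFinP; exact: measurable_abs2 (cint_meas iu).
move=> x _; rewrite /= lee_fin ger0_norm ?abs2_ge0// (le_trans _ (ler_norm _))//.
by rewrite abs2E expr2 ler_wpM2r ?normc_ge0.
Qed.

(* The value of kappa (which is 1) never matters. *)
Lemma kappaP : (forall x, Im (k0 x) = 0 /\ 0 <= Re (k0 x)) -> exists kappa : R, [/\ 0 < kappa,
  forall u x, tst u -> fourier2 (ift u) x = kappa%:C * u x &
  forall u, tst u -> (\int[leb2]_x (abs2 (fourier2 u x))%:E =
    kappa%:E * \int[leb2]_x (abs2 (u x))%:E)%E].
Proof.
move=> k0pos.
have tk := tk0.
have fin u : tst u -> leb2.-integrable setT (fun x => (abs2 (u x))%:E) /\
    leb2.-integrable setT (fun x => (abs2 (fourier2 u x))%:E).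
  move=> tu; have [C1 [_ H1]] := tst_bounded tu; have [C2 H2] := tst_fourier2_bounded tu.
  split; first exact: abs2_integrable (tst_cint tu) H1.
  exact: abs2_integrable (moments_cint (sch_moments (sch_fourier2 tu))) H2.
have E u : tst u -> (Rintegral leb2 setT (fun x => abs2 (fourier2 u x)))%:C =
    ckappa * (Rintegral leb2 setT (fun x => abs2 (u x)))%:C.
  move=> tu; have := plancherelC tu; rewrite -!int_real.
  rewrite (_ : (fun xi => _) = fun x => (abs2 (fourier2 u x))%:C); last first.
    by apply/funext => x; rewrite mul_conj.
  by rewrite (_ : (fun x => u x * _) = fun x => (abs2 (u x))%:C)//; apply/funext => x; rewrite mul_conj.
have pos u x : tst u -> u x != 0 -> 0 < Rintegral leb2 setT (fun x => abs2 (u x)).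
  move=> tu ux; have [iu _] := fin _ tu.
  rewrite fine_gt0//; apply/andP; split; last by rewrite -ge0_fin_numE ?integrable_fin_num//;
    apply: integral_ge0 => y _; rewrite lee_fin abs2_ge0.
  apply: (@ge0_integral_gt0 _ x); [exact: continuous_abs2 tu.1|by move=> y; exact: abs2_ge0|].
  rewrite lt_neqAle abs2_ge0 andbT eq_sym abs2E sqrf_eq0.
  by apply: contra ux => /eqP/ComplexField.Normc.eq0_normc ->.
have B0 : 0 < Rintegral leb2 setT (fun x => abs2 (k0 x)).
  by apply: (pos _ 0 tk); rewrite k00 oner_neq0.
have A0 : 0 < Rintegral leb2 setT (fun x => abs2 (fourier2 k0 x)).
  have [_ iu] := fin _ tk.
  rewrite fine_gt0//; apply/andP; split; last by rewrite -ge0_fin_numE ?integrable_fin_num//;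
    apply: integral_ge0 => y _; rewrite lee_fin abs2_ge0.
  apply: (@ge0_integral_gt0 _ 0); [exact: continuous_abs2 (sch_fourier2 tk).1|by move=> y; exact: abs2_ge0|].
  (* At the origin the transform is the integral of k0, positive since k0 is nonnegative and equals
     1 at 0. *)
  have : 0 < Re (fourier2 k0 0).
    rewrite fourier2E (_ : (fun x => _) = k0); last first.
      by apply/funext => x; rewrite echC ech0 mulr1.
    have [ir _] := tst_cint tk.
    rewrite fine_gt0//; apply/andP; split; last by rewrite -ge0_fin_numE ?integrable_fin_num//;
      apply: integral_ge0 => y _; rewrite lee_fin; have [] := k0pos y.
    have [cr _] := csmooth_continuous tk.1.
    by apply: (@ge0_integral_gt0 _ 0 cr); [move=> x; have [] := k0pos x|rewrite k00].
  move=> re; rewrite /abs2 (@lt_le_trans _ _ (Re (fourier2 k0 0) ^+ 2))// ?exprn_gt0//.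
  by rewrite lerDl sqr_ge0.
set A := Rintegral _ _ _ in A0; set B := Rintegral _ _ _ in B0.
(* Plancherel for k0 itself exhibits [ckappa] as a quotient of two positive reals. *)
have kE : ckappa = (A / B)%:C.
  have := E _ tk; rewrite -/A -/B => e.
  have B1 : B * B^-1 = 1 by rewrite mulfV// gt_eqF.
  rewrite -[LHS]mulr1 -[1]/((1 : R)%:C) -B1 !rmorphM mulrA -e.
  by [].
exists (A / B); split; first by rewrite divr_gt0.
  by move=> u x tu; rewrite fourier2_ift// kE.
move=> u tu; have [i1 i2] := fin _ tu.
rewrite -[LHS]fineK ?integrable_fin_num// -[X in (_ * X)%E]fineK ?integrable_fin_num// -EFinM.
congr EFin; have := E _ tu; rewrite kE -rmorphM => /(congr1 (@complex.Re R)).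
by [].
Qed.

End kappa.

End fourier_inversion.

(** * Smooth steps and cutoffs *)

Section smooth_step.
Context {R : realType}.
Local Notation P := (R^o * R^o)%type.

Definition smooth_step (st : R -> R) := [/\ csmooth (V := R^o) (fun x => (st x)%:C),
  forall x, 0 <= st x <= 1, forall x, x <= -1 -> st x = 0 & forall x, 1 <= x -> st x = 1].

(* The primitive of |b|^2 is a smooth step. *)
Lemma smooth_step_exists (b : R -> R[i]) : test_function (V := R^o) setT b ->
  (\int[leb1]_x (abs2 (b x))%:E = 1)%E -> closed_support (V := R^o) b `<=` `[-1, 1] ->
  exists st, smooth_step st.
Proof.
move=> [/csmooth_onP sb _ _] b1 bsupp.
pose f x := abs2 (b x).
have f0 x : 0 <= f x by exact: abs2_ge0.
have fsupp x : f x != 0 -> -1 <= x <= 1.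
  move=> fx; have : closed_support (V := R^o) b x.
    apply: subset_closure => /=; apply: contra fx => /eqP bx.
    by rewrite /f bx /abs2/= expr0n addr0.
  by move/bsupp; rewrite /= in_itv.
have [cr ci] := csmooth_continuous sb.
have cf : continuous f.
  by move=> x; apply: cvgD; rewrite expr2; apply: cvgM; first [exact: cr|exact: ci].
have mf : measurable_fun setT f by exact: continuous_measurable_fun.
have iF : lebesgue_measure.-integrable setT (EFin \o f).
  apply/integrableP; split; first exact/measurable_EFinP.
  under eq_integral do rewrite gee0_abs ?lee_fin//.
  by rewrite [X in (X < _)%E]b1 ltry.
pose H x := Rintegral lebesgue_measure `]-oo, x] f.
have dH x : derivable (H : R^o -> R^o) x 1 /\ derive1 (H : R^o -> R^o) x = f x.
  apply: (@continuous_FTC1 R f -oo%O x (x + 1)); [by rewrite ltrDl| |first [exact: isT|by rewrite /Order.lt/=|by rewrite ltNyo|by rewrite lt0x]|exact: cf].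
  by apply: integrableS iF => //; exact: measurable_itv.
have H0 x : x < -1 -> H x = 0.
  move=> x1; rewrite /H /Rintegral integral0_eq// => y /=; rewrite in_itv/= => yx.
  apply/eqP; rewrite eqe; apply/negPn/negP => /fsupp; lra.
have H1 x : 1 < x -> H x = 1.
  move=> x1; rewrite /H /Rintegral integral_mkcond.
  rewrite (_ : (\int[_]_y _)%E = 1%E)// -b1; apply: eq_integral => y _.
  rewrite patchE; case: ifPn => // /negP; rewrite inE/= in_itv/= => /negP; rewrite -ltNge => xy.
  apply/esym/eqP; rewrite eqe; apply/negPn/negP => /fsupp; lra.
have H01 x : 0 <= H x <= 1.
  apply/andP; split; first by apply: Rintegral_ge0 => y _; exact: f0.
  rewrite -lee_fin /H /Rintegral fineK; last first.
    by apply: integrable_fin_num => //; apply: integrableS iF => //; exact: measurable_itv.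
  rewrite -b1; apply: ge0_le_integral_any => // y _; rewrite lee_fin; exact: f0.
have sH : csmooth (V := R^o) (fun x => (H x)%:C).
  apply/csmoothS; split=> [x|v].
    split=> /=; last exact: differentiable_cst.
    by apply/derivable1_diffP; have [] := dH x.
  (* The density |b|^2 is written as b times its conjugate, which is visibly smooth. *)
  rewrite (_ : cD _ _ = fun x => (v : R)%:C * (b x * (b x)^*)).
    by apply: csmoothZ; apply: csmoothM => //; exact: csmooth_conj.
  apply/funext => x; have [d e] := dH x.
  have dd : cdiff (V := R^o) (fun x => (H x)%:C) x.
    by split=> /=; [apply/derivable1_diffP|exact: differentiable_cst].
  have := cD_dirZ (v : R) (1 : R^o) dd; rewrite /GRing.scale/= mulr1 => ->; congr (_ * _).
  apply: complexP; rewrite ?(Re_mulc, Im_mulc) /cD/=.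
    rewrite -derive1E e /f /abs2; case: (b x) => p q /=; ring.
  by rewrite derive_cst; case: (b x) => p q /=; ring.
(* The doubling turns the strict inequalities of [H0] and [H1] into the large ones of
   [smooth_step]. *)
exists (fun x => H (2 * x)); split.
- have dA : forall x : R^o, differentiable (fun x : R^o => (2 : R) *: x) x /\
     'd (fun x : R^o => (2 : R) *: x) x = (fun x : R^o => (2 : R) *: x) :> (R^o -> R^o).
    apply: (@affine_diff _ _ _ _ _ 2).
    + by move=> k g h; rewrite scalerDr !scalerA mulrC.
    + by move=> h; rewrite normrZ ger0_norm.
    + by move=> y h; rewrite scalerDr.
  exact: csmooth_comp_affine dA sH.
- by move=> x; exact: H01.
- by move=> x x1; apply: H0; lra.
- by move=> x x1; apply: H1; lra.
Qed.

Lemma csmooth_comp_affine1 (u : R -> R[i]) (a c : R) : csmooth (V := R^o) u ->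
  csmooth (V := R^o) (fun x => u (a * x + c)).
Proof.
move=> su; have dA : forall x : R^o, differentiable (fun x : R^o => a *: x + c : R^o) x /\
     'd (fun x : R^o => a *: x + c : R^o) x = (fun x : R^o => a *: x) :> (R^o -> R^o).
  apply: (@affine_diff _ _ _ _ _ `|a|).
  - by move=> k g h; rewrite scalerDr !scalerA mulrC.
  - by move=> h; rewrite normrZ.
  - by move=> y h; rewrite scalerDr addrAC.
exact: csmooth_comp_affine dA su.
Qed.

Lemma csmooth_real_M (V : normedModType R) (p q : V -> R) : csmooth (fun x => (p x)%:C) ->
  csmooth (fun x => (q x)%:C) -> csmooth (fun x => (p x * q x)%:C).
Proof.
move=> sp sq; rewrite (_ : (fun x => _) = fun x => (p x)%:C * (q x)%:C); first exact: csmoothM.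
by apply/funext => x; rewrite rmorphM.
Qed.

Section cutoffs.
Variable st : R -> R.
Hypothesis hst : smooth_step st.

Definition bump x := st (x + 2) * st (2 - x).

Let bump_smooth : csmooth (V := R^o) (fun x => (bump x)%:C).
Proof.
have [sst _ _ _] := hst; apply: csmooth_real_M.
  have := csmooth_comp_affine1 1 2 sst.
  by rewrite (_ : (fun x => _) = fun x => (st (x + 2))%:C)//; apply/funext => x; rewrite mul1r.
have := csmooth_comp_affine1 (-1) 2 sst.
by rewrite (_ : (fun x => _) = fun x => (st (2 - x))%:C)//; apply/funext => x; rewrite mulN1r addrC.
Qed.

Let bump01 x : 0 <= bump x <= 1.
Proof.
have [_ b _ _] := hst; have /andP[a1 a2] := b (x + 2); have /andP[a3 a4] := b (2 - x).
by rewrite /bump mulr_ge0//= mulr_ile1.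
Qed.

Let bump1 x : `|x| <= 1 -> bump x = 1.
Proof.
have [_ _ _ b] := hst; rewrite ler_norml => /andP[x1 x2].
by rewrite /bump !b ?mulr1//; lra.
Qed.

Let bump0 x : 3 <= `|x| -> bump x = 0.
Proof.
have [_ _ b _] := hst; rewrite ler_normr => /orP[x1|x1].
  by rewrite /bump (b (2 - x)) ?mulr0//; lra.
by rewrite /bump (b (x + 2)) ?mul0r//; lra.
Qed.

(** Equal to 1 on the square of half-side r and to 0 outside that of half-side 3 r: the source of
    the many 3 * r in what follows. *)
Definition cut (x0 : R * R) (r : R) (x : R * R) : R[i] :=
  (bump ((x.1 - x0.1) / r) * bump ((x.2 - x0.2) / r))%:C.

Lemma cut_smooth x0 r : csmooth (V := P) (cut x0 r).
Proof.
have l1 : csmooth (V := P) (fun x => ((x.1 - x0.1) / r)%:C).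
  have d1 (x : P) : differentiable (fun x : P => (x.1 - x0.1) / r : R^o) x /\
      'd (fun x : P => (x.1 - x0.1) / r : R^o) x = (fun h : P => h.1 / r : R^o) :> (P -> R^o).
    apply: (@affine_diff _ _ _ _ _ `|r^-1|).
    - by move=> k g h; rewrite /= mulrDl -mulrA.
    - by move=> h; rewrite normrM mulrC ler_wpM2l// le_mnorm1.
    - by move=> y h; rewrite /= -mulrDl addrAC.
  have sid : csmooth (V := R^o) (fun t => (t : R)%:C).
    apply/csmoothS; split=> [x|v]; first by split=> //=; exact: differentiable_cst.
    rewrite (_ : cD _ _ = fun=> (v : R)%:C); first exact: csmooth_cst.
    by apply/funext => x; apply: complexP; rewrite /cD/= ?derive_id ?derive_cst.
  exact: (csmooth_comp_affine d1 sid).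
have l2 : csmooth (V := P) (fun x => ((x.2 - x0.2) / r)%:C).
  have d1 (x : P) : differentiable (fun x : P => (x.2 - x0.2) / r : R^o) x /\
      'd (fun x : P => (x.2 - x0.2) / r : R^o) x = (fun h : P => h.2 / r : R^o) :> (P -> R^o).
    apply: (@affine_diff _ _ _ _ _ `|r^-1|).
    - by move=> k g h; rewrite /= mulrDl -mulrA.
    - by move=> h; rewrite normrM mulrC ler_wpM2l// le_mnorm2.
    - by move=> y h; rewrite /= -mulrDl addrAC.
  have sid : csmooth (V := R^o) (fun t => (t : R)%:C).
    apply/csmoothS; split=> [x|v]; first by split=> //=; exact: differentiable_cst.
    rewrite (_ : cD _ _ = fun=> (v : R)%:C); first exact: csmooth_cst.
    by apply/funext => x; apply: complexP; rewrite /cD/= ?derive_id ?derive_cst.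
  exact: (csmooth_comp_affine d1 sid).
apply: (@csmooth_real_M P (fun x => bump ((x.1 - x0.1) / r)) (fun x => bump ((x.2 - x0.2) / r))).
  exact: csmooth_comp_real bump_smooth l1.
exact: csmooth_comp_real bump_smooth l2.
Qed.

Lemma cut_real x0 r x : Im (cut x0 r x) = 0 /\ 0 <= Re (cut x0 r x) <= 1.
Proof.
split=> //=; have /andP[a b] := bump01 ((x.1 - x0.1) / r).
have /andP[c e] := bump01 ((x.2 - x0.2) / r).
by rewrite mulr_ge0//= mulr_ile1.
Qed.

Lemma cut1 x0 r x : 0 < r -> mnorm (x - x0) <= r -> cut x0 r x = 1.
Proof.
move=> r0; rewrite mnorm_le => /andP[h1 h2].
rewrite /cut !bump1 ?mulr1//.
  by rewrite normrM (gtr0_norm (x := r^-1)) ?invr_gt0// ler_pdivrMr// mul1r.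
by rewrite normrM (gtr0_norm (x := r^-1)) ?invr_gt0// ler_pdivrMr// mul1r.
Qed.

Lemma cut0 x0 r x : 0 < r -> 3 * r <= mnorm (x - x0) -> cut x0 r x = 0.
Proof.
move=> r0; rewrite mnormE le_max => /orP[h|h]; apply: complexP => //=.
  rewrite bump0 ?mul0r//.
  by rewrite normrM (gtr0_norm (x := r^-1)) ?invr_gt0// ler_pdivlMr.
rewrite [X in _ * X]bump0 ?mulr0//.
by rewrite normrM (gtr0_norm (x := r^-1)) ?invr_gt0// ler_pdivlMr.
Qed.

Lemma cut_tst x0 r : 0 < r -> tst (cut x0 r).
Proof.
move=> r0; split; first exact: cut_smooth.
exists (mnorm x0 + 3 * r) => x; rewrite leNgt; apply: contraNN => H; apply/eqP/cut0 => //.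
have := mnormD (x - x0) x0; rewrite subrK; lra.
Qed.

Lemma cut_kappa : exists kappa : R, [/\ 0 < kappa,
  forall u x, tst u -> fourier2 (ift u) x = kappa%:C * u x &
  forall u, tst u -> (\int[leb2]_x (abs2 (fourier2 u x))%:E =
    kappa%:E * \int[leb2]_x (abs2 (u x))%:E)%E].
Proof.
apply: (@kappaP R (cut 0 1)); first exact: cut_tst.
  by apply: cut1 => //; rewrite subrr /mnorm normr0.
by move=> x; have [-> /andP[-> _]] := cut_real 0 1 x.
Qed.

End cutoffs.
End smooth_step.

(** * The continuous representative of psi *)

Section representative.
Context {R : realType}.
Local Notation P := (R^o * R^o)%type.
Local Notation int := (cintegral leb2 setT).
Local Notation cint := (cintegrable leb2 setT).
Implicit Types (x y v xi : R * R) (u w : R * R -> R[i]).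
Variables (st : R -> R) (kap : R).
Hypothesis hst : smooth_step st.
Hypothesis inversion : forall u x, tst u -> fourier2 (ift u) x = kap%:C * u x.

Lemma ift_fourier2 u : cint u -> ift u = fourier2 (fun x => u (- (x : P))).
Proof. by move=> iu; apply/funext => x; rewrite iftE. Qed.

Lemma tst_opp u : tst u -> tst (fun x => u (- (x : P))).
Proof.
move=> tu; rewrite (_ : (fun x => _) = fun x => u ((-1) *: (x : P))); last first.
  by apply/funext => x; rewrite scaleN1r.
by apply: tst_scale => //; rewrite oppr_eq0 oner_neq0.
Qed.

Lemma sch_ift u : tst u -> sch (ift u).
Proof. by move=> tu; rewrite ift_fourier2; [exact/sch_fourier2/tst_opp|exact: tst_cint]. Qed.

(** If g were positive at a point, its integral against a narrow cutoff around that point would be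
    positive too; the same holds for - g. *)
Lemma continuous_eq0 (g : R * R -> R) : continuous (g : P -> R^o) ->
  (forall x0 r, 0 < r -> Rintegral leb2 setT (fun x => g x * Re (cut st x0 r x)) = 0) ->
  forall x, g x = 0.
Proof.
have key (h : R * R -> R) : continuous (h : P -> R^o) ->
  (forall x0 r, 0 < r -> leb2.-integrable setT (fun x => (h x * Re (cut st x0 r x))%:E)) ->
  (forall x0 r, 0 < r -> Rintegral leb2 setT (fun x => h x * Re (cut st x0 r x)) = 0) ->
  forall x, h x <= 0.
  move=> ch ih h0 x; rewrite leNgt; apply/negP => hx.
  have := ch x; move/cvgrPdist_lt => /(_ _ hx)/nbhs_ballP[e /= e0 He].
  pose r := e / 4; have r0 : 0 < r by rewrite divr_gt0.
  have pos y : 0 <= h y * Re (cut st x r y).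
    have [_ /andP[c0 _]] := cut_real hst x r y.
    have [ey|ey] := leP e (mnorm (y - x)).
      by rewrite cut0 ?mulr0//; rewrite /r; lra.
    rewrite mulr_ge0// ltW//.
    have : ball (x : P) e y by rewrite -ball_normE/= distrC.
    by move/He; rewrite ltr_norml => /andP[_]; lra.
  have [cc _] := csmooth_continuous (cut_smooth hst x r).
  have : (0 < \int[leb2]_y (h y * Re (cut st x r y))%:E)%E.
    apply: (@ge0_integral_gt0 _ _ x) => //.
      by move=> y; apply: cvgM; [exact: ch|exact: cc].
    by rewrite cut1 ?subrr ?/mnorm ?normr0 ?mulr1// ltW.
  have fi := integrable_fin_num measurableT (ih x r r0).
  by rewrite -(fineK fi) lte_fin -[X in _ < X]/(Rintegral _ _ _) h0// ltxx.
move=> cg g0 x.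
have ig x0 r : 0 < r -> leb2.-integrable setT (fun x => (g x * Re (cut st x0 r x))%:E).
  move=> r0; have tc := cut_tst hst x0 r0; have [M M0 cM] := tst_supp tc.
  have [C [C0 HC]] := continuous_bounded_compact cg (@compact_box R 0 M).
  have [cc _] := csmooth_continuous (cut_smooth hst x0 r).
  have [ic _] := tst_cint tc.
  apply: (le_integrable _ _ _ (integrable_scale C (integrable_norm ic))) => //.
    apply/measurable_EFinP; apply: measurable_funM; exact: continuous_measurable_fun2.
  move=> y _; rewrite /= lee_fin normrM [leRHS]ger0_norm ?mulr_ge0//.
  have [yM|My] := leP (mnorm y) M.
    by rewrite ler_wpM2r// HC//= subr0.
  have : Re (cut st x0 r y) = 0 by rewrite (cM y My).
  by move=> /= ->; rewrite normr0 !mulr0.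
apply/eqP; rewrite eq_le key//= -oppr_le0 (key (fun x => - g x))//.
- by move=> y; apply: cvgN; exact: cg.
- move=> x0 r r0; have := integrable_scale (-1) (ig x0 r r0).
  by under eq_fun do rewrite mulN1r -mulNr.
- move=> x0 r r0; have := g0 x0 r r0.
  under [in X in _ -> X]eq_Rintegral do rewrite mulNr -mulN1r.
  by rewrite RintegralZl// => [->|]; [rewrite mulr0|exact: ig].
Qed.

(** psi is tied to b only through functionals. Testing against [fourier2 (ift c)] for a cutoff c,
    which is kap * c by [inversion], moves everything onto b; continuity then turns an equality of
    functionals into one of values. *)
Lemma fourier_representative (psi b : R * R -> R[i]) :
  continuous (fun x : R * R => Re (psi x)) -> continuous (fun x : R * R => Im (psi x)) ->
  is_fourier2 psi b -> tst b -> forall x, kap%:C * psi x = ift b x.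
Proof.
move=> cr ci [h1 h2] tb x.
have sb := (sch_ift tb).1; have [br bi] := csmooth_continuous sb.
have ib := tst_cint tb.
pose w x := kap%:C * psi x - ift b x.
have intw x0 r : 0 < r -> cint (fun x => w x * cut st x0 r x) /\
    int (fun x => w x * cut st x0 r x) = 0.
  move=> r0; set c := cut st x0 r; have tc : tst c by exact: cut_tst.
  have ic := tst_cint tc.
  have [ip _] := h1 _ ((schP _).2 (tst_sch tc)).
  have [_ e2] := h2 _ ((schP _).2 (sch_ift tc)).
  have ibc : cint (fun x => ift b x * c x).
    rewrite (_ : (fun x => _) = fun x => c x * ift b x); first exact: tst_cint (tstM tc sb).
    by apply/funext => y; rewrite mulrC.
  have ipk := cintZ kap%:C ip.
  have -> : (fun x => w x * c x) = fun x => kap%:C * (psi x * c x) - ift b x * c x.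
    by apply/funext => y; rewrite /w mulrBl mulrA.
  split; first exact: cintB.
  rewrite (cintegralB ipk ibc) (cintegralZ kap%:C ip).
  suff -> : kap%:C * int (fun x => psi x * c x) = int (fun x => ift b x * c x) by rewrite subrr.
  transitivity (int (fun x => b x * ift c x)).
    rewrite -e2 /fourier_distr2 /regular2 -(cintegralZ kap%:C ip).
    congr cintegral; apply/funext => y; rewrite (inversion y tc); exact: mulrCA.
  have io : cint (fun x => c (- (x : P))) by exact: tst_cint (tst_opp tc).
  rewrite (ift_fourier2 ic) -(multiplication_formula ib io).
  rewrite -[LHS]cintegral_opp; last first.
    rewrite (_ : (fun xi => _) = fun x => c (- (x : P)) * fourier2 b x); last first.
      by apply/funext => y; rewrite mulrC.
    exact: tst_cint (tstM (tst_opp tc) (sch_fourier2 tb).1).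
  by congr cintegral; apply/funext => y; rewrite opprK.
have cutC x0 r y z : Re (z * cut st x0 r y) = Re z * Re (cut st x0 r y) /\
    Im (z * cut st x0 r y) = Im z * Re (cut st x0 r y).
  have [e _] := cut_real hst x0 r y.
  by rewrite Re_mulc Im_mulc e !mulr0 subr0 add0r.
have wr : forall x, Re (w x) = 0.
  apply: continuous_eq0 => [y|x0 r r0].
    rewrite /w; under eq_fun do rewrite Re_addc Re_mulc Re_oppc/= mul0r subr0.
    by apply: cvgB; [apply: cvgM; [exact: cvg_cst|exact: cr]|exact: br].
  have [_ /(congr1 (@complex.Re R))/= <-] := intw x0 r r0.
  by apply: eq_Rintegral => y _; have [-> _] := cutC x0 r y (w y).
have wi : forall x, Im (w x) = 0.
  apply: continuous_eq0 => [y|x0 r r0].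
    rewrite /w; under eq_fun do rewrite Im_addc Im_mulc Im_oppc/= mul0r addr0.
    by apply: cvgB; [apply: cvgM; [exact: cvg_cst|exact: ci]|exact: bi].
  have [_ /(congr1 (@complex.Im R))/= <-] := intw x0 r r0.
  by apply: eq_Rintegral => y _; have [_ ->] := cutC x0 r y (w y).
by apply/eqP; rewrite -subr_eq0; apply/eqP; apply: complexP; [exact: wr|exact: wi].
Qed.

End representative.

(** * Temperate functionals *)

Section temperate_functionals.
Context {R : realType}.
Local Notation P := (R^o * R^o)%type.
Implicit Types (x y v xi : R * R) (u w phi : R * R -> R[i]) (g f : (R * R -> R[i]) -> R[i]).

(** Multipliers of the Schwartz space. Besides test functions, the class contains 1 minus a cutoff,
    which has no decay. *)
Definition bdd u := csmooth (V := P) u /\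
  forall vs, exists C, forall x, normc (foldr (cD (V := P)) u vs x) <= C.

Lemma tst_bdd u : tst u -> bdd u.
Proof.
move=> tu; split=> [|vs]; first exact: tu.1.
by have [C [_ HC]] := tst_bounded (tst_foldr vs tu); exists C.
Qed.

Lemma bdd_1 : bdd (fun=> 1).
Proof.
split; first exact: csmooth_cst.
have E vs : foldr (cD (V := P)) (fun=> 1) vs = fun=> if vs is [::] then 1 else 0.
  by elim: vs => //= v vs ->; exact: cD_cst.
move=> vs; exists 1 => x; rewrite E; case: vs => [|v vs]; last by rewrite normc0.
by rewrite (normcC 1) normr1.
Qed.

Lemma bddB u w : bdd u -> bdd w -> bdd (fun x => u x - w x).
Proof.
move=> [su bu] [sw bw].
have sN := csmoothZ (-1) sw.
have -> : (fun x => u x - w x) = fun x => u x + (-1) * w x.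
  by apply/funext => x; rewrite mulN1r.
split; first exact: csmoothD.
move=> vs; have [C1 H1] := bu vs; have [C2 H2] := bw vs.
exists (C1 + C2) => x; rewrite (foldr_cDD vs su sN) (foldr_cDZ vs (-1) sw) mulN1r.
by rewrite (le_trans (normcB _ _))// lerD.
Qed.

Lemma leibniz_bound phi vs : bdd phi -> exists C, 0 <= C /\
  forall u, csmooth (V := P) u -> forall x B,
  (forall ws, ws \in map snd (splits vs) -> normc (foldr (cD (V := P)) u ws x) <= B) ->
  normc (foldr (cD (V := P)) (fun y => phi y * u y) vs x) <= C * B.
Proof.
move=> [sp bp].
have [C HC] := choice bp.
have C0 ws : 0 <= C ws by exact: le_trans (normc_ge0 _) (HC ws 0).
exists (\sum_(p <- splits vs) C p.1); split; first by rewrite sumr_ge0.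
move=> u su x B HB; rewrite foldr_cDM// mulr_suml.
elim: (splits vs) HB => [|p s IH] HB; first by rewrite !big_nil normc0.
rewrite !big_cons (le_trans (normcD _ _))// lerD//; last first.
  by apply: IH => ws wss; apply: HB; rewrite in_cons wss orbT.
by rewrite normcM ler_pM ?normc_ge0 ?HC// HB// in_cons eqxx.
Qed.

Lemma leibniz_bound_list phi (L : seq (seq P)) : bdd phi -> exists (C : R) (L' : seq (seq P)), 0 <= C /\
  forall u, csmooth (V := P) u -> forall x B,
  (forall ws, ws \in L' -> normc (foldr (cD (V := P)) u ws x) <= B) -> 0 <= B ->
  forall vs, vs \in L -> normc (foldr (cD (V := P)) (fun y => phi y * u y) vs x) <= C * B.
Proof.
move=> bp; elim: L => [|vs L [C [L' [C0 H]]]]; first by exists 0, [::]; split.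
have [C1 [C10 H1]] := leibniz_bound vs bp.
exists (C1 + C), (map snd (splits vs) ++ L'); split; first by rewrite addr_ge0.
move=> u su x B HB B0 ws; rewrite in_cons => /predU1P[->|wsL].
  apply: (@le_trans _ _ (C1 * B)); last by rewrite ler_wpM2r// lerDl.
  by apply: H1 => // ws' h; apply: HB; rewrite mem_cat h.
apply: (@le_trans _ _ (C * B)); last by rewrite ler_wpM2r// lerDr.
by apply: H => // ws' h; apply: HB; rewrite mem_cat h orbT.
Qed.

Lemma sch_mul phi u : bdd phi -> sch u -> sch (fun x => phi x * u x).
Proof.
move=> bp [su du]; split=> [|vs N]; first exact: csmoothM bp.1 su.
have [C [C0 HC]] := leibniz_bound vs bp.
have [D HD] := choice (fun ws => du ws N).
have D0 ws : 0 <= D ws by apply: le_trans (HD ws 0); rewrite mulr_ge0 ?wtX_ge0 ?normc_ge0.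
pose B := \sum_(ws <- map snd (splits vs)) D ws.
exists (C * B) => x; rewrite -ler_pdivlMl ?exprn_gt0 ?wt_gt0// mulrCA.
apply: HC => // ws wss; rewrite ler_pdivlMl ?exprn_gt0 ?wt_gt0//.
apply: (le_trans (HD ws x)); rewrite /B.
elim: (map _ _) wss => // ws' s IH; rewrite in_cons big_cons => /predU1P[->|/IH h].
  by rewrite lerDl sumr_ge0.
by rewrite (le_trans h)// lerDr.
Qed.

(** [tempered] with the suprema replaced by an arbitrary pointwise bound B, so that estimates on
    derivatives can be fed in directly. *)
Definition temperate g := linear_on sch g /\
  exists c N (L : seq (seq P)), 0 <= c /\ forall u B, sch u -> 0 <= B ->
  (forall vs x, vs \in L -> wt x ^+ N * normc (foldr (cD (V := P)) u vs x) <= B) ->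
  normc (g u) <= c * B.

Lemma seminorm_le N vs u (B : R) :
  (forall x, wt x ^+ N * normc (foldr (cD (V := P)) u vs x) <= B) -> seminorm (V := P) N vs u <= B.
Proof.
move=> H; apply: ge_sup; first by exists ((1 + `|0 : P|) ^+ N * normc (iter_cderive vs u 0)), 0.
by move=> _ [x _ <-]; rewrite iter_cderiveE; exact: H.
Qed.

Lemma sum_seminorm_le N (L : seq (seq P)) u (B : R) :
  (forall vs x, vs \in L -> wt x ^+ N * normc (foldr (cD (V := P)) u vs x) <= B) ->
  \sum_(vs <- L) seminorm (V := P) N vs u <= (size L)%:R * B.
Proof.
elim: L => [|vs L IH] H; first by rewrite big_nil mul0r.
rewrite big_cons /= -natr1 mulrDl mul1r addrC lerD//.
  by apply: IH => ws x h; apply: H; rewrite in_cons h orbT.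
by apply: seminorm_le => x; apply: H; rewrite in_cons eqxx.
Qed.

Lemma tempered_temperate g : tempered (V := P) g -> temperate g.
Proof.
move=> [lg [c [N [L H]]]]; split.
  by move=> k u w /schP su /schP sw; exact: lg.
exists (`|c| * (size L)%:R), N, L; split; first by rewrite mulr_ge0.
move=> u B su B0 HB; rewrite (le_trans (H u ((schP u).2 su)))//.
set S := \sum_(_ <- _) _; have SB : S <= (size L)%:R * B by exact: sum_seminorm_le.
have S0 : 0 <= S.
  rewrite /S big_seq; apply: sumr_ge0 => vs vsL.
  have ub : has_ubound (range (fun x : P => (1 + `|x|) ^+ N * normc (iter_cderive vs u x))).
    by exists B => _ [x _ <-]; rewrite iter_cderiveE; exact: HB.
  apply: le_trans (ub_le_sup ub _); last by exists 0.
  by rewrite mulr_ge0 ?normc_ge0// exprn_ge0// addr_ge0.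
rewrite (le_trans (ler_wpM2r S0 (ler_norm c)))// -mulrA ler_wpM2l//.
Qed.

End temperate_functionals.

(** * Localized functionals and their transforms *)

Section localized_functionals.
Context {R : realType}.
Local Notation T2 := (measurableTypeR R * measurableTypeR R)%type.
Local Notation P := (R^o * R^o)%type.
Implicit Types (x y v xi zeta : R * R) (u w phi eta : R * R -> R[i]) (g f : (R * R -> R[i]) -> R[i]).

Lemma test_function_tst (Om : set (R * R)) phi : test_function (V := P) Om phi -> tst phi.
Proof.
move=> [/csmooth_onP sp cp _]; split=> //.
have /compact_bounded [M [Mr HM]] := cp.
exists (`|M| + 1) => x px; apply: (HM (`|M| + 1)); last exact: subset_closure.
by rewrite (le_lt_trans (ler_norm M))// ltrDl.
Qed.

Lemma closed_supportM phi w :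
  closed_support (V := P) (fun x => phi x * w x) `<=` closed_support (V := P) phi.
Proof.
apply: closure_subset => x /=; apply: contraNN => /eqP ->; by rewrite mul0r.
Qed.

Lemma test_functionM (Om : set (R * R)) phi w : test_function (V := P) Om phi ->
  csmooth (V := P) w -> test_function (V := P) Om (fun x => phi x * w x).
Proof.
move=> [/csmooth_onP sp cp po] sw; split.
- by apply/csmooth_onP; exact: csmoothM.
- apply: subclosed_compact cp (@closed_supportM phi w).
  exact: closed_closure.
- exact: subset_trans (@closed_supportM phi w) po.
Qed.

Lemma tst_test_function (Om : set (R * R)) phi x0 (rho : R) : tst phi ->
  (forall x, phi x != 0 -> mnorm (x - x0) <= rho) ->
  (forall x, mnorm (x - x0) <= rho -> Om x) -> test_function (V := P) Om phi.
Proof.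
move=> tp sp oO; have cB := @compact_box R x0 rho.
have sub : closed_support (V := P) phi `<=` [set x : P | mnorm (x - x0) <= rho].
  rewrite /closed_support [X in _ `<=` X](closure_id _).1.
    by apply: closure_subset => x; exact: sp.
  by apply: compact_closed => //; exact: norm_hausdorff.
split; first by apply/csmooth_onP; exact: tp.1.
  by apply: subclosed_compact cB sub; exact: closed_closure.
by move=> x /sub; exact: oO.
Qed.

Lemma sch_seminorm_ge0 N vs u : sch u -> 0 <= seminorm (V := P) N vs u.
Proof.
move=> [_ du]; have [C HC] := du vs N.
have ub : has_ubound (range (fun x : P => (1 + `|x|) ^+ N * normc (iter_cderive vs u x))).
  by exists C => _ [x _ <-]; rewrite iter_cderiveE; exact: HC.
apply: le_trans (ub_le_sup ub _); last by exists 0.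
by rewrite mulr_ge0 ?normc_ge0// exprn_ge0// addr_ge0.
Qed.

(** The products phi * u all live in the compact support of phi, so a single continuity estimate of
    f serves them, with weight exponent 0. *)
Lemma mul_distr_temperate (Om : set (R * R)) f phi : is_distribution (V := P) Om f ->
  test_function (V := P) Om phi -> temperate (mul_distr phi f).
Proof.
move=> [lf bf] tphi; have tp := test_function_tst tphi.
have [_ cp po] := tphi; have [c [L H]] := bf _ cp po.
have [C [L' [C0 HC]]] := leibniz_bound_list L (tst_bdd tp).
split.
  move=> k u w su sw; rewrite /mul_distr.
  rewrite -(lf k _ _ (test_functionM tphi su.1) (test_functionM tphi sw.1)).
  by congr f; apply/funext => x; rewrite mulrDr mulrCA.
exists (`|c| * (size L)%:R * C), 0%N, L'; split; first by rewrite !mulr_ge0.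
move=> u B su B0 HB.
have schpu : sch (fun x => phi x * u x) by exact: sch_mul (tst_bdd tp) su.
rewrite /mul_distr (le_trans (H _ (test_functionM tphi su.1) (@closed_supportM phi u)))//.
set S := \sum_(_ <- _) _.
have S0 : 0 <= S by apply: sumr_ge0 => vs _; exact: sch_seminorm_ge0.
rewrite (le_trans (ler_wpM2r S0 (ler_norm c)))// -!mulrA ler_wpM2l//.
apply: sum_seminorm_le => vs x vsL; rewrite expr0 mul1r.
apply: HC => //; first exact: su.1.
by move=> ws wsL; have := HB ws x wsL; rewrite expr0 mul1r.
Qed.

(** Since phi cuts off, only the derivatives of w on a fixed square count, and w may be any smooth
    function, for instance a character. *)
Lemma temperate_bound g phi : temperate g -> tst phi ->
  exists (C : R) (L : seq (seq P)) (M : R), [/\ 0 <= C, 0 <= M &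
  forall w B, csmooth (V := P) w -> 0 <= B ->
  (forall ws x, ws \in L -> mnorm x <= M -> normc (foldr (cD (V := P)) w ws x) <= B) ->
  normc (g (fun x => phi x * w x)) <= C * B].
Proof.
move=> [_ [c [N [L [c0 H]]]]] tp; have [M M0 pM] := tst_supp tp.
have [C [L' [C0 HC]]] := leibniz_bound_list L (tst_bdd tp).
exists (c * ((1 + M) ^+ N * C)), L', M; split=> //.
  by rewrite !mulr_ge0// exprn_ge0// addr_ge0.
move=> w B sw B0 HB; have tpw := tstM tp sw.
rewrite -mulrA; apply: H => //; first exact: tst_sch.
  by rewrite !mulr_ge0// exprn_ge0// addr_ge0.
move=> vs x vsL; have [xM|Mx] := leP (mnorm x) M.
  rewrite -mulrA; apply: ler_pM; rewrite ?wtX_ge0 ?normc_ge0//.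
    by rewrite lerXn2r ?nnegrE ?(ltW (wt_gt0 x)) ?addr_ge0// lerD2l.
  by apply: HC => // ws wsL; exact: HB.
rewrite (@foldr_cD_local _ _ _ (fun=> 0)); last first.
  by apply: filterS (near_mnorm_gt Mx) => y My; rewrite pM// mul0r.
have -> : foldr (cD (V := P)) (fun=> 0) vs = fun=> 0.
  by elim: (vs) => //= v ws ->; exact: cD_cst.
by rewrite normc0 mulr0 !mulr_ge0// exprn_ge0// addr_ge0.
Qed.

Lemma facs_bound (L : seq (seq P)) : exists (C : R) k, 0 <= C /\
  forall ws, ws \in L -> forall xi, normc (facs ws xi) <= C * wt xi ^+ k.
Proof.
have one (ws : seq P) : exists C, 0 <= C /\ forall xi, normc (facs ws xi) <= C * wt xi ^+ size ws.
  elim: ws => [|v ws [C [C0 H]]].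
    by exists 1; split=> // xi; rewrite /facs big_nil expr0 mulr1 (normcC 1) normr1.
  exists (4 * pi * mnorm v * C); split; first by rewrite !mulr_ge0 ?pi_ge0 ?mnorm_ge0.
  move=> xi; rewrite /facs big_cons normcM.
  apply: (@le_trans _ _ ((4 * pi * mnorm v * wt xi) * (C * wt xi ^+ size ws))).
    apply: ler_pM; rewrite ?normc_ge0 ?H// (le_trans (normc_fac _ _))//.
    by rewrite ler_wpM2l ?mnorm_le_wt// !mulr_ge0 ?pi_ge0 ?mnorm_ge0.
  by rewrite mulrACA -exprS.
elim: L => [|vs L [C [k [C0 H]]]]; first by exists 0, 0%N.
have [C1 [C10 H1]] := one vs.
exists (C1 + C), (size vs + k)%N; split; first by rewrite addr_ge0.
move=> ws; rewrite in_cons => /predU1P[->|wsL] xi; rewrite exprD.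
  rewrite (le_trans (H1 xi))//; apply: ler_pM; rewrite ?wtX_ge0 ?lerDl//.
  by rewrite ler_peMr ?wtX_ge0 ?wtX_ge1.
rewrite (le_trans (H _ wsL xi))//; apply: ler_pM; rewrite ?wtX_ge0 ?lerDr//.
by rewrite ler_peMl ?wtX_ge0 ?wtX_ge1.
Qed.

Lemma ech_lip (M : R) xi zeta x : mnorm x <= M ->
  normc (ech xi x - ech zeta x) <= 8 * pi * M * mnorm (xi - zeta).
Proof.
move=> xM; have -> : ech xi x - ech zeta x = (ech (xi - zeta) x - 1) * ech zeta x.
  by rewrite mulrBl mul1r -echDl subrK.
rewrite normcM normc_ech mulr1 /ech (le_trans (cis_lip _))// normrN normrM.
rewrite (ger0_norm (x := 2 * pi)) ?mulr_ge0 ?pi_ge0//.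
rewrite [leRHS](_ : _ = 2 * (2 * pi * (2 * (M * mnorm (xi - zeta))))); last by ring.
rewrite ler_wpM2l// ler_wpM2l ?mulr_ge0 ?pi_ge0// (le_trans (le_dot _ _))//.
by rewrite ler_wpM2l// ler_wpM2r// mnorm_ge0.
Qed.

Lemma facs_ech_lip (M : R) (L : seq (seq P)) : 0 <= M -> exists (C : R) k, 0 <= C /\
  forall ws, ws \in L -> forall xi zeta x, mnorm x <= M ->
  normc (facs ws xi * ech xi x - facs ws zeta * ech zeta x) <=
  C * mnorm (xi - zeta) * (wt xi * wt zeta) ^+ k.
Proof.
move=> M0.
have w0 xi zeta k : 0 <= (wt xi * wt zeta) ^+ k by rewrite exprn_ge0// mulr_ge0// ltW// wt_gt0.
have w1 xi zeta k : 1 <= (wt xi * wt zeta) ^+ k.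
  by rewrite exprn_ege1// mulr_ege1 ?wt_ge1.
have one (ws : seq P) : exists (C : R) k, 0 <= C /\ forall xi zeta x, mnorm x <= M ->
    normc (facs ws xi * ech xi x - facs ws zeta * ech zeta x) <=
    C * mnorm (xi - zeta) * (wt xi * wt zeta) ^+ k.
  elim: ws => [|v ws [C [k [C0 H]]]].
    exists (8 * pi * M), 0%N; split; first by rewrite !mulr_ge0 ?pi_ge0.
    by move=> xi zeta x xM; rewrite /facs !big_nil !mul1r expr0 mulr1; exact: ech_lip.
  have [D [l [D0 HD]]] := facs_bound [:: ws].
  pose c := 4 * pi * mnorm v; have c0 : 0 <= c by rewrite !mulr_ge0 ?pi_ge0 ?mnorm_ge0.
  exists (c * D + c * C), (l + k.+1)%N; split; first by rewrite addr_ge0// mulr_ge0.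
  move=> xi zeta x xM; rewrite /facs !big_cons -/(facs ws xi) -/(facs ws zeta).
  set A := facs ws xi * ech xi x; set B := facs ws zeta * ech zeta x.
  (* Telescoping: the first term gains |xi - zeta| from the linearity of [fac], the second from the
     induction hypothesis. *)
  have -> : fac v xi * facs ws xi * ech xi x - fac v zeta * facs ws zeta * ech zeta x =
      fac v (xi - zeta) * A + fac v zeta * (A - B).
    have -> : fac v (xi - zeta) = fac v xi - fac v zeta.
      by apply: complexP; rewrite ?(Re_addc, Im_addc, Re_oppc, Im_oppc)/= ?subr0// dotDr dotNr; ring.
    by rewrite /A /B; ring.
  have d0 := mnorm_ge0 (xi - zeta).
  rewrite (le_trans (normcD _ _))// (normcM _ A) (normcM _ (A - B)) -[leRHS]mulrA mulrDl; apply: lerD.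
    have h1 : normc A <= D * wt xi ^+ l.
      by rewrite normcM normc_ech mulr1; apply: HD; rewrite inE.
    apply: (@le_trans _ _ ((c * mnorm (xi - zeta)) * (D * wt xi ^+ l))).
      by apply: ler_pM; rewrite ?normc_ge0// ?h1//; exact: normc_fac.
    rewrite [leLHS](_ : _ = c * D * (mnorm (xi - zeta) * wt xi ^+ l)); last by ring.
    apply: ler_wpM2l; first by rewrite mulr_ge0.
    apply: ler_wpM2l; first by [].
    rewrite exprD.
    apply: (@le_trans _ _ ((wt xi * wt zeta) ^+ l)); last by rewrite ler_peMr.
    by rewrite lerXn2r ?nnegrE ?mulr_ge0 ?(ltW (wt_gt0 _))// ler_peMr ?wt_ge1// ltW// wt_gt0.
  apply: (@le_trans _ _ ((c * wt zeta) * (C * mnorm (xi - zeta) * (wt xi * wt zeta) ^+ k))).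
    apply: ler_pM; rewrite ?normc_ge0 ?H// (le_trans (normc_fac _ _))//.
    by rewrite ler_wpM2l ?mnorm_le_wt.
  rewrite [leLHS](_ : _ = c * C * (mnorm (xi - zeta) * (wt zeta * (wt xi * wt zeta) ^+ k))); last by ring.
  apply: ler_wpM2l; first by rewrite mulr_ge0.
  apply: ler_wpM2l; first by [].
  rewrite exprD exprS.
  apply: (@le_trans _ _ (wt xi * wt zeta * (wt xi * wt zeta) ^+ k)).
    by rewrite ler_wpM2r// ler_peMl ?wt_ge1// ltW// wt_gt0.
  by rewrite ler_peMl ?w1// mulr_ge0// mulr_ge0 ?(ltW (wt_gt0 _)).
elim: L => [|vs L [C [k [C0 H]]]]; first by exists 0, 0%N.
have [C1 [k1 [C10 H1]]] := one vs.
exists (C1 + C), (k1 + k)%N; split; first by rewrite addr_ge0.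
move=> ws; rewrite in_cons => /predU1P[->|wsL] xi zeta x xM; rewrite exprD.
  rewrite (le_trans (H1 xi zeta x xM))//; have d0 := mnorm_ge0 (xi - zeta).
  apply: ler_pM; rewrite ?mulr_ge0//; first by rewrite ler_wpM2r// lerDl.
  by rewrite ler_peMr.
rewrite (le_trans (H _ wsL xi zeta x xM))//; have d0 := mnorm_ge0 (xi - zeta).
apply: ler_pM; rewrite ?mulr_ge0//; first by rewrite ler_wpM2r// lerDr.
by rewrite ler_peMl.
Qed.

(* The Fourier transform of phi g, as a function. *)
Definition Ftr g phi xi : R[i] := g (fun x => phi x * ech xi x).

Section fourier_of_localized.
Variables (g : (R * R -> R[i]) -> R[i]) (phi : R * R -> R[i]).
Hypotheses (tg : temperate g) (tphi : tst phi).

Lemma temperate_linM (c : R[i]) u w : csmooth (V := P) u -> csmooth (V := P) w ->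
  g (fun x => phi x * (c * u x + w x)) = c * g (fun x => phi x * u x) + g (fun x => phi x * w x).
Proof.
move=> su sw; have [lg _] := tg.
rewrite -(lg c _ _ (tst_sch (tstM tphi su)) (tst_sch (tstM tphi sw))).
by congr g; apply/funext => x; rewrite mulrDr mulrCA.
Qed.

Lemma Ftr_bound : exists (C : R) k, 0 <= C /\ forall xi, normc (Ftr g phi xi) <= C * wt xi ^+ k.
Proof.
have [C [L [M [C0 M0 H]]]] := temperate_bound tg tphi.
have [D [k [D0 HD]]] := facs_bound L.
exists (C * D), k; split; first by rewrite mulr_ge0.
move=> xi; rewrite -mulrA; apply: H; [exact: csmooth_ech|by rewrite mulr_ge0 ?wtX_ge0|].
move=> ws x wsL xM; rewrite foldr_ech normcM normc_ech mulr1; exact: HD.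
Qed.

(** Yields the continuity, hence the measurability, of the transform, and the estimate on small
    cells in [err_cell]. *)
Lemma Ftr_lip : exists (C : R) k, 0 <= C /\ forall xi zeta,
  normc (Ftr g phi xi - Ftr g phi zeta) <= C * mnorm (xi - zeta) * (wt xi * wt zeta) ^+ k.
Proof.
have [C [L [M [C0 M0 H]]]] := temperate_bound tg tphi.
have [D [k [D0 HD]]] := facs_ech_lip L M0.
exists (C * D), k; split; first by rewrite mulr_ge0.
move=> xi zeta; have s1 := csmooth_ech xi; have s2 := csmooth_ech zeta.
have -> : Ftr g phi xi - Ftr g phi zeta = g (fun x => phi x * ((-1) * ech zeta x + ech xi x)).
  by rewrite temperate_linM// mulN1r addrC.
rewrite -!mulrA; apply: H.
- by apply: csmoothD => //; exact: csmoothZ.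
- by rewrite !mulr_ge0 ?mnorm_ge0// exprn_ge0// mulr_ge0// ltW// wt_gt0.
- move=> ws x wsL xM; rewrite (foldr_cDD _ (csmoothZ (-1) s2) s1) (foldr_cDZ _ _ s2) !foldr_ech.
  by rewrite mulN1r addrC mulrA; exact: HD.
Qed.

Lemma cmeas_Ftr : cmeas (Ftr g phi : T2 -> R[i]).
Proof.
have [C [k [C0 H]]] := Ftr_lip.
have key (p : R[i] -> R) : (forall z w : R[i], p (z - w) = p z - p w) -> (forall z : R[i], `|p z| <= normc z) ->
    continuous (fun xi : P => p (Ftr g phi xi) : R^o).
  move=> pB pn; move=> xi; apply/cvgrPdist_lt => e e0.
  (* Within distance 1 of xi the weight at most doubles, so K is a local Lipschitz constant. *)
  pose K := C * (wt xi * (wt xi * 2)) ^+ k + 1.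
  have K0 : 0 < K.
    by rewrite ltr_wpDl// mulr_ge0// exprn_ge0// !mulr_ge0// ltW// wt_gt0.
  apply/(@nbhs_ballP _ P); exists (Num.min 1 (e / K)); first by rewrite /= lt_min ltr01/= divr_gt0.
  move=> zeta; rewrite -ball_normE/= lt_min => /andP[d1 d2].
  rewrite -pB (le_lt_trans (pn _))// (le_lt_trans (H _ _))//.
  rewrite -/(mnorm (xi - zeta)) in d1 d2; have d0 := mnorm_ge0 (xi - zeta).
  have wz : wt zeta <= wt xi * 2.
    rewrite -(subKr xi zeta) (le_trans (wtD _ _))// wtN ler_wpM2l ?(ltW (wt_gt0 _))//.
    by rewrite /wt; lra.
  apply: (@le_lt_trans _ _ (K * mnorm (xi - zeta))); last by rewrite mulrC -ltr_pdivlMr.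
  rewrite mulrAC ler_wpM2r// /K (@le_trans _ _ (C * (wt xi * (wt xi * 2)) ^+ k))// ?lerDl//.
  rewrite ler_wpM2l// lerXn2r ?nnegrE ?mulr_ge0 ?(ltW (wt_gt0 _))//.
  by rewrite ler_wpM2l// ltW// wt_gt0.
split; apply: continuous_measurable_fun2; apply: key.
- by move=> z w; rewrite Re_addc Re_oppc.
- exact: le_normc_Re.
- by move=> z w; rewrite Im_addc Im_oppc.
- exact: le_normc_Im.
Qed.

Lemma moments_Ftr eta : moments eta -> moments (fun xi => Ftr g phi xi * eta xi).
Proof.
move=> me; have [C [k [C0 H]]] := Ftr_bound.
apply: (@moments_le _ _ eta C k) => //.
  by apply: cmeasM; [exact: cmeas_Ftr|exact: moments_cmeas].
by move=> xi; rewrite normcM ler_wpM2r ?normc_ge0.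
Qed.

End fourier_of_localized.

End localized_functionals.

(** * Weighted masses *)

Section weighted_mass.
Context {R : realType}.
Local Notation T2 := (measurableTypeR R * measurableTypeR R)%type.
Local Notation int := (cintegral leb2 setT).
Implicit Types (xi : R * R) (u w eta : R * R -> R[i]).

Definition wmass k u : R := fine (\int[leb2]_x (wt x ^+ k * normc (u x))%:E)%E.

Lemma wmassE k u : moments u -> (\int[leb2]_x (wt x ^+ k * normc (u x))%:E = (wmass k u)%:E)%E.
Proof.
move=> mu; rewrite fineK// ge0_fin_numE; last first.
  by apply: integral_ge0 => x _; rewrite lee_fin mulr_ge0 ?wtX_ge0 ?normc_ge0.
have := cint_lty (mu k); under eq_integral do rewrite normc_wt; by [].
Qed.

Lemma wmass_ge0 k u : 0 <= wmass k u.
Proof.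
by apply: fine_ge0; apply: integral_ge0 => x _; rewrite lee_fin mulr_ge0 ?wtX_ge0 ?normc_ge0.
Qed.

Definition restr (A : R * R -> bool) u xi : R[i] := if A xi then u xi else 0.

Lemma moments_restr A u : measurable_fun setT (A : T2 -> bool) -> moments u -> moments (restr A u).
Proof.
move=> mA mu; apply: (@moments_le _ _ u 1 0) => //.
  by apply: (cmeas_if mA (moments_cmeas mu)); exact: cmeas_cst.
by move=> x; rewrite expr0 mulr1 mul1r /restr; case: ifP; rewrite ?normc0 ?normc_ge0.
Qed.

(** An equality, which is what lets a square be cut again and again without any loss in the
    constants. *)
Lemma wmass_split A k u : measurable_fun setT (A : T2 -> bool) -> moments u ->
  wmass k u = wmass k (restr A u) + wmass k (restr (fun x => ~~ A x) u).
Proof.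
move=> mA mu; have mA' : measurable_fun setT ((fun x => ~~ A x) : T2 -> bool).
  exact: measurable_neg.
apply: EFin_inj; rewrite EFinD -!wmassE; [|exact: moments_restr..|by []].
have me w : moments w -> measurable_fun setT (fun x : T2 => (wt x ^+ k * normc (w x))%:E).
  move=> mw; apply/measurable_EFinP; apply: measurable_funM; first exact: measurable_wtX.
  exact: measurable_normc (moments_cmeas mw).
rewrite -ge0_integralD//; first last.
- by apply: me; exact: moments_restr.
- by move=> x _; rewrite lee_fin mulr_ge0 ?wtX_ge0 ?normc_ge0.
- by apply: me; exact: moments_restr.
- by move=> x _; rewrite lee_fin mulr_ge0 ?wtX_ge0 ?normc_ge0.
apply: eq_integral => x _; rewrite -EFinD /restr; case: (A x).
  by rewrite [in X in _ + X]normc0 mulr0 addr0.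
by rewrite [in X in X + _]normc0 mulr0 add0r.
Qed.

Lemma wmass_le k l (c : R) u w : moments u -> moments w -> 0 <= c ->
  (forall x, wt x ^+ k * normc (u x) <= c * (wt x ^+ l * normc (w x))) ->
  wmass k u <= c * wmass l w.
Proof.
move=> mu mw c0 H; rewrite -lee_fin EFinM -!wmassE//.
rewrite -ge0_integral_scale//; last first.
- by move=> x; rewrite mulr_ge0 ?wtX_ge0 ?normc_ge0.
- apply: measurable_funM; first exact: measurable_wtX.
  exact: measurable_normc (moments_cmeas mw).
by apply: ge0_le_integral_any => // x _; rewrite ?lee_fin ?mulr_ge0 ?wtX_ge0 ?normc_ge0//.
Qed.

Lemma normc_cintegral_wmass v u k (c : R) : cmeas (v : T2 -> R[i]) -> moments u -> 0 <= c ->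
  (forall x, normc (v x) <= c * (wt x ^+ k * normc (u x))) ->
  cintegrable leb2 setT v /\ normc (int v) <= 2 * (c * wmass k u).
Proof.
move=> mv mu c0 H; have iv : cintegrable leb2 setT v.
  apply: (@cint_lec _ T2 R leb2 _ (fun x => (wt x ^+ k)%:C * u x) c) => //.
  by move=> x; rewrite normc_wt; exact: H.
split=> //; apply: normc_cintegral_le iv _.
rewrite EFinM -wmassE// -ge0_integral_scale//; last first.
- by move=> x; rewrite mulr_ge0 ?wtX_ge0 ?normc_ge0.
- apply: measurable_funM; first exact: measurable_wtX.
  exact: measurable_normc (moments_cmeas mu).
by apply: ge0_le_integral_any => // x _; rewrite lee_fin ?normc_ge0 ?H// !mulr_ge0 ?wtX_ge0 ?normc_ge0.
Qed.

End weighted_mass.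

(* The pairing of g with phi * fourier2 eta is compared with the integral of Ftr g phi against eta.
   The error is additive in eta, and bounded by the side of a small square times the mass of eta when
   eta lives on that square; cutting a large square into small ones shows that it vanishes. *)
Section interchange.
Context {R : realType}.
Local Notation T2 := (measurableTypeR R * measurableTypeR R)%type.
Local Notation int := (cintegral leb2 setT).
Variables (g : (R * R -> R[i]) -> R[i]) (phi : R * R -> R[i]).
Hypotheses (tg : temperate g) (tphi : tst phi).
Implicit Types (c xi : R * R) (eta u w : R * R -> R[i]).

Definition interchange_err eta : R[i] :=
  g (fun x => phi x * fourier2 eta x) - int (fun xi => Ftr g phi xi * eta xi).
Local Notation err := interchange_err.

Let cFtr eta : moments eta -> cintegrable leb2 setT (fun xi => Ftr g phi xi * eta xi).
Proof. by move=> me; exact: moments_cint (moments_Ftr tg tphi me). Qed.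

Lemma errD u w : moments u -> moments w -> err (fun x => u x + w x) = err u + err w.
Proof.
move=> mu mw; rewrite /err.
have -> : (fun xi => Ftr g phi xi * (u xi + w xi)) =
    (fun xi => Ftr g phi xi * u xi + Ftr g phi xi * w xi).
  by apply/funext => xi; rewrite mulrDr.
rewrite (cintegralD (cFtr mu) (cFtr mw)).
have su := csmooth_fourier2 mu; have sw := csmooth_fourier2 mw.
have -> : (fun x => phi x * fourier2 (fun x0 => u x0 + w x0) x) =
    (fun x => phi x * (1 * fourier2 u x + fourier2 w x)).
  apply/funext => x; congr (_ * _); rewrite mul1r !fourier2E.
  rewrite -(cintegralD (cint_ech x (moments_cint mu)) (cint_ech x (moments_cint mw))).
  by congr (cintegral _ _ _); apply/funext => y; rewrite mulrDl.
rewrite (temperate_linM tg tphi 1 su sw) mul1r opprD.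
exact: addrACA.
Qed.

Lemma err_split A u : measurable_fun setT (A : T2 -> bool) -> moments u ->
  err u = err (restr A u) + err (restr (fun x => ~~ A x) u).
Proof.
move=> mA mu; have mA' : measurable_fun setT ((fun x => ~~ A x) : T2 -> bool).
  exact: measurable_neg.
rewrite -(errD (moments_restr mA mu) (moments_restr mA' mu)).
by congr err; apply/funext => x; rewrite /restr; case: (A x); rewrite ?addr0 ?add0r.
Qed.

(** A crude bound, meant for the part of eta far from the origin, whose mass is small. *)
Lemma err_bound : exists (C : R) k, 0 <= C /\ forall eta, moments eta ->
  normc (err eta) <= C * wmass k eta.
Proof.
have [C [L [M [C0 M0 H]]]] := temperate_bound tg tphi.
have [D [k [D0 HD]]] := facs_bound L.
have [E [l [E0 HE]]] := Ftr_bound tg tphi.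
exists (C * (2 * D) + 2 * E), (k + l)%N; split; first by rewrite addr_ge0// !mulr_ge0.
move=> eta me; have W0 := wmass_ge0 (k + l) eta.
have mono (F : R) n (v : R[i]) x : (n <= k + l)%N -> 0 <= F -> normc v <= F * wt x ^+ n ->
    normc (v * eta x) <= F * (wt x ^+ (k + l) * normc (eta x)).
  move=> nk F0 vF; rewrite normcM mulrA ler_wpM2r ?normc_ge0// (le_trans vF)// ler_wpM2l//.
  by rewrite ler_weXn2l ?wt_ge1.
rewrite /err (le_trans (normcB _ _))// mulrDl; apply: lerD.
  rewrite -mulrA; apply: H; first exact: csmooth_fourier2.
    by rewrite !mulr_ge0.
  move=> ws x wsL _; rewrite (foldr_fourier2 _ me) fourier2E -mulrA.
  apply: (normc_cintegral_wmass _ me D0 _).2.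
    by apply: cmeasM; [exact: moments_cmeas (moments_facs _ me)|exact: cmeas_ech].
  move=> xi; rewrite normcM normc_ech mulr1; by apply: mono (leq_addr _ _) D0 (HD _ wsL xi).
rewrite -mulrA; apply: (normc_cintegral_wmass _ me E0 _).2.
  by apply: cint_meas; exact: cFtr.
by move=> xi; apply: mono (leq_addl _ _) E0 (HE xi).
Qed.

Definition in_box c (d1 d2 : R) eta := forall xi, eta xi != 0 ->
  `|xi.1 - c.1| <= d1 /\ `|xi.2 - c.2| <= d2.

(** Each term of the error is compared with its value if all of eta were concentrated at the center
    c. Both comparison values are the integral of eta times [Ftr g phi c] and cancel; the two
    remainders are Lipschitz in xi - c. *)
Lemma err_cell : exists (C : R) k, 0 <= C /\ forall c (d : R) eta, 0 <= d -> d <= 1 ->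
  moments eta -> in_box c d d eta -> normc (err eta) <= C * d * wmass k eta.
Proof.
have [C [L [M [C0 M0 H]]]] := temperate_bound tg tphi.
have [D [k [D0 HD]]] := facs_ech_lip L M0.
have [E [l [E0 HE]]] := Ftr_lip tg tphi.
pose N := maxn k l; pose B := 2 ^+ N : R.
have B0 : 0 <= B by rewrite exprn_ge0.
exists (C * (2 * (D * B)) + 2 * (E * B)), (N + N)%N; split.
  by rewrite addr_ge0// !mulr_ge0.
move=> c d eta d0 d1 me cd; have W0 := wmass_ge0 (N + N) eta.
pose I := int eta; have ie := moments_cint me.
have mono (F : R) n (v : R[i]) xi : (n <= N)%N -> 0 <= F ->
    normc v <= F * mnorm (xi - c) * (wt xi * wt c) ^+ n ->
    normc (v * eta xi) <= F * B * d * (wt xi ^+ (N + N) * normc (eta xi)).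
  move=> nN F0 vF; rewrite normcM; have [->|ex] := eqVneq (eta xi) 0.
    by rewrite normc0 !mulr0.
  rewrite mulrA ler_wpM2r ?normc_ge0// (le_trans vF)//.
  have xcd : mnorm (xi - c) <= d by rewrite mnorm_le; apply/andP; exact: cd.
  have wx0 := ltW (wt_gt0 xi); have wc0 := ltW (wt_gt0 c).
  have wc : wt c <= 2 * wt xi.
    have -> : c = xi - (xi - c) by rewrite subKr.
    rewrite (le_trans (wtD _ _))// wtN mulrC ler_wpM2r// /wt; lra.
  apply: (@le_trans _ _ (F * d * (wt xi * (2 * wt xi)) ^+ N)).
    apply: ler_pM; rewrite ?mulr_ge0 ?mnorm_ge0 ?exprn_ge0 ?ler_wpM2l ?mulr_ge0//.
    apply: (@le_trans _ _ ((wt xi * wt c) ^+ N)).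
      by rewrite ler_weXn2l// mulr_ege1 ?wt_ge1.
    by rewrite lerXn2r ?nnegrE ?mulr_ge0// ler_wpM2l.
  by rewrite mulrCA !exprMn exprD /B; rewrite [leLHS](_ : _ = F * 2 ^+ N * d * (wt xi ^+ N * wt xi ^+ N))//; ring.
have sF := csmooth_fourier2 me; have se := csmooth_ech c.
have -> : err eta = g (fun x => phi x * ((- I) * ech c x + fourier2 eta x)) -
    int (fun xi => (Ftr g phi xi - Ftr g phi c) * eta xi).
  rewrite (temperate_linM tg tphi (- I) se sF).
  have -> : (fun xi => (Ftr g phi xi - Ftr g phi c) * eta xi) =
      (fun xi => Ftr g phi xi * eta xi - Ftr g phi c * eta xi).
    by apply/funext => xi; rewrite mulrBl.
  rewrite (cintegralB (cFtr me) (cintZ (Ftr g phi c) ie)) (cintegralZ (Ftr g phi c) ie).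
  rewrite -/I -/(Ftr g phi c) /err.
  move: (g _) (Ftr g phi c) (int (fun xi => Ftr g phi xi * eta xi)) => a b e; ring.
rewrite (le_trans (normcB _ _))// (mulrDl _ _ d) (mulrDl _ _ (wmass _ _)); apply: lerD.
  rewrite -[leRHS]mulrA -[leRHS]mulrA; apply: H.
  - exact: csmoothD (csmoothZ (- I) se) sF.
  - by do ![apply: mulr_ge0 => //].
  move=> ws x wsL xM; rewrite (foldr_cDD _ (csmoothZ (- I) se) sF) (foldr_cDZ _ _ se).
  rewrite foldr_ech (foldr_fourier2 _ me) fourier2E.
  have im := cint_ech x (moments_cint (moments_facs ws me)).
  have -> : - I * (facs ws c * ech c x) + int (fun xi => facs ws xi * eta xi * ech x xi) =
      int (fun xi => (facs ws xi * ech xi x - facs ws c * ech c x) * eta xi).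
    have -> : (fun xi => (facs ws xi * ech xi x - facs ws c * ech c x) * eta xi) =
        (fun xi => facs ws xi * eta xi * ech x xi - facs ws c * ech c x * eta xi).
      by apply/funext => xi; rewrite mulrBl (echC x xi) mulrAC.
    rewrite (cintegralB im (cintZ (facs ws c * ech c x) ie)) (cintegralZ _ ie) -/I.
    by rewrite addrC mulNr mulrC.
  rewrite -mulrA (mulrA (D * B)) .
  apply: (normc_cintegral_wmass _ me _ _).2; rewrite ?mulr_ge0//.
    apply: cmeasM (moments_cmeas me); apply: cmeasB; last exact: cmeas_cst.
    apply: cmeasM; last first.
      by rewrite (_ : (fun xi => ech xi x) = ech x); [exact: cmeas_ech|apply/funext => xi; exact: echC].
    by elim: (ws) => [|v ws' IH]; rewrite /facs; [under eq_fun do rewrite big_nil; exact: cmeas_cst|];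
      under eq_fun do rewrite big_cons; exact: cmeasM (cmeas_fac v) IH.
  move=> xi; apply: mono (leq_maxl _ _) D0 _; exact: HD.
rewrite -[leRHS]mulrA -[leRHS]mulrA (mulrA (E * B)).
apply: (normc_cintegral_wmass _ me _ _).2; rewrite ?mulr_ge0//.
  apply: cmeasM (moments_cmeas me); apply: cmeasB; [exact: cmeas_Ftr|exact: cmeas_cst].
by move=> xi; apply: mono (leq_maxr _ _) E0 (HE xi c).
Qed.

(** The box is cut along its middle line; as the masses of the two halves add up, K does not
    grow. *)
Lemma err_double1 (K : R) k (d1 d2 : R) :
  (forall c eta, moments eta -> in_box c d1 d2 eta -> normc (err eta) <= K * wmass k eta) ->
  forall c eta, moments eta -> in_box c (2 * d1) d2 eta -> normc (err eta) <= K * wmass k eta.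
Proof.
move=> H c eta me ce; pose A xi := xi.1 < c.1.
have mA : measurable_fun setT (A : T2 -> bool).
  by apply: measurable_fun_ltr; [exact: measurable_fst|exact: measurable_cst].
have mA' : measurable_fun setT ((fun x => ~~ A x) : T2 -> bool) by exact: measurable_neg.
rewrite (err_split mA me) (wmass_split k mA me) (le_trans (normcD _ _))// mulrDr.
apply: lerD; [apply: (H (c.1 - d1, c.2))|apply: (H (c.1 + d1, c.2))];
  try exact: moments_restr; move=> xi; rewrite /restr /A; case: ltP => //= xc; rewrite ?eqxx// => /ce [];
  rewrite !ler_norml; lra.
Qed.

Lemma err_double2 (K : R) k (d1 d2 : R) :
  (forall c eta, moments eta -> in_box c d1 d2 eta -> normc (err eta) <= K * wmass k eta) ->
  forall c eta, moments eta -> in_box c d1 (2 * d2) eta -> normc (err eta) <= K * wmass k eta.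
Proof.
move=> H c eta me ce; pose A xi := xi.2 < c.2.
have mA : measurable_fun setT (A : T2 -> bool).
  by apply: measurable_fun_ltr; [exact: measurable_snd|exact: measurable_cst].
have mA' : measurable_fun setT ((fun x => ~~ A x) : T2 -> bool) by exact: measurable_neg.
rewrite (err_split mA me) (wmass_split k mA me) (le_trans (normcD _ _))// mulrDr.
apply: lerD; [apply: (H (c.1, c.2 - d2))|apply: (H (c.1, c.2 + d2))];
  try exact: moments_restr; move=> xi; rewrite /restr /A; case: ltP => //= xc; rewrite ?eqxx// => /ce [];
  rewrite !ler_norml; lra.
Qed.

(** The bound by C d times the mass, valid on cells of half-side d, reaches the whole support by
    doublings; d is then as small as wished. *)
Lemma err_compact (M : R) eta : moments eta -> (forall xi, eta xi != 0 -> mnorm xi <= M) ->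
  err eta = 0.
Proof.
move=> me eM; have [C [k [C0 H]]] := err_cell.
have dyadic (d : R) n : 0 <= d -> d <= 1 -> forall c w, moments w ->
    in_box c (2 ^+ n * d) (2 ^+ n * d) w -> normc (err w) <= C * d * wmass k w.
  move=> d0 d1; elim: n => [|n IH]; first by rewrite expr0 mul1r => c w mw cw; exact: H cw.
  by rewrite exprS -mulrA; apply: err_double1; apply: err_double2.
pose N := `|M| + 1; have N0 : 0 < N by rewrite ltr_wpDl.
apply: ComplexField.Normc.eq0_normc; apply/le_anti; rewrite normc_ge0 andbT.
apply: (@le_archi0 _ _ (C * N * wmass k eta)) => n.
have W0 := wmass_ge0 k eta.
(* As 2^K exceeds N, the half-side d chosen below is at most 1 / (n + 1), and n + 1 + K doublings
   lead from d back to N. *)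
pose K := (Num.truncn N).+1.
have NK : N <= 2 ^+ K.
  by rewrite (le_trans (ltW (truncnS_gt N)))// -natrX ler_nat ltnW// ltn_expl.
have nK : n.+1%:R <= 2 ^+ n.+1 :> R by rewrite -natrX ler_nat ltnW// ltn_expl.
have n1 : 1 <= 2 ^+ n.+1 :> R by rewrite exprn_ege1// ler1n.
have K0 : 0 < 2 ^+ K :> R by rewrite exprn_gt0.
have m0 : 0 < 2 ^+ n.+1 :> R by rewrite exprn_gt0.
pose d := N / (2 ^+ n.+1 * 2 ^+ K).
have d0 : 0 <= d by rewrite divr_ge0// ?mulr_ge0 ltW.
have d1 : d <= n.+1%:R^-1 * 1.
  rewrite /d invfM mulrCA ler_pM ?divr_ge0 ?invr_ge0 ?(ltW m0) ?(ltW K0) ?(ltW N0)//.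
    by rewrite lef_pV2 ?posrE.
  by rewrite ler_pdivrMr// mul1r.
have dN : d <= N / n.+1%:R.
  rewrite /d ler_pM2l// lef_pV2 ?posrE ?mulr_gt0// (le_trans nK)// ler_peMr ?(ltW m0)//.
  by rewrite exprn_ege1// ler1n.
apply: (@le_trans _ _ (C * d * wmass k eta)).
  apply: (dyadic d (n.+1 + K)%N d0 _ 0) => //.
    by rewrite (le_trans d1)// mulr1 invf_le1// ler1n.
  move=> xi ex; rewrite exprD /d mulrCA divff ?mulf_neq0 ?gt_eqF// mulr1 !subr0.
  have := eM _ ex; rewrite mnorm_le => /andP[h1 h2].
  by split; rewrite (le_trans _ (_ : M <= N))// /N (le_trans (ler_norm M))// lerDl.
by rewrite -!mulrA ler_wpM2l// (mulrC (wmass k eta)) !mulrA ler_wpM2r.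
Qed.

Theorem interchange eta : moments eta ->
  g (fun x => phi x * fourier2 eta x) = int (fun xi => Ftr g phi xi * eta xi).
Proof.
move=> me; have [C [k [C0 H]]] := err_bound.
suff : err eta = 0 by move/eqP; rewrite subr_eq0 => /eqP.
apply: ComplexField.Normc.eq0_normc; apply/le_anti; rewrite normc_ge0 andbT.
apply: (@le_archi0 _ _ (C * wmass k.+1 eta)) => n.
(* Outside this square one extra power of the weight is worth a factor n + 1, so the mass of the
   tail is O(1 / (n + 1)). *)
pose A (xi : R * R) := mnorm xi <= n.+1%:R.
have mA : measurable_fun setT (A : T2 -> bool).
  by apply: measurable_fun_ler; [exact: measurable_mnorm|exact: measurable_cst].
have mA' : measurable_fun setT ((fun x => ~~ A x) : T2 -> bool) by exact: measurable_neg.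
rewrite (err_split mA me) (err_compact (M := n.+1%:R) (moments_restr mA me)); last first.
  by move=> xi; rewrite /restr; case: ifP => //; rewrite eqxx.
rewrite add0r (le_trans (H _ (moments_restr mA' me)))// -mulrA ler_wpM2l// mulrC.
apply: wmass_le => //; first exact: moments_restr.
move=> xi; rewrite /restr /A -ltNge; case: ltP => [nx|_]; last first.
  by rewrite normc0 mulr0 !mulr_ge0 ?wtX_ge0 ?normc_ge0.
rewrite exprS -(mulrA (wt xi)) mulrA ler_peMl ?mulr_ge0 ?wtX_ge0 ?normc_ge0//.
by rewrite ler_pdivlMl// mulr1 (le_trans (ltW nx))// mnorm_le_wt.
Qed.

End interchange.

(** * Shearlet molecules *)

Section shearlet_windows.
Context {R : realType}.
Local Notation T2 := (measurableTypeR R * measurableTypeR R)%type.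
Local Notation P := (R^o * R^o)%type.
Implicit Types (a s : R) (t x y xi : R * R) (u w b : R * R -> R[i]) (g : (R * R -> R[i]) -> R[i]).

Definition coswap (v : bool) x : R * R := if v then (x.2, x.1) else x.

(* dil is the transpose of M_as, after swapping coordinates in the vertical case; codil is the
   inverse of M_as. *)
Definition dil v a s xi : R * R :=
  (a * (coswap v xi).1, Num.sqrt a * ((coswap v xi).2 - s * (coswap v xi).1)).

Definition codil v a s x : R * R :=
  (((coswap v x).1 + s * (coswap v x).2) / a, (coswap v x).2 / Num.sqrt a).

(** The exponent 3/4 is - 3/4, from the normalization of shearlets, plus 3/2, from the determinant
    a^(3/2) of M_as. *)
Definition window b v a s xi : R[i] := (a `^ (3 / 4))%:C * b (dil v a s xi).

(** By [shearlet_molecule], the conjugate of a shearlet up to a constant factor; it is presented as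
    a Fourier transform so that [interchange] applies to it. *)
Definition molecule b v a s t : R * R -> R[i] :=
  fourier2 (fun xi => window b v a s xi * ech xi (- t)).

Lemma mnorm_coswap v x : mnorm (coswap v x) = mnorm x.
Proof. by case: v => //; rewrite !mnormE maxC. Qed.

Lemma dot_dil_codil v a s x xi : 0 < a -> dot (dil v a s xi) (codil v a s x) = dot xi x.
Proof.
move=> a0; have s0 : Num.sqrt a != 0 by rewrite gt_eqF ?sqrtr_gt0.
have a1 : a != 0 by rewrite gt_eqF.
rewrite /dot /dil /codil /=; case: v => /=; field; exact/andP.
Qed.

Lemma le_sqrt1 a : 0 < a -> a < 1 -> a <= Num.sqrt a.
Proof.
move=> a0 a1; rewrite -{1}(sqr_sqrtr (ltW a0)) expr2 ler_piMr ?sqrtr_ge0//.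
by rewrite -sqrtr1 ler_wsqrtr// ltW.
Qed.

(** The order sqrt a of this norm is the gain of the commutator estimate, through [window_lip]. *)
Lemma dil_bound v a s (S : R) xi : 0 < a -> a < 1 -> `|s| <= S ->
  mnorm (dil v a s xi) <= (1 + S) * Num.sqrt a * mnorm xi.
Proof.
move=> a0 a1 sS; have aq := le_sqrt1 a0 a1; have q0 := sqrtr_ge0 a.
have S0 : 0 <= S := le_trans (normr_ge0 _) sS.
rewrite -(mnorm_coswap v xi) mnorm_le /dil /=; set z := coswap v xi.
have z1 := le_mnorm1 z; have z2 := le_mnorm2 z; have z0 := mnorm_ge0 z.
apply/andP; split; rewrite normrM ger0_norm ?(ltW a0)// (mulrC (1 + S)).
  rewrite ler_pM ?(ltW a0) ?normr_ge0//; by rewrite (le_trans aq)// ler_peMr// lerDl.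
rewrite -mulrA ler_wpM2l// mulrDl mul1r (le_trans (ler_normB _ _))// lerD// normrM.
by rewrite ler_pM.
Qed.

Lemma dil_proper v a s xi : 0 < a -> a < 1 ->
  mnorm xi <= (1 + `|s|) / a * mnorm (dil v a s xi).
Proof.
move=> a0 a1; have aq := le_sqrt1 a0 a1; have q0 : 0 < Num.sqrt a by rewrite sqrtr_gt0.
rewrite -(mnorm_coswap v xi); set z := coswap v xi; set w := dil v a s xi.
have w1 := le_mnorm1 w; have w2 := le_mnorm2 w; have w0 := mnorm_ge0 w.
have e1 : z.1 = w.1 / a by rewrite /w /dil -/z /= mulrAC divff ?mul1r// gt_eqF.
have e2 : z.2 = w.2 / Num.sqrt a + s * (w.1 / a).
  by rewrite -e1 /w /dil -/z /= mulrAC divff ?mul1r ?gt_eqF// subrK.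
have h1 : `|w.1 / a| <= mnorm w / a by rewrite normrM (gtr0_norm (x := a^-1)) ?invr_gt0// ler_pM2r ?invr_gt0.
have h2 : `|w.2 / Num.sqrt a| <= mnorm w / a.
  rewrite normrM (gtr0_norm (x := (Num.sqrt a)^-1)) ?invr_gt0//.
  by rewrite ler_pM ?invr_ge0 ?(ltW q0)// lef_pV2 ?posrE.
have E : (1 + `|s|) / a * mnorm w = mnorm w / a + `|s| * (mnorm w / a) by ring.
have m0 : 0 <= `|s| * (mnorm w / a) by rewrite mulr_ge0// divr_ge0// ltW.
rewrite mnorm_le E e1 {1}e2; apply/andP; split; first by rewrite (le_trans h1)// lerDl.
by rewrite (le_trans (ler_normD _ _))// lerD// normrM ler_wpM2l.
Qed.

Lemma codil_bound v a s (S : R) x : 0 < a -> a < 1 -> `|s| <= S ->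
  mnorm (codil v a s x) <= (1 + S) / a * mnorm x.
Proof.
move=> a0 a1 sS; have aq := le_sqrt1 a0 a1; have q0 : 0 < Num.sqrt a by rewrite sqrtr_gt0.
have S0 : 0 <= S := le_trans (normr_ge0 _) sS.
rewrite -(mnorm_coswap v x) mnorm_le /codil /=; set z := coswap v x.
have z1 := le_mnorm1 z; have z2 := le_mnorm2 z; have z0 := mnorm_ge0 z.
have ia : 0 < a^-1 by rewrite invr_gt0.
apply/andP; split; rewrite normrM.
  rewrite (gtr0_norm ia) mulrAC ler_pM2r// mulrDl mul1r (le_trans (ler_normD _ _))// lerD//.
  by rewrite normrM ler_pM.
rewrite (gtr0_norm (x := (Num.sqrt a)^-1)) ?invr_gt0// mulrC.
rewrite ler_pM ?invr_ge0 ?(ltW q0)//.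
apply: (@le_trans _ _ a^-1); first by rewrite lef_pV2 ?posrE.
by rewrite ler_peMl ?(ltW ia)// lerDl.
Qed.

(** A vector of length of order 1 is sent to one of length at least of order a^(-1/2): the source of
    the negligibility of molecules away from t. *)
Lemma codil_proper v a s (S : R) x : 0 < a -> a < 1 -> `|s| <= S ->
  mnorm x <= (1 + S) * Num.sqrt a * mnorm (codil v a s x).
Proof.
move=> a0 a1 sS; have aq := le_sqrt1 a0 a1; have q0 : 0 < Num.sqrt a by rewrite sqrtr_gt0.
have S0 : 0 <= S := le_trans (normr_ge0 _) sS.
rewrite -(mnorm_coswap v x); set z := coswap v x; set w := codil v a s x.
have w1 := le_mnorm1 w; have w2 := le_mnorm2 w; have w0 := mnorm_ge0 w.
have e2 : z.2 = w.2 * Num.sqrt a by rewrite /w /codil -/z /= mulfVK ?gt_eqF.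
have e1 : z.1 = a * w.1 - s * z.2 by rewrite /w /codil -/z /= mulrC mulfVK ?gt_eqF// addrK.
have h2 : `|z.2| <= Num.sqrt a * mnorm w.
  by rewrite e2 normrM (gtr0_norm q0) mulrC ler_pM2l.
have E : (1 + S) * Num.sqrt a * mnorm w = Num.sqrt a * mnorm w + S * (Num.sqrt a * mnorm w) by ring.
have m0 : 0 <= S * (Num.sqrt a * mnorm w) by rewrite !mulr_ge0// ltW.
rewrite mnorm_le E; apply/andP; split; last by rewrite (le_trans h2)// lerDl.
rewrite e1 (le_trans (ler_normB _ _))// lerD// normrM.
  by rewrite (gtr0_norm a0) ler_pM// ltW.
by rewrite ler_pM.
Qed.

Lemma dil_linear v a s (k : R) (x y : P) :
  dil v a s (k *: x + y) = k *: (dil v a s x : P) + dil v a s y.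
Proof.
have -> : k *: (dil v a s x : P) + dil v a s y =
  (k * (dil v a s x).1 + (dil v a s y).1, k * (dil v a s x).2 + (dil v a s y).2) by [].
have -> : k *: x + y = (k * x.1 + y.1, k * x.2 + y.2) by [].
by rewrite /dil /=; case: v => /=; congr pair; ring.
Qed.

Lemma codil_linear v a s (k : R) (x y : P) :
  codil v a s (k *: x + y) = k *: (codil v a s x : P) + codil v a s y.
Proof.
have -> : k *: (codil v a s x : P) + codil v a s y =
  (k * (codil v a s x).1 + (codil v a s y).1, k * (codil v a s x).2 + (codil v a s y).2) by [].
have -> : k *: x + y = (k * x.1 + y.1, k * x.2 + y.2) by [].
by rewrite /codil /=; case: v => /=; congr pair; ring.
Qed.

Lemma dil_diff v a s : 0 < a -> a < 1 -> forall x : P, differentiable (dil v a s : P -> P) x /\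
  'd (dil v a s : P -> P) x = (dil v a s) :> (P -> P).
Proof.
move=> a0 a1 x; apply: (@affine_diff _ _ _ _ _ ((1 + `|s|) * Num.sqrt a)).
- by move=> k g h; exact: dil_linear.
- by move=> h; exact: dil_bound.
- by move=> y h; rewrite addrC -[h in LHS]scale1r dil_linear scale1r addrC.
Qed.

Lemma codil_diff v a s t : 0 < a -> a < 1 -> forall x : P,
  differentiable ((fun x => codil v a s (x - t)) : P -> P) x /\
  'd ((fun x => codil v a s (x - t)) : P -> P) x = (codil v a s) :> (P -> P).
Proof.
move=> a0 a1 x; apply: (@affine_diff _ _ _ _ _ ((1 + `|s|) / a)).
- by move=> k g h; exact: codil_linear.
- by move=> h; exact: codil_bound.
- move=> y h; have -> : y + h - t = 1 *: h + (y - t) by rewrite scale1r addrAC addrC.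
  by rewrite codil_linear scale1r addrC.
Qed.

Lemma tst_window b v a s : tst b -> 0 < a -> a < 1 -> tst (window b v a s).
Proof.
move=> tb a0 a1; have tbd : tst (b \o dil v a s).
  apply: (@tst_comp_affine _ _ _ ((1 + `|s|) / a) 0 _ tb (dil_diff v s a0 a1)).
    by move=> x; rewrite addr0; exact: dil_proper.
  by rewrite divr_ge0 ?(ltW a0)// addr_ge0.
have sc : csmooth (V := P) (fun=> (a `^ (3 / 4))%:C) by exact: csmooth_cst.
have := tstM tbd sc; rewrite (_ : (fun x => _) = window b v a s)//.
by apply/funext => x; rewrite mulrC.
Qed.

Lemma tst_modulated b v a s t : tst b -> 0 < a -> a < 1 ->
  tst (fun xi => window b v a s xi * ech xi (- t)).
Proof.
move=> tb a0 a1; apply: tstM; first exact: tst_window.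
rewrite (_ : (fun xi => _) = ech (- t)); first exact: csmooth_ech.
by apply/funext => xi; exact: echC.
Qed.

Lemma sch_molecule b v a s t : tst b -> 0 < a -> a < 1 -> sch (molecule b v a s t).
Proof. by move=> tb a0 a1; apply: sch_fourier2; exact: tst_modulated. Qed.

Lemma rescales_dil v a s : 0 < a -> rescales (dil v a s : T2 -> T2) (a^-1 * (Num.sqrt a)^-1).
Proof.
move=> a0; have q0 : 0 < Num.sqrt a by rewrite sqrtr_gt0.
have h1 := @rescales_shear R (- s).
have h2 := @rescales_diag R a 0 (Num.sqrt a) 0 (lt0r_neq0 a0) (lt0r_neq0 q0).
rewrite (gtr0_norm a0) (gtr0_norm q0) in h2.
have h3 := rescales_comp h2 h1; rewrite mulr1 in h3.
case: v.
  have := rescales_comp h3 rescales_swap; rewrite mulr1.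
  by congr rescales; apply/funext => x; rewrite /dil /= !addr0 mulNr.
by move: h3; congr rescales; apply/funext => x; rewrite /dil /= !addr0 mulNr.
Qed.

Lemma moleculeE b v a s t x : tst b -> 0 < a -> a < 1 ->
  molecule b v a s t x = (a `^ (- (3 / 4)))%:C * fourier2 b (codil v a s (x - t)).
Proof.
move=> tb a0 a1; rewrite /molecule !fourier2E.
have ie := cint_ech (codil v a s (x - t)) (tst_cint tb).
have -> : (fun xi => window b v a s xi * ech xi (- t) * ech x xi) =
    (fun xi => (a `^ (3 / 4))%:C * (b (dil v a s xi) * ech (codil v a s (x - t)) (dil v a s xi))).
  apply/funext => xi; rewrite /window -!mulrA; congr (_ * (_ * _)).
  rewrite (echC (- t)) -echDl addrC /ech; congr cis; rewrite dot_dil_codil//.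
have ic := cint_rescales (rescales_dil v s a0) ie.
rewrite (cintegralZ _ ic) (cintegral_rescales (rescales_dil v s a0) ie) mulrA -rmorphM.
congr (_%:C * _); have -> : a^-1 = a `^ (-1) by rewrite powR_inv1// ltW.
have -> : (Num.sqrt a)^-1 = a `^ (- 2^-1) by rewrite powRN powR12_sqrt// ltW.
rewrite -!powRD ?(gt_eqF a0) ?implybT//; congr (_ `^ _); lra.
Qed.

Lemma sch_cD v u : sch u -> sch (cD (V := P) v u).
Proof.
move=> [su du]; split=> [|vs]; first by have /csmoothS[_] := su.
by have := du (rcons vs v); rewrite foldr_rcons.
Qed.

(** The directions will be images under [codil], which vary with a and s; multilinearity in the
    directions makes the constant uniform. *)
Lemma sch_direction_bound n u N : sch u -> exists C, 0 <= C /\ forall (ws : seq P) y, size ws = n ->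
  wt y ^+ N * normc (foldr (cD (V := P)) u ws y) <= C * \prod_(w <- ws) mnorm w.
Proof.
elim: n u => [|n IH] u su.
  have [C HC] := su.2 [::] N; exists `|C|; split=> // ws y /size0nil ->.
  by rewrite big_nil mulr1 (le_trans (HC y))// ler_norm.
have [u1 [u2 [su1 su2 E]]] : exists u1 u2, [/\ sch u1, sch u2 &
    forall w : P, cD w u = fun x => w.1%:C * u1 x + w.2%:C * u2 x].
  exists (cD ((1, 0) : P) u), (cD ((0, 1) : P) u); split; [exact: sch_cD..|move=> w].
  by apply/funext => x; apply: cD_coord; have /csmoothS[du _] := su.1; exact: du.
have [C1 [C10 H1]] := IH _ su1; have [C2 [C20 H2]] := IH _ su2.
have [s1 _] := su1; have [s2 _] := su2.
exists (C1 + C2); split; first exact: addr_ge0.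
move=> ws y; case/lastP: ws => // ws w; rewrite size_rcons => -[sz].
rewrite foldr_rcons big_rcons /= E.
rewrite (foldr_cDD ws (csmoothZ _ s1) (csmoothZ _ s2)) (foldr_cDZ ws _ s1) (foldr_cDZ ws _ s2).
have h1 := H1 ws y sz; have h2 := H2 ws y sz.
move: (foldr _ u1 ws y) (foldr _ u2 ws y) h1 h2 => D1 D2 h1 h2.
set Q := \prod_(_ <- _) _ in h1 h2 *; have Q0 : 0 <= Q by apply: prodr_ge0 => i _; exact: mnorm_ge0.
apply: (@le_trans _ _ (mnorm w * (wt y ^+ N * normc D1) + mnorm w * (wt y ^+ N * normc D2))).
  rewrite !(mulrCA (mnorm w)) -mulrDr ler_wpM2l ?wtX_ge0// (le_trans (normcD _ _))//.
  rewrite (normcM w.1%:C) (normcM w.2%:C) (normcC w.1) (normcC w.2).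
  by apply: lerD; rewrite ler_wpM2r ?normc_ge0// (le_mnorm1 w, le_mnorm2 w).
have m0 := mnorm_ge0 w.
rewrite [leRHS](_ : _ = mnorm w * (C1 * Q) + mnorm w * (C2 * Q)); last by ring.
by apply: lerD; rewrite ler_wpM2l.
Qed.

(** The order of the quantifiers matters: the loss a^(-n) is fixed before the decay exponents N and
    M, so that M can be chosen afterwards to beat it. *)
Lemma molecule_derivative_bound b v (S : R) (L : seq (seq P)) : tst b -> 0 <= S ->
  exists n, forall N M, exists C : R, 0 <= C /\ forall vs a s t x, vs \in L -> 0 < a -> a < 1 -> `|s| <= S ->
  wt (x - t) ^+ N * (wt (codil v a s (x - t)) ^+ M *
    normc (foldr (cD (V := P)) (molecule b v a s t) vs x)) <= C * a^-1 ^+ n.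
Proof.
move=> tb S0; have sb := sch_fourier2 tb.
have one (vs : seq P) N M : exists C : R, 0 <= C /\ forall a s t x, 0 < a -> a < 1 -> `|s| <= S ->
    wt (x - t) ^+ N * (wt (codil v a s (x - t)) ^+ M *
      normc (foldr (cD (V := P)) (molecule b v a s t) vs x)) <= C * a^-1 ^+ (size vs).+1.
  have [C [C0 HC]] := sch_direction_bound (size vs) (N + M) sb.
  pose Q := \prod_(w <- vs) mnorm w; have Q0 : 0 <= Q by apply: prodr_ge0 => i _; exact: mnorm_ge0.
  exists ((1 + S) ^+ N * (C * ((1 + S) ^+ size vs * Q))); split.
    by do ![apply: mulr_ge0 => //]; rewrite exprn_ge0// addr_ge0.
  move=> a s t x a0 a1 sS; set y := codil v a s (x - t).
  have ia : 0 < a^-1 by rewrite invr_gt0.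
  have -> : foldr (cD (V := P)) (molecule b v a s t) vs x =
      (a `^ (- (3 / 4)))%:C * foldr (cD (V := P)) (fourier2 b) (map (codil v a s) vs) y.
    have -> : molecule b v a s t = fun x => (a `^ (- (3 / 4)))%:C *
        (fourier2 b \o (fun x => codil v a s (x - t))) x.
      by apply/funext => z; exact: moleculeE.
    rewrite (foldr_cDZ _ _ (csmooth_comp_affine (codil_diff v s t a0 a1) sb.1)).
    by rewrite (foldr_cD_comp_affine _ (codil_diff v s t a0 a1) sb.1).
  rewrite (normcM _%:C) normcC ger0_norm ?powR_ge0//.
  have xy : wt (x - t) <= (1 + S) * wt y.
    have h := codil_proper v (x - t) a0 a1 sS; have y0 := mnorm_ge0 y.
    have q1 : Num.sqrt a <= 1 by rewrite -sqrtr1 ler_wsqrtr// ltW.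
    have : (1 + S) * Num.sqrt a * mnorm y <= (1 + S) * mnorm y.
      by rewrite ler_wpM2r// ler_piMr// addr_ge0.
    rewrite -/y in h; rewrite /wt; lra.
  (* The prefactor of the molecule costs one more power of 1/a, hence the successor of [size vs] in
     the bound. *)
  have pa : a `^ (- (3 / 4)) <= a^-1.
    rewrite powRN lef_pV2 ?posrE ?powR_gt0//; apply: ger1_powR; rewrite ?a0 ?(ltW a1)//.
    lra.
  have prod : \prod_(w <- map (codil v a s) vs) mnorm w <= ((1 + S) * a^-1) ^+ size vs * Q.
    rewrite /Q; elim: (vs) => [|w ws IH]; first by rewrite !big_nil expr0 mulr1.
    rewrite /= !big_cons exprS mulrACA; apply: ler_pM => //; first exact: mnorm_ge0.
      by apply: prodr_ge0 => i _; exact: mnorm_ge0.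
    exact: codil_bound.
  have h := HC (map (codil v a s) vs) y; rewrite size_map exprD in h.
  have {}h := h erefl; set D := normc _ in h *; have D0 : 0 <= D by exact: normc_ge0.
  have w0 := ltW (wt_gt0 y); have S1 : 0 <= 1 + S by rewrite addr_ge0.
  apply: (@le_trans _ _ (((1 + S) * wt y) ^+ N * (wt y ^+ M * (a^-1 * D)))).
    apply: ler_pM; rewrite ?wtX_ge0//.
    - by rewrite mulr_ge0 ?wtX_ge0// mulr_ge0// powR_ge0.
    - by rewrite lerXn2r ?nnegrE ?(ltW (wt_gt0 _))// mulr_ge0.
    - by rewrite ler_wpM2l ?wtX_ge0// ler_wpM2r.
  rewrite exprMn.
  rewrite [leLHS](_ : _ = (1 + S) ^+ N * (a^-1 * (wt y ^+ N * wt y ^+ M * D))); last by ring.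
  rewrite exprS.
  rewrite [leRHS](_ : _ = (1 + S) ^+ N * (a^-1 * (C * ((1 + S) ^+ size vs * a^-1 ^+ size vs * Q)))); last by ring.
  rewrite ler_wpM2l ?exprn_ge0// ler_wpM2l ?(ltW ia)// (le_trans h)// ler_wpM2l//.
  by rewrite -exprMn.
elim: L => [|vs L [n H]]; first by exists 0%N => N M; exists 0.
exists ((size vs).+1 + n)%N => N M; have [C [C0 {}H]] := H N M.
have [C1 [C10 H1]] := one vs N M.
exists (C1 + C); split; first by rewrite addr_ge0.
move=> ws a s t x; rewrite in_cons exprD => wsL a0 a1 sS.
have ia1 k : 1 <= a^-1 ^+ k by rewrite exprn_ege1// invf_ge1// ltW.
have ia k : 0 <= a^-1 ^+ k by rewrite (le_trans _ (ia1 k)).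
case/predU1P: wsL => [->|wsL].
  rewrite (le_trans (H1 a s t x a0 a1 sS))// ler_pM ?lerDl//.
  by rewrite ler_peMr.
rewrite (le_trans (H ws a s t x wsL a0 a1 sS))// ler_pM ?lerDr//.
by rewrite ler_peMl.
Qed.

End shearlet_windows.

(** * Localization of molecules *)

Section molecule_localization.
Context {R : realType}.
Variable (st : R -> R).
Hypothesis hst : smooth_step st.
Local Notation P := (R^o * R^o)%type.
Implicit Types (a s : R) (t x y xi : R * R) (u w b : R * R -> R[i]) (g : (R * R -> R[i]) -> R[i]).
Local Notation cut := (cut st).

Lemma near_mnorm_lt x0 x (r : R) : mnorm (x - x0) < r -> \forall y \near (x : P), mnorm (y - x0) < r.
Proof.
move=> xr; apply/nbhs_ballP; exists (r - mnorm (x - x0)) => /=; first by rewrite subr_gt0.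
move=> y; rewrite -ball_normE/= -/(mnorm (x - y)) => xy.
have := mnormB (x - x0) (x - y); rewrite (_ : x - x0 - (x - y) = y - x0); last first.
  by rewrite opprB addrC addrA subrK.
lra.
Qed.

(** Serves for a bounded away from 0, where a power of 1/a is harmless. *)
Lemma molecule_growth g b v (S T : R) : temperate g -> tst b -> 0 <= S ->
  exists (C : R) n, 0 <= C /\ forall a s t, 0 < a -> a < 1 -> `|s| <= S -> mnorm t <= T ->
  normc (g (molecule b v a s t)) <= C * a^-1 ^+ n.
Proof.
move=> [_ [c [N [L [c0 H]]]]] tb S0.
have [n Hn] := molecule_derivative_bound v L tb S0; have [C [C0 HC]] := Hn N 0%N.
pose T' := 1 + `|T|; exists (c * (T' ^+ N * C)), n; split.
  by do ![apply: mulr_ge0 => //]; rewrite exprn_ge0// addr_ge0.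
move=> a s t a0 a1 sS tT; rewrite -mulrA; apply: H; first exact: sch_molecule.
  by do ![apply: mulr_ge0 => //]; rewrite ?exprn_ge0 ?addr_ge0 ?invr_ge0// ltW.
move=> vs x vsL; rewrite -mulrA.
apply: le_trans (ler_wpM2l _ (HC vs a s t x vsL a0 a1 sS)); last by rewrite exprn_ge0// addr_ge0.
rewrite expr0 mul1r mulrA ler_wpM2r ?normc_ge0// -exprMn.
have tT' : wt t <= T' by rewrite /wt lerD2l (le_trans tT)// ler_norm.
rewrite lerXn2r ?nnegrE ?(ltW (wt_gt0 _))//.
  by rewrite mulr_ge0 ?(ltW (wt_gt0 _))// addr_ge0.
rewrite -{1}(subrK t x) mulrC (le_trans (wtD _ _))// ler_wpM2l//.
exact: ltW (wt_gt0 _).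
Qed.

Lemma sch_far x0 r u : 0 < r -> sch u -> sch (fun x => (1 - cut x0 r x) * u x).
Proof.
move=> r0; apply: sch_mul; apply: bddB bdd_1 _; apply: tst_bdd; exact: cut_tst.
Qed.

(** Where the cutoff differs from 1, x is at distance at least r / 2 from t, and [codil] sends x - t
    to distance of order a^(-1/2) or more. *)
Lemma molecule_far g b v (S r : R) x0 K : temperate g -> tst b -> 0 <= S -> 0 < r ->
  exists C : R, 0 <= C /\ forall a s t, 0 < a -> a < 1 -> `|s| <= S -> mnorm (t - x0) <= r / 2 ->
  normc (g (fun x => (1 - cut x0 r x) * molecule b v a s t x)) <= C * a ^+ K.
Proof.
move=> [_ [c [N [L [c0 H]]]]] tb S0 r0.
have bc : bdd (fun x => 1 - cut x0 r x) by apply: bddB bdd_1 _; apply: tst_bdd; exact: cut_tst.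
have [D [L' [D0 HD]]] := leibniz_bound_list L bc.
have [n Hn] := molecule_derivative_bound v L' tb S0.
(* Two powers of the weight at [codil v a s (x - t)] are worth one power of a: K of these are kept,
   and n absorb the loss of the derivatives. *)
pose M := (2 * (K + n))%N; have [C [C0 HC]] := Hn N M.
pose T := 1 + (mnorm x0 + r / 2); have T0 : 0 <= T by rewrite !addr_ge0 ?mnorm_ge0// divr_ge0// ltW.
pose h := 2 * (1 + S) / r; have h0 : 0 <= h by rewrite divr_ge0 ?(ltW r0)// mulr_ge0// addr_ge0.
exists (c * (D * (T ^+ N * (C * h ^+ M)))); split.
  by do ![apply: mulr_ge0 => //]; rewrite exprn_ge0.
move=> a s t a0 a1 sS tr.
have aK k : 0 <= a ^+ k by rewrite exprn_ge0// ltW.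
have ia : 0 <= a^-1 ^+ n by rewrite exprn_ge0// invr_ge0 ltW.
pose Q := T ^+ N * (C * h ^+ M) * a ^+ K.
have Q0 : 0 <= Q by do ![apply: mulr_ge0 => //]; rewrite exprn_ge0.
rewrite (_ : c * _ * _ = c * (D * Q)); last by rewrite /Q; ring.
apply: H; first by apply: sch_far => //; exact: sch_molecule.
  by rewrite mulr_ge0.
move=> vs x vsL; have [xr|rx] := ltP (mnorm (x - x0)) r.
  rewrite (@foldr_cD_local _ _ _ (fun=> 0)); last first.
    by apply: filterS (near_mnorm_lt xr) => y yr; rewrite cut1 ?(ltW yr)// subrr mul0r.
  have -> : foldr (cD (V := P)) (fun=> 0) vs = fun=> 0.
    by elim: (vs) => //= w ws ->; exact: cD_cst.
  by rewrite normc0 mulr0 mulr_ge0.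
have wx0 : 0 < wt x ^+ N by rewrite exprn_gt0// wt_gt0.
rewrite -ler_pdivlMl// mulrCA; apply: HD => //; first exact: (sch_molecule v s t tb a0 a1).1.
  move=> ws wsL'; rewrite ler_pdivlMl//.
  set y := codil v a s (x - t); have w0 := wt_gt0 y.
  have xt : r / 2 <= mnorm (x - t).
    have := mnormD (x - t) (t - x0); rewrite addrA subrK; lra.
  have xy := codil_proper v (x - t) a0 a1 sS; rewrite -/y in xy.
  have q0 := sqrtr_ge0 a; have S1 : 0 <= 1 + S by rewrite addr_ge0.
  have wy : 1 <= h * Num.sqrt a * wt y.
    have : r / 2 <= (1 + S) * Num.sqrt a * wt y.
      rewrite (le_trans xt)// (le_trans xy)// ler_wpM2l ?mulr_ge0//; exact: mnorm_le_wt.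
    rewrite /h -(ler_pM2l (_ : 0 < r / 2)) ?divr_gt0// mulr1 => /le_trans; apply.
    rewrite [leRHS](_ : _ = (1 + S) * Num.sqrt a * wt y)//.
    by field; rewrite gt_eqF.
  have wM : 1 <= h ^+ M * a ^+ (K + n) * wt y ^+ M.
    have -> : a ^+ (K + n) = Num.sqrt a ^+ M by rewrite exprM sqr_sqrtr// ltW.
    by rewrite -!exprMn exprn_ege1.
  set E := normc _; have E0 : 0 <= E by exact: normc_ge0.
  have xT : wt x <= T * wt (x - t).
    rewrite -{1}(subrK t x) mulrC (le_trans (wtD _ _))// ler_wpM2l ?(ltW (wt_gt0 _))//.
    by have := mnormD (t - x0) x0; rewrite subrK /T /wt; lra.
  have {}HC := HC ws a s t x wsL' a0 a1 sS; rewrite -/y -/E in HC.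
  apply: (@le_trans _ _ ((T * wt (x - t)) ^+ N * (h ^+ M * a ^+ (K + n) * wt y ^+ M * E))).
    apply: ler_pM; rewrite ?(ltW wx0)//.
      by rewrite lerXn2r ?nnegrE ?(ltW (wt_gt0 _))// mulr_ge0// ltW// wt_gt0.
    by rewrite ler_peMl.
  rewrite exprMn exprD.
  rewrite [leLHS](_ : _ = T ^+ N * (h ^+ M * (a ^+ K * a ^+ n)) * (wt (x - t) ^+ N * (wt y ^+ M * E))); last by ring.
  apply: le_trans (ler_wpM2l _ HC) _.
    by do ![apply: mulr_ge0 => //]; rewrite exprn_ge0.
  rewrite le_eqVlt; apply/orP; left; apply/eqP.
  have e1 : a ^+ n * a^-1 ^+ n = 1 by rewrite -exprMn divff ?expr1n// gt_eqF.
  rewrite /Q -[RHS]mulr1 -e1; ring.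
by rewrite mulr_ge0// invr_ge0 ltW.
Qed.

(** The two values agree on the part of the molecule cut off near x0, and each remaining part is
    negligible. *)
Lemma molecule_difference g1 g2 b v (S r : R) x0 K : temperate g1 -> temperate g2 ->
  (forall phi, tst phi -> (forall x, 3 * r < mnorm (x - x0) -> phi x = 0) -> g1 phi = g2 phi) ->
  tst b -> 0 <= S -> 0 < r ->
  exists C : R, 0 <= C /\ forall a s t, 0 < a -> a < 1 -> `|s| <= S -> mnorm (t - x0) <= r / 2 ->
  normc (g1 (molecule b v a s t) - g2 (molecule b v a s t)) <= C * a ^+ K.
Proof.
move=> tg1 tg2 g12 tb S0 r0.
have [C1 [C10 H1]] := molecule_far v x0 K tg1 tb S0 r0.
have [C2 [C20 H2]] := molecule_far v x0 K tg2 tb S0 r0.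
exists (C1 + C2); split; first exact: addr_ge0.
move=> a s t a0 a1 sS tr; have sm := sch_molecule v s t tb a0 a1.
have tc := tstM (cut_tst hst x0 r0) sm.1; have sf := sch_far x0 r0 sm.
have E g : temperate g -> g (molecule b v a s t) =
    g (fun x => cut x0 r x * molecule b v a s t x) +
    g (fun x => (1 - cut x0 r x) * molecule b v a s t x).
  move=> [lg _]; rewrite -[X in X + _]mul1r -(lg 1 _ _ (tst_sch tc) sf).
  by congr g; apply/funext => x; rewrite mul1r -mulrDl addrCA subrr addr0 mul1r.
rewrite (E _ tg1) (E _ tg2) (g12 _ tc); last first.
  by move=> x /ltW rx; rewrite cut0// mul0r.
rewrite opprD addrACA subrr add0r mulrDl (le_trans (normcB _ _))// lerD//; [exact: H1|exact: H2].
Qed.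

End molecule_localization.

(** * Kernel estimates *)

Section weights.
Context {R : realType}.
Implicit Types (x y z xi : R * R).

(** Covers both signs of be at once, the constant being raised to |be|. *)
Lemma powR_comparable (x y c be : R) : 0 < y -> 1 <= c -> x <= c * y -> y <= c * x ->
  x `^ be <= c `^ `|be| * y `^ be.
Proof.
move=> y0 c1 xcy ycx; have c0 : 0 < c by exact: lt_le_trans c1.
have x0 : 0 < x by rewrite -(pmulr_rgt0 _ c0) (lt_le_trans y0).
have [b0|b0] := leP 0 be.
  rewrite (ger0_norm b0) -powRM; [|exact: ltW..].
    by apply: ge0_ler_powR => //; rewrite nnegrE ?mulr_ge0// ltW.
rewrite (ltr0_norm b0) -[be in leLHS]opprK -[be in X in _ <= _ * X]opprK.
rewrite [X in X <= _]powRN [X in _ <= _ * X]powRN ler_pdivlMr ?powR_gt0// mulrC.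
rewrite ler_pdivrMr ?powR_gt0// -powRM; [|exact: ltW..].
by apply: ge0_ler_powR; rewrite ?nnegrE ?mulr_ge0 ?oppr_ge0 ?(ltW x0) ?(ltW c0) ?(ltW y0) ?(ltW b0).
Qed.

Lemma peetre be xi z : wt xi `^ be <= wt (xi - z) `^ `|be| * wt z `^ be.
Proof.
apply: powR_comparable; rewrite ?wt_gt0 ?wt_ge1//.
  by rewrite -{1}(subrK z xi) wtD.
by rewrite -{1}(subKr xi z) mulrC -(wtN (xi - z)) wtD.
Qed.

End weights.

(** * Cauchy-Schwarz, Young and convolutions *)

Section plane_estimates.
Context {R : realType}.
Local Notation T1 := (measurableTypeR R).
Local Notation T2 := (measurableTypeR R * measurableTypeR R)%type.
Local Notation P := (R^o * R^o)%type.
Local Notation int := (cintegral leb2 setT).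
Local Notation cint := (cintegrable leb2 setT).
Implicit Types (x y t xi zeta : R * R) (u w k : R * R -> R[i]).

Lemma tonelli2 (f : T2 * T2 -> \bar R) : measurable_fun setT f -> (forall z, 0 <= f z)%E ->
  (\int[leb2]_x \int[leb2]_y f (x, y) = \int[leb2]_y \int[leb2]_x f (x, y))%E.
Proof. by move=> mf f0; exact: (@ge0_integral_prod_swap _ _ T2 T2 R sleb2 sleb2). Qed.

Lemma measurable_section_integral (f : T2 * T2 -> \bar R) : measurable_fun setT f ->
  (forall z, 0 <= f z)%E -> measurable_fun setT (fun x : T2 => \int[leb2]_y f (x, y))%E.
Proof.
move=> mf f0; exact: (@measurable_fun_fubini_tonelli_F _ _ T2 T2 R sleb2 f mf f0).
Qed.

(** In the form of a Schur test: K is a kernel of mass at most A. The factor 4 is the square of the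
    2 in [normc_cintegral]. *)
Lemma cauchy_schwarz w (h K : T2 -> R) (A : R) : cint w -> measurable_fun setT h ->
  measurable_fun setT K -> (forall x, 0 <= h x) -> (forall x, 0 <= K x) -> 0 < A ->
  (forall x, normc (w x) <= h x * K x) -> (\int[leb2]_x (K x)%:E <= A%:E)%E ->
  ((abs2 (int w))%:E <= (4 * A)%:E * \int[leb2]_x (h x ^+ 2 * K x)%:E)%E.
Proof.
move=> iw mh mK h0 K0 A0 whK KA.
have mhK : measurable_fun setT (fun x => h x ^+ 2 * K x).
  by apply: measurable_funM => //; exact: measurable_funX.
have hK0 x : 0 <= h x ^+ 2 * K x by rewrite mulr_ge0// sqr_ge0.
have I0 : (0 <= \int[leb2]_x (h x ^+ 2 * K x)%:E)%E.
  by apply: integral_ge0 => x _; rewrite lee_fin.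
have [fi|] := ltP (\int[leb2]_x (h x ^+ 2 * K x)%:E)%E (+oo)%E; last first.
  rewrite leye_eq => /eqP ->; rewrite gt0_muley ?leey//.
  by rewrite lte_fin mulr_gt0.
set b := fine (\int[leb2]_x (h x ^+ 2 * K x)%:E)%E.
have bE : (\int[leb2]_x (h x ^+ 2 * K x)%:E = b%:E)%E by rewrite fineK// ge0_fin_numE.
have b0 : 0 <= b by rewrite -lee_fin -bE.
rewrite bE -EFinM lee_fin abs2E.
(* Pointwise, h K is at most (l K + h^2 K / l) / 2, for every l > 0. *)
have key (l : R) : 0 < l -> normc (int w) <= l * A + l^-1 * b.
  move=> l0; rewrite (_ : _ + _ = 2 * (2^-1 * (l * A + l^-1 * b))); last by field; rewrite gt_eqF.
  apply: normc_cintegral_le iw _.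
  apply: (@le_trans _ _ (\int[leb2]_x (2^-1 * (l * K x + l^-1 * (h x ^+ 2 * K x)))%:E)%E).
    apply: ge0_le_integral_any => // x _; rewrite ?lee_fin ?normc_ge0//.
      by rewrite mulr_ge0// addr_ge0// mulr_ge0// ?invr_ge0 ltW.
    rewrite (le_trans (whK x))//.
    have -> : 2^-1 * (l * K x + l^-1 * (h x ^+ 2 * K x)) =
        h x * K x + K x * (2^-1 * l^-1 * (l - h x) ^+ 2) by field; rewrite gt_eqF.
    by rewrite lerDl mulr_ge0// mulr_ge0 ?sqr_ge0// mulr_ge0// invr_ge0 ltW.
  rewrite ge0_integral_scale//; last 2 first.
  - by apply: measurable_funD; exact: measurable_funM.
  - by move=> x; rewrite addr_ge0// mulr_ge0// ?invr_ge0 ltW.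
  rewrite EFinM lee_wpmul2l ?lee_fin//.
  under eq_integral do rewrite EFinD.
  rewrite ge0_integralD//; last 4 first.
  - by move=> x _; rewrite lee_fin mulr_ge0// ltW.
  - by apply/measurable_EFinP; exact: measurable_funM.
  - by move=> x _; rewrite lee_fin mulr_ge0// invr_ge0 ltW.
  - by apply/measurable_EFinP; exact: measurable_funM.
  rewrite !ge0_integral_scale ?invr_ge0 ?(ltW l0)// bE EFinD !EFinM leeD2r// lee_wpmul2l//.
  by rewrite lee_fin ltW.
have N0 := normc_ge0 (int w); set N := normc _ in key N0 *.
move: N0; rewrite le_eqVlt => /predU1P[<-|N0].
  by rewrite expr0n/= !mulr_ge0// ltW.
(* This l makes the first term equal to N / 2, which the left-hand side absorbs. *)
have := key (N / (2 * A)); rewrite divr_gt0 ?mulr_gt0// => /(_ isT).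
have -> : N / (2 * A) * A + (N / (2 * A))^-1 * b = (N ^+ 2 + 4 * A * b) / (2 * N).
  by field; rewrite !gt_eqF.
by rewrite ler_pdivlMr ?mulr_gt0//; nra.
Qed.

Lemma integral_translate_opp (q : T2 -> R) zeta : measurable_fun setT q -> (forall x, 0 <= q x) ->
  (\int[leb2]_x (q (zeta - x))%:E = \int[leb2]_x (q x)%:E)%E.
Proof.
move=> mq q0; have := rescales_comp (rescales_translate zeta) rescales_opp; rewrite mulr1 => rF.
have := @ge0_integral_rescales R _ _ (fun x => (q x)%:E) rF; rewrite mul1e => <-//.
- by apply: eq_integral => x _; rewrite /= addrC.
exact/measurable_EFinP.
Qed.

Lemma integral_translate (q : T2 -> R) zeta : measurable_fun setT q -> (forall x, 0 <= q x) ->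
  (\int[leb2]_x (q (x - zeta))%:E = \int[leb2]_x (q x)%:E)%E.
Proof.
move=> mq q0; have rF := rescales_translate (- zeta).
have := @ge0_integral_rescales R _ _ (fun x => (q x)%:E) rF; rewrite mul1e => <-//.
exact/measurable_EFinP.
Qed.

Lemma measurable_sub2 d (T : measurableType d) (F G : T -> T2) : measurable_fun setT F ->
  measurable_fun setT G -> measurable_fun setT (fun z => F z - G z : T2).
Proof.
move=> mF mG; have F1 := measurableT_comp measurable_fst mF.
have F2 := measurableT_comp measurable_snd mF.
have G1 := measurableT_comp measurable_fst mG; have G2 := measurableT_comp measurable_snd mG.
by apply: measurable_fun_pair; apply: measurable_funB.
Qed.

Lemma iterated_leb2 (F : T2 -> \bar R) : measurable_fun setT F -> (forall p, 0 <= F p)%E ->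
  (\int[leb1]_a \int[leb1]_s F (a, s) = \int[leb2]_p F p)%E.
Proof.
move=> mF F0.
by rewrite (@fubini_tonelli1 _ _ T1 T1 R (@lebesgue_measure R) (@lebesgue_measure R) F mF F0).
Qed.

Lemma young (h q : T2 -> R) : measurable_fun setT h -> measurable_fun setT q ->
  (forall x, 0 <= h x) -> (forall x, 0 <= q x) ->
  (\int[leb2]_zeta \int[leb2]_xi (h xi * q (xi - zeta))%:E =
   \int[leb2]_xi (h xi)%:E * \int[leb2]_x (q x)%:E)%E.
Proof.
move=> mh mq h0 q0.
have mF : measurable_fun setT (fun z : T2 * T2 => (h z.2 * q (z.2 - z.1))%:E).
  apply/measurable_EFinP; apply: measurable_funM.
    exact: (measurableT_comp mh).
  have mD : measurable_fun setT (fun z : T2 * T2 => z.2 - z.1 : T2).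
    by apply: measurable_sub2.
  exact: (measurableT_comp mq mD).
rewrite (tonelli2 mF); last by move=> z; rewrite lee_fin mulr_ge0.
under eq_integral => xi _.
  rewrite (@ge0_integral_scale _ T2 R leb2 (h xi) (fun x => q (xi - x)))//; last first.
    by apply: (measurableT_comp mq); apply: measurable_sub2 => //; exact: measurable_cst.
  rewrite (integral_translate_opp xi mq q0).
  over.
rewrite ge0_integralZr//; last first.
- by apply: integral_ge0 => x _; rewrite lee_fin.
- by move=> x _; rewrite lee_fin.
- exact/measurable_EFinP.
Qed.

Lemma fourier2_ech k zeta xi : fourier2 (fun x => k x * ech zeta x) xi = fourier2 k (xi + zeta).
Proof.
rewrite !fourier2E; congr cintegral; apply/funext => x.
by rewrite -mulrA -echDl addrC.
Qed.

(** The transform of a product as a convolution, by the multiplication formula alone; it is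
    therefore exact, without kappa, and valid for any u with moments, smooth or not. *)
Lemma fourier2_mul_ift k u zeta : tst k -> moments u ->
  fourier2 (fun x => k x * ift u x) zeta = int (fun xi => ift k (xi - zeta) * u xi).
Proof.
move=> tk mu; have iu := moments_cint mu.
have tk' : tst (fun x => k (- (x : P)) * ech (- zeta) x).
  by apply: tstM (tst_opp tk) _; exact: csmooth_ech.
have ik := tst_cint tk'.
have sU : csmooth (V := P) (ift u).
  have := csmooth_comp_affine (scale_diff (-1)) (csmooth_fourier2 mu).
  by congr csmooth; apply/funext => x; rewrite /= scaleN1r.
have i1 : cint (fun x => k x * ift u x * ech zeta x).
  by apply: cint_ech; exact: tst_cint (tstM tk sU).
rewrite fourier2E -(cintegral_opp i1).
rewrite (_ : (fun x => _) = fun x => fourier2 u x * (k (- (x : P)) * ech (- zeta) x)); last first.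
  by apply/funext => x; rewrite ech_oppl /ift opprK mulrCA mulrA.
rewrite (multiplication_formula iu ik); congr cintegral; apply/funext => xi.
rewrite mulrC; congr (_ * _).
by rewrite fourier2_ech /ift -(ift_fourier2 (tst_cint tk)) .
Qed.

End plane_estimates.

(** * Bessel's inequality on a square *)

Section bessel_inequality.
Context {R : realType}.
Variable st : R -> R.
Hypothesis hst : smooth_step st.
Local Notation T2 := (measurableTypeR R * measurableTypeR R)%type.
Local Notation P := (R^o * R^o)%type.
Local Notation int := (cintegral leb2 setT).
Implicit Types (x y t xi zeta : R * R) (u w k : R * R -> R[i]).

Lemma tst_int_normc_ift k : tst k -> exists A : R, 0 < A /\
  (\int[leb2]_x (normc (ift k x))%:E <= A%:E)%E.
Proof.
move=> tk; have := cint_lty (moments_cint (sch_moments (sch_ift tk))).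
set I := (\int[_]_x _)%E => Ioo; have I0 : (0 <= I)%E.
  by apply: integral_ge0 => x _; rewrite lee_fin normc_ge0.
exists (fine I + 1); split; first by rewrite ltr_wpDl// fine_ge0.
by rewrite -[X in (X <= _)%E]fineK ?ge0_fin_numE// lee_fin lerDl.
Qed.

(** u has moments but may be rough, so Plancherel is applied to the test function k * ift u, with k
    a cutoff. Its transform is the convolution of u with the integrable function [ift k], which
    Cauchy-Schwarz and Young bound in L^2. *)
Lemma bessel x0 (r : R) : 0 < r -> exists C : R, 0 <= C /\ forall u, moments u ->
  (\int[leb2]_(t in [set t : R * R | (mnorm (t - x0)%R <= r)%R]) (abs2 (ift u t))%:E <=
   C%:E * \int[leb2]_xi (abs2 (u xi))%:E)%E.
Proof.
move=> r0; have [kap [k0 _ plancherel]] := cut_kappa hst.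
have [k [tk k1]] : exists k, tst k /\ forall x, mnorm (x - x0) <= r -> k x = 1.
  by exists (cut st x0 r); split=> [|x]; [exact: cut_tst|exact: cut1].
have [A [A0 HA]] := tst_int_normc_ift tk.
have sk := sch_ift tk; have mk := measurable_normc (csmooth_cmeas sk.1).
exists (kap^-1 * (4 * A * A)); split.
  by rewrite !mulr_ge0 ?invr_ge0// ltW.
move=> u mu; have sU : csmooth (V := P) (ift u).
  have := csmooth_comp_affine (scale_diff (-1)) (csmooth_fourier2 mu).
  by congr csmooth; apply/funext => x; rewrite /= scaleN1r.
have tkU := tstM tk sU; have mmu := moments_cmeas mu.
have mn := measurable_normc mmu.
apply: (@le_trans _ _ (\int[leb2]_t (abs2 (k t * ift u t))%:E)%E).
  apply: ge0_le_integral_any => // t; rewrite ?lee_fin ?abs2_ge0//=.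
  by move=> tr; rewrite k1// mul1r.
rewrite EFinM -muleA -[leLHS]mul1e -[X in (X%:E * _ <= _)%E](mulVf (lt0r_neq0 k0)) EFinM -muleA.
rewrite lee_wpmul2l ?lee_fin ?invr_ge0 ?(ltW k0)// -plancherel//.
apply: (@le_trans _ _ (\int[leb2]_zeta ((4 * A)%:E * \int[leb2]_xi
    (normc (u xi) ^+ 2 * normc (ift k (xi - zeta)))%:E))%E).
  apply: ge0_le_integral_any => // zeta _; first by rewrite lee_fin abs2_ge0.
    apply: mule_ge0; first by rewrite lee_fin mulr_ge0// ltW.
    by apply: integral_ge0 => x _; rewrite lee_fin mulr_ge0 ?sqr_ge0 ?normc_ge0.
  have msub : measurable_fun setT (fun x : T2 => x - zeta : T2).
    by apply: measurable_sub2; [exact: measurable_id|exact: measurable_cst].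
  have mw : moments (fun x => ift k (x - zeta) * u x).
    have [C HC] := sk.2 [::] 0%N.
    apply: (@moments_le _ _ u C 0) => //.
      by apply: cmeasM mmu; exact: (cmeas_comp msub (csmooth_cmeas sk.1)).
    move=> x; rewrite normcM ler_wpM2r ?normc_ge0// expr0 mulr1.
    by have := HC (x - zeta); rewrite expr0 mul1r.
  have mK : measurable_fun setT (fun x : T2 => normc (ift k (x - zeta))).
    exact: (measurableT_comp mk msub).
  rewrite (fourier2_mul_ift zeta tk mu).
  apply: (cauchy_schwarz (moments_cint mw) mn mK _ _ A0 _ _).
  - by move=> x; exact: normc_ge0.
  - by move=> x; exact: normc_ge0.
  - by move=> x; rewrite normcM mulrC.
  - by rewrite (integral_translate zeta mk) => // x; exact: normc_ge0.
rewrite ge0_integralZl//; last 3 first.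
- apply: (@measurable_section_integral R (fun z => (normc (u z.2) ^+ 2 * normc (ift k (z.2 - z.1)))%:E)).
    apply/measurable_EFinP; apply: measurable_funM.
      by apply: measurable_funX; exact: (measurableT_comp mn).
    apply: (measurableT_comp mk).
    by apply: measurable_sub2.
  by move=> z; rewrite lee_fin mulr_ge0 ?sqr_ge0 ?normc_ge0.
- by move=> z _; apply: integral_ge0 => x _; rewrite lee_fin mulr_ge0 ?sqr_ge0 ?normc_ge0.
- by rewrite lee_fin mulr_ge0// ltW.
rewrite (@young R (fun x => normc (u x) ^+ 2) (fun x => normc (ift k x))) => //; first last.
- by move=> x; exact: normc_ge0.
- by move=> x; exact: sqr_ge0.
- exact: measurable_funX.
under [X in (_ * (X * _))%E]eq_integral do rewrite -abs2E.
rewrite (EFinM (4 * A) A) -[leRHS]muleA (muleC A%:E).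
apply: lee_wpmul2l; first by rewrite lee_fin mulr_ge0// ltW.
by apply: lee_wpmul2l => //; apply: integral_ge0 => x _; rewrite lee_fin abs2_ge0.
Qed.

End bessel_inequality.

(** * Windows as kernels between (a, s) and xi *)

Section kernels.
Context {R : realType}.
Local Notation T2 := (measurableTypeR R * measurableTypeR R)%type.
Implicit Types (a s S be : R) (p x y z xi : R * R) (b : R * R -> R[i]).

Lemma integral_rect (a1 a2 b1 b2 c : R) : a1 <= a2 -> b1 <= b2 -> 0 <= c ->
  (\int[leb2]_p (if (a1 <= p.1 <= a2) && (b1 <= p.2 <= b2) then c else 0)%:E =
   (c * ((a2 - a1) * (b2 - b1)))%:E)%E.
Proof.
move=> a12 b12 c0; pose A : set T2 := `[a1, a2]%classic `*` `[b1, b2]%classic.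
have mA : measurable A by apply: measurableX.
rewrite (_ : (fun p => _) = fun p : T2 => (c * \1_A p)%:E); last first.
  apply/funext => p; congr EFin; rewrite indicE; case: ifPn => H.
    by rewrite mem_set ?mulr1// /A; case/andP: H => h1 h2; split; rewrite /= in_itv.
  rewrite memNset ?mulr0//; rewrite /A => -[/= h1 h2]; move: H; rewrite !in_itv/= in h1 h2.
  by rewrite h1 h2.
rewrite ge0_integral_scale//.
rewrite integral_indic// setIT EFinM; congr (_ * _)%E.
rewrite -[LHS]/((lebesgue_measure \x lebesgue_measure)%E A) product_measure1E//.
rewrite -[LHS]/(lebesgue_measure `[a1, a2]%classic * lebesgue_measure `[b1, b2]%classic)%E.
rewrite !lebesgue_measure_itv/= !lte_fin.
have E (u v : R) : u <= v -> (if u < v then (v%:E - u%:E)%E else 0%E) = (v - u)%:E.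
  by rewrite le_eqVlt => /predU1P[->|->//]; rewrite ltxx subrr.
by rewrite !E.
Qed.

(** What (C1) and (C2) say about the support of the product of the transforms of psi1 at eta1 and of
    psi2 at eta2 / eta1. *)
Definition gen_supp b := forall eta, b eta != 0 ->
  [/\ 2^-1 <= `|eta.1|, `|eta.1| <= 2 & `|eta.2| <= `|eta.1|].

(* The frequency support of the windows, as a relation between p = (a, s) and xi. *)
Definition slab (v : bool) p xi := [&& 2^-1 <= p.1 * `|(coswap v xi).1|,
  p.1 * `|(coswap v xi).1| <= 2 &
  `|(coswap v xi).2 - p.2 * (coswap v xi).1| <= Num.sqrt p.1 * `|(coswap v xi).1|].

Lemma window_slab b v a s xi : gen_supp b -> 0 < a -> window b v a s xi != 0 -> slab v (a, s) xi.
Proof.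
move=> gb a0; rewrite /window => w0; have : b (dil v a s xi) != 0.
  by apply: contraNN w0 => /eqP ->; rewrite mulr0.
move=> /gb[]; rewrite /dil /slab /=; set z := coswap v xi.
have q0 : 0 < Num.sqrt a by rewrite sqrtr_gt0.
rewrite !normrM (gtr0_norm a0) (gtr0_norm q0) => -> -> /=.
by rewrite -{2}(sqr_sqrtr (ltW a0)) expr2 -mulrA ler_pM2l.
Qed.

Lemma abs2_window b v a s xi : 0 < a ->
  abs2 (window b v a s xi) = a `^ (3 / 2) * abs2 (b (dil v a s xi)).
Proof.
move=> a0; rewrite /window abs2M; congr (_ * _).
rewrite /abs2 /= expr0n /= addr0 -powR_mulrn ?powR_ge0// -powRrM; congr (_ `^ _); lra.
Qed.

Lemma slab_wt v S p xi : 0 <= S -> 0 < p.1 -> p.1 < 1 -> `|p.2| <= S -> slab v p xi ->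
  wt xi <= (2 * S + 3) * p.1^-1 /\ p.1^-1 <= (2 * S + 3) * wt xi.
Proof.
case: p => a s /= S0 a0 a1 sS /and3P[/=].
rewrite /wt -(mnorm_coswap v xi); set z := coswap v xi => h1 h2 h3.
have ia1 : 1 <= a^-1 by rewrite invf_ge1// ltW.
have ia : 0 < a^-1 by rewrite invr_gt0.
have z1 : `|z.1| <= 2 * a^-1 by rewrite ler_pdivlMr// mulrC.
have q1 : Num.sqrt a <= 1 by rewrite -sqrtr1 ler_wsqrtr// ltW.
have z2 : `|z.2| <= (S + 1) * `|z.1|.
  rewrite -(subrK (s * z.1) z.2) (le_trans (ler_normD _ _))// addrC mulrDl lerD//.
    by rewrite normrM ler_wpM2r.
  by rewrite (le_trans h3)// ler_wpM2r.
have z0 : 0 <= `|z.1| by [].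
split.
  have : mnorm z <= (S + 1) * (2 * a^-1).
    rewrite mnorm_le; apply/andP; split.
      by rewrite (le_trans z1)// ler_peMl ?mulr_ge0 ?(ltW ia)// lerDr.
    by rewrite (le_trans z2)// ler_wpM2l// addr_ge0.
  have : 0 <= S * a^-1 by rewrite mulr_ge0// ltW.
  lra.
have : a^-1 <= 2 * `|z.1| by rewrite -[leLHS]mulr1 ler_pdivrMl//; lra.
have := le_mnorm1 z; have := mnorm_ge0 z => m0 m1 m2.
have : 0 <= S * mnorm z by rewrite mulr_ge0.
lra.
Qed.

Lemma slab_powR v S be : 0 <= S -> exists C : R, 0 <= C /\ forall p xi, 0 < p.1 -> p.1 < 1 ->
  `|p.2| <= S -> slab v p xi -> p.1 `^ be <= C * wt xi `^ (- be).
Proof.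
move=> S0; exists ((2 * S + 3) `^ `|be|); split; first exact: powR_ge0.
move=> p xi p0 p1 pS sl; have [h1 h2] := slab_wt S0 p0 p1 pS sl.
have -> : p.1 `^ be = (p.1^-1) `^ (- be).
  by rewrite -powR_inv1 ?(ltW p0)// -powRrM mulN1r opprK.
by rewrite -[`|be|]normrN; apply: powR_comparable => //; [exact: wt_gt0|lra].
Qed.

(** With l = |z1| for the swapped frequency z, the slab confines a to an interval of length about 1
    / l and s to one of length about l^(-1/2). The area l^(-3/2) and the value l^(-be) of the
    integrand give the exponent, l being comparable to the weight. *)
Lemma slab_kernel v S be : 0 <= S -> exists C : R, 0 <= C /\ forall xi,
  (\int[leb2]_p (if [&& 0 < p.1 < 1, `|p.2| <= S & slab v p xi] then p.1 `^ be else 0)%:E <=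
   (C * wt xi `^ (- be - 3 / 2))%:E)%E.
Proof.
move=> S0; have [C [C0 HC]] := slab_powR v be S0.
have c1 : 1 <= 2 * (2 * S + 3) :> R by lra.
exists (C * (6 * (2 * (2 * S + 3)) `^ (3 / 2))); split.
  by do ![apply: mulr_ge0 => //]; exact: powR_ge0.
move=> xi; have W0 be' : 0 <= wt xi `^ be' by exact: powR_ge0.
have [[q /and3P[/andP[q0 q1] qS sl]]|nz] := pselect (exists q : R * R,
  [&& 0 < q.1 < 1, `|q.2| <= S & slab v q xi]); last first.
  rewrite integral0_eq ?lee_fin; first by do ![apply: mulr_ge0 => //]; exact: powR_ge0.
  by move=> p _; case: ifPn => // H; exfalso; apply: nz; exists p.
set z := coswap v xi; pose l := `|z.1|.
have l0 : 0 < l.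
  case/and3P: sl; rewrite -/z -/l => h _ _; rewrite -(pmulr_rgt0 _ q0); lra.
have rl0 : 0 < Num.sqrt l by rewrite sqrtr_gt0.
have z1 : z.1 != 0 by rewrite -normr_gt0.
have wl : wt xi <= 2 * (2 * S + 3) * l.
  have [h _] := slab_wt S0 q0 q1 qS sl; rewrite (le_trans h)//.
  case/and3P: sl; rewrite -/z -/l => h' _ _.
  rewrite [leRHS](_ : _ = (2 * S + 3) * (2 * l)); last by ring.
  apply: ler_wpM2l; first by lra.
  by rewrite -[leLHS]mulr1 ler_pdivrMl//; lra.
have lw : l <= 2 * (2 * S + 3) * wt xi.
  have := le_mnorm1 z; rewrite mnorm_coswap -/l => h; have := mnorm_le_wt xi => h2.
  rewrite (le_trans h)// (le_trans h2)// ler_peMl// ltW// wt_gt0//.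
pose y := z.2 / z.1.
(* On the slab |s - y| is at most sqrt a, hence at most 2 / sqrt l because a l <= 2. *)
apply: (@le_trans _ _ (\int[leb2]_p (if (2^-1 / l <= p.1 <= 2 / l) &&
    (y - 2 / Num.sqrt l <= p.2 <= y + 2 / Num.sqrt l) then C * wt xi `^ (- be) else 0)%:E)%E).
  apply: ge0_le_integral_any => // p _; rewrite ?lee_fin; try by case: ifP => // _; rewrite ?powR_ge0 ?mulr_ge0.
  case: ifPn => [/and3P[/andP[p0 p1] pS pl]|_]; last by case: ifP => // _; rewrite mulr_ge0.
  rewrite ifT ?HC//; case/and3P: pl; rewrite -/z -/l => h1 h2 h3.
  rewrite ler_pdivrMr// h1 ler_pdivlMr// h2 /= -ler_distl distrC.
  rewrite -(ler_pM2r l0) -normrM mulrBl /y divfK//.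
  have e1 : 2 / Num.sqrt l * l = 2 * Num.sqrt l.
    by rewrite -mulrA -[X in _^-1 * X](sqr_sqrtr (ltW l0)) expr2 mulKf// gt_eqF.
  have e2 : Num.sqrt p.1 * l = Num.sqrt (p.1 * l) * Num.sqrt l.
    by rewrite sqrtrM ?(ltW p0)// -mulrA -expr2 sqr_sqrtr// ltW.
  rewrite (le_trans h3)// e1 e2 ler_pM2r//.
  rewrite (_ : 2 = Num.sqrt (2 ^+ 2)); last by rewrite sqrtr_sqr ger0_norm.
  by rewrite ler_wsqrtr// (le_trans h2)//; lra.
rewrite integral_rect; last 3 first.
- by rewrite ler_pM2r ?invr_gt0//; lra.
- have : 0 < 2 / Num.sqrt l by rewrite divr_gt0.
  lra.
- by rewrite mulr_ge0.
rewrite lee_fin -!mulrA ler_wpM2l//.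
rewrite powRD ?(gt_eqF (wt_gt0 _)) ?implybT//.
rewrite [leRHS](_ : _ = wt xi `^ (- be) *
  (6 * ((2 * (2 * S + 3)) `^ (3 / 2) * wt xi `^ (- (3 / 2))))); last by ring.
rewrite ler_wpM2l//.
have -> : (2 / l - 2^-1 / l) * (y + 2 / Num.sqrt l - (y - 2 / Num.sqrt l)) = 6 * (l^-1 * (Num.sqrt l)^-1).
  by field; rewrite !gt_eqF.
have -> : l^-1 * (Num.sqrt l)^-1 = l `^ (- (3 / 2)).
  have -> : l^-1 = l `^ (-1) by rewrite powR_inv1// ltW.
  have -> : (Num.sqrt l)^-1 = l `^ (- 2^-1) by rewrite powRN powR12_sqrt// ltW.
  rewrite -!powRD ?(gt_eqF l0) ?implybT//; congr (_ `^ _); lra.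
rewrite ler_wpM2l//; have := powR_comparable (- (3 / 2)) (wt_gt0 xi) c1 lw wl.
by rewrite normrN ger0_norm.
Qed.

(* In the coordinates A = a |z1| and tau = (z2 / z1 - s) sqrt |z1|, where z = coswap v xi, the
   value b (dil v a s xi) only depends on A, tau and the sign of z1. *)
Definition gen_pos b (sg : R) := exists A1 A2 t1 t2 c : R, [/\ 0 < A1 < A2, t1 < t2, 0 < c &
  forall A t, A1 <= A <= A2 -> t1 <= t <= t2 -> c <= abs2 (b (sg * A, sg * (Num.sqrt A * t)))].

(** Matches [slab_kernel] from below. In the coordinates (A, tau), the box on which b is bounded
    below becomes a rectangle in (a, s) of area of order l^(-3/2), with l = |z1|; for l >= L it lies
    inside the region of integration. *)
Lemma window_kernel_lower b v (sg s1 r a0 be : R) : `|sg| = 1 -> gen_pos b sg -> 0 < r ->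
  0 < a0 -> a0 <= 1 -> exists (c L : R), [/\ 0 < c, 0 < L & forall xi, L <= sg * (coswap v xi).1 ->
  `|(coswap v xi).2 - s1 * (coswap v xi).1| <= r / 2 * `|(coswap v xi).1| ->
  ((c * wt xi `^ (- be - 3))%:E <=
   \int[leb2]_p (if (0 < p.1 < a0) && (`|p.2 - s1| < r)
      then abs2 (window b v p.1 p.2 xi) * p.1 `^ be else 0)%:E)%E].
Proof.
move=> sg1 [A1 [A2 [t1 [t2 [c [/andP[A10 A12] t12 c0 H]]]]]] r0 a00 a01.
have A20 : 0 < A2 by exact: lt_trans A12.
have sg2 : sg * sg = 1 by rewrite -expr2 -[sg ^+ 2]real_normK ?num_real// sg1 expr1n.
pose T := `|t1| + `|t2| + 1; have T0 : 0 < T by rewrite ltr_wpDl// addr_ge0.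
have tT (t : R) : t1 <= t <= t2 -> `|t| < T.
  move: (ler_norm t2) (ler_norm (- t1)) (normr_ge0 t1) (normr_ge0 t2).
  rewrite /T ltr_norml normrN; clear => h1 h2 h3 h4 /andP[h5 h6]; apply/andP; split; lra.
pose q := 4 * T / r; have q0 : 0 < q by rewrite divr_gt0// mulr_gt0.
(* The first term makes l at least 1, the second forces a < a0 on the rectangle, and the third
   forces |y - s| <= r / 4 there. *)
pose L := 1 + 2 * A2 / a0 + q ^+ 2.
have L1 : 1 <= L by rewrite /L -addrA lerDl addr_ge0 ?sqr_ge0// divr_ge0 ?mulr_ge0// ltW.
have L0 : 0 < L by exact: lt_le_trans L1.
pose K := 2 + `|s1| + r; have K1 : 1 <= K by rewrite /K; have := normr_ge0 s1; lra.
(* A comparability constant between 1 / a and the weight of xi on the rectangle. *)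
pose D := K * (1 + A1^-1 + A2).
have iA1 : 0 < A1^-1 by rewrite invr_gt0.
have D1 : 1 <= D by rewrite /D mulr_ege1//; lra.
pose be' := be + 3 / 2.
exists (c * ((D `^ `|- be'|)^-1 * ((K `^ (3 / 2))^-1 * ((A2 - A1) * (t2 - t1))))), L.
have pos (x e : R) : 1 <= x -> 0 < x `^ e by move=> x1; rewrite powR_gt0// (lt_le_trans _ x1).
split=> //.
  do ![apply: mulr_gt0 => //]; rewrite ?invr_gt0 ?pos// subr_gt0//.
move=> xi; set z := coswap v xi; pose l := `|z.1| => Lz zs.
have lE : sg * z.1 = l by rewrite /l -[RHS]mul1r -sg1 -normrM ger0_norm// (le_trans (ltW L0)).
have zE : z.1 = sg * l by rewrite -lE mulrA sg2 mul1r.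
rewrite -/z in Lz; rewrite lE in Lz; have l0 : 0 < l by exact: lt_le_trans Lz.
have l1 : 1 <= l by exact: le_trans Lz.
have rl0 : 0 < Num.sqrt l by rewrite sqrtr_gt0.
have z1 : z.1 != 0 by rewrite -normr_gt0.
pose y := z.2 / z.1.
have ys : `|y - s1| <= r / 2.
  by rewrite -(ler_pM2r l0) -normrM mulrBl /y divfK.
have wl : wt xi <= K * l.
  have : mnorm z <= (1 + `|s1| + r) * l.
    rewrite mnorm_le; apply/andP; split.
      by rewrite ler_peMl ?(ltW l0)//; have := normr_ge0 s1; lra.
    rewrite -(subrK (s1 * z.1) z.2) (le_trans (ler_normD _ _))// normrM -/l.
    have : r / 2 * l <= r * l by rewrite ler_wpM2r ?(ltW l0)//; lra.
    rewrite -/l in zs; lra.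
  rewrite mnorm_coswap /wt /K; lra.
have lw : l <= wt xi by have := le_mnorm1 z; rewrite mnorm_coswap -/l /wt; lra.
have lKw : l <= K * wt xi by rewrite (le_trans lw)// ler_peMl// ltW// wt_gt0.
have W0 e : 0 < wt xi `^ e by rewrite powR_gt0 ?wt_gt0.
pose m := c * ((D `^ `|- be'|)^-1 * wt xi `^ (- be')).
have m0 : 0 <= m by rewrite ltW// !mulr_gt0// ?invr_gt0 ?pos.
apply: (@le_trans _ _ (\int[leb2]_p (if (A1 / l <= p.1 <= A2 / l) &&
    (y - t2 / Num.sqrt l <= p.2 <= y - t1 / Num.sqrt l) then m else 0)%:E)%E).
  rewrite integral_rect//; last 2 first.
  - by rewrite ler_pM2r ?invr_gt0// ltW.
  - by rewrite lerD2l lerN2 ler_pM2r ?invr_gt0// ltW.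
  have -> : (A2 / l - A1 / l) * (y - t1 / Num.sqrt l - (y - t2 / Num.sqrt l)) =
      (A2 - A1) * (t2 - t1) * (l^-1 * (Num.sqrt l)^-1) by field; rewrite !gt_eqF.
  have -> : l^-1 * (Num.sqrt l)^-1 = l `^ (- (3 / 2)).
    have -> : l^-1 = l `^ (-1) by rewrite powR_inv1// ltW.
    have -> : (Num.sqrt l)^-1 = l `^ (- 2^-1) by rewrite powRN powR12_sqrt// ltW.
    rewrite -!powRD ?(gt_eqF l0) ?implybT//; congr (_ `^ _); lra.
  have h : (K `^ (3 / 2))^-1 * wt xi `^ (- (3 / 2)) <= l `^ (- (3 / 2)).
    have := powR_comparable (- (3 / 2)) l0 K1 wl lKw.
    by rewrite normrN ger0_norm// ler_pdivrMl ?pos.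
  rewrite lee_fin /m.
  have -> : - be - 3 = - be' + - (3 / 2) by rewrite /be'; lra.
  rewrite powRD ?(gt_eqF (wt_gt0 _)) ?implybT//.
  have d0 : 0 < (D `^ `|- be'|)^-1 by rewrite invr_gt0 pos.
  rewrite [leLHS](_ : _ = c * ((D `^ `|- be'|)^-1 * wt xi `^ (- be')) * ((A2 - A1) * (t2 - t1) *
    ((K `^ (3 / 2))^-1 * wt xi `^ (- (3 / 2))))); last by ring.
  rewrite ler_wpM2l// ler_wpM2l// mulr_ge0// subr_ge0 ltW//.
apply: ge0_le_integral_any => // p _; rewrite ?lee_fin; try by case: ifP => // _;
  rewrite ?mulr_ge0 ?abs2_ge0 ?powR_ge0.
case: ifPn => [/andP[/andP[p1 p2] /andP[p3 p4]]|_]; last first.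
  by case: ifP => // _; rewrite ?mulr_ge0 ?abs2_ge0 ?powR_ge0.
have p0 : 0 < p.1 by rewrite (lt_le_trans _ p1)// divr_gt0.
have pa0 : p.1 < a0.
  rewrite (le_lt_trans p2)// ltr_pdivrMr// mulrC -ltr_pdivrMr// (lt_le_trans _ Lz)//.
  have : 0 < A2 / a0 by rewrite divr_gt0.
  by move: (sqr_ge0 q); rewrite /L -mulrA; clear => *; lra.
pose t := (y - p.2) * Num.sqrt l.
have ht : t1 <= t <= t2.
  move: p3 p4; rewrite lerBlDr -lerBlDl ler_pdivlMr// => p4'; rewrite lerBrDr -lerBrDl.
  by rewrite ler_pdivrMr// /t => ->.
have ps : `|p.2 - s1| < r.
  have qs : q <= Num.sqrt l.
    rewrite -(ger0_norm (ltW q0)) -sqrtr_sqr ler_wsqrtr// (le_trans _ Lz)// /L lerDr.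
    by rewrite addr_ge0// divr_ge0 ?mulr_ge0// ltW.
  have : `|y - p.2| <= r / 4.
    rewrite -(ler_pM2r rl0) -{1}(gtr0_norm rl0) -normrM -/t (le_trans (ltW (tT _ ht)))//.
    by rewrite (le_trans _ (ler_wpM2l _ qs)) ?divr_ge0 ?(ltW r0)// /q le_eqVlt; apply/orP; left; apply/eqP; field; rewrite gt_eqF.
  rewrite (_ : p.2 - s1 = (y - s1) - (y - p.2)); last by ring.
  by move: (ler_normB (y - s1) (y - p.2)) ys r0; clear => *; lra.
rewrite p0 pa0 ps /= abs2_window// mulrAC -powRD ?(gt_eqF p0) ?implybT//.
rewrite (addrC (3 / 2)) -/be' mulrC /m; apply: ler_pM => //.
- exact: ltW.
- by rewrite mulr_ge0// ?invr_ge0 ltW// pos.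
- have -> : dil v p.1 p.2 xi = (sg * (p.1 * l), sg * (Num.sqrt (p.1 * l) * t)).
    rewrite /dil -/z; congr pair; first by rewrite zE; ring.
    have -> : z.2 - p.2 * z.1 = z.1 * (y - p.2) by rewrite /y; field.
    rewrite sqrtrM ?(ltW p0)// /t zE {1}(_ : l = Num.sqrt l * Num.sqrt l); first by ring.
    by rewrite -expr2 sqr_sqrtr// ltW.
  by apply: H => //; rewrite -ler_pdivrMr// p1 -ler_pdivlMr.
rewrite ler_pdivrMl ?pos//.
have -> : p.1 `^ be' = (p.1^-1) `^ (- be').
  by rewrite -powR_inv1 ?(ltW p0)// -powRrM mulN1r opprK.
have ip : 0 < p.1^-1 by rewrite invr_gt0.
have Kp : 0 < K by exact: lt_le_trans K1.
apply: powR_comparable => //.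
- have lA : l <= A2 * p.1^-1 by rewrite ler_pdivlMr// mulrC -ler_pdivlMr.
  rewrite (le_trans wl)// /D -!mulrA ler_wpM2l ?(ltW Kp)// (le_trans lA)// ler_wpM2r ?(ltW ip)//.
  lra.
- have lA : p.1^-1 <= A1^-1 * l.
    by rewrite -(ler_pM2l p0) mulfV ?gt_eqF// mulrCA ler_pdivlMl// mulr1 -ler_pdivrMr.
  rewrite (le_trans lA)// /D mulrAC.
  apply: (@le_trans _ _ (A1^-1 * (K * wt xi))); first by rewrite ler_wpM2l// ltW.
  rewrite mulrC ler_wpM2l//; first by rewrite mulr_ge0 ?(ltW Kp)// ltW// wt_gt0.
  lra.
Qed.

End kernels.

(** * From Sobolev regularity to shearlet decay *)

Section shearlet_measurability.
Context {R : realType}.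
Local Notation T1 := (measurableTypeR R).
Local Notation T2 := (measurableTypeR R * measurableTypeR R)%type.
Local Notation P := (R^o * R^o)%type.
Local Notation int := (cintegral leb2 setT).
Local Notation cint := (cintegrable leb2 setT).
Implicit Types (a s S be : R) (x y xi : R * R) (b h u : R * R -> R[i]).

Lemma measurable_coswap d (T : measurableType d) v (F : T -> T2) : measurable_fun setT F ->
  measurable_fun setT (fun z => (coswap v (F z)).1 : T1) /\
  measurable_fun setT (fun z => (coswap v (F z)).2 : T1).
Proof.
move=> mF; have F1 := measurableT_comp measurable_fst mF.
by have F2 := measurableT_comp measurable_snd mF; case: v.
Qed.

Lemma measurable_sqrt d (T : measurableType d) (F : T -> T1) : measurable_fun setT F ->
  measurable_fun setT (fun z => Num.sqrt (F z) : T1).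
Proof.
move=> mF; apply: (measurableT_comp _ mF); apply: continuous_measurable_fun.
exact: sqrt_continuous.
Qed.

Lemma cmeas_window b v : csmooth (V := P) b ->
  cmeas (fun z : T2 * T2 => window b v z.1.1 z.1.2 z.2).
Proof.
move=> sb; have ma : measurable_fun setT (fun z : T2 * T2 => z.1.1 : T1).
  exact: (measurableT_comp measurable_fst measurable_fst).
have ms : measurable_fun setT (fun z : T2 * T2 => z.1.2 : T1).
  exact: (measurableT_comp measurable_snd measurable_fst).
have [m1 m2] := @measurable_coswap _ (T2 * T2)%type v _ measurable_snd.
apply: cmeasM.
  by apply: cmeas_real; apply: (measurableT_comp (measurable_powR _) ma).
apply: (cmeas_comp _ (csmooth_cmeas sb)); apply: measurable_fun_pair.
  exact: measurable_funM.
apply: measurable_funM; first exact: measurable_sqrt.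
by apply: measurable_funB => //; exact: measurable_funM.
Qed.

Lemma measurable_slab v : measurable_fun setT (fun z : T2 * T2 => slab v z.1 z.2).
Proof.
have ma : measurable_fun setT (fun z : T2 * T2 => z.1.1 : T1).
  exact: (measurableT_comp measurable_fst measurable_fst).
have ms : measurable_fun setT (fun z : T2 * T2 => z.1.2 : T1).
  exact: (measurableT_comp measurable_snd measurable_fst).
have [m1 m2] := @measurable_coswap _ (T2 * T2)%type v _ measurable_snd.
have mn : measurable_fun setT (fun z : T2 * T2 => `|(coswap v z.2).1| : T1).
  exact: measurableT_comp.
have ml := measurable_funM ma mn.
rewrite /slab; apply: measurable_and; last apply: measurable_and.
- by apply: measurable_fun_ler; [exact: measurable_cst|exact: ml].
- by apply: measurable_fun_ler; [exact: ml|exact: measurable_cst].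
apply: measurable_fun_ler; last by apply: measurable_funM => //; exact: measurable_sqrt.
apply: measurableT_comp => //; apply: measurable_funB => //; exact: measurable_funM.
Qed.

(** A double cone, symmetric under xi -> - xi, around the line of slope s1 in the coordinates
    swapped according to v. *)
Definition sector v (s1 rho : R) xi :=
  `|(coswap v xi).2 - s1 * (coswap v xi).1| <= rho * `|(coswap v xi).1|.

Lemma measurable_sector v s1 rho : measurable_fun setT (sector v s1 rho : T2 -> bool).
Proof.
have [m1 m2] := @measurable_coswap _ T2 v _ (@measurable_id _ T2 setT).
apply: measurable_fun_ler.
  by apply: measurableT_comp => //; apply: measurable_funB => //; exact: measurable_funM.
by apply: measurable_funM => //; exact: measurableT_comp.
Qed.

Lemma cint_support_moments u (M : R) : cint u -> (forall x, u x != 0 -> mnorm x <= M) -> moments u.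
Proof.
move=> iu uM N; apply: (@cint_lec _ T2 R leb2 _ u ((1 + `|M|) ^+ N)) => //.
  by apply: cmeasM (cint_meas iu); apply: cmeas_real; exact: measurable_wtX.
move=> x; rewrite normc_wt; have [->|ux] := eqVneq (u x) 0; first by rewrite normc0 !mulr0.
rewrite ler_wpM2r ?normc_ge0// lerXn2r ?nnegrE ?(ltW (wt_gt0 _)) ?addr_ge0//.
by rewrite lerD2l (le_trans (uM _ ux))// ler_norm.
Qed.

(** h is only known through its integrals against Schwartz functions; multiplying it by cutoffs
    equal to 1 on larger and larger squares reveals its measurability. *)
Lemma cmeas_of_local (st : R -> R) h : smooth_step st ->
  (forall eta, sch eta -> cint (fun xi => h xi * eta xi)) -> cmeas (h : T2 -> R[i]).
Proof.
move=> hst H; pose B n : set T2 := [set x | mnorm x <= n.+1%:R].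
have BT : \bigcup_n B n = setT.
  apply/seteqP; split=> // x _; exists (Num.truncn (mnorm x)) => //.
  by rewrite /B /= ltW// truncnS_gt.
have mB n : measurable (B n).
  have := @measurable_fun_ler _ T2 R setT _ (cst n.+1%:R) (measurable_mnorm (R := R)) (measurable_cst _).
  move=> /(_ measurableT [set true] I); rewrite setTI => mm.
  by rewrite (_ : B n = (fun x => mnorm x <= n.+1%:R) @^-1` [set true])//; apply/seteqP; split.
have key (p : R[i] -> R) : (forall u, cint u -> measurable_fun setT (fun x : T2 => p (u x))) ->
    measurable_fun setT (fun x : T2 => p (h x)).
  move=> pm; rewrite -BT; apply/measurable_fun_bigcup => // n.
  have n0 : (0 : R) < n.+1%:R by [].
  have := pm _ (H _ (tst_sch (cut_tst hst 0 n0))).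
  move=> /(measurable_funS measurableT (@subsetT _ (B n))).
  apply: eq_measurable_fun => x; rewrite inE => xn.
  by rewrite (cut1 hst) ?mulr1// subr0.
by split; apply: key => u iu; [exact: (cint_meas iu).1|exact: (cint_meas iu).2].
Qed.

Lemma mnorm_le_enorm x : mnorm x <= enorm x.
Proof.
rewrite mnorm_le /enorm /dot; apply/andP; split; rewrite -sqrtr_sqr ler_wsqrtr// -!expr2.
  by rewrite lerDl sqr_ge0.
by rewrite lerDr sqr_ge0.
Qed.

Lemma enorm_le_mnorm x : enorm x <= 2 * mnorm x.
Proof.
have m0 := mnorm_ge0 x; rewrite /enorm /dot -[leRHS]ger0_norm ?mulr_ge0// -sqrtr_sqr ler_wsqrtr//.
have h1 := le_mnorm1 x; have h2 := le_mnorm2 x.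
have : x.1 ^+ 2 <= mnorm x ^+ 2 by rewrite -real_normK ?num_real// lerXn2r ?nnegrE.
have : x.2 ^+ 2 <= mnorm x ^+ 2 by rewrite -real_normK ?num_real// lerXn2r ?nnegrE.
rewrite exprMn -!expr2; have := sqr_ge0 (mnorm x); lra.
Qed.

(** F is an integral in xi of a jointly measurable kernel; its integral over (a, s) is computed in
    the other order, with [slab_kernel]. *)
Lemma window_majorant b v s1 rho (m S : R) h : tst b -> gen_supp b -> 0 <= S ->
  cmeas (h : T2 -> R[i]) ->
  (\int[leb2]_xi (if sector v s1 rho xi then wt xi `^ (2 * m) * abs2 (h xi) else 0)%:E < +oo)%E ->
  exists F : T2 -> \bar R, [/\ measurable_fun setT F, forall p, (0 <= F p)%E,
    (\int[leb2]_p F p < +oo)%E &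
    forall a s, 0 < a -> a < 1 -> `|s| <= S ->
    (forall xi, slab v (a, s) xi -> sector v s1 rho xi) ->
    ((a `^ (- (2 * m) - 3))%:E * \int[leb2]_xi (abs2 (h xi * window b v a s xi))%:E <= F (a, s))%E].
Proof.
move=> tb gb S0 mh fin; have [B [B0 HB]] := tst_bounded tb.
(* - 2m - 3 from the weight of the shearlet integral plus 3/2 from |W|^2; [slab_kernel] then returns
   the exponent - be - 3/2 = 2m. *)
pose be : R := - (2 * m) - 3 / 2.
pose K (p xi : T2) : R := if [&& 0 < p.1 < 1, `|p.2| <= S & slab v p xi] then p.1 `^ be else 0.
have K0 p xi : 0 <= K p xi by rewrite /K; case: ifP => // _; exact: powR_ge0.
pose H xi : R := if sector v s1 rho xi then abs2 (h xi) else 0.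
have H0 xi : 0 <= H xi by rewrite /H; case: ifP => // _; exact: abs2_ge0.
have mH : measurable_fun setT (H : T2 -> T1).
  apply: measurable_fun_ifT; [exact: measurable_sector|exact: measurable_abs2|exact: measurable_cst].
have ma : measurable_fun setT (fun z : T2 * T2 => z.1.1 : T1).
  exact: (measurableT_comp measurable_fst measurable_fst).
have ms : measurable_fun setT (fun z : T2 * T2 => z.1.2 : T1).
  exact: (measurableT_comp measurable_snd measurable_fst).
have mK : measurable_fun setT (fun z : T2 * T2 => K z.1 z.2).
  apply: measurable_fun_ifT; last exact: measurable_cst.
    apply: measurable_and; last apply: measurable_and.
    - apply: measurable_and.
        by apply: measurable_fun_ltr; [exact: measurable_cst|exact: ma].
      by apply: measurable_fun_ltr; [exact: ma|exact: measurable_cst].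
    - apply: measurable_fun_ler; last exact: measurable_cst.
      exact: measurableT_comp.
    - exact: measurable_slab.
  exact: (measurableT_comp (measurable_powR _) ma).
pose G (z : T2 * T2) := (B ^+ 2 * (H z.2 * K z.1 z.2))%:E.
have mG : measurable_fun setT G.
  apply/measurable_EFinP; apply: measurable_funM; first exact: measurable_cst.
  by apply: measurable_funM => //; exact: (measurableT_comp mH measurable_snd).
have G0 z : (0 <= G z)%E by rewrite lee_fin mulr_ge0 ?sqr_ge0// mulr_ge0.
exists (fun p => \int[leb2]_xi G (p, xi))%E; split.
- exact: measurable_section_integral.
- by move=> p; apply: integral_ge0 => xi _.
- rewrite (tonelli2 mG G0).
  have [C [C0 HC]] := slab_kernel v be S0.
  apply: (@le_lt_trans _ _ (\int[leb2]_xi (B ^+ 2 * C *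
     (if sector v s1 rho xi then wt xi `^ (2 * m) * abs2 (h xi) else 0))%:E)%E).
    apply: ge0_le_integral_any => // xi _; first by apply: integral_ge0 => p _.
      rewrite lee_fin mulr_ge0 ?mulr_ge0 ?sqr_ge0//; case: ifP => // _.
      by rewrite mulr_ge0 ?powR_ge0 ?abs2_ge0.
    have mKx : measurable_fun setT (fun p : T2 => K p xi).
      exact: (measurableT_comp mK (pair2_measurable xi)).
    rewrite [leLHS](_ : _ = \int[leb2]_p (B ^+ 2 * H xi * K p xi)%:E)%E; last first.
      by apply: eq_integral => p _; rewrite /G /= mulrA.
    rewrite (ge0_integral_scale _ _ mKx) ?mulr_ge0 ?sqr_ge0//.
    apply: (@le_trans _ _ ((B ^+ 2 * H xi)%:E * (C * wt xi `^ (- be - 3 / 2))%:E)%E).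
      by apply: lee_wpmul2l; [rewrite lee_fin mulr_ge0 ?sqr_ge0|exact: HC].
    rewrite -EFinM lee_fin /H (_ : - be - 3 / 2 = 2 * m); last by rewrite /be; lra.
    case: ifP => _; last by rewrite !mulr0 mul0r.
    by rewrite le_eqVlt; apply/orP; left; apply/eqP; ring.
  rewrite ge0_integral_scale//; last 3 first.
  - by rewrite mulr_ge0 ?sqr_ge0.
  - apply: measurable_fun_ifT; [exact: measurable_sector| |exact: measurable_cst].
    apply: measurable_funM; last exact: measurable_abs2.
    apply: (measurableT_comp (measurable_powR _)).
    by have := @measurable_wtX R 1; under eq_fun do rewrite expr1.
  - by move=> xi; case: ifP => // _; rewrite mulr_ge0 ?powR_ge0 ?abs2_ge0.
  by apply: lte_mul_pinfty => //; rewrite lee_fin mulr_ge0 ?sqr_ge0.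
move=> a s a0 a1 sS sec.
have mw : cmeas (fun xi : T2 => h xi * window b v a s xi).
  by apply: cmeasM => //; exact: csmooth_cmeas (tst_window v s tb a0 a1).1.
rewrite -ge0_integral_scale ?powR_ge0//; last 2 first.
- exact: measurable_abs2.
- by move=> x; exact: abs2_ge0.
apply: ge0_le_integral_any => // xi _; rewrite ?G0// /G lee_fin.
  by rewrite mulr_ge0 ?powR_ge0 ?abs2_ge0.
rewrite abs2M abs2_window//; have [w0|w0] := eqVneq (window b v a s xi) 0.
  rewrite -(abs2_window b v s xi a0) w0 [abs2 0](_ : _ = 0); last by rewrite abs2E normc0 expr0n.
  by rewrite !mulr0 mulr_ge0 ?sqr_ge0// mulr_ge0.
have sl := window_slab gb a0 w0.
rewrite /H sec// /K /= a0 a1 sS sl /=.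
have -> : be = - (2 * m) - 3 + 3 / 2 by rewrite /be; lra.
rewrite (@powRD _ a (- (2 * m) - 3) (3 / 2)) ?(gt_eqF a0) ?implybT//.
set X := a `^ (- (2 * m) - 3); set Y := a `^ (3 / 2); set Z := abs2 (h xi).
set V := abs2 (b (dil v a s xi)).
rewrite [leLHS](_ : _ = V * (Z * (X * Y))); last by ring.
rewrite ler_wpM2r; first by [].
  by do ![apply: mulr_ge0]; rewrite ?abs2_ge0 ?powR_ge0.
by rewrite /V abs2E lerXn2r ?nnegrE ?normc_ge0.
Qed.

End shearlet_measurability.

(** * Finiteness of the shearlet integral *)

Section decay_from_regularity.
Context {R : realType}.
Variable st : R -> R.
Hypothesis hst : smooth_step st.
Local Notation T1 := (measurableTypeR R).
Local Notation T2 := (measurableTypeR R * measurableTypeR R)%type.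
Local Notation P := (R^o * R^o)%type.
Local Notation int := (cintegral leb2 setT).
Local Notation cint := (cintegrable leb2 setT).
Implicit Types (a s S : R) (t x y xi : R * R) (b h u : R * R -> R[i]) (g : (R * R -> R[i]) -> R[i]).

Definition box x0 (r : R) : set (R * R) := [set t | mnorm (t - x0) <= r].

Lemma measurable_box x0 r : measurable (box x0 r : set T2).
Proof.
have mD : measurable_fun setT (fun t : T2 => mnorm (t - x0) : T1).
  apply: (measurableT_comp measurable_mnorm); apply: measurable_sub2.
    exact: measurable_id.
  exact: measurable_cst.
have := @measurable_fun_ler _ T2 R setT _ (cst r) mD (measurable_cst _).
move=> /(_ measurableT [set true] I); rewrite setTI => mm.
by rewrite (_ : box x0 r = (fun x => mnorm (x - x0) <= r) @^-1` [set true])//; apply/seteqP; split.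
Qed.

Lemma csmooth_ift u : moments u -> csmooth (V := P) (ift u).
Proof.
move=> mu; have := csmooth_comp_affine (scale_diff (-1)) (csmooth_fourier2 mu).
by congr csmooth; apply/funext => x; rewrite /= scaleN1r.
Qed.

Lemma integral_box_cst x0 (r c : R) : 0 <= r -> 0 <= c ->
  (\int[leb2]_(t in box x0 r) c%:E <= (c * ((2 * r) * (2 * r)))%:E)%E.
Proof.
move=> r0 c0; have := @integral_rect R (x0.1 - r) (x0.1 + r) (x0.2 - r) (x0.2 + r) c.
rewrite (_ : x0.1 + r - (x0.1 - r) = 2 * r); last by ring.
rewrite (_ : x0.2 + r - (x0.2 - r) = 2 * r); last by ring.
move=> <- //; [|by lra..].
apply: ge0_le_integral_any => // t; rewrite ?lee_fin//; first by move=> _; case: ifP.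
by rewrite /box /= mnorm_le -!ler_distl => ->.
Qed.

Lemma bessel_sum x0 (r : R) : 0 < r -> exists C : R, 0 <= C /\ forall u1 u2 (c : R),
  moments u1 -> moments u2 -> 0 <= c ->
  (\int[leb2]_(t in box x0 r) (abs2 (ift u1 t) + abs2 (ift u2 t) + c)%:E <=
   C%:E * \int[leb2]_xi (abs2 (u1 xi))%:E + C%:E * \int[leb2]_xi (abs2 (u2 xi))%:E + (C * c)%:E)%E.
Proof.
move=> r0; have [B [B0 HB]] := bessel hst x0 r0.
exists (B + (2 * r) * (2 * r)); split; first by rewrite addr_ge0// !mulr_ge0// ltW.
move=> u1 u2 c m1 m2 c0; have mB := measurable_box x0 r.
have ma u : moments u -> measurable_fun (box x0 r) (fun t : T2 => (abs2 (ift u t))%:E).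
  move=> mu; apply/measurable_EFinP; apply: (measurable_funS measurableT (@subsetT _ _)).
  exact: measurable_abs2 (csmooth_cmeas (csmooth_ift mu)).
under eq_integral do rewrite !EFinD.
rewrite ge0_integralD//; last 2 first.
- by move=> t _; rewrite adde_ge0// lee_fin abs2_ge0.
- by apply: emeasurable_funD; exact: ma.
rewrite ge0_integralD//; [|by move=> t _; rewrite lee_fin abs2_ge0|exact: ma|
    by move=> t _; rewrite lee_fin abs2_ge0|exact: ma].
have V0 : 0 <= (2 * r) * (2 * r) by rewrite !mulr_ge0// ltW.
have I0 u : (0 <= \int[leb2]_xi (abs2 (u xi))%:E)%E.
  by apply: integral_ge0 => xi _; rewrite lee_fin abs2_ge0.
have key u : moments u -> (\int[leb2]_(t in box x0 r) (abs2 (ift u t))%:E <=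
    (B + (2 * r) * (2 * r))%:E * \int[leb2]_xi (abs2 (u xi))%:E)%E.
  move=> mu; apply: (le_trans (HB u mu)).
  by apply: lee_wpmul2r => //; rewrite lee_fin lerDl.
apply: leeD; first by apply: leeD; exact: key.
apply: (le_trans (integral_box_cst x0 (ltW r0) c0)).
by rewrite lee_fin mulrC ler_wpM2r// lerDr.
Qed.

Lemma abs2D3 (z1 z2 z : R[i]) (c : R) : normc (z - (z1 + z2)) <= c ->
  abs2 z <= 3 * (abs2 z1 + abs2 z2 + c ^+ 2).
Proof.
move=> h; have h3 : normc z <= normc z1 + normc z2 + c.
  have -> : z = (z1 + z2) + (z - (z1 + z2)) by rewrite addrC subrK.
  by rewrite (le_trans (normcD _ _))// lerD// normcD.
rewrite !abs2E; set x := normc z1; set y := normc z2; set w := normc z in h3 *.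
have c0 : 0 <= c := le_trans (normc_ge0 _) h.
apply: (@le_trans _ _ ((x + y + c) ^+ 2)).
  by rewrite lerXn2r ?nnegrE ?addr_ge0 ?normc_ge0.
have := sqr_ge0 (x - y); have := sqr_ge0 (x - c); have := sqr_ge0 (y - c); nra.
Qed.

(** Half of the opening pays for the width sqrt a of the slab, the other half for the distance from
    s to s1. *)
Lemma slab_sector v s1 rho a s xi : Num.sqrt a <= rho / 2 -> `|s - s1| <= rho / 2 ->
  slab v (a, s) xi -> sector v s1 rho xi.
Proof.
move=> ar sr /and3P[/= _ _]; rewrite /sector; set z := coswap v xi => h.
have -> : z.2 - s1 * z.1 = (z.2 - s * z.1) + (s - s1) * z.1 by ring.
rewrite (le_trans (ler_normD _ _))// normrM.
have := ler_wpM2r (normr_ge0 z.1) ar; have := ler_wpM2r (normr_ge0 z.1) sr; lra.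
Qed.

(** h alone may have no moments; its product with a compactly supported window has them all. *)
Lemma supported_measure_moments b v a s f h t : tst b -> 0 < a -> a < 1 ->
  (forall eta, sch eta -> cint (fun xi => h xi * eta xi) /\
     f (fourier2 eta) = int (fun xi => h xi * eta xi)) ->
  moments (fun xi => h xi * window b v a s xi) /\
  f (molecule b v a s t) = ift (fun xi => h xi * window b v a s xi) t.
Proof.
move=> tb a0 a1 rep; have tw := tst_window v s tb a0 a1.
have [iw _] := rep _ (tst_sch tw); have [M M0 wM] := tst_supp tw.
split.
  apply: (cint_support_moments iw (M := M)) => xi; rewrite leNgt; apply: contraNN => Mxi.
  by rewrite wM// mulr0.
have [_ ->] := rep _ (tst_sch (tst_modulated v s t tb a0 a1)).
rewrite /ift fourier2E; congr cintegral; apply/funext => xi; rewrite mulrA; congr (_ * _).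
exact: echC.
Qed.

(** Regularity at xi0 and at - xi0 provides two localizations fp and fm with unrelated cutoffs. The
    generator b is split accordingly into bp + bm, and g is replaced by fp on the first part and by
    fm on the second, at the cost of a negligible error. *)
Lemma forward_bound v (m s1 rho r : R) x0 b bp bm g fp fm hp hm : 0 < rho -> 0 < r ->
  tst bp -> tst bm -> gen_supp bp -> gen_supp bm -> (forall eta, b eta = bp eta + bm eta) ->
  temperate g -> temperate fp -> temperate fm ->
  (forall phi, tst phi -> (forall x, 3 * r < mnorm (x - x0) -> phi x = 0) -> g phi = fp phi) ->
  (forall phi, tst phi -> (forall x, 3 * r < mnorm (x - x0) -> phi x = 0) -> g phi = fm phi) ->
  (forall eta, sch eta -> cint (fun xi => hp xi * eta xi) /\
     fp (fourier2 eta) = int (fun xi => hp xi * eta xi)) ->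
  (forall eta, sch eta -> cint (fun xi => hm xi * eta xi) /\
     fm (fourier2 eta) = int (fun xi => hm xi * eta xi)) ->
  (exists Fp : T2 -> \bar R, [/\ measurable_fun setT Fp, forall p, (0 <= Fp p)%E,
    (\int[leb2]_p Fp p < +oo)%E &
    forall a s, 0 < a -> a < 1 -> `|s| <= `|s1| + 1 ->
    (forall xi, slab v (a, s) xi -> sector v s1 rho xi) ->
    ((a `^ (- (2 * m) - 3))%:E * \int[leb2]_xi (abs2 (hp xi * window bp v a s xi))%:E <= Fp (a, s))%E]) ->
  (exists Fm : T2 -> \bar R, [/\ measurable_fun setT Fm, forall p, (0 <= Fm p)%E,
    (\int[leb2]_p Fm p < +oo)%E &
    forall a s, 0 < a -> a < 1 -> `|s| <= `|s1| + 1 ->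
    (forall xi, slab v (a, s) xi -> sector v s1 rho xi) ->
    ((a `^ (- (2 * m) - 3))%:E * \int[leb2]_xi (abs2 (hm xi * window bm v a s xi))%:E <= Fm (a, s))%E]) ->
  exists r1 : R, 0 < r1 /\ forall (F : R -> R -> R * R -> R[i]) (c0 r' : R), 0 <= c0 -> 0 < r' -> r' <= r1 ->
    (forall a s t, 0 < a -> a < 1 -> abs2 (F a s t) <= c0 * abs2 (g (molecule b v a s t))) ->
    (shearlet_integral m F s1 x0 r' < +oo)%E.
Proof.
move=> rho0 r0 tbp tbm gbp gbm bE tg tfp tfm agp agm repp repm.
move=> [Fp [mFp Fp0 Fpfin HFp]] [Fm [mFm Fm0 Fmfin HFm]].
pose S := `|s1| + 1; have S0 : 0 <= S by rewrite addr_ge0.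
(* K satisfies 2 K + e >= 0, so that the square of the negligible error a^K absorbs a^e. *)
pose e : R := - (2 * m) - 3; pose K := ((Num.truncn `|m|).+1 + 2)%N.
(* Below a0 the slabs fit into the sector of opening rho; the entry 1/2 ensures a0 < 1. *)
pose a0 : R := Num.min 2^-1 ((rho / 2) ^+ 2).
have h2 : 0 < rho / 2 by rewrite divr_gt0.
have a00 : 0 < a0 by rewrite lt_min invr_gt0 ltr0n exprn_gt0.
have a01 : a0 < 1 by rewrite gt_min; apply/orP; left; lra.
have a0rho : Num.sqrt a0 <= rho / 2.
  rewrite -[leRHS]ger0_norm ?divr_ge0 ?(ltW rho0)// -sqrtr_sqr ler_wsqrtr//.
  by rewrite ge_min lexx orbT.
pose r1 := Num.min 1 (Num.min (rho / 2) (r / 2)).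
have r10 : 0 < r1 by rewrite !lt_min ltr01 !divr_gt0.
have r11 : r1 <= 1 by rewrite ge_min lexx.
have r1rho : r1 <= rho / 2 by rewrite !ge_min lexx orbT.
have r1r : r1 <= r / 2 by rewrite !ge_min lexx !orbT.
have [Dp [Dp0 HDp]] := molecule_difference hst v K tg tfp agp tbp S0 r0.
have [Dm [Dm0 HDm]] := molecule_difference hst v K tg tfm agm tbm S0 r0.
have tb : tst b.
  have [sp [Mp HMp]] := tbp; have [sm [Mm HMm]] := tbm.
  rewrite (_ : b = fun eta => bp eta + bm eta); last exact/funext.
  split; first exact: csmoothD.
  exists (Num.max Mp Mm) => x; rewrite le_max; have [p0|p0] := eqVneq (bp x) 0.
    by rewrite p0 add0r => /HMm ->; rewrite orbT.
  by rewrite HMp.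
have [G [n [G0 HG]]] := molecule_growth v (mnorm x0 + r) tg tb S0.
have [B [B0 HB]] := bessel_sum x0 r10.
exists r1; split=> // F c0 r' c00 r'0 r'r1 HF.
have boxr1 t : eball r' x0 t -> box x0 r1 t.
  by move=> tr; rewrite /box /= (le_trans (mnorm_le_enorm _))// (le_trans (ltW tr)).
have sS s : `|s - s1| <= r1 -> `|s| <= S.
  by move: (ler_normD (s - s1) s1) r11; rewrite subrK /S; clear => *; lra.
have boxr t : box x0 r1 t -> mnorm (t - x0) <= r / 2 by move=> h; exact: le_trans h r1r.
pose D := Dp + Dm; have D0 : 0 <= D by rewrite addr_ge0.
pose V := 2 * r1 * (2 * r1); have V0 : 0 <= V by rewrite !mulr_ge0// ltW.
pose E2 := c0 * ((G * a0^-1 ^+ n) ^+ 2 * a0^-1 `^ `|e|) * V.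
have E20 : 0 <= E2.
  by apply: mulr_ge0 V0; apply: mulr_ge0 c00 _; apply: mulr_ge0; [exact: sqr_ge0|exact: powR_ge0].
pose k1 := c0 * 3 * B; have k10 : 0 <= k1 by rewrite !mulr_ge0.
pose k2 := k1 * D ^+ 2 + E2; have k20 : 0 <= k2 by rewrite addr_ge0// mulr_ge0 ?sqr_ge0.
have eE : e = - (2 * m) - 3 by [].
have small a s : 0 < a -> a < a0 -> `|s - s1| <= r1 ->
    (\int[leb2]_(t in eball r' x0) (abs2 (F a s t) * a `^ e)%:E <=
      k1%:E * (Fp (a, s) + Fm (a, s)) + k2%:E)%E.
  move=> p0 pa0 ps; have p1 : a < 1 by exact: lt_trans a01.
  have sec xi : slab v (a, s) xi -> sector v s1 rho xi.
    by apply: slab_sector; [rewrite (le_trans _ a0rho)// ler_wsqrtr// ltW|exact: le_trans r1rho].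
  have [mup Eup] := supported_measure_moments v s x0 tbp p0 p1 repp.
  have [mum Eum] := supported_measure_moments v s x0 tbm p0 p1 repm.
  set up := (fun xi => _) in mup Eup; set um := (fun xi => _) in mum Eum.
  have c2 : 0 <= (D * a ^+ K) ^+ 2 by exact: sqr_ge0.
  have pw t : box x0 r1 t -> abs2 (F a s t) * a `^ e <=
      (c0 * 3 * a `^ e) * (abs2 (ift up t) + abs2 (ift um t) + (D * a ^+ K) ^+ 2).
    move=> /boxr tr; rewrite [leRHS](_ : _ = c0 * (3 * (abs2 (ift up t) + abs2 (ift um t) +
      (D * a ^+ K) ^+ 2)) * a `^ e); last by ring.
    rewrite ler_wpM2r ?powR_ge0// (le_trans (HF a s t p0 p1))// ler_wpM2l//.
    apply: abs2D3.
    have -> : g (molecule b v a s t) = g (molecule bp v a s t) + g (molecule bm v a s t).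
      have sp := sch_molecule v s t tbp p0 p1; have sm := sch_molecule v s t tbm p0 p1.
      have [lg _] := tg; rewrite -[X in X + _]mul1r -(lg 1 _ _ sp sm); congr g.
      apply/funext => x; rewrite mul1r /molecule !fourier2E.
      have ip := cint_ech x (tst_cint (tst_modulated v s t tbp p0 p1)).
      have im := cint_ech x (tst_cint (tst_modulated v s t tbm p0 p1)).
      rewrite -(cintegralD ip im); congr cintegral; apply/funext => xi.
      by rewrite /window bE; move: (ech xi (- t)) (ech x xi) => w1 w2; ring.
    have [_ Ep] := supported_measure_moments v s t tbp p0 p1 repp.
    have [_ Em] := supported_measure_moments v s t tbm p0 p1 repm.
    rewrite -Ep -Em /D mulrDl opprD addrACA (le_trans (normcD _ _))// lerD//.
      exact: HDp (sS _ ps) tr.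
    exact: HDm (sS _ ps) tr.
  have ca : 0 <= c0 * 3 * a `^ e by rewrite mulr_ge0 ?powR_ge0// mulr_ge0.
  have s0 t : 0 <= abs2 (ift up t) + abs2 (ift um t) + (D * a ^+ K) ^+ 2.
    by apply: addr_ge0 c2; apply: addr_ge0; exact: abs2_ge0.
  apply: (@le_trans _ _ (\int[leb2]_(t in box x0 r1) ((c0 * 3 * a `^ e) *
      (abs2 (ift up t) + abs2 (ift um t) + (D * a ^+ K) ^+ 2))%:E)%E).
    apply: ge0_le_integral_any => //.
    - by move=> t _; rewrite lee_fin mulr_ge0 ?abs2_ge0 ?powR_ge0.
    - by move=> t _; rewrite lee_fin mulr_ge0.
    - by move=> t /boxr1/pw; rewrite lee_fin.
  under eq_integral do rewrite EFinM.
  rewrite ge0_integralZl_EFin//; last 3 first.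
  - exact: measurable_box.
  - by move=> t _; rewrite lee_fin.
  - apply/measurable_EFinP; apply: (measurable_funS measurableT (@subsetT _ _)).
    apply: measurable_funD; last exact: measurable_cst.
    by apply: measurable_funD; apply: measurable_abs2; apply: csmooth_cmeas; exact: csmooth_ift.
  apply: (@le_trans _ _ ((c0 * 3 * a `^ e)%:E * (B%:E * \int[leb2]_xi (abs2 (up xi))%:E +
     B%:E * \int[leb2]_xi (abs2 (um xi))%:E + (B * (D * a ^+ K) ^+ 2)%:E))%E).
    by apply: lee_wpmul2l; [rewrite lee_fin|exact: HB].
  have hZp := HFp a s p0 p1 (sS _ ps) sec; have hZm := HFm a s p0 p1 (sS _ ps) sec.
  rewrite -/up -eE in hZp; rewrite -/um -eE in hZm.
  have Zp0 : (0 <= \int[leb2]_xi (abs2 (up xi))%:E)%E.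
    by apply: integral_ge0 => xi _; rewrite lee_fin abs2_ge0.
  have Zm0 : (0 <= \int[leb2]_xi (abs2 (um xi))%:E)%E.
    by apply: integral_ge0 => xi _; rewrite lee_fin abs2_ge0.
  move: (\int[leb2]_xi (abs2 (up xi))%:E)%E (\int[leb2]_xi (abs2 (um xi))%:E)%E hZp hZm Zp0 Zm0.
  move=> Zp Zm hZp hZm Zp0 Zm0.
  have B0' : (0 <= B%:E)%E by rewrite lee_fin.
  rewrite ge0_muleDr ?adde_ge0 ?mule_ge0 ?lee_fin ?mulr_ge0//.
  rewrite ge0_muleDr ?mule_ge0// ge0_muleDr//.
  have cE Z : ((c0 * 3 * a `^ e)%:E * (B%:E * Z) = k1%:E * ((a `^ e)%:E * Z))%E.
    rewrite !muleA -!EFinM; congr (_%:E * _)%E; rewrite /k1; ring.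
  rewrite !cE; apply: leeD.
    by apply: leeD; apply: lee_wpmul2l => //; rewrite lee_fin.
  rewrite -EFinM lee_fin /k2; apply: (@le_trans _ _ (k1 * D ^+ 2)); last by rewrite lerDl.
  rewrite exprMn [leLHS](_ : _ = k1 * D ^+ 2 * (a `^ e * (a ^+ K) ^+ 2)); last by rewrite /k1; ring.
  apply: ler_piMr; first by rewrite mulr_ge0 ?sqr_ge0.
  rewrite -exprM -powR_mulrn ?(ltW p0)// -powRD ?(gt_eqF p0) ?implybT// -[leRHS](powRr0 a).
  apply: ger_powR; first by rewrite p0 ltW.
  rewrite natrM /K natrD.
  move: (truncnS_gt `|m|) (ler_norm m); rewrite /e; clear => *; lra.
- by rewrite exprn_ge0// ltW.
- by rewrite exprn_ge0// ltW.
(* Away from a = 0 the growth bound on the coefficients is enough. *)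
have large a s : a0 <= a -> a < 1 -> `|s - s1| <= r1 ->
    (\int[leb2]_(t in eball r' x0) (abs2 (F a s t) * a `^ e)%:E <= k2%:E)%E.
  move=> pa0 p1 ps; have p0 : 0 < a by exact: lt_le_trans pa0.
  have ia0 : 0 < a0^-1 by rewrite invr_gt0.
  have ia1 : 1 <= a0^-1 by rewrite invf_ge1// ltW.
  have Q0 : 0 <= c0 * ((G * a0^-1 ^+ n) ^+ 2 * a0^-1 `^ `|e|).
    by apply: mulr_ge0 c00 _; apply: mulr_ge0; [exact: sqr_ge0|exact: powR_ge0].
  apply: (@le_trans _ _ (\int[leb2]_(t in box x0 r1) (c0 * ((G * a0^-1 ^+ n) ^+ 2 * a0^-1 `^ `|e|))%:E)%E).
    apply: ge0_le_integral_any => //.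
    - by move=> t _; rewrite lee_fin mulr_ge0 ?abs2_ge0 ?powR_ge0.
    move=> t /boxr1 tr; rewrite lee_fin mulrA; apply: ler_pM; rewrite ?abs2_ge0 ?powR_ge0//.
      rewrite (le_trans (HF a s t p0 p1))// ler_wpM2l// abs2E.
      have tx : mnorm t <= mnorm x0 + r.
        have := mnormD (t - x0) x0; rewrite subrK; move: (boxr _ tr) r0; clear => *; lra.
      have := HG a s t p0 p1 (sS _ ps) tx => h.
      have h' : normc (g (molecule b v a s t)) <= G * a0^-1 ^+ n.
        rewrite (le_trans h)// ler_wpM2l// lerXn2r ?nnegrE ?invr_ge0 ?(ltW p0) ?(ltW a00)//.
        by rewrite lef_pV2 ?posrE.
      by rewrite lerXn2r ?nnegrE ?normc_ge0// (le_trans (normc_ge0 _) h').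
    have := @powR_comparable R a 1 a0^-1 e ltr01 ia1; rewrite powR1 !mulr1; apply.
      by rewrite (le_trans (ltW p1)).
    by rewrite mulrC ler_pdivlMr// mul1r.
  apply: (le_trans (integral_box_cst x0 (ltW r10) Q0)).
  by rewrite lee_fin /k2 -/V -/E2 lerDr mulr_ge0 ?sqr_ge0.
have F0 p : (0 <= k1%:E * (Fp p + Fm p))%E by rewrite mule_ge0 ?adde_ge0 ?lee_fin.
(* Carries the constant k2 on a rectangle containing the domain of (a, s), so that the total
   majorant is integrable over the whole plane. *)
pose H (p : T2) : R := if (0 <= p.1 <= 1) && (s1 - r1 <= p.2 <= s1 + r1) then k2 else 0.
have H0 p : 0 <= H p by rewrite /H; case: ifP.
have mH : measurable_fun setT H.
  apply: measurable_fun_ifT; [|exact: measurable_cst..].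
  by apply: measurable_and; apply: measurable_and; apply: measurable_fun_ler => //;
    (exact: measurable_fst || exact: measurable_snd || exact: measurable_cst).
have mFF : measurable_fun setT (fun p : T2 => k1%:E * (Fp p + Fm p))%E.
  by apply: measurable_funeM; exact: emeasurable_funD.
have mPhi : measurable_fun setT (fun p : T2 => k1%:E * (Fp p + Fm p) + (H p)%:E)%E.
  by apply: emeasurable_funD => //; exact/measurable_EFinP.
have Phi0 p : (0 <= k1%:E * (Fp p + Fm p) + (H p)%:E)%E by rewrite adde_ge0// lee_fin.
rewrite /shearlet_integral.
apply: (@le_lt_trans _ _ (\int[leb2]_p (k1%:E * (Fp p + Fm p) + (H p)%:E))%E).
  rewrite -(iterated_leb2 mPhi Phi0).
  have in0 a s : (0 <= \int[leb2]_(t in eball r' x0) (abs2 (F a s t) * a `^ (- (2 * m) - 3))%:E)%E.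
    by apply: integral_ge0 => t _; rewrite lee_fin mulr_ge0 ?abs2_ge0 ?powR_ge0.
  apply: ge0_le_integral_any => //.
  - by move=> a _; apply: integral_ge0 => s _.
  - by move=> a _; apply: integral_ge0 => s _.
  move=> a; rewrite /= in_itv/= => /andP[p0 p1].
  apply: ge0_le_integral_any => // s; rewrite /= in_itv/= => /andP[l1 l2].
  have ss : `|s - s1| <= r1.
    by rewrite ler_distl; move: l1 l2 r'r1; clear => *; apply/andP; split; lra.
  have -> : H (a, s) = k2 by rewrite /H /= (ltW p0) (ltW p1) -ler_distl ss.
  rewrite -eE; have [pa|pa] := ltP a a0; first exact: small.
  by apply: (le_trans (large a s pa p1 ss)); rewrite leeDr.
rewrite ge0_integralD//; last 2 first.
- by move=> p _; rewrite lee_fin.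
- exact/measurable_EFinP.
rewrite ge0_integralZl_EFin//; last 2 first.
- by move=> p _; rewrite adde_ge0.
- exact: emeasurable_funD.
rewrite (ge0_integralD _ _ (f1 := Fp) (f2 := Fm))//.
rewrite /H integral_rect//; [|by move: r10; clear => *; lra].
by apply: lte_add_pinfty; rewrite ?ltry//; apply: lte_mul_pinfty; rewrite ?lee_fin//; apply: lte_add_pinfty.
Qed.

End decay_from_regularity.

(** * From shearlet decay to Sobolev regularity *)

Section bootstrap_tools.
Context {R : realType}.
Variable st : R -> R.
Hypothesis hst : smooth_step st.
Local Notation T1 := (measurableTypeR R).
Local Notation T2 := (measurableTypeR R * measurableTypeR R)%type.
Local Notation P := (R^o * R^o)%type.
Local Notation int := (cintegral leb2 setT).
Local Notation cint := (cintegrable leb2 setT).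
Implicit Types (a s S : R) (t x y xi zeta : R * R) (b h u phi chi : R * R -> R[i])
  (g : (R * R -> R[i]) -> R[i]).

Lemma temperateZ g (c : R[i]) u : temperate g -> sch u -> g (fun x => c * u x) = c * g u.
Proof.
(* [linear_on] speaks of c * u + eta; here it is used with the scalar c - 1 and eta = u. *)
move=> [lg _] su; have := lg (c - 1) _ _ su su.
have -> : (fun x => (c - 1) * u x + u x) = (fun x => c * u x).
  by apply/funext => x; rewrite mulrBl mul1r subrK.
by move=> ->; rewrite mulrBl mul1r subrK.
Qed.

Lemma sch_cint_translate u zeta : sch u -> moments (fun x => u (x - zeta)).
Proof.
move=> su; have rt := rescales_translate (- zeta); have mu := sch_moments su.
have msub : measurable_fun setT (fun x : T2 => x - zeta : T2).
  by apply: measurable_sub2; [exact: measurable_id|exact: measurable_cst].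
move=> N; apply: (@cint_lec _ T2 R leb2 _ (fun x => (wt (x - zeta) ^+ N)%:C * u (x - zeta)) (wt zeta ^+ N)).
- apply: cmeasM; first by apply: cmeas_real; exact: measurable_wtX.
  exact: (cmeas_comp msub (csmooth_cmeas su.1)).
- exact: (cint_rescales rt (mu N)).
- move=> x; rewrite !normc_wt mulrA -exprMn ler_wpM2r ?normc_ge0//.
  rewrite lerXn2r ?nnegrE ?mulr_ge0 ?(ltW (wt_gt0 _))//.
  by rewrite -{1}(subrK zeta x) mulrC wtD.
Qed.

(** phi times a character equals chi times itself, and it is, up to kap, the transform of a
    translate of [ift phi]; [interchange] for chi concludes. *)
Lemma Ftr_convolution g phi chi (kap : R) : temperate g -> tst phi -> tst chi ->
  (forall u x, tst u -> fourier2 (ift u) x = kap%:C * u x) ->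
  (forall x, chi x * phi x = phi x) ->
  forall xi, moments (fun z => ift phi (z - xi)) /\
    kap%:C * Ftr g phi xi = int (fun z => Ftr g chi z * ift phi (z - xi)).
Proof.
move=> tg tphi tchi inv cp xi; have si := sch_ift tphi.
have me := sch_cint_translate xi si; split=> //.
rewrite -(interchange tg tchi me) /Ftr -(temperateZ _ tg); last first.
  by apply: tst_sch; apply: tstM => //; exact: csmooth_ech.
congr g; apply/funext => x.
have := @fourier2_translate R (- xi) (ift phi) x (moments_cint (sch_moments si)).
rewrite opprK => ->; rewrite (inv _ x tphi) -[in LHS](cp x) (echC x xi).
move: (phi x) (chi x) (ech _ _) => w1 w2 w3; ring.
Qed.

Lemma window_lip b v S : tst b -> 0 <= S -> exists C : R, 0 <= C /\ forall a s xi zeta,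
  0 < a -> a < 1 -> `|s| <= S ->
  normc (window b v a s xi - window b v a s zeta) <= C * a `^ (5 / 4) * mnorm (xi - zeta).
Proof.
move=> tb S0; have [L [L0 HL]] := tst_lipschitz tb.
exists (L * (1 + S)); split; first by rewrite mulr_ge0// addr_ge0.
move=> a s xi zeta a0 a1 sS; rewrite /window -mulrBr normcM normcC ger0_norm ?powR_ge0//.
have -> : a `^ (5 / 4) = a `^ (3 / 4) * Num.sqrt a.
  by rewrite -powR12_sqrt ?(ltW a0)// -powRD ?(gt_eqF a0) ?implybT//; congr (_ `^ _); lra.
rewrite [leRHS](_ : _ = a `^ (3 / 4) * (L * ((1 + S) * Num.sqrt a * mnorm (xi - zeta)))); last by ring.
rewrite ler_wpM2l ?powR_ge0// (le_trans (HL _ _))// ler_wpM2l//.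
have -> : dil v a s xi - dil v a s zeta = dil v a s (xi - zeta).
  have := dil_linear v a s (-1) (zeta : P) xi; rewrite !scaleN1r addrC => ->.
  by rewrite addrC.
exact: dil_bound.
Qed.

(** Such xi and z are separated by an angle, so |z - xi| is at least a fraction of |z|. The decay of
    [ift phi] at z - xi can then pay for any power of the weight at z. *)
Lemma sector_far v s1 rho : 0 < rho -> exists c : R, 1 <= c /\ forall xi z,
  sector v s1 (rho / 2) xi -> ~~ sector v s1 rho z -> wt z <= c * wt (z - xi).
Proof.
move=> rho0; pose s := `|s1|; have s0 : 0 <= s by exact: normr_ge0.
pose c1 := 1 + 2 / rho * (1 + s); have c10 : 0 <= c1.
  by rewrite addr_ge0// mulr_ge0 ?addr_ge0// divr_ge0// ltW.
pose c2 := rho / 2 * (c1 + 1) + (1 + s) + s * c1 + c1.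
have hr : 0 <= rho / 2 by rewrite divr_ge0// ltW.
have c30 : 0 <= rho / 2 * (c1 + 1) + (1 + s) + s * c1.
  exact: addr_ge0 (addr_ge0 (mulr_ge0 hr (addr_ge0 c10 ler01)) (addr_ge0 ler01 s0)) (mulr_ge0 s0 c10).
have c20 : 0 <= c2 := addr_ge0 c30 c10.
exists (1 + c2); split; first by rewrite lerDl.
move=> xi z; rewrite /sector -ltNge; set X := coswap v xi; set Z := coswap v z => hX hZ.
set d := mnorm (z - xi); have d0 : 0 <= d by exact: mnorm_ge0.
have [e1 e2] : `|Z.1 - X.1| <= d /\ `|Z.2 - X.2| <= d.
  rewrite /Z /X /d; have h1 := le_mnorm1 (z - xi); have h2 := le_mnorm2 (z - xi).
  by case: (v).
have hX1 : `|X.1| <= `|Z.1| + d.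
  rewrite -(subKr Z.1 X.1) (le_trans (ler_normB _ _))// lerD2l//.
have hmid : `|Z.2 - s1 * Z.1| <= rho / 2 * (`|Z.1| + d) + (1 + s) * d.
  have -> : Z.2 - s1 * Z.1 = (X.2 - s1 * X.1) + ((Z.2 - X.2) - s1 * (Z.1 - X.1)) by ring.
  rewrite (le_trans (ler_normD _ _))// lerD//.
    by rewrite (le_trans hX)// ler_wpM2l// divr_ge0// ltW.
  rewrite (le_trans (ler_normB _ _))// mulrDl mul1r lerD// normrM ler_wpM2l//.
have z1 : `|Z.1| <= c1 * d.
  have : rho * `|Z.1| < rho / 2 * (`|Z.1| + d) + (1 + s) * d by exact: lt_le_trans hmid.
  have -> : rho * `|Z.1| = rho / 2 * `|Z.1| + rho / 2 * `|Z.1| by field.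
  rewrite mulrDr -addrA ltrD2l => h.
  rewrite -(ler_pM2l (_ : 0 < rho / 2)) ?divr_gt0// (le_trans (ltW h))//.
  by rewrite le_eqVlt; apply/orP; left; apply/eqP; rewrite /c1; field; rewrite gt_eqF.
have z2 : `|Z.2| <= rho / 2 * ((c1 + 1) * d) + (1 + s) * d + s * (c1 * d).
  rewrite -(subrK (s1 * Z.1) Z.2) (le_trans (ler_normD _ _))//; apply: lerD.
    rewrite (le_trans hmid)// lerD2r ler_wpM2l ?divr_ge0 ?(ltW rho0)// mulrDl mul1r lerD2r//.
  by rewrite normrM ler_wpM2l.
have : mnorm z <= c2 * d.
  rewrite -(mnorm_coswap v z) mnorm_le -/Z; apply/andP; split.
    by rewrite (le_trans z1)// ler_wpM2r// /c2 lerDr.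
  rewrite (le_trans z2)//; have : 0 <= c1 * d by rewrite mulr_ge0.
  rewrite /c2 => h; rewrite [leRHS](_ : _ = rho / 2 * ((c1 + 1) * d) + (1 + s) * d + s * (c1 * d) + c1 * d); last by ring.
  by rewrite lerDl.
rewrite /wt -/d (_ : (1 + c2) * (1 + d) = 1 + c2 + d + c2 * d); last by ring.
move: d0 c20; clear => *; lra.
Qed.

Lemma abs2_le_split (kap : R) (X A E : R[i]) : 0 < kap -> kap%:C * X = A + E ->
  abs2 X <= 2 / kap ^+ 2 * (abs2 A + abs2 E).
Proof.
move=> k0 e; have k20 : 0 < kap ^+ 2 by rewrite exprn_gt0.
have : kap ^+ 2 * abs2 X <= 2 * (abs2 A + abs2 E).
  have -> : kap ^+ 2 * abs2 X = abs2 (A + E).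
    by rewrite -e abs2M; congr (_ * _); rewrite /abs2 /= expr0n addr0.
  have := normcD A E; rewrite !abs2E => h; have h1 := normc_ge0 A; have h2 := normc_ge0 E.
  apply: (@le_trans _ _ ((normc A + normc E) ^+ 2)).
    by rewrite lerXn2r ?nnegrE ?normc_ge0// addr_ge0.
  by have := sqr_ge0 (normc A - normc E); nra.
by move=> H; rewrite mulrAC ler_pdivlMr// mulrC.
Qed.

(** E(xi) is the integral over z of (W(xi) - W(z)) times [Ftr g chi z] times [ift phi (z - xi)]. The
    Lipschitz bound on W supplies a^(5/4) |z - xi|, and Cauchy-Schwarz with the integrable kernel
    |y| |ift phi (y)| squares a^(5/4). If neither xi nor z is in the slab, both windows vanish. *)
Lemma error_bound g phi chi b v S x0 (de kap : R) : temperate g -> tst phi -> tst chi -> tst b ->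
  gen_supp b -> 0 <= S -> 0 < kap ->
  (forall u x, tst u -> fourier2 (ift u) x = kap%:C * u x) ->
  (forall x, chi x * phi x = phi x) ->
  exists (C : R), 0 <= C /\ forall a s, 0 < a -> a < 1 -> `|s| <= S ->
   let u xi := Ftr g chi xi * window b v a s xi in moments u /\
   exists E : R * R -> R[i], [/\ cmeas (E : T2 -> R[i]),
     forall xi, kap%:C * (Ftr g phi xi * window b v a s xi) = fourier2 (fun x => phi x * ift u x) xi + E xi &
     forall xi, ((abs2 (E xi))%:E <= (C * a `^ (5 / 2))%:E * \int[leb2]_z
       (if slab v (a, s) xi || slab v (a, s) z
        then abs2 (Ftr g chi z) * (mnorm (z - xi) * normc (ift phi (z - xi))) else 0)%:E)%E].
Proof.
move=> tg tphi tchi tb gb S0 k0 inv cp.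
have [L [L0 HL]] := window_lip v tb S0.
have sphi := sch_ift tphi; have mphi := sch_moments sphi.
have [Cphi HCphi] := sphi.2 [::] 0%N.
pose q (y : T2) : R := mnorm y * normc (ift phi y).
have q0 y : 0 <= q y by rewrite mulr_ge0 ?mnorm_ge0 ?normc_ge0.
have mq : measurable_fun setT (q : T2 -> T1).
  apply: measurable_funM; first exact: measurable_mnorm.
  exact: measurable_normc (csmooth_cmeas sphi.1).
have [A [A0 HA]] : exists A : R, 0 < A /\ (\int[leb2]_y (q y)%:E <= A%:E)%E.
  exists (wmass 1 (ift phi) + 1); split; first by rewrite ltr_wpDl// wmass_ge0.
  apply: (@le_trans _ _ (wmass 1 (ift phi))%:E); last by rewrite lee_fin lerDl.
  rewrite -(wmassE 1 mphi); apply: ge0_le_integral_any => // y _; rewrite ?lee_fin//.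
    by rewrite mulr_ge0 ?wtX_ge0 ?normc_ge0.
  by rewrite /q expr1 ler_wpM2r ?normc_ge0// mnorm_le_wt.
exists (4 * A * L ^+ 2); split; first by do ![apply: mulr_ge0 => //]; rewrite ?sqr_ge0 ?(ltW A0).
move=> a s a0 a1 sS; set w := window b v a s => u.
have tw : tst w by exact: tst_window.
have mu : moments u by exact: (moments_Ftr tg tchi (tst_moments tw)).
split=> //.
have cF := cmeas_Ftr tg tchi; have cFphi := cmeas_Ftr tg tphi.
have tkU := tstM tphi (csmooth_ift mu).
pose Af := fourier2 (fun x => phi x * ift u x).
have mA : cmeas (Af : T2 -> R[i]) by exact: csmooth_cmeas (csmooth_fourier2 (tst_moments tkU)).
exists (fun xi => kap%:C * (Ftr g phi xi * w xi) - Af xi); split.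
- apply: cmeasB mA; apply: cmeasM; first exact: cmeas_cst.
  exact: (cmeasM cFphi (tst_cmeas tw)).
- move=> xi; rewrite -/Af; move: (kap%:C * _) (Af xi) => z1 z2; ring.
move=> xi; have [mi Ei] := Ftr_convolution tg tphi tchi inv cp xi.
have [Cw [Cw0 HCw]] := tst_bounded tw.
have i1 : cint (fun z => Ftr g chi z * ift phi (z - xi)).
  exact: moments_cint (moments_Ftr tg tchi mi).
have m2 : moments (fun z => w z * ift phi (z - xi)).
  apply: (@moments_le _ _ (fun z => ift phi (z - xi)) Cw 0) => //.
    exact: (cmeasM (tst_cmeas tw) (moments_cmeas mi)).
  by move=> z; rewrite normcM expr0 mulr1 ler_wpM2r ?normc_ge0.
have i2 : cint (fun z => ift phi (z - xi) * u z).
  have := moments_cint (moments_Ftr tg tchi m2); congr cint; apply/funext => z.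
  by rewrite /u; move: (Ftr _ _ _) (w z) (ift _ _) => z1 z2 z3; ring.
have Eint : kap%:C * (Ftr g phi xi * w xi) - Af xi =
    int (fun z => w xi * (Ftr g chi z * ift phi (z - xi)) - ift phi (z - xi) * u z).
  rewrite (cintegralB (cintZ (w xi) i1) i2) (cintegralZ (w xi) i1) -Ei.
  rewrite -(fourier2_mul_ift xi tphi mu) -/Af.
  by move: (kap%:C) (Ftr _ _ _) (w xi) (Af xi) => z1 z2 z3 z4; ring.
have iE := cintB (cintZ (w xi) i1) i2.
pose B (z : T2) := slab v (a, s) xi || slab v (a, s) z.
have mB : measurable_fun setT B.
  apply: measurable_or; first exact: measurable_cst.
  exact: (measurableT_comp (measurable_slab v) (pair1_measurable (a, s))).
pose h (z : T2) : R := if B z then L * a `^ (5 / 4) * normc (Ftr g chi z) else 0.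
have mh : measurable_fun setT (h : T2 -> T1).
  apply: measurable_fun_ifT => //; apply: measurable_funM; first exact: measurable_cst.
  exact: measurable_normc.
have msub : measurable_fun setT (fun x : T2 => x - xi : T2).
  by apply: measurable_sub2; [exact: measurable_id|exact: measurable_cst].
have mqx : measurable_fun setT (fun z : T2 => q (z - xi)) by exact: (measurableT_comp mq msub).
have La0 : 0 <= L * a `^ (5 / 4) by rewrite mulr_ge0 ?powR_ge0.
rewrite Eint.
apply: (le_trans (cauchy_schwarz iE mh mqx _ _ A0 _ _)).
- by move=> z; rewrite /h; case: ifP => // _; rewrite mulr_ge0 ?normc_ge0.
- by move=> z; exact: q0.
- move=> z; rewrite (_ : w xi * _ - _ = Ftr g chi z * ift phi (z - xi) * (w xi - w z)); last first.
    by rewrite /u; move: (Ftr _ _ _) (w z) (ift _ _) (w xi) => z1 z2 z3 z4; ring.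
  rewrite !normcM /h; case: ifPn => [_|].
    have := HL a s xi z a0 a1 sS; rewrite -/w -(mnormN (xi - z)) opprB => hl.
    rewrite /q [leRHS](_ : _ = normc (Ftr g chi z) * normc (ift phi (z - xi)) *
      (L * a `^ (5 / 4) * mnorm (z - xi))); last by ring.
    by rewrite ler_wpM2l ?mulr_ge0 ?normc_ge0.
  rewrite negb_or => /andP[n1 n2].
  have w1 : w xi = 0 by apply/eqP; apply: contraNT n1 => /(window_slab gb a0).
  have w2 : w z = 0 by apply/eqP; apply: contraNT n2 => /(window_slab gb a0).
  by rewrite w1 w2 subrr normc0 mulr0 mul0r.
- by rewrite (integral_translate xi mq q0).
pose G (z : T2) : R := if B z then abs2 (Ftr g chi z) * q (z - xi) else 0.
have G0 z : 0 <= G z by rewrite /G; case: ifP => // _; rewrite mulr_ge0 ?abs2_ge0.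
have mG : measurable_fun setT (G : T2 -> T1).
  by apply: measurable_fun_ifT => //; apply: measurable_funM => //; exact: measurable_abs2.
rewrite (_ : (\int[leb2]_x _)%E = \int[leb2]_z ((L * a `^ (5 / 4)) ^+ 2 * G z)%:E)%E; last first.
  apply: eq_integral => z _; congr EFin; rewrite /h /G; case: (B z).
    by rewrite abs2E; ring.
  by rewrite expr0n mul0r mulr0.
rewrite (ge0_integral_scale _ (sqr_ge0 _) mG G0) muleA -EFinM.
rewrite (_ : 4 * A * (L * a `^ (5 / 4)) ^+ 2 = 4 * A * L ^+ 2 * a `^ (5 / 2)) //.
rewrite exprMn -(powR_mulrn 2 (powR_ge0 a (5 / 4))) -powRrM (_ : 5 / 4 * 2%:R = 5 / 2); last by lra.
by rewrite mulrA.
Qed.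

Lemma wt_powR_le (x : R * R) (e : R) n : `|e| <= n%:R -> wt x `^ e <= wt x ^+ n.
Proof.
move=> en; rewrite -powR_mulrn ?(ltW (wt_gt0 _))//; apply: ler_powR; first exact: wt_ge1.
exact: le_trans (ler_norm e) en.
Qed.

(** Moves the weights onto z. For z in the wide sector this is Peetre's inequality; otherwise
    [sector_far] compares z with z - xi, so that even (1 + |z|)^(-N) is affordable, for N as large
    as wished. *)
Lemma sector_weight v s1 rho (e C : R) N : 0 < rho -> 0 <= C -> exists (C' : R) J, 0 <= C' /\
  forall xi z, (if sector v s1 (rho / 2) xi then C * wt xi `^ e else 0) +
    (if sector v s1 (rho / 2) z then C * wt z `^ e else 0) <=
    C' * wt (z - xi) ^+ J * ((if sector v s1 rho z then wt z `^ e else 0) + (wt z ^+ N)^-1).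
Proof.
move=> rho0 C0; have [c [c1 Hc]] := sector_far v s1 rho0.
pose n := (Num.truncn `|e|).+1; have en : `|e| <= n%:R by rewrite ltW// truncnS_gt.
have c0 : 0 <= c by exact: le_trans c1.
have cn1 : 1 <= c ^+ (n + N) by rewrite exprn_ege1.
exists (C * (2 * c ^+ (n + N))), (n + (n + N))%N; split.
  by do ![apply: mulr_ge0 => //]; rewrite exprn_ge0.
move=> xi z; set d := wt (z - xi); have d1 : 1 <= d by exact: wt_ge1.
have d0 : 0 <= d by exact: le_trans d1.
have W x : 0 <= wt x `^ e by exact: powR_ge0.
have dX k : 1 <= d ^+ k by rewrite exprn_ege1.
have wN : 0 <= (wt z ^+ N)^-1 by rewrite invr_ge0 wtX_ge0.
have pe : wt xi `^ e <= d ^+ n * wt z `^ e.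
  rewrite (le_trans (peetre e xi z))// ler_wpM2r// -opprB wtN.
  by apply: wt_powR_le; rewrite normr_id.
pose K := c ^+ (n + N) * d ^+ (n + (n + N)); have K1 : 1 <= K by rewrite mulr_ege1.
have K0 : 0 <= K by exact: le_trans K1.
have dK : d ^+ n <= K.
  rewrite /K (exprD d n); apply: (@le_trans _ _ (d ^+ n * d ^+ (n + N))).
    by rewrite ler_peMr// exprn_ge0.
  by rewrite ler_peMl// mulr_ge0 ?exprn_ge0.
set I := (if sector v s1 rho z then _ else _); have I0 : 0 <= I by rewrite /I; case: ifP.
have sub : sector v s1 (rho / 2) z -> sector v s1 rho z.
  move=> h; apply: le_trans h _; rewrite ler_wpM2r//; move: rho0; clear => *; lra.
have CK0 : 0 <= C * (K * (I + (wt z ^+ N)^-1)) := mulr_ge0 C0 (mulr_ge0 K0 (addr_ge0 I0 wN)).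
have t1 : (if sector v s1 (rho / 2) xi then C * wt xi `^ e else 0) <= C * (K * (I + (wt z ^+ N)^-1)).
  case: ifPn => sx; last exact: CK0.
  rewrite ler_wpM2l// (le_trans pe)// mulrDr; have [sz|sz] := boolP (sector v s1 rho z).
    rewrite /I sz; apply: (@le_trans _ _ (K * wt z `^ e)); first by rewrite ler_wpM2r.
    by rewrite lerDl mulr_ge0.
  apply: (@le_trans _ _ (K * (wt z ^+ N)^-1)); last by rewrite lerDr mulr_ge0.
  rewrite /K (exprD d n) mulrCA -mulrA ler_wpM2l ?exprn_ge0//.
  have wz : 0 < wt z ^+ N by rewrite exprn_gt0// wt_gt0.
  rewrite ler_pdivlMr//; apply: (@le_trans _ _ (wt z ^+ n * wt z ^+ N)).
    by rewrite ler_wpM2r ?(ltW wz)//; exact: wt_powR_le.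
  rewrite -exprD -exprMn lerXn2r ?nnegrE ?(ltW (wt_gt0 _)) ?mulr_ge0//.
  exact: Hc.
have t2 : (if sector v s1 (rho / 2) z then C * wt z `^ e else 0) <= C * (K * (I + (wt z ^+ N)^-1)).
  case: ifPn => sx; last exact: CK0.
  rewrite ler_wpM2l// /I sub//; apply: (@le_trans _ _ (wt z `^ e + (wt z ^+ N)^-1)).
    by rewrite lerDl.
  by rewrite ler_peMl// addr_ge0.
rewrite (le_trans (lerD t1 t2))// /K le_eqVlt; apply/orP; left; apply/eqP; ring.
Qed.

Definition window_region (s1 a0 r : R) (p : R * R) := (0 < p.1 < a0) && (`|p.2 - s1| < r).

Lemma measurable_window_region s1 a0 r : measurable_fun setT (window_region s1 a0 r : T2 -> bool).
Proof.
apply: measurable_and; first apply: measurable_and.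
- by apply: measurable_fun_ltr; [exact: measurable_cst|exact: measurable_fst].
- by apply: measurable_fun_ltr; [exact: measurable_fst|exact: measurable_cst].
apply: measurable_fun_ltr; last exact: measurable_cst.
apply: measurableT_comp => //; apply: measurable_funB; [exact: measurable_snd|exact: measurable_cst].
Qed.

(** The exponent - e - 1/2 is - e - 3, from the energy of order e, plus 5/2, from the commutator; it
    comes out as e - 1, the announced gain. The halvings of rho leave room between the slabs, the
    narrow sector and the wide one. *)
Lemma sector_kernel v s1 rho a0 r (e : R) : 0 < rho -> a0 <= 1 -> Num.sqrt a0 <= rho / 2 / 2 ->
  r <= rho / 2 / 2 -> r <= 1 -> exists C : R, 0 <= C /\ forall xi,
  (\int[leb2]_p (if window_region s1 a0 r p && slab v p xi then p.1 `^ (- e - 2^-1) else 0)%:E <=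
   (if sector v s1 (rho / 2) xi then C * wt xi `^ (e - 1) else 0)%:E)%E.
Proof.
move=> rho0 a01 a0rho rrho r1; have S0 : 0 <= `|s1| + 1 by rewrite addr_ge0.
have [C [C0 HC]] := slab_kernel v (- e - 2^-1) S0; exists C; split=> // xi.
have sub p : window_region s1 a0 r p && slab v p xi ->
    sector v s1 (rho / 2) xi /\ [&& 0 < p.1 < 1, `|p.2| <= `|s1| + 1 & slab v p xi].
  case: p => a s /andP[/andP[/= /andP[p0 pa] ps] sl]; split.
    apply: slab_sector sl; last exact: le_trans (ltW ps) rrho.
    by rewrite (le_trans _ a0rho)// ler_wsqrtr// ltW.
  rewrite p0 (lt_le_trans pa)// sl andbT /=.
  by move: (ler_normD (s - s1) s1) (ltW ps) r1; rewrite subrK; clear => *; lra.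
case: ifPn => sx.
  apply: le_trans (_ : _ <= (C * wt xi `^ (- (- e - 2^-1) - 3 / 2))%:E)%E _.
    apply: le_trans (HC xi); apply: ge0_le_integral_any => // p _; rewrite lee_fin.
    - by case: ifP => // _; exact: powR_ge0.
    - by case: ifP => // _; exact: powR_ge0.
    - case: ifPn => [/sub[_ ->]//|_]; by case: ifP => // _; exact: powR_ge0.
  by rewrite (_ : - (- e - 2^-1) - 3 / 2 = e - 1)//; lra.
rewrite integral0_eq// => p _; case: ifPn => // /sub[]; by rewrite (negbTE sx).
Qed.

End bootstrap_tools.

(** * Energy of the commutator, and the starting point of the induction *)

Section bootstrap.
Context {R : realType}.
Variable st : R -> R.
Hypothesis hst : smooth_step st.
Local Notation T1 := (measurableTypeR R).
Local Notation T2 := (measurableTypeR R * measurableTypeR R)%type.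
Local Notation int := (cintegral leb2 setT).
Implicit Types (a s S : R) (t x y xi zeta : R * R) (b h u phi chi : R * R -> R[i])
  (g : (R * R -> R[i]) -> R[i]).

Definition sector_energy v s1 rho (e : R) (H : R * R -> R[i]) : \bar R :=
  (\int[leb2]_xi (if sector v s1 rho xi then wt xi `^ e * abs2 (H xi) else 0)%:E)%E.

Lemma measurable_wt_powR (e : R) : measurable_fun setT (fun x : T2 => wt x `^ e).
Proof.
apply: (measurableT_comp (measurable_powR _)).
by have := @measurable_wtX R 1; under eq_fun do rewrite expr1.
Qed.

(** Integrating in (a, s) first gives weights of order e - 1 at xi and at z; [sector_weight] moves
    both to z, and Young's formula separates z from z - xi. *)
Lemma error_energy g phi chi v s1 rho a0 r (e : R) : temperate g -> tst phi -> tst chi ->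
  0 < rho -> a0 <= 1 -> Num.sqrt a0 <= rho / 2 / 2 -> r <= rho / 2 / 2 -> r <= 1 ->
  (sector_energy v s1 rho (e - 1) (Ftr g chi) < +oo)%E ->
  exists F : T2 -> \bar R, [/\ measurable_fun setT F, forall p, (0 <= F p)%E,
    (\int[leb2]_p F p < +oo)%E &
    forall (c : R) p, 0 <= c -> window_region s1 a0 r p ->
    (\int[leb2]_xi ((c * p.1 `^ (- e - 2^-1))%:E * \int[leb2]_z
       (if slab v p xi || slab v p z
        then abs2 (Ftr g chi z) * (mnorm (z - xi) * normc (ift phi (z - xi))) else 0)%:E) <= c%:E * F p)%E].
Proof.
move=> tg tphi tchi rho0 a01 a0rho rrho r1 fin.
have [C [C0 HC]] := sector_kernel v s1 e rho0 a01 a0rho rrho r1.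
have [CF [k [CF0 HF]]] := Ftr_bound tg tchi.
(* |Ftr g chi|^2 grows at most like the power 2 k of the weight; outside the sector this N leaves
   the integrable power - 4. *)
pose N := (2 * k + 4)%N.
have [C' [J [C'0 HC']]] := sector_weight v s1 (e - 1) N rho0 C0.
have sphi := sch_ift tphi; have mphi := sch_moments sphi.
have mF := measurable_abs2 (cmeas_Ftr tg tchi).
pose q (y : T2) : R := mnorm y * normc (ift phi y).
have q0 y : 0 <= q y by rewrite mulr_ge0 ?mnorm_ge0 ?normc_ge0.
have mq : measurable_fun setT (q : T2 -> T1).
  apply: measurable_funM; first exact: measurable_mnorm.
  exact: measurable_normc (csmooth_cmeas sphi.1).
pose al : R := - e - 2^-1.
have mp : measurable_fun setT (fun w : T2 * T2 * T2 => w.1.1 : T2).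
  exact: (measurableT_comp measurable_fst measurable_fst).
have mxi : measurable_fun setT (fun w : T2 * T2 * T2 => w.1.2 : T2).
  exact: (measurableT_comp measurable_snd measurable_fst).
have mz : measurable_fun setT (fun w : T2 * T2 * T2 => w.2 : T2) by exact: measurable_snd.
have msl (G : T2 * T2 * T2 -> T2) : measurable_fun setT G ->
    measurable_fun setT (fun w : T2 * T2 * T2 => slab v w.1.1 (G w)).
  by move=> mG; exact: (measurableT_comp (measurable_slab v) (measurable_fun_pair mp mG)).
pose W (w : T2 * T2 * T2) : R := if window_region s1 a0 r w.1.1 && (slab v w.1.1 w.1.2 || slab v w.1.1 w.2)
  then w.1.1.1 `^ al * (abs2 (Ftr g chi w.2) * q (w.2 - w.1.2)) else 0.
have W0 w : 0 <= W w.
  by rewrite /W; case: ifP => // _; rewrite mulr_ge0 ?powR_ge0// mulr_ge0 ?abs2_ge0.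
have mW : measurable_fun setT (W : _ -> T1).
  apply: measurable_fun_ifT; last exact: measurable_cst.
    apply: measurable_and; last by apply: measurable_or; exact: msl.
    exact: (measurableT_comp (measurable_window_region s1 a0 r) mp).
  apply: measurable_funM.
    exact: (measurableT_comp (measurable_powR _) (measurableT_comp measurable_fst mp)).
  apply: measurable_funM; first exact: (measurableT_comp mF mz).
  by apply: (measurableT_comp mq); exact: measurable_sub2.
pose W1 (z : T2 * T2) : \bar R := (\int[leb2]_y (W (z, y))%:E)%E.
have mW1 : measurable_fun setT W1.
  have mWE : measurable_fun setT (fun w => (W w)%:E) by exact/measurable_EFinP.
  exact: (@measurable_fun_fubini_tonelli_F _ _ (T2 * T2)%type T2 R sleb2 _ mWE (fun w => W0 w)).
have W10 z : (0 <= W1 z)%E by apply: integral_ge0 => y _; rewrite lee_fin.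
exists (fun p => \int[leb2]_xi W1 (p, xi))%E; split.
- exact: measurable_section_integral.
- by move=> p; apply: integral_ge0.
- rewrite (tonelli2 mW1 W10).
  pose I (z : T2) : R := if sector v s1 rho z then wt z `^ (e - 1) else 0.
  have I0 z : 0 <= I z by rewrite /I; case: ifP => // _; exact: powR_ge0.
  pose M (z : T2) : R := abs2 (Ftr g chi z) * (I z + (wt z ^+ N)^-1).
  have wN (z : R * R) : 0 <= (wt z ^+ N)^-1 by rewrite invr_ge0 wtX_ge0.
  have M0 z : 0 <= M z.
    by rewrite /M mulr_ge0 ?abs2_ge0//; exact: addr_ge0.
  have mI : measurable_fun setT (I : T2 -> T1).
    apply: measurable_fun_ifT; [exact: measurable_sector|exact: measurable_wt_powR|exact: measurable_cst].
  have mM : measurable_fun setT (M : T2 -> T1).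
    apply: measurable_funM => //; apply: measurable_funD => //.
    apply: measurable_inv_fun; first exact: measurable_wtX.
  pose q2 (y : T2) : R := C' * (wt y ^+ J * q y).
  have q20 y : 0 <= q2 y by rewrite mulr_ge0// mulr_ge0 ?wtX_ge0.
  have mq2 : measurable_fun setT (q2 : T2 -> T1).
    apply: measurable_funM; first exact: measurable_cst.
    by apply: measurable_funM => //; exact: measurable_wtX.
  apply: (@le_lt_trans _ _ (\int[leb2]_xi \int[leb2]_z (M z * q2 (z - xi))%:E)%E).
    apply: ge0_le_integral_any => // xi _.
    + by apply: integral_ge0.
    + by apply: integral_ge0 => z _; rewrite lee_fin mulr_ge0.
    have msec : measurable_fun setT (fun z : T2 * T2 => (W (z.1, xi, z.2))%:E).
      apply/measurable_EFinP; apply: (measurableT_comp mW).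
      apply: measurable_fun_pair; last exact: measurable_snd.
      apply: measurable_fun_pair; [exact: measurable_fst|exact: measurable_cst].
    rewrite [leLHS](tonelli2 msec); last by move=> z; rewrite lee_fin.
    apply: ge0_le_integral_any => // z _; first by apply: integral_ge0 => p _; rewrite lee_fin.
      by rewrite lee_fin mulr_ge0.
    pose K (x : T2) (p : T2) : R := if window_region s1 a0 r p && slab v p x then p.1 `^ al else 0.
    have K0 x p : 0 <= K x p by rewrite /K; case: ifP => // _; exact: powR_ge0.
    have mK x : measurable_fun setT (K x : T2 -> T1).
      apply: measurable_fun_ifT; last exact: measurable_cst.
        apply: measurable_and; first exact: measurable_window_region.
        exact: (measurableT_comp (measurable_slab v) (pair2_measurable x)).
      exact: (measurableT_comp (measurable_powR _) measurable_fst).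
    pose D := abs2 (Ftr g chi z) * q (z - xi).
    have D0 : 0 <= D by apply: mulr_ge0; [exact: abs2_ge0|exact: q0].
    apply: (@le_trans _ _ (\int[leb2]_p (D * (K xi p + K z p))%:E)%E).
      apply: ge0_le_integral_any => // p _; rewrite ?lee_fin//; first by rewrite mulr_ge0// addr_ge0.
      rewrite /W /K /=; case: (window_region s1 a0 r p) => /=; last by rewrite addr0 mulr0.
      have pa : 0 <= p.1 `^ al by exact: powR_ge0.
      case: (slab v p xi); case: (slab v p z) => /=; rewrite -/D ?addr0 ?add0r ?mulr0 // mulrC//.
      by rewrite ler_wpM2l// lerDl.
    have mKK : measurable_fun setT (fun p : T2 => K xi p + K z p) := measurable_funD (mK xi) (mK z).
    have KK0 p : 0 <= K xi p + K z p := addr_ge0 (K0 xi p) (K0 z p).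
    rewrite (ge0_integral_scale _ D0 mKK KK0).
    under eq_integral do rewrite EFinD.
    have mKE x : measurable_fun setT (fun p : T2 => (K x p)%:E).
      by apply/measurable_EFinP; exact: mK.
    have KE0 x (p : T2) : setT p -> (0 <= (K x p)%:E)%E by rewrite lee_fin.
    rewrite (ge0_integralD _ measurableT (KE0 xi) (mKE xi) (KE0 z) (mKE z)).
    apply: (@le_trans _ _ (D%:E * ((if sector v s1 (rho / 2) xi then C * wt xi `^ (e - 1) else 0)%:E +
        (if sector v s1 (rho / 2) z then C * wt z `^ (e - 1) else 0)%:E))%E).
      by apply: lee_wpmul2l; [rewrite lee_fin|apply: leeD; exact: HC].
    rewrite -EFinD -EFinM lee_fin (le_trans (ler_wpM2l D0 (HC' xi z)))//.
    by rewrite /D /M /q2 -/(I z) le_eqVlt; apply/orP; left; apply/eqP; ring.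
  rewrite (young mM mq2 M0 q20); apply: lte_mul_pinfty.
  + by apply: integral_ge0 => z _; rewrite lee_fin.
  + rewrite ge0_fin_numE; last by apply: integral_ge0 => z _; rewrite lee_fin.
    have mI2 : measurable_fun setT (fun z : T2 => (I z * abs2 (Ftr g chi z))%:E).
      by apply/measurable_EFinP; exact: measurable_funM.
    apply: (@le_lt_trans _ _ (\int[leb2]_z ((I z * abs2 (Ftr g chi z))%:E +
        (CF ^+ 2 * (wt z ^+ 4)^-1)%:E))%E).
      apply: ge0_le_integral_any => // z _; rewrite -?EFinD ?lee_fin//.
        by rewrite addr_ge0 ?mulr_ge0 ?abs2_ge0 ?sqr_ge0 ?invr_ge0 ?wtX_ge0.
      rewrite /M mulrDr mulrC lerD2l /N exprD invfM mulrA.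
      rewrite ler_wpM2r ?invr_ge0 ?wtX_ge0// ler_pdivrMr ?exprn_gt0 ?wt_gt0//.
      by rewrite abs2E mulnC exprM -exprMn lerXn2r ?nnegrE ?normc_ge0 ?mulr_ge0 ?wtX_ge0.
    rewrite ge0_integralD//; last 3 first.
    * by move=> z _; rewrite lee_fin mulr_ge0 ?abs2_ge0.
    * by move=> z _; rewrite lee_fin mulr_ge0 ?sqr_ge0 ?invr_ge0 ?wtX_ge0.
    * apply/measurable_EFinP; apply: measurable_funM; first exact: measurable_cst.
      by apply: measurable_inv_fun; exact: measurable_wtX.
    apply: lte_add_pinfty.
      apply: le_lt_trans fin; rewrite /sector_energy; apply: ge0_le_integral_any => // z _.
      * by rewrite lee_fin mulr_ge0 ?abs2_ge0.
      * by rewrite lee_fin; case: ifP => // _; rewrite mulr_ge0 ?powR_ge0 ?abs2_ge0.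
      * by rewrite lee_fin /I; case: ifP => // _; rewrite mul0r.
    have /integrableP[_] := integrable_scale (CF ^+ 2) (integrable_wtV (R := R)).
    apply: le_lt_trans; apply: ge0_le_integral_any => // z _.
      by rewrite lee_fin mulr_ge0 ?sqr_ge0 ?invr_ge0 ?wtX_ge0.
    by rewrite lee_fin ler_norm.
  + rewrite (_ : (fun x => _) = fun x : T2 => (C' * (wt x ^+ J * q x))%:E)//.
    rewrite ge0_integral_scale//; last 2 first.
    * by apply: measurable_funM => //; exact: measurable_wtX.
    * by move=> x; rewrite mulr_ge0 ?wtX_ge0.
    apply: lte_mul_pinfty; rewrite ?lee_fin//.
    apply: (@le_lt_trans _ _ (wmass J.+1 (ift phi))%:E); last exact: ltry.
    rewrite -(wmassE J.+1 mphi); apply: ge0_le_integral_any => // x _; rewrite ?lee_fin.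
    * by rewrite mulr_ge0 ?wtX_ge0.
    * by rewrite mulr_ge0 ?wtX_ge0 ?normc_ge0.
    * by rewrite /q exprSr -mulrA ler_wpM2l ?wtX_ge0// ler_wpM2r ?normc_ge0// mnorm_le_wt.
move=> c p c0 wp; have mW1p (xi : T2) : measurable_fun setT (fun z : T2 => (if slab v p xi || slab v p z
    then abs2 (Ftr g chi z) * q (z - xi) else 0) : T1).
  apply: measurable_fun_ifT; last exact: measurable_cst.
    apply: measurable_or; first exact: measurable_cst.
    exact: (measurableT_comp (measurable_slab v) (pair1_measurable p)).
  apply: measurable_funM => //; apply: (measurableT_comp mq).
  by apply: measurable_sub2; [exact: measurable_id|exact: measurable_cst].
have pa : 0 < p.1 `^ al by rewrite powR_gt0//; case/andP: wp => /andP[].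
have E xi : (\int[leb2]_z (if slab v p xi || slab v p z
    then abs2 (Ftr g chi z) * q (z - xi) else 0)%:E = (p.1 `^ al)^-1%:E * W1 (p, xi))%E.
  rewrite /W1; have -> : (\int[leb2]_y (W (p, xi, y))%:E = \int[leb2]_y (p.1 `^ al *
      (if slab v p xi || slab v p y then abs2 (Ftr g chi y) * q (y - xi) else 0))%:E)%E.
    by apply: eq_integral => y _; rewrite /W /= wp /=; case: ifP => // _; rewrite mulr0.
  have H0 y : 0 <= (if slab v p xi || slab v p y then abs2 (Ftr g chi y) * q (y - xi) else 0).
    by case: ifP => // _; rewrite mulr_ge0 ?abs2_ge0.
  rewrite (ge0_integral_scale _ (ltW pa) (mW1p xi) H0).
  by rewrite muleA -EFinM mulVf ?gt_eqF// mul1e.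
have mWp : measurable_fun setT (fun xi : T2 => W1 (p, xi)) by exact: (measurableT_comp mW1 (pair1_measurable p)).
have <- : (\int[leb2]_xi (c%:E * W1 (p, xi)) = c%:E * \int[leb2]_xi W1 (p, xi))%E.
  exact: (ge0_integralZl_EFin leb2 measurableT (fun xi _ => W10 (p, xi)) mWp c0).
rewrite le_eqVlt; apply/orP; left; apply/eqP; apply: eq_integral => xi _.
rewrite -/(q _) E muleA -EFinM; congr (_%:E * _)%E.
by rewrite -mulrA mulfV ?gt_eqF// mulr1.
Qed.

(** rho and de come before phi: to reach order e for phi, a step uses the energy of order e - 1 of a
    larger cutoff chi, which must be covered by the same statement. *)
Definition concentrated g x0 v s1 (e : R) := exists rho de : R, [/\ 0 < rho, 0 < de &
  forall phi, tst phi -> (forall x, de < mnorm (x - x0) -> phi x = 0) ->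
  (sector_energy v s1 rho e (Ftr g phi) < +oo)%E].

(** The exponent k given by [Ftr_bound] depends on the cutoff. Writing the transform of phi as a
    convolution of that of one fixed chi transfers the k of chi to all phi supported where chi =
    1. *)
Lemma concentrated_base g x0 v s1 : temperate g -> exists e0 : R, forall e, e <= e0 ->
  concentrated g x0 v s1 e.
Proof.
move=> tg; have [kap [k0 inv _]] := cut_kappa hst.
pose chi := cut st x0 1; have tchi : tst chi by exact: cut_tst.
have [C [k [C0 HC]]] := Ftr_bound tg tchi.
exists (- (2 * k + 4)%N%:R) => e ee; exists 1, 1; split=> // phi tphi pz.
have cp x : chi x * phi x = phi x.
  by have [h|h] := leP (mnorm (x - x0)) 1; [rewrite /chi cut1// mul1r|rewrite pz// mulr0].
have mphi := sch_moments (sch_ift tphi).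
pose D := kap^-1 * (2 * (C * wmass k (ift phi))).
have W0 := wmass_ge0 k (ift phi).
have D0 : 0 <= D by rewrite /D !mulr_ge0// invr_ge0 ltW.
have HD xi : normc (Ftr g phi xi) <= D * wt xi ^+ k.
  have [mi Ei] := Ftr_convolution tg tphi tchi inv cp xi.
  have : normc (kap%:C * Ftr g phi xi) <= 2 * (C * wt xi ^+ k * wmass k (ift phi)).
    rewrite Ei; have Cw : 0 <= C * wt xi ^+ k by rewrite mulr_ge0 ?wtX_ge0.
    pose I := (\int[leb2]_z (wt (z - xi) ^+ k * normc (ift phi (z - xi)))%:E)%E.
    have IE : I = (wmass k (ift phi))%:E.
      rewrite /I (@integral_translate R (fun y => wt y ^+ k * normc (ift phi y)) xi).
      - exact: wmassE.
      - apply: measurable_funM; first exact: measurable_wtX.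
        exact: measurable_normc (moments_cmeas mphi).
      - by move=> y; rewrite mulr_ge0 ?wtX_ge0 ?normc_ge0.
    apply: normc_cintegral_le; first exact: moments_cint (moments_Ftr tg tchi mi).
    rewrite EFinM -IE /I -ge0_integral_scale//; last 2 first.
    - have ms : measurable_fun setT (fun z : T2 => z - xi : T2).
        by apply: measurable_sub2; [exact: measurable_id|exact: measurable_cst].
      apply: measurable_funM; first exact: (measurableT_comp (measurable_wtX k) ms).
      exact: measurable_normc (moments_cmeas mi).
    - by move=> z; rewrite mulr_ge0 ?wtX_ge0 ?normc_ge0.
    apply: ge0_le_integral_any => // z _; rewrite ?lee_fin ?normc_ge0//.
      by rewrite mulr_ge0// mulr_ge0 ?wtX_ge0 ?normc_ge0.
    rewrite normcM mulrA ler_wpM2r ?normc_ge0// (le_trans (HC z))// -mulrA ler_wpM2l//.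
    rewrite -exprMn lerXn2r ?nnegrE ?mulr_ge0 ?(ltW (wt_gt0 _))//.
    by rewrite -{1}(subrK xi z) mulrC wtD.
  rewrite normcM normcC gtr0_norm// -ler_pdivlMl// => h; rewrite (le_trans h)//.
  by rewrite /D le_eqVlt; apply/orP; left; apply/eqP; ring.
have /integrableP[_] := integrable_scale (D ^+ 2) (integrable_wtV (R := R)).
apply: le_lt_trans; rewrite /sector_energy; apply: ge0_le_integral_any => // xi _.
  by rewrite lee_fin; case: ifP => // _; rewrite mulr_ge0 ?powR_ge0 ?abs2_ge0.
rewrite /= lee_fin (le_trans _ (ler_norm _))//; have w0 := wt_gt0 xi.
have R0 : 0 <= D ^+ 2 * (wt xi ^+ 4)^-1 by rewrite mulr_ge0 ?sqr_ge0 ?invr_ge0 ?wtX_ge0.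
case: ifP => // _; rewrite ler_pdivlMr ?exprn_gt0//.
have we : wt xi `^ e <= (wt xi ^+ (2 * k + 4))^-1.
  rewrite -powR_mulrn ?(ltW w0)// -powRN; apply: ler_powR => //; exact: wt_ge1.
apply: (@le_trans _ _ ((wt xi ^+ (2 * k + 4))^-1 * (D * wt xi ^+ k) ^+ 2 * wt xi ^+ 4)).
  rewrite ler_wpM2r ?wtX_ge0//; apply: ler_pM; rewrite ?powR_ge0 ?abs2_ge0// abs2E.
  by rewrite lerXn2r ?nnegrE ?normc_ge0// mulr_ge0 ?wtX_ge0.
rewrite exprMn -exprM (mulnC k) exprD invfM.
have e1 n : (wt xi ^+ n)^-1 * wt xi ^+ n = 1 by rewrite mulVf// expf_neq0// gt_eqF.
rewrite [leLHS](_ : _ = D ^+ 2 * ((wt xi ^+ (2 * k))^-1 * wt xi ^+ (2 * k)) *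
  ((wt xi ^+ 4)^-1 * wt xi ^+ 4)); last by ring.
by rewrite !e1 !mulr1.
Qed.

End bootstrap.

(** * One step of the bootstrap: energy of a localized molecule *)

Section bootstrap_step.
Context {R : realType}.
Variable st : R -> R.
Hypothesis hst : smooth_step st.
Local Notation T2 := (measurableTypeR R * measurableTypeR R)%type.
Local Notation int := (cintegral leb2 setT).
Implicit Types (a s S : R) (t x y xi zeta : R * R) (b h u phi chi : R * R -> R[i])
  (g : (R * R -> R[i]) -> R[i]).

Lemma integral_le_restrict d (T : measurableType d) (mu : {measure set T -> \bar R}) (D : set T)
    (f : T -> \bar R) : (forall x : T, 0 <= f x)%E -> (forall x : T, ~ D x -> f x = 0%E) ->
  (\int[mu]_x f x <= \int[mu]_(x in D) f x)%E.
Proof.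
move=> f0 fD; rewrite [leRHS]integral_mkcond; apply: ge0_le_integral_any => // x _.
  by rewrite patchE; case: ifP.
by rewrite patchE; case: ifPn => // /negP H; rewrite fD// => /mem_set.
Qed.

Lemma fourier2_mul_energy phi u x0 (de kap M : R) : 0 < kap ->
  (forall u, tst u -> (\int[leb2]_x (abs2 (fourier2 u x))%:E =
    kap%:E * \int[leb2]_x (abs2 (u x))%:E)%E) ->
  tst phi -> moments u -> (forall x, normc (phi x) <= M) ->
  (forall x, de < mnorm (x - x0) -> phi x = 0) ->
  (\int[leb2]_xi (abs2 (fourier2 (fun x => phi x * ift u x) xi))%:E <=
   (kap * M ^+ 2)%:E * \int[leb2]_(t in box x0 de) (abs2 (ift u t))%:E)%E.
Proof.
move=> k0 plancherel tphi mu pM pz; have sU := csmooth_ift mu.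
rewrite (plancherel _ (tstM tphi sU)) EFinM -muleA; apply: lee_wpmul2l; first by rewrite lee_fin ltW.
rewrite -ge0_integralZl_EFin ?sqr_ge0//; last 3 first.
- exact: measurable_box.
- by move=> t _; rewrite lee_fin abs2_ge0.
- apply/measurable_EFinP; apply: (measurable_funS measurableT (@subsetT _ _)).
  exact: measurable_abs2 (csmooth_cmeas sU).
apply: (@le_trans _ _ (\int[leb2]_(t in box x0 de) (abs2 (phi t * ift u t))%:E)%E).
  apply: integral_le_restrict => t; first by rewrite lee_fin abs2_ge0.
  rewrite /box /= => /negP; rewrite -ltNge => /pz ->.
  by rewrite mul0r /abs2 /= expr0n addr0.
apply: ge0_le_integral_any => // t _; rewrite -?EFinM ?lee_fin ?abs2_ge0//.
  by rewrite mulr_ge0 ?sqr_ge0 ?abs2_ge0.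
rewrite abs2M ler_wpM2r ?abs2_ge0// abs2E lerXn2r ?nnegrE ?normc_ge0//.
exact: le_trans (normc_ge0 _) (pM t).
Qed.

(* With W the window at (a, s), kappa * Ftr g phi * W is the Fourier transform of phi times the
   function t |-> g (molecule b v a s t), up to a commutator of relative size sqrt a. *)
Lemma molecular_energy g phi chi b v s1 rho r r0 a0 rq (e m : R) x0 (de : R)
    (F : R -> R -> R * R -> R[i]) (c0 : R) :
  temperate g -> tst phi -> chi = cut st x0 r -> 0 < r -> tst b -> gen_supp b ->
  (forall x, chi x * phi x = phi x) -> 0 < de -> de <= r / 2 -> 2 * de < r0 ->
  (forall x, de < mnorm (x - x0) -> phi x = 0) ->
  0 < c0 -> (forall a s t, 0 < a -> a < 1 ->
    abs2 (g (molecule b v a s t)) <= c0 * abs2 (F a s t)) ->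
  e <= 2 * m -> 0 < rho -> a0 <= 1 -> Num.sqrt a0 <= rho / 2 / 2 -> rq <= rho / 2 / 2 -> rq <= 1 ->
  (sector_energy v s1 rho (e - 1) (Ftr g chi) < +oo)%E ->
  exists (k2 D : R) (FE : T2 -> \bar R), [/\ 0 < k2, 0 <= D, measurable_fun setT FE,
    (forall p, 0 <= FE p)%E /\ (\int[leb2]_p FE p < +oo)%E &
    forall a s, window_region s1 a0 rq (a, s) ->
    (k2%:E * ((a `^ (- e - 3))%:E * \int[leb2]_xi (abs2 (Ftr g phi xi * window b v a s xi))%:E) <=
     (\int[leb2]_(t in eball r0 x0) (abs2 (F a s t) * a `^ (- (2 * m) - 3))%:E) +
     (D%:E + FE (a, s)))%E].
Proof.
move=> tg tphi chiE r_gt0 tb gb cp de0 der der0 pz c00 HF em rho0 a01 a0rho rrho r1 fin.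
have [kap [k0 inv plancherel]] := cut_kappa hst.
have tchi : tst chi by rewrite chiE; exact: cut_tst.
pose S := `|s1| + 1; have S0 : 0 <= S by rewrite addr_ge0.
(* K satisfies 2 K - e - 3 >= 0, so that the squared far part of the molecule stays bounded after
   multiplication by a^(- e - 3). *)
pose K := ((Num.truncn `|e|).+1 + 2)%N.
have [C1 [C10 Hfar]] := molecule_far hst v x0 K tg tb S0 r_gt0.
have [CE [CE0 HE]] := error_bound v x0 de tg tphi tchi tb gb S0 k0 inv cp.
have [FE [mFE FE0 FEfin HFE]] := error_energy tg tphi tchi rho0 a01 a0rho rrho r1 fin.
have [M0 [M00 HM0]] := tst_bounded tphi; pose M := M0 + 1.
have M1 : 0 < M by rewrite ltr_wpDl.
have HM x : normc (phi x) <= M by rewrite (le_trans (HM0 x))// lerDl.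
pose cc := 2 / kap ^+ 2; have cc0 : 0 < cc by rewrite divr_gt0// exprn_gt0.
(* The factors come from the splitting in [step1], from Plancherel in [step2] and from [step3]; M is
   the bound on phi made positive, so that kk is invertible. *)
pose kk := cc * (kap * M ^+ 2) * (2 * c0).
have kk0 : 0 < kk by do ![apply: mulr_gt0 => //]; rewrite exprn_gt0.
pose D := C1 ^+ 2 / c0 * ((2 * de) * (2 * de)).
have V0 : 0 <= (2 * de) * (2 * de) by rewrite !mulr_ge0// ltW.
have D0 : 0 <= D by apply: mulr_ge0 V0; rewrite divr_ge0 ?sqr_ge0// ltW.
pose k3 := kk^-1 * (cc * CE).
have k30 : 0 <= k3 by rewrite mulr_ge0 ?invr_ge0 ?(ltW kk0)// mulr_ge0// ltW.
exists kk^-1, D, (fun p => k3%:E * FE p)%E; split=> //.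
- by rewrite invr_gt0.
- exact: measurable_funeM.
- split; first by move=> p; rewrite mule_ge0// lee_fin.
  by rewrite ge0_integralZl_EFin//; apply: lte_mul_pinfty; rewrite ?lee_fin.
move=> a s wr; have /andP[/andP[/= p0 pa] ps] := wr.
have p1 : a < 1 by exact: lt_le_trans a01.
have sS : `|s| <= S.
  by move: (ler_normD (s - s1) s1) (ltW ps) r1; rewrite subrK /S; clear => *; lra.
have [mu [E [mE HA HEb]]] := HE a s p0 p1 sS.
set u := (fun xi => Ftr g chi xi * window b v a s xi) in mu HA *.
set Af := fourier2 (fun x => phi x * ift u x) in HA *.
have mA : cmeas (Af : T2 -> R[i]).
  exact: csmooth_cmeas (csmooth_fourier2 (tst_moments (tstM tphi (csmooth_ift mu)))).
have al0 be : 0 <= a `^ be by exact: powR_ge0.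
have step1 : (\int[leb2]_xi (abs2 (Ftr g phi xi * window b v a s xi))%:E <=
    cc%:E * (\int[leb2]_xi (abs2 (Af xi))%:E + \int[leb2]_xi (abs2 (E xi))%:E))%E.
  have n1 (w : T2 -> R[i]) (x : T2) : setT x -> (0 <= (abs2 (w x))%:E)%E by rewrite lee_fin abs2_ge0.
  have n2 (w : T2 -> R[i]) : cmeas w -> measurable_fun setT (fun x => (abs2 (w x))%:E).
    by move=> mw; apply/measurable_EFinP; exact: measurable_abs2.
  rewrite -(ge0_integralD _ measurableT (n1 Af) (n2 _ mA) (n1 E) (n2 _ mE)).
  rewrite -ge0_integralZl_EFin ?(ltW cc0)//; last 2 first.
  - by move=> x _; rewrite adde_ge0// lee_fin abs2_ge0.
  - by apply: emeasurable_funD; exact: n2.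
  apply: ge0_le_integral_any => // xi _; first by rewrite lee_fin abs2_ge0.
    by rewrite mule_ge0 ?adde_ge0 ?lee_fin ?abs2_ge0// ltW.
  by rewrite -EFinD -EFinM lee_fin; apply: abs2_le_split k0 (HA xi).
have step2 := fourier2_mul_energy k0 plancherel tphi mu HM pz.
rewrite -/Af in step2.
(* On the square, [ift u] is the molecule coefficient minus the far part of the molecule, and e <= 2
   m allows the change of exponent. F may fail to be measurable in t, hence
   [ge0_integral_le_add]. *)
have step3 : (((2 * c0)^-1 * a `^ (- e - 3))%:E * \int[leb2]_(t in box x0 de) (abs2 (ift u t))%:E <=
    \int[leb2]_(t in eball r0 x0) (abs2 (F a s t) * a `^ (- (2 * m) - 3))%:E + D%:E)%E.
  have ub t : box x0 de t -> (2 * c0)^-1 * a `^ (- e - 3) * abs2 (ift u t) <=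
      abs2 (F a s t) * a `^ (- (2 * m) - 3) + C1 ^+ 2 / c0.
    move=> td; have tr : mnorm (t - x0) <= r / 2 by exact: le_trans td der.
    have far := Hfar a s t p0 p1 sS tr; rewrite -chiE in far.
    have sm := sch_molecule v s t tb p0 p1.
    have Eu : ift u t = g (fun x => chi x * molecule b v a s t x).
      rewrite /molecule (interchange tg tchi (tst_moments (tst_modulated v s t tb p0 p1))).
      rewrite /ift fourier2E; congr cintegral; apply/funext => xi.
      by rewrite /u (echC (- t) xi) mulrA.
    have Eg : 1%:C * ift u t = g (molecule b v a s t) + (- g (fun x => (1 - chi x) * molecule b v a s t x)).
      have [lg _] := tg; have tc := tstM tchi sm.1.
      have sf : sch (fun x => (1 - chi x) * molecule b v a s t x).
        by rewrite chiE; exact: sch_far.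
      have -> : g (molecule b v a s t) = ift u t + g (fun x => (1 - chi x) * molecule b v a s t x).
        rewrite Eu -[X in X + _]mul1r -(lg 1 _ _ (tst_sch tc) sf).
        by congr g; apply/funext => x; rewrite mul1r -mulrDl addrCA subrr addr0 mul1r.
      by rewrite addrK mul1r.
    have h1 := abs2_le_split ltr01 Eg.
    have h2 : abs2 (- g (fun x => (1 - chi x) * molecule b v a s t x)) <= C1 ^+ 2 * (a ^+ K) ^+ 2.
      by rewrite abs2E normcN -exprMn lerXn2r ?nnegrE ?normc_ge0// mulr_ge0// exprn_ge0// ltW.
    have h3 := HF a s t p0 p1.
    have h4 : abs2 (ift u t) <= 2 * (c0 * abs2 (F a s t) + C1 ^+ 2 * (a ^+ K) ^+ 2).
      move: h1; rewrite expr1n divr1 => /le_trans; apply; apply: ler_wpM2l => //; exact: lerD h3 h2.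
    have h5 : a `^ (- e - 3) * (a ^+ K) ^+ 2 <= 1.
      rewrite -exprM -powR_mulrn ?(ltW p0)// -powRD ?(gt_eqF p0) ?implybT// -[leRHS](powRr0 a).
      apply: ger_powR; first by rewrite p0 ltW.
      rewrite natrM /K natrD.
      by move: (truncnS_gt `|e|) (ler_norm e) (normr_ge0 e); clear => *; lra.
    have h6 : a `^ (- e - 3) <= a `^ (- (2 * m) - 3).
      by apply: ger_powR; rewrite ?p0 ?(ltW p1)//; move: em; clear => *; lra.
    have i0 : 0 <= (2 * c0)^-1 * a `^ (- e - 3) by rewrite mulr_ge0// invr_ge0 mulr_ge0// ltW.
    rewrite (le_trans (ler_wpM2l i0 h4))//.
    have -> : (2 * c0)^-1 * a `^ (- e - 3) * (2 * (c0 * abs2 (F a s t) + C1 ^+ 2 * (a ^+ K) ^+ 2)) =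
        abs2 (F a s t) * a `^ (- e - 3) + C1 ^+ 2 / c0 * (a `^ (- e - 3) * (a ^+ K) ^+ 2).
      by field; rewrite gt_eqF.
    apply: lerD; first by rewrite ler_wpM2l ?abs2_ge0.
    by apply: ler_piMr h5; rewrite divr_ge0 ?sqr_ge0// ltW.
  have cc1 : 0 <= C1 ^+ 2 / c0 by rewrite divr_ge0 ?sqr_ge0// ltW.
  have i0 : 0 <= (2 * c0)^-1 * a `^ (- e - 3) by rewrite mulr_ge0// invr_ge0 mulr_ge0// ltW.
  have mU : measurable_fun (box x0 de) (fun t : T2 => (abs2 (ift u t))%:E).
    apply/measurable_EFinP; apply: (measurable_funS measurableT (@subsetT _ _)).
    exact: measurable_abs2 (csmooth_cmeas (csmooth_ift mu)).
  have U0 t : box x0 de t -> (0 <= (abs2 (ift u t))%:E)%E by rewrite lee_fin abs2_ge0.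
  rewrite -(ge0_integralZl_EFin leb2 (measurable_box x0 de) U0 mU i0).
  apply: (@le_trans _ _ (\int[leb2]_(t in box x0 de) (abs2 (F a s t) * a `^ (- (2 * m) - 3))%:E +
      \int[leb2]_(t in box x0 de) (C1 ^+ 2 / c0)%:E)%E).
    apply: ge0_integral_le_add; [exact: measurable_box|exact: measurable_funeM|exact: measurable_cst|..].
    - by move=> t td; rewrite mule_ge0 ?U0// lee_fin.
    - by move=> t _; rewrite lee_fin mulr_ge0 ?abs2_ge0.
    - by move=> t _; rewrite lee_fin.
    - by move=> t td; rewrite -EFinM -EFinD lee_fin; exact: ub.
  apply: leeD; last exact: integral_box_cst (ltW de0) cc1.
  apply: ge0_le_integral_any => // t td; rewrite ?lee_fin ?mulr_ge0 ?abs2_ge0//.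
  by rewrite /eball /= (le_lt_trans (enorm_le_mnorm _))// (le_lt_trans _ der0)// ler_wpM2l.
have step4 : ((a `^ (- e - 3))%:E * \int[leb2]_xi (abs2 (E xi))%:E <= CE%:E * FE (a, s))%E.
  apply: le_trans (HFE CE (a, s) CE0 wr).
  have mE2 : measurable_fun setT (fun xi : T2 => (abs2 (E xi))%:E).
    by apply/measurable_EFinP; exact: measurable_abs2.
  have E0 (xi : T2) : setT xi -> (0 <= (abs2 (E xi))%:E)%E by rewrite lee_fin abs2_ge0.
  rewrite -(ge0_integralZl_EFin leb2 measurableT E0 mE2 (al0 _)).
  have G0 xi : (0 <= \int[leb2]_z (if slab v (a, s) xi || slab v (a, s) z
       then abs2 (Ftr g chi z) * (mnorm (z - xi) * normc (ift phi (z - xi))) else 0)%:E)%E.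
    apply: integral_ge0 => z _; rewrite lee_fin; case: ifP => // _.
    by rewrite mulr_ge0 ?abs2_ge0// mulr_ge0 ?mnorm_ge0 ?normc_ge0.
  apply: ge0_le_integral_any => // xi _.
  - by rewrite mule_ge0 ?E0 ?lee_fin.
  - by rewrite mule_ge0 ?lee_fin// mulr_ge0.
  apply: (le_trans (lee_wpmul2l _ (HEb xi))); first by rewrite lee_fin.
  rewrite muleA -EFinM (_ : a `^ (- e - 3) * (CE * a `^ (5 / 2)) = CE * a `^ (- e - 2^-1))//.
  rewrite mulrCA -powRD ?(gt_eqF p0) ?implybT//; congr (_ * _ `^ _); clear; lra.
have B0 : (0 <= \int[leb2]_(t in box x0 de) (abs2 (ift u t))%:E)%E.
  by apply: integral_ge0 => t _; rewrite lee_fin abs2_ge0.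
have IA0 : (0 <= \int[leb2]_xi (abs2 (Af xi))%:E)%E.
  by apply: integral_ge0 => t _; rewrite lee_fin abs2_ge0.
have IE0 : (0 <= \int[leb2]_xi (abs2 (E xi))%:E)%E.
  by apply: integral_ge0 => t _; rewrite lee_fin abs2_ge0.
move: step1 step2 step3 step4 B0 IA0 IE0.
set X := (\int[leb2]_xi (abs2 (Ftr g phi xi * _))%:E)%E.
set IA := (\int[leb2]_xi (abs2 (Af xi))%:E)%E; set IE := (\int[leb2]_xi (abs2 (E xi))%:E)%E.
set Bx := (\int[leb2]_(t in box x0 de) _)%E; set Y := (\int[leb2]_(t in eball r0 x0) _)%E.
move: X IA IE Bx Y => X IA IE Bx Y; set al := a `^ (- e - 3); have al1 : 0 <= al by exact: al0.
move=> s1' s2 s3 s4 B0 IA0 IE0.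
have ik : 0 <= kk^-1 by rewrite invr_ge0 ltW.
have kcc : 0 <= kk^-1 * cc by rewrite mulr_ge0// ltW.
have kca : 0 <= kk^-1 * al * cc by apply: mulr_ge0 (ltW cc0); exact: mulr_ge0.
apply: (@le_trans _ _ ((kk^-1 * al * cc)%:E * (IA + IE))%E).
  rewrite muleA -EFinM (EFinM (kk^-1 * al) cc) -[leRHS]muleA; apply: lee_wpmul2l s1'.
  by rewrite lee_fin mulr_ge0.
rewrite ge0_muleDr// addeA; apply: leeD.
  apply: le_trans s3; apply: (@le_trans _ _ ((kk^-1 * al * cc)%:E * ((kap * M ^+ 2)%:E * Bx))%E).
    by apply: lee_wpmul2l; rewrite ?lee_fin.
  rewrite muleA -EFinM (_ : kk^-1 * al * cc * (kap * M ^+ 2) = (2 * c0)^-1 * al)//.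
  by rewrite /kk; field; rewrite !gt_eqF.
rewrite (_ : kk^-1 * al * cc = kk^-1 * cc * al); last by ring.
rewrite (EFinM (kk^-1 * cc) al) -muleA; apply: (@le_trans _ _ ((kk^-1 * cc)%:E * (CE%:E * FE (a, s)))%E).
  by apply: lee_wpmul2l; rewrite ?lee_fin.
by rewrite muleA -EFinM /k3 -!mulrA.
Qed.

End bootstrap_step.

(** * Iteration of the bootstrap *)

Section bootstrap_iteration.
Context {R : realType}.
Variable st : R -> R.
Hypothesis hst : smooth_step st.
Local Notation T1 := (measurableTypeR R).
Local Notation T2 := (measurableTypeR R * measurableTypeR R)%type.
Local Notation int := (cintegral leb2 setT).
Implicit Types (a s S : R) (t x y xi zeta : R * R) (b h u phi chi : R * R -> R[i])
  (g : (R * R -> R[i]) -> R[i]).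

(** By Tonelli and [window_kernel_lower], once for each sign of z1, the kernel integrated in (a, s)
    dominates the weight of order e where |z1| >= L. The rest of the sector is bounded, and the
    growth bound on H disposes of it. *)
Lemma sector_energy_kernel b v (s1 rq a0 e : R) (H : T2 -> R[i]) (CF : R) k :
  tst b -> gen_pos b 1 -> gen_pos b (-1) -> 0 < rq -> 0 < a0 -> a0 <= 1 ->
  cmeas H -> 0 <= CF -> (forall xi, normc (H xi) <= CF * wt xi ^+ k) ->
  (\int[leb2]_p \int[leb2]_xi ((if window_region s1 a0 rq p
      then abs2 (window b v p.1 p.2 xi) * p.1 `^ (- e - 3) else 0) * abs2 (H xi))%:E < +oo)%E ->
  (sector_energy v s1 (rq / 2) e H < +oo)%E.
Proof.
move=> tb gp gm rq0 a00 a01 mH CF0 HCF fin.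
have n1 : `|-1| = 1 :> R by rewrite normrN normr1.
have [cp [Lp [cp0 Lp0 HLp]]] := window_kernel_lower v s1 (- e - 3) (normr1 R) gp rq0 a00 a01.
have [cm [Lm [cm0 Lm0 HLm]]] := window_kernel_lower v s1 (- e - 3) n1 gm rq0 a00 a01.
pose c := Num.min cp cm; have c0 : 0 < c by rewrite lt_min cp0.
pose L := Num.max Lp Lm; have L0 : 0 < L by rewrite lt_max Lp0.
have eE : - (- e - 3) - 3 = e by ring.
pose n := (Num.truncn `|e|).+1; have en : `|e| <= n%:R by rewrite ltW// truncnS_gt.
pose B := 1 + (1 + `|s1| + rq) * L.
have B0 : 0 <= B by rewrite /B addr_ge0// mulr_ge0 ?(ltW L0)// !addr_ge0// ltW.
(* On the bounded part the weight is at most B; the extra power 4 puts the bound in the integrable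
   form D / (1 + |xi|)^4. *)
pose D := CF ^+ 2 * B ^+ (n + 2 * k + 4).
have D0 : 0 <= D by rewrite mulr_ge0 ?sqr_ge0 ?exprn_ge0.
pose W (p xi : T2) : R := if window_region s1 a0 rq p
  then abs2 (window b v p.1 p.2 xi) * p.1 `^ (- e - 3) else 0.
have W0 p xi : 0 <= W p xi by rewrite /W; case: ifP => // _; rewrite mulr_ge0 ?abs2_ge0 ?powR_ge0.
have mW : measurable_fun setT (fun z : T2 * T2 => W z.1 z.2).
  apply: measurable_fun_ifT; last exact: measurable_cst.
    exact: (measurableT_comp (measurable_window_region s1 a0 rq) measurable_fst).
  apply: measurable_funM; first exact: measurable_abs2 (cmeas_window v tb.1).
  exact: (measurableT_comp (measurable_powR _) (measurableT_comp measurable_fst measurable_fst)).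
have mH2 := measurable_abs2 mH.
have mWH : measurable_fun setT (fun z : T2 * T2 => (W z.1 z.2 * abs2 (H z.2))%:E).
  apply/measurable_EFinP; apply: measurable_funM => //.
  exact: (measurableT_comp mH2 measurable_snd).
have WH0 (z : T2 * T2) : (0 <= (W z.1 z.2 * abs2 (H z.2))%:E)%E.
  by rewrite lee_fin mulr_ge0 ?abs2_ge0.
rewrite (tonelli2 mWH WH0) in fin.
have mI : measurable_fun setT (fun xi : T2 => \int[leb2]_p (W p xi * abs2 (H xi))%:E)%E.
  have mS : measurable_fun setT (fun z : T2 * T2 => (W z.2 z.1 * abs2 (H z.1))%:E).
    exact: (measurableT_comp mWH (@measurable_swap _ _ T2 T2)).
  exact: measurable_section_integral mS (fun z => WH0 (z.2, z.1)).
have I0 xi : (0 <= \int[leb2]_p (W p xi * abs2 (H xi))%:E)%E.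
  by apply: integral_ge0 => p _; rewrite lee_fin mulr_ge0 ?abs2_ge0.
have iw : (\int[leb2]_xi (D * (wt xi ^+ 4)^-1)%:E < +oo)%E.
  have /integrableP[_] := integrable_scale D (integrable_wtV (R := R)).
  apply: le_lt_trans; apply: ge0_le_integral_any => // xi _; rewrite lee_fin.
    by rewrite mulr_ge0 ?invr_ge0 ?wtX_ge0.
  exact: ler_norm.
pose X (xi : T2) : R := if sector v s1 (rq / 2) xi then wt xi `^ e * abs2 (H xi) else 0.
have X0 xi : 0 <= X xi by rewrite /X; case: ifP => // _; rewrite mulr_ge0 ?powR_ge0 ?abs2_ge0.
have mX : measurable_fun setT (X : T2 -> T1).
  apply: measurable_fun_ifT; [exact: measurable_sector| |exact: measurable_cst].
  apply: measurable_funM => //; exact: measurable_wt_powR.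
have V0 (xi : T2) : 0 <= D * (wt xi ^+ 4)^-1 by rewrite mulr_ge0 ?invr_ge0 ?wtX_ge0.
have key xi : ((c * X xi)%:E <= \int[leb2]_p (W p xi * abs2 (H xi))%:E + (c * (D * (wt xi ^+ 4)^-1))%:E)%E.
  rewrite /X; case: ifPn => sx; last by rewrite mulr0 adde_ge0// lee_fin mulr_ge0 ?(ltW c0).
  set z1 := (coswap v xi).1; have [zL|zL] := leP L `|z1|.
    rewrite -[leLHS]adde0; apply: leeD; last by rewrite lee_fin mulr_ge0 ?(ltW c0).
    have kern : ((c * wt xi `^ e)%:E <= \int[leb2]_p (W p xi)%:E)%E.
      have [z0|z0] := leP 0 z1.
        rewrite ger0_norm// in zL; have := HLp xi; rewrite mul1r eE => H1.
        apply: le_trans (H1 _ sx); last by rewrite (le_trans _ zL)// le_max lexx.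
        by rewrite lee_fin ler_wpM2r ?powR_ge0// ge_min lexx.
      rewrite ltr0_norm// in zL; have := HLm xi; rewrite mulN1r eE => H1.
      apply: le_trans (H1 _ sx); last by rewrite (le_trans _ zL)// le_max lexx orbT.
      by rewrite lee_fin ler_wpM2r ?powR_ge0// ge_min lexx orbT.
    have mWx : measurable_fun setT (fun p : T2 => W p xi).
      exact: (measurableT_comp mW (pair2_measurable xi)).
    rewrite mulrA mulrC EFinM.
    have -> : (\int[leb2]_p (W p xi * abs2 (H xi))%:E = (abs2 (H xi))%:E * \int[leb2]_p (W p xi)%:E)%E.
      by rewrite -(ge0_integral_scale leb2 (abs2_ge0 _) mWx (fun p => W0 p xi)); apply: eq_integral => p _; rewrite mulrC.
    by apply: lee_wpmul2l => //; rewrite lee_fin abs2_ge0.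
  rewrite -[leLHS]add0e; apply: leeD => //; rewrite lee_fin ler_wpM2l ?(ltW c0)//.
  have wB : wt xi <= B.
    have : mnorm xi <= (1 + `|s1| + rq) * L.
      have zl : `|z1| <= L by exact: ltW.
      have hz : `|(coswap v xi).2| <= (rq / 2 + `|s1|) * `|z1|.
        rewrite -(subrK (s1 * z1) (coswap v xi).2) (le_trans (ler_normD _ _))// mulrDl lerD//.
        by rewrite normrM.
      have l0 := ltW L0; have s0 := normr_ge0 s1; have q0 := ltW rq0.
      rewrite -(mnorm_coswap v xi) mnorm_le -/z1; apply/andP; split.
        by rewrite (le_trans zl)// ler_peMl//; move: s0 q0; clear => *; lra.
      rewrite (le_trans hz)//; apply: ler_pM => //.
        by rewrite addr_ge0// divr_ge0.
      by move: s0 q0; clear => *; lra.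
    by rewrite /wt /B lerD2l.
  have w0 := wt_gt0 xi; rewrite ler_pdivlMr ?exprn_gt0//.
  apply: (@le_trans _ _ (wt xi ^+ n * (CF * wt xi ^+ k) ^+ 2 * wt xi ^+ 4)).
    rewrite ler_wpM2r ?wtX_ge0//; apply: ler_pM; rewrite ?powR_ge0 ?abs2_ge0//.
      exact: wt_powR_le.
    by rewrite abs2E lerXn2r ?nnegrE ?normc_ge0// mulr_ge0 ?wtX_ge0.
  rewrite exprMn -exprM (mulnC k) [leLHS](_ : _ = CF ^+ 2 * (wt xi ^+ n * wt xi ^+ (2 * k) * wt xi ^+ 4)); last by ring.
  by rewrite -!exprD ler_wpM2l ?sqr_ge0// lerXn2r ?nnegrE ?(ltW w0).
have cX : (c%:E * \int[leb2]_xi (X xi)%:E < +oo)%E.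
  rewrite -(ge0_integral_scale leb2 (ltW c0) mX X0).
  apply: (@le_lt_trans _ _ (\int[leb2]_xi (\int[leb2]_p (W p xi * abs2 (H xi))%:E +
     (c * (D * (wt xi ^+ 4)^-1))%:E))%E).
    apply: ge0_le_integral_any => // xi _; first by rewrite lee_fin mulr_ge0 ?(ltW c0).
    by rewrite adde_ge0// lee_fin mulr_ge0 ?(ltW c0).
  have mV : measurable_fun setT (fun xi : T2 => D * (wt xi ^+ 4)^-1).
    apply: measurable_funM; first exact: measurable_cst.
    by apply: measurable_inv_fun; exact: measurable_wtX.
  rewrite ge0_integralD//; last 2 first.
  - by move=> xi _; rewrite lee_fin mulr_ge0 ?(ltW c0).
  - by apply/measurable_EFinP; exact: measurable_funM.
  apply: lte_add_pinfty => //; rewrite (ge0_integral_scale leb2 (ltW c0) mV V0).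
  by apply: lte_mul_pinfty; rewrite ?lee_fin ?(ltW c0).
rewrite /sector_energy -/X.
have Xge : (0 <= \int[leb2]_xi (X xi)%:E)%E by apply: integral_ge0 => xi _; rewrite lee_fin.
rewrite ltNge; apply/negP; rewrite leye_eq => /eqP Xoo.
by move: cX; rewrite [X in (c%:E * X)%E]Xoo gt0_muley ?lte_fin// ltxx.
Qed.

(** With chi equal to 1 on the supports of the new cutoffs phi, the energy of chi at order e - 1
    controls the commutator, and the shearlet integral controls what remains. *)
Lemma concentrated_step g b v s1 (e m r0 c0 : R) x0 (F : R -> R -> R * R -> R[i]) :
  temperate g -> tst b -> gen_supp b -> gen_pos b 1 -> gen_pos b (-1) -> 0 < r0 -> 0 < c0 ->
  (forall a s t, 0 < a -> a < 1 -> abs2 (g (molecule b v a s t)) <= c0 * abs2 (F a s t)) ->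
  (shearlet_integral m F s1 x0 r0 < +oo)%E -> e <= 2 * m ->
  concentrated g x0 v s1 (e - 1) -> concentrated g x0 v s1 e.
Proof.
move=> tg tb gb gp gm r00 c00 HF fin em [rho [de [rho0 de0 hyp]]].
(* A cutoff of radius r vanishes beyond 3 r, so chi is admissible in the hypothesis at order e -
   1. *)
pose r := de / 3; have rp : 0 < r by rewrite divr_gt0.
pose chi := cut st x0 r; have tchi : tst chi by exact: cut_tst.
have chifin : (sector_energy v s1 rho (e - 1) (Ftr g chi) < +oo)%E.
  apply: hyp tchi _ => x dx; rewrite /chi cut0//.
  by rewrite /r mulrC divfK// ltW.
have q0 : 0 < rho / 2 / 2 by rewrite !divr_gt0.
pose rq := Num.min 1 (Num.min r0 (rho / 2 / 2)); pose a0 : R := Num.min 1 ((rho / 2 / 2) ^+ 2).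
have rq0 : 0 < rq by rewrite !lt_min ltr01 r00.
have a00 : 0 < a0 by rewrite lt_min ltr01 exprn_gt0.
have a01 : a0 <= 1 by rewrite ge_min lexx.
have a0rho : Num.sqrt a0 <= rho / 2 / 2.
  by rewrite -[leRHS](ger0_norm (ltW q0)) -sqrtr_sqr ler_wsqrtr// ge_min lexx orbT.
have rq1 : rq <= 1 by rewrite ge_min lexx.
have rqr : rq <= r0 by rewrite !ge_min lexx orbT.
have rqrho : rq <= rho / 2 / 2 by rewrite !ge_min lexx !orbT.
(* r / 2 keeps t well inside the region where chi = 1; r0 / 3 puts the square of half-side de' into
   the Euclidean ball of radius r0, since [enorm] is at most twice [mnorm]. *)
pose de' := Num.min (r / 2) (r0 / 3).
have de'0 : 0 < de' by rewrite lt_min !divr_gt0.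
have de'r : de' <= r / 2 by rewrite ge_min lexx.
have de'r0 : 2 * de' < r0.
  have : de' <= r0 / 3 by rewrite ge_min lexx orbT.
  by move: r00; clear => *; lra.
exists (rq / 2), de'; split=> //; first by rewrite divr_gt0.
move=> phi tphi pz.
have cp x : chi x * phi x = phi x.
  have [h|h] := leP (mnorm (x - x0)) de'; last by rewrite pz// mulr0.
  by rewrite /chi cut1 ?mul1r// (le_trans h)// (le_trans de'r)//; move: rp; clear => *; lra.
have [k2 [D [FE [k20 D0 mFE [FE0 FEfin] Hmol]]]] :=
  molecular_energy hst tg tphi (erefl chi) rp tb gb cp de'0 de'r de'r0 pz c00 HF em rho0 a01 a0rho rqrho rq1 chifin.
have [CF [k [CF0 HCF]]] := Ftr_bound tg tphi.
have mF := cmeas_Ftr tg tphi.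
apply: (sector_energy_kernel tb gp gm rq0 a00 a01 mF CF0 HCF).
set Hp := (fun p : R * R => _)%E.
have mW : measurable_fun setT (fun z : T2 * T2 => ((if window_region s1 a0 rq z.1
    then abs2 (window b v z.1.1 z.1.2 z.2) * z.1.1 `^ (- e - 3) else 0) * abs2 (Ftr g phi z.2))%:E).
  apply/measurable_EFinP; apply: measurable_funM; last first.
    exact: (measurableT_comp (measurable_abs2 mF) measurable_snd).
  apply: measurable_fun_ifT; last exact: measurable_cst.
    exact: (measurableT_comp (measurable_window_region s1 a0 rq) measurable_fst).
  apply: measurable_funM; first exact: measurable_abs2 (cmeas_window v tb.1).
  exact: (measurableT_comp (measurable_powR _) (measurableT_comp measurable_fst measurable_fst)).
have W0 (z : T2 * T2) : (0 <= ((if window_region s1 a0 rq z.1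
    then abs2 (window b v z.1.1 z.1.2 z.2) * z.1.1 `^ (- e - 3) else 0) * abs2 (Ftr g phi z.2))%:E)%E.
  by rewrite lee_fin mulr_ge0 ?abs2_ge0//; case: ifP => // _; rewrite mulr_ge0 ?abs2_ge0 ?powR_ge0.
have mHp : measurable_fun setT (Hp : T2 -> \bar R) by exact: measurable_section_integral mW W0.
have Hp0 p : (0 <= Hp p)%E by apply: integral_ge0 => xi _; exact: (W0 (p, xi)).
have Hpz p : ~~ window_region s1 a0 rq p -> Hp p = 0%E.
  by move=> np; apply: integral0_eq => xi _; rewrite (negbTE np) mul0r.
have HpE a s : window_region s1 a0 rq (a, s) -> Hp (a, s) =
    ((a `^ (- e - 3))%:E * \int[leb2]_xi (abs2 (Ftr g phi xi * window b v a s xi))%:E)%E.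
  move=> wr; have /andP[/andP[/= p0 pa] _] := wr; have p1 : a < 1 by exact: lt_le_trans a01.
  have mm : measurable_fun setT (fun xi : T2 => abs2 (Ftr g phi xi * window b v a s xi)).
    by apply: measurable_abs2; exact: (cmeasM mF (tst_cmeas (tst_window v s tb p0 p1))).
  rewrite -(ge0_integral_scale leb2 (powR_ge0 _ _) mm (fun xi => abs2_ge0 _)).
  by apply: eq_integral => xi _; rewrite wr /= abs2M; congr EFin; ring.
pose Rb (p : T2) : R := if (0 <= p.1 <= 1) && (s1 - r0 <= p.2 <= s1 + r0) then D else 0.
have Rb0 p : 0 <= Rb p by rewrite /Rb; case: ifP.
have mRb : measurable_fun setT (Rb : T2 -> T1).
  apply: measurable_fun_ifT; [|exact: measurable_cst..].
  by apply: measurable_and; apply: measurable_and; apply: measurable_fun_ler => //;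
    (exact: measurable_fst || exact: measurable_snd || exact: measurable_cst).
pose Em (p : T2) : \bar R := ((Rb p)%:E + FE p)%E.
have Em0 p : (0 <= Em p)%E by rewrite adde_ge0// lee_fin.
have mEm : measurable_fun setT Em by apply: emeasurable_funD => //; exact/measurable_EFinP.
have Emfin : (\int[leb2]_p Em p < +oo)%E.
  rewrite ge0_integralD//; last 2 first.
  - by move=> p _; rewrite lee_fin.
  - exact/measurable_EFinP.
  apply: lte_add_pinfty => //; rewrite integral_rect ?ltry//; first by move: r00; clear => *; lra.
have mk2 : measurable_fun setT (fun p : T2 => k2%:E * Hp p)%E by exact: measurable_funeM.
have k2H0 p : (0 <= k2%:E * Hp p)%E by rewrite mule_ge0// lee_fin ltW.
have k2Hz p : ~~ window_region s1 a0 rq p -> (k2%:E * Hp p = 0)%E by move=> /Hpz ->; rewrite mule0.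
have sec (G : T2 -> \bar R) (a : T1) : measurable_fun setT G -> measurable_fun setT (fun s : T1 => G (a, s)).
  by move=> mG; exact: (measurableT_comp mG (pair1_measurable a)).
have mh (G : T2 -> \bar R) : measurable_fun setT G -> (forall p, 0 <= G p)%E ->
    measurable_fun setT (fun a : T1 => \int[leb1]_s G (a, s))%E.
  by move=> mG G0; exact: (@measurable_fun_fubini_tonelli_F _ _ T1 T1 R (@lebesgue_measure R) G mG G0).
have Y0 a s : (0 <= \int[leb2]_(t in eball r0 x0) (abs2 (F a s t) * a `^ (- (2 * m) - 3))%:E)%E.
  by apply: integral_ge0 => t _; rewrite lee_fin mulr_ge0 ?abs2_ge0 ?powR_ge0.
(* Without joint measurability the iterated shearlet integral cannot be merged into a plane
   integral, so [ge0_integral_le_add] is applied in s for fixed a, and then in a. *)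
have slice (a : T1) : 0 < a < 1 -> (\int[leb1]_s (k2%:E * Hp (a, s)) <=
    \int[leb1]_(s in `](s1 - r0)%R, (s1 + r0)%R[)
     \int[leb2]_(t in eball r0 x0) (abs2 (F a s t) * a `^ (- (2 * m) - 3))%:E +
    \int[leb1]_s Em (a, s))%E.
  move=> /andP[p0 p1].
  have hr : (\int[leb1]_s (k2%:E * Hp (a, s)) <=
      \int[leb1]_(s in `](s1 - r0)%R, (s1 + r0)%R[) (k2%:E * Hp (a, s)))%E.
    apply: integral_le_restrict => s; first exact: k2H0.
    move=> ns; apply: k2Hz; apply/negP => /andP[_ /= ps]; apply: ns.
    by rewrite /= in_itv/= -ltr_distl (lt_le_trans ps).
  apply: (le_trans hr).
  apply: (@le_trans _ _ (\int[leb1]_(s in `](s1 - r0)%R, (s1 + r0)%R[)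
     \int[leb2]_(t in eball r0 x0) (abs2 (F a s t) * a `^ (- (2 * m) - 3))%:E +
    \int[leb1]_(s in `](s1 - r0)%R, (s1 + r0)%R[) Em (a, s))%E); last first.
    by apply: leeD => //; apply: ge0_le_integral_any.
  apply: ge0_integral_le_add => //.
  - by apply: (measurable_funS measurableT (@subsetT _ _)); exact: sec mk2.
  - by apply: (measurable_funS measurableT (@subsetT _ _)); exact: sec mEm.
  move=> s; rewrite /= in_itv/= => /andP[l1 l2].
  have [wr|/k2Hz ->] := boolP (window_region s1 a0 rq (a, s)); last by rewrite adde_ge0.
  rewrite HpE// (le_trans (Hmol a s wr))//; apply: leeD => //; apply: leeD => //.
  by rewrite lee_fin /Rb /= (ltW p0) (ltW p1) (ltW l1) (ltW l2).
have fin2 : (k2%:E * \int[leb2]_p Hp p < +oo)%E.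
  rewrite -(ge0_integralZl_EFin leb2 measurableT (fun p _ => Hp0 p) mHp (ltW k20)).
  rewrite -(iterated_leb2 mk2 k2H0).
  apply: (@le_lt_trans _ _ (\int[leb1]_(a in `]0%R, 1%R[) \int[leb1]_s (k2%:E * Hp (a, s)))%E).
    apply: integral_le_restrict => a; first by apply: integral_ge0 => s _; exact: k2H0.
    move=> na; apply: integral0_eq => s _; apply: k2Hz; apply/negP => /andP[/andP[/= p0 pa] _].
    by apply: na; rewrite /= in_itv/= p0 (lt_le_trans pa).
  apply: (@le_lt_trans _ _ (shearlet_integral m F s1 x0 r0 +
      \int[leb1]_(a in `]0%R, 1%R[) \int[leb1]_s Em (a, s))%E).
    apply: ge0_integral_le_add.
    - exact: measurable_itv.
    - by apply: (measurable_funS measurableT (@subsetT _ _)); exact: mh mk2 k2H0.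
    - by apply: (measurable_funS measurableT (@subsetT _ _)); exact: mh mEm Em0.
    - by move=> a _; apply: integral_ge0 => s _; exact: k2H0.
    - by move=> a _; apply: integral_ge0 => s _.
    - by move=> a _; apply: integral_ge0 => s _; exact: Em0.
    - by move=> a; rewrite /= in_itv/= => /slice.
  apply: (lte_add_pinfty fin); apply: le_lt_trans Emfin; rewrite -(iterated_leb2 mEm Em0).
  by apply: ge0_le_integral_any => // a _; apply: integral_ge0 => s _; exact: Em0.
have Hge : (0 <= \int[leb2]_p Hp p)%E by apply: integral_ge0 => p _.
rewrite ltNge; apply/negP; rewrite leye_eq => /eqP Hoo.
by move: fin2; rewrite Hoo gt0_muley ?lte_fin// ltxx.
Qed.

(** n steps of length 1 lead from 2 m - n, which lies below the starting exponent e0, up to 2 m. *)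
Lemma concentrated_of_shearlets g b v s1 (m r0 c0 : R) x0 (F : R -> R -> R * R -> R[i]) :
  temperate g -> tst b -> gen_supp b -> gen_pos b 1 -> gen_pos b (-1) -> 0 < r0 -> 0 < c0 ->
  (forall a s t, 0 < a -> a < 1 -> abs2 (g (molecule b v a s t)) <= c0 * abs2 (F a s t)) ->
  (shearlet_integral m F s1 x0 r0 < +oo)%E -> concentrated g x0 v s1 (2 * m).
Proof.
move=> tg tb gb gp gm r00 c00 HF fin; have [e0 He0] := concentrated_base hst x0 v s1 tg.
pose n := (Num.truncn `|2 * m - e0|).+1.
have main k : (k <= n)%N -> concentrated g x0 v s1 (2 * m - n%:R + k%:R).
  elim: k => [|k IH] kn.
    apply: He0; rewrite addr0; have := truncnS_gt `|2 * m - e0|; have := ler_norm (2 * m - e0).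
    by rewrite -/n; clear => *; lra.
  apply: (concentrated_step tg tb gb gp gm r00 c00 HF fin).
    have : k.+1%:R <= n%:R :> R by rewrite ler_nat.
    by clear => *; lra.
  have -> : 2 * m - n%:R + k.+1%:R - 1 = 2 * m - n%:R + k%:R :> R by rewrite -natr1; ring.
  by apply: IH; exact: ltnW.
by have := main n (leqnn n); rewrite subrK.
Qed.

End bootstrap_iteration.

(** * Generators, cones and sectors *)

Section generators.
Context {R : realType}.
Variable st : R -> R.
Hypothesis hst : smooth_step st.
Local Notation P := (R^o * R^o)%type.
Implicit Types (a s : R) (xi eta : R * R) (b : R * R -> R[i]).

Lemma csmooth_coord : csmooth (V := P) (fun x => (x.1)%:C) /\ csmooth (V := P) (fun x => (x.2)%:C).
Proof.
have sid : csmooth (V := R^o) (fun t => (t : R)%:C).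
  apply/csmoothS; split=> [x|v]; first by split=> //=; exact: differentiable_cst.
  rewrite (_ : cD _ _ = fun=> (v : R)%:C); first exact: csmooth_cst.
  by apply/funext => x; apply: complexP; rewrite /cD/= ?derive_id ?derive_cst.
split.
  have d1 (x : P) : differentiable (fun x : P => x.1 : R^o) x /\
      'd (fun x : P => x.1 : R^o) x = (fun h : P => h.1 : R^o) :> (P -> R^o).
    by apply: (@affine_diff _ _ _ _ _ 1) => // h; rewrite mul1r; exact: le_mnorm1.
  exact: (csmooth_comp_affine d1 sid).
have d2 (x : P) : differentiable (fun x : P => x.2 : R^o) x /\
    'd (fun x : P => x.2 : R^o) x = (fun h : P => h.2 : R^o) :> (P -> R^o).
  by apply: (@affine_diff _ _ _ _ _ 1) => // h; rewrite mul1r; exact: le_mnorm2.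
exact: (csmooth_comp_affine d2 sid).
Qed.

(* On the support of b1 the quotient agrees with eta.2 * eta.1 / den eta.1, where the smooth
   function den is positive everywhere and equals x ^ 2 for 1 / 2 <= |x|. *)
Lemma csmooth_quotient (b1 b2 : R -> R[i]) : csmooth (V := R^o) b1 -> csmooth (V := R^o) b2 ->
  (forall x, b1 x != 0 -> 2^-1 <= `|x|) ->
  csmooth (V := P) (fun eta => b1 eta.1 * b2 (eta.2 / eta.1)).
Proof.
move=> s1 s2 supp1; have [sst st01 st0 st1] := hst; have [c1 c2] := csmooth_coord.
(* th is 1 for |x| >= 1/2 and 0 for |x| <= 1/4, because 8/2 - 3 = 1 and 8/4 - 3 = - 1. *)
pose th x := st (8 * x + -3) + st (- 8 * x + -3).
pose den x := x * x + (1 - th x).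
have th1 x : th x <= 1.
  rewrite /th; have [x0|x0] := leP 0 x.
    by rewrite [st (- 8 * x + _)]st0 ?addr0; [have /andP[]:= st01 (8 * x + -3)|lra].
  by rewrite [st (8 * x + _)]st0 ?add0r; [have /andP[]:= st01 (- 8 * x + -3)|lra].
have den0 x : den x != 0.
  rewrite gt_eqF// /den; have [->|x0] := eqVneq x 0.
    by rewrite /th !mulr0 !add0r !st0 ?addr0 ?subr0//; lra.
  by rewrite ltr_pwDl ?subr_ge0// -expr2 exprn_even_gt0.
have denE x : 2^-1 <= `|x| -> den x = x * x.
  move=> hx; rewrite /den (_ : th x = 1) ?subrr ?addr0// /th.
  have [x0|x0] := leP 0 x.
    rewrite ger0_norm// in hx; rewrite st1 ?st0 ?addr0//; lra.
  rewrite ltr0_norm// in hx; rewrite st0 ?st1 ?add0r//; lra.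
have sth (k : R) : csmooth (V := P) (fun eta => (st (k * eta.1 + -3))%:C).
  have := csmooth_comp_affine1 k (-3) sst => h.
  exact: (@csmooth_comp_real R P (fun x => (st (k * x + -3))%:C) (fun eta => eta.1) h c1).
have sden : csmooth (V := P) (fun eta => (den eta.1)%:C).
  have -> : (fun eta : P => (den eta.1)%:C) = fun eta : P => (eta.1)%:C * (eta.1)%:C +
      (1 + (-1) * ((st (8 * eta.1 + -3))%:C + (st (- 8 * eta.1 + -3))%:C)).
    apply/funext => eta; rewrite /den /th rmorphD rmorphM rmorphB rmorphD /=.
    by rewrite mulN1r.
  apply: csmoothD; first exact: csmoothM.
  apply: csmoothD; first exact: csmooth_cst.
  by apply: csmoothZ; apply: csmoothD; exact: sth.
have sq : csmooth (V := P) (fun eta => (eta.2 * (eta.1 * (den eta.1)^-1))%:C).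
  apply: (@csmooth_real_M R P (fun eta => eta.2) (fun eta => eta.1 * (den eta.1)^-1)) => //.
  apply: (@csmooth_real_M R P (fun eta => eta.1) (fun eta => (den eta.1)^-1)) => //.
  exact: (@csmooth_inv R P (fun eta => den eta.1)).
have -> : (fun eta : P => b1 eta.1 * b2 (eta.2 / eta.1)) =
    (fun eta : P => b1 eta.1 * b2 (eta.2 * (eta.1 * (den eta.1)^-1))).
  apply/funext => eta; have [->|/supp1 h] := eqVneq (b1 eta.1) 0; first by rewrite !mul0r.
  have e0 : eta.1 != 0 by rewrite -normr_gt0 (lt_le_trans _ h)// invr_gt0.
  by congr (_ * b2 _); rewrite denE//; field.
apply: csmoothM; first exact: (@csmooth_comp_real R P b1 (fun eta => eta.1)).
exact: (@csmooth_comp_real R P b2 (fun eta => eta.2 * (eta.1 * (den eta.1)^-1))).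
Qed.

(** The conjugate reflects that the pairing is conjugate-linear in the shearlet. *)
Definition shearlet_gen (b1 b2 : R -> R[i]) : R * R -> R[i] :=
  fun eta => (b1 eta.1 * b2 (eta.2 / eta.1))^*.

Lemma conjc_neq0 (z : R[i]) : (z^* != 0) = (z != 0).
Proof.
have E (w : R[i]) : w = 0 -> w^* = 0 by move=> ->; apply: complexP; rewrite /= ?oppr0.
have K (w : R[i]) : w^*^* = w by case: w => [p q]; apply: complexP => //=; rewrite opprK.
by congr negb; apply/eqP/eqP => [/E|/E//]; rewrite K.
Qed.

Section from_supports.
Variables b1 b2 : R -> R[i].
Hypotheses (sm1 : csmooth (V := R^o) b1) (sm2 : csmooth (V := R^o) b2).
Hypotheses (supp1 : forall x, b1 x != 0 -> 2^-1 <= `|x| <= 2)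
  (supp2 : forall x, b2 x != 0 -> `|x| <= 1).

Lemma shearlet_gen_supp : gen_supp (shearlet_gen b1 b2).
Proof.
move=> eta; rewrite /shearlet_gen conjc_neq0 mulf_eq0 negb_or => /andP[/supp1/andP[h1 h2] /supp2 h3].
split=> //; have e0 : 0 < `|eta.1| by apply: lt_le_trans h1; rewrite invr_gt0.
by move: h3; rewrite normrM normfV ler_pdivrMr// mul1r.
Qed.

Lemma tst_shearlet_prod : tst (fun eta => b1 eta.1 * b2 (eta.2 / eta.1)).
Proof.
split; first by apply: csmooth_quotient => // x /supp1/andP[].
exists 2 => eta; rewrite -conjc_neq0 => /shearlet_gen_supp[_ h2 h3].
by rewrite mnorm_le h2 (le_trans h3).
Qed.

Lemma tst_shearlet_gen : tst (shearlet_gen b1 b2).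
Proof. exact: tst_conj tst_shearlet_prod. Qed.

Lemma shearlet_gen_pos (sg A0 q0 : R) : `|sg| = 1 -> 0 < A0 -> b1 (sg * A0) != 0 -> b2 q0 != 0 ->
  gen_pos (shearlet_gen b1 b2) sg.
Proof.
move=> sg1 A00 n1 n2; set b := shearlet_gen b1 b2.
have sg0 : sg != 0 by rewrite -normr_gt0 sg1.
pose G (z : P) : R^o := abs2 (b (sg * z.1, sg * (Num.sqrt z.1 * z.2))).
have cG : continuous G.
  have cb := continuous_abs2 tst_shearlet_gen.1.
  pose H (z : P) : P := (sg * z.1, sg * (Num.sqrt z.1 * z.2)).
  move=> z; apply: (@continuous_comp P P R^o H (fun x => abs2 (b x) : R^o)); last exact: cb.
  have c1 : (sg * w.1 : R^o) @[w --> z] --> (sg * z.1 : R^o).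
    by apply: (@cvgM R P _ _ (cst sg)); [exact: cvg_cst|exact: cvg_fst].
  have c2 : (sg * (Num.sqrt w.1 * w.2) : R^o) @[w --> z] --> (sg * (Num.sqrt z.1 * z.2) : R^o).
    apply: (@cvgM R P _ _ (cst sg)); first exact: cvg_cst.
    apply: (@cvgM R P); last exact: cvg_snd.
    by apply: (@continuous_comp P R^o R^o fst Num.sqrt); [exact: cvg_fst|exact: sqrt_continuous].
  exact: (cvg_pair c1 c2).
(* At (A, t) the factor b2 is evaluated at t / sqrt A, which is q0 at this point; continuity then
   gives a whole box. *)
pose z0 : P := (A0, q0 * Num.sqrt A0); pose c := G z0.
have c0 : 0 < c.
  rewrite /c lt_neqAle abs2_ge0 andbT eq_sym /G abs2E sqrf_eq0.
  apply/negP => /eqP/ComplexField.Normc.eq0_normc/eqP; apply/negP.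
  rewrite /b /shearlet_gen conjc_neq0 /= mulf_neq0//.
  rewrite (_ : sg * _ / (sg * A0) = q0)//.
  have e : Num.sqrt A0 * (q0 * Num.sqrt A0) = q0 * A0.
    by rewrite mulrCA -expr2 sqr_sqrtr// ltW.
  by rewrite e; field; rewrite sg0 gt_eqF.
have := cG z0; move/cvgrPdist_lt => /(_ (c / 2)); rewrite divr_gt0// => /(_ isT).
move=> /(@nbhs_ballP _ P)[d /= d0 Hd].
pose dd := Num.min (d / 2) (A0 / 2); have dd0 : 0 < dd by rewrite lt_min !divr_gt0.
have ddd : dd <= d / 2 by rewrite ge_min lexx.
have ddA : dd <= A0 / 2 by rewrite ge_min lexx orbT.
exists (A0 - dd), (A0 + dd), (z0.2 - dd), (z0.2 + dd), (c / 2); split.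
- by apply/andP; split; lra.
- by lra.
- by rewrite divr_gt0.
move=> A t hA ht; have : ball z0 d ((A, t) : P).
  rewrite -ball_normE /= -[`|_|]/(mnorm (z0 - (A, t))).
  apply: (@le_lt_trans _ _ dd); last by lra.
  rewrite mnorm_le /= !ler_distlC; apply/andP; split; first by [].
  by [].
move=> /Hd /=; rewrite -/c ltr_distlC => /andP[h _].
by rewrite -[abs2 _]/(G (A, t)); lra.
Qed.

End from_supports.

(** b vanishes for |eta1| < 1/2, and st (4 eta1) makes its transition within |eta1| <= 1/4:
    multiplying by this step separates the two signs smoothly. *)
Lemma gen_sign_split b : tst b -> gen_supp b -> exists bp bm : R * R -> R[i],
  [/\ tst bp /\ tst bm, gen_supp bp /\ gen_supp bm, forall eta, b eta = bp eta + bm eta,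
   forall eta, bp eta != 0 -> 0 < eta.1 & forall eta, bm eta != 0 -> eta.1 < 0].
Proof.
move=> tb gb; have [sst st01 st0 st1] := hst; have [c1 _] := csmooth_coord.
have ss : csmooth (V := P) (fun eta => (st (4 * eta.1))%:C).
  have h := csmooth_comp_affine1 4 0 sst.
  have -> : (fun eta : P => (st (4 * eta.1))%:C) = (fun eta : P => (st (4 * eta.1 + 0))%:C).
    by apply/funext => eta; rewrite addr0.
  exact: (@csmooth_comp_real R P (fun x => (st (4 * x + 0))%:C) (fun eta => eta.1) h c1).
have ss' : csmooth (V := P) (fun eta => 1 + (-1) * (st (4 * eta.1))%:C).
  by apply: csmoothD; [exact: csmooth_cst|exact: csmoothZ].
exists (fun eta => b eta * (st (4 * eta.1))%:C), (fun eta => b eta * (1 + (-1) * (st (4 * eta.1))%:C)).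
have nz (p q : R[i]) : p * q != 0 -> p != 0.
  by apply: contraNN => /eqP ->; rewrite mul0r.
split; [by split; exact: tstM|by split=> eta /nz; exact: gb|..] => eta.
- by rewrite -mulrDr addrCA mulN1r subrr addr0 mulr1.
- move=> h; have [h1 _ _] := gb _ (nz _ _ h); rewrite ltNge; apply/negP => e0.
  rewrite ler0_norm// in h1; move: h; rewrite st0 ?mulr0 ?eqxx//; lra.
- move=> h; have [h1 _ _] := gb _ (nz _ _ h); rewrite ltNge; apply/negP => e0.
  rewrite ger0_norm// in h1; move: h; rewrite st1 ?mulr1 ?subrr ?mulr0 ?eqxx//; lra.
Qed.

(** Conjugation turns the inverse transform of b0 into the forward transform of its conjugate, and
    the inverse of M_as acts as [codil]. *)
Lemma shearlet_molecule (psi b0 : R * R -> R[i]) (kap : R) v a s (t x : R * R) : 0 < kap -> tst b0 ->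
  (forall x, kap%:C * psi x = ift b0 x) -> 0 < a -> a < 1 ->
  ((if v then vshearlet psi a s t else shearlet psi a s t) x)^* =
  (kap^-1)%:C * molecule (fun eta => (b0 eta)^*) v a s t x.
Proof.
move=> k0 tb hpsi a0 a1; have q0 : 0 < Num.sqrt a by rewrite sqrtr_gt0.
have tb' := tst_conj tb.
have pE (y : R * R) : (psi y)^* = (kap^-1)%:C * fourier2 (fun eta => (b0 eta)^*) y.
  have e1 : fourier2 (fun eta => (b0 eta)^*) y = (ift b0 y)^*.
    rewrite /ift (conj_fourier2 _ (tst_cint tb)) /ift opprK.
    by [].
  rewrite e1 -hpsi conjc_mul mulrA.
  rewrite [X in _ * X * _](_ : _ = kap%:C); last by apply: complexP => //=; rewrite oppr0.
  by rewrite -rmorphM mulVf ?gt_eqF// mul1r.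
have invE : invmx (shear_mx a s) = (\matrix_(i < 2, j < 2)
    if i == 0 then (if j == 0 then a^-1 else s / a) else (if j == 0 then 0 else (Num.sqrt a)^-1)) :> 'M[R]_2.
  set N := (X in _ = X); have MN : shear_mx a s *m N = 1%:M.
    rewrite /N; apply/matrixP => i j; rewrite !mxE !big_ord_recl big_ord0 !mxE.
    case: i => [[|[|//]] hi]; case: j => [[|[|//]] hj] //=; rewrite ?mxE /=.
    - by field; rewrite gt_eqF.
    - by field; rewrite !gt_eqF.
    - by rewrite mul0r mulr0 !addr0.
    - by field; rewrite !gt_eqF.
  have [uM _] := mulmx1_unit MN.
  by rewrite -[LHS]mulmx1 -MN mulKmx.
rewrite (moleculeE v s t x tb' a0 a1).
have E (y : R * R) : mx_act (invmx (shear_mx a s)) (coswap v y) = codil v a s y.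
  rewrite /mx_act invE !mxE /= /codil; congr pair; first by ring.
  by rewrite mul0r add0r mulrC.
rewrite (_ : (if v then _ else _) x = (a `^ (- (3 / 4)))%:C * psi (codil v a s (x - t))); last first.
  by rewrite -E; case: (v).
rewrite conjc_mul.
rewrite [LHS](_ : _ = (a `^ (- (3 / 4)))%:C *
    ((kap^-1)%:C * fourier2 (fun eta => (b0 eta)^*) (codil v a s (x - t)))); last first.
  by congr (_ * _); [apply: complexP => //=; rewrite oppr0|exact: pE].
by rewrite mulrCA.
Qed.

End generators.

(** * Cones in angle and sectors in slope *)

Section cones.
Context {R : realType}.
Implicit Types (xi z : R * R).

Lemma Arg_polar xi : xi != 0 -> [/\ 0 < enorm xi, xi.1 = enorm xi * cos (Arg xi) &
  xi.2 = enorm xi * sin (Arg xi)].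
Proof.
move=> xn; have d0 : 0 < dot xi xi.
  rewrite /dot -!expr2 lt_neqAle addr_ge0 ?sqr_ge0// andbT eq_sym paddr_eq0 ?sqr_ge0//.
  by rewrite !sqrf_eq0; apply: contra xn => /andP[/eqP h1 /eqP h2]; rewrite [xi]surjective_pairing h1 h2.
have n0 : 0 < enorm xi by rewrite sqrtr_gt0.
have nn : enorm xi ^+ 2 = xi.1 ^+ 2 + xi.2 ^+ 2 by rewrite sqr_sqrtr ?(ltW d0)// /dot -!expr2.
set u := xi.1 / enorm xi.
have u1 : -1 <= u <= 1.
  rewrite -ler_norml /u normrM normfV (gtr0_norm n0) ler_pdivrMr// mul1r.
  have := le_mnorm1 xi => h; exact: le_trans h (mnorm_le_enorm xi).
have cu : cos (acos u) = u by have [_] := acos_def u1.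
have su : sin (acos u) = `|xi.2| / enorm xi.
  rewrite sin_acos// (_ : 1 - u ^+ 2 = (xi.2 / enorm xi) ^+ 2).
    by rewrite sqrtr_sqr normrM normfV (gtr0_norm n0).
  have n20 : enorm xi != 0 by rewrite gt_eqF.
  rewrite /u !expr_div_n; apply: (mulIf (expf_neq0 2 n20)).
  by rewrite mulrBl mul1r !divfK ?expf_neq0// nn addrAC subrr add0r.
split=> //; rewrite /Arg -/u; case: ifP => h.
- by rewrite cu /u mulrC divfK ?gt_eqF.
- by rewrite cosN cu /u mulrC divfK ?gt_eqF.
- by rewrite su ger0_norm// mulrC divfK ?gt_eqF.
- rewrite sinN su ltr0_norm; last by rewrite ltNge h.
  by rewrite mulNr opprK mulrC divfK ?gt_eqF.
Qed.

Lemma cis_coord_lip (th A : R) : `|cos th - cos A| <= 2 * `|th - A| /\ `|sin th - sin A| <= 2 * `|th - A|.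
Proof.
have h : normc (cis th - cis A) <= 2 * `|th - A|.
  have -> : cis th - cis A = (cis (th - A) - 1) * cis A by rewrite mulrBl mul1r -cisD subrK.
  by rewrite normcM normc_cis mulr1; exact: cis_lip.
split; apply: le_trans h.
  by have := le_normc_Re (cis th - cis A); rewrite Re_addc Re_oppc.
by have := le_normc_Im (cis th - cis A); rewrite Im_addc Im_oppc.
Qed.

(** Sine and cosine are Lipschitz, so the slope stays close to its value at xi0 as long as the first
    swapped coordinate stays away from 0. *)
Lemma cone_sub_sector v xi0 rho : xi0 != 0 -> (coswap v xi0).1 != 0 -> 0 < rho ->
  exists eps : R, 0 < eps < pi / 2 /\ forall xi, cone xi0 eps xi ->
  sector v ((coswap v xi0).2 / (coswap v xi0).1) rho xi.
Proof.
move=> xn zn rho0; have [n0 e1 e2] := Arg_polar xn; set A := Arg xi0 in e1 e2 *.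
set n := enorm xi0 in n0 e1 e2.
pose c : R * R := coswap v (cos A, sin A).
have zE : coswap v xi0 = (n * c.1, n * c.2).
  by rewrite /c; move: e1 e2; case: (v) => /= <- <-; case: (xi0).
have c10 : c.1 != 0 by move: zn; rewrite zE /= mulf_eq0 negb_or => /andP[].
set s := (coswap v xi0).2 / (coswap v xi0).1; have sE : c.2 = s * c.1.
  by rewrite /s zE /=; field; rewrite c10 gt_eqF.
pose k := `|c.1|; have k0 : 0 < k by rewrite normr_gt0.
pose m := 1 + `|s|; have m0 : 0 < m by rewrite ltr_wpDr.
(* The second entry keeps |w1| above k / 2, and the third bounds m (2 eps) by rho k / 2. *)
pose eps := Num.min (pi / 4) (Num.min (k / 4) (rho * k / (4 * m))).
have pi0 := pi_gt0 R.
have eps0 : 0 < eps by rewrite !lt_min !divr_gt0 ?mulr_gt0.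
have eps1 : eps <= pi / 4 by rewrite ge_min lexx.
have eps2 : eps <= k / 4 by rewrite !ge_min lexx orbT.
have eps3 : eps <= rho * k / (4 * m) by rewrite !ge_min lexx !orbT.
exists eps; split; first by rewrite eps0 /= (le_lt_trans eps1)//; lra.
move=> xi [r [th [r0 hth ->]]].
have [h1 h2] := cis_coord_lip th A.
pose w : R * R := coswap v (cos th, sin th).
have wE : coswap v (r * cos th, r * sin th) = (r * w.1, r * w.2) by rewrite /w; case: (v).
have [d1 d2] : `|w.1 - c.1| <= 2 * `|th - A| /\ `|w.2 - c.2| <= 2 * `|th - A|.
  by rewrite /w /c; case: (v).
have he : 2 * `|th - A| <= 2 * eps by rewrite ler_wpM2l// ltW.
rewrite /sector wE /= !normrM (gtr0_norm r0).
rewrite (_ : r * w.2 - s * (r * w.1) = r * ((w.2 - c.2) - s * (w.1 - c.1))); last first.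
  by rewrite sE; ring.
rewrite normrM (gtr0_norm r0) mulrCA ler_pM2l//.
have l1 : `|w.2 - c.2 - s * (w.1 - c.1)| <= m * (2 * eps).
  rewrite (le_trans (ler_normB _ _))// /m mulrDl mul1r lerD//; first exact: le_trans he.
  by rewrite normrM ler_wpM2l// (le_trans d1).
have l2 : k / 2 <= `|w.1|.
  have : k <= `|w.1| + `|w.1 - c.1|.
    by rewrite /k -{1}(subKr w.1 c.1) ler_normB.
  move: (le_trans d1 he) eps2; clear; lra.
have l3 : m * (2 * eps) <= rho * (k / 2).
  move: eps3; rewrite ler_pdivlMr ?mulr_gt0//; clear; lra.
by rewrite (le_trans l1)// (le_trans l3)// ler_wpM2l// ltW.
Qed.

Lemma half_sector_sub_cone v xi0 eps : xi0 != 0 -> 0 < eps < pi / 2 ->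
  exists rho : R, 0 < rho /\ forall xi, 0 < (coswap v xi0).1 * (coswap v xi).1 ->
  sector v ((coswap v xi0).2 / (coswap v xi0).1) rho xi -> cone xi0 eps xi.
Proof.
move=> xn /andP[eps0 epspi]; set z := coswap v xi0.
have [n0 e1 e2] := Arg_polar xn; set A := Arg xi0 in e1 e2.
set n := enorm xi0 in n0 e1 e2; set s := z.2 / z.1.
have t0 : 0 < tan eps.
  rewrite /tan divr_gt0//; last by rewrite cos_gt0_pihalf//; apply/andP; split=> //; have := pi_gt0 R; lra.
  by rewrite sin_gt0_pi//; apply/andP; split=> //; have := pi_gt0 R; lra.
pose m := `|s| + 1; have m0 : 0 < m by rewrite ltr_wpDl.
(* The first entry makes D at least |z1| |w1| / 2; the second then gives |X / D| < tan eps. *)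
pose rho := Num.min ((2 * m)^-1) (tan eps / 4).
have rho0 : 0 < rho by rewrite lt_min invr_gt0 mulr_gt0//= divr_gt0.
exists rho; split=> // xi; rewrite /sector; set w := coswap v xi => p0 hs.
have z0 : z.1 != 0 by apply: contraTneq p0 => ->; rewrite mul0r ltxx.
have zE : z.2 = s * z.1 by rewrite /s divfK.
have zn : 0 < `|z.1| by rewrite normr_gt0.
have pE : z.1 * w.1 = `|z.1| * `|w.1| by rewrite -normrM gtr0_norm.
have w0 : 0 < `|w.1| by rewrite -(pmulr_rgt0 _ zn) -pE.
pose tau := w.2 - s * w.1.
have wE : w.2 = s * w.1 + tau by rewrite /tau addrC subrK.
pose D := dot xi0 xi; pose X := xi0.1 * xi.2 - xi0.2 * xi.1.
have DE : D = z.1 * (w.1 * (1 + s ^+ 2) + s * tau).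
  have -> : D = z.1 * w.1 + z.2 * w.2 by rewrite /D /dot /z /w; case: (v) => //=; rewrite addrC.
  by rewrite zE wE; ring.
have XE : `|X| = `|z.1| * `|tau|.
  have -> : `|X| = `|z.1 * w.2 - z.2 * w.1|.
    by rewrite /X /z /w; case: (v) => //=; rewrite distrC; congr `|_|; ring.
  by rewrite zE wE (_ : _ - _ = z.1 * tau) ?normrM//; ring.
have r1 : rho <= (2 * m)^-1 by rewrite ge_min lexx.
have r2 : rho <= tan eps / 4 by rewrite ge_min lexx orbT.
have st : `|s * tau| <= `|w.1| / 2.
  rewrite normrM (le_trans (ler_wpM2l (normr_ge0 s) hs))// mulrA mulrC ler_wpM2l//.
  apply: (@le_trans _ _ (m * (2 * m)^-1)).
    by apply: ler_pM; rewrite ?(ltW rho0)// /m lerDl.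
  by rewrite invfM mulrCA mulfV ?gt_eqF// mulr1.
have Dlow : `|z.1| * (`|w.1| / 2) <= D.
  have -> : D = `|z.1| * `|w.1| * (1 + s ^+ 2) + z.1 * (s * tau) by rewrite DE -pE; ring.
  have : - (z.1 * (s * tau)) <= `|z.1| * (`|w.1| / 2).
    rewrite (le_trans (ler_norm _))// normrN normrM ler_pM2l//.
  have : 0 <= `|z.1| * `|w.1| * s ^+ 2 by rewrite mulr_ge0 ?sqr_ge0// mulr_ge0.
  by clear; lra.
have D0 : 0 < D by apply: lt_le_trans Dlow; rewrite mulr_gt0// divr_gt0.
pose de := atan (X / D).
have td : tan de = X / D by exact: atanK.
have [/andP[dlo dhi] _] := atan_def (X / D); rewrite -/de in dlo dhi.
have cd : 0 < cos de by rewrite cos_gt0_pihalf// dlo dhi.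
have sd : sin de = X / D * cos de by rewrite -td /tan divfK ?gt_eqF.
have Xlt : `|X / D| < tan eps.
  rewrite normrM normfV (gtr0_norm D0) ltr_pdivrMr// XE.
  apply: (@lt_le_trans _ _ (tan eps * (`|z.1| * (`|w.1| / 2)))); last by rewrite ler_pM2l.
  rewrite mulrCA ltr_pM2l// (le_lt_trans hs)//.
  have : rho * `|w.1| <= tan eps / 4 * `|w.1| by rewrite ler_wpM2r// ltW.
  have : 0 < tan eps * `|w.1| by rewrite mulr_gt0.
  by clear; lra.
have epsin : eps \in `](- (pi / 2)), (pi / 2)[ by rewrite in_itv/= epspi andbT; have := pi_gt0 R; lra.
have dle : `|de| < eps.
  move: Xlt; rewrite !ltr_norml => /andP[x1 x2]; apply/andP; split.
    have := lt_atan x1; rewrite -/de; congr (_ < _).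
    by rewrite -tanN tanK// in_itv/=; move: epsin; rewrite in_itv/= => /andP[? ?]; apply/andP; split; lra.
  by have := lt_atan x2; rewrite tanK.
exists (D / (n * cos de)), (A + de); split.
- by rewrite divr_gt0// mulr_gt0.
- by rewrite (addrC A) -/A addrK.
have n2 : n ^+ 2 = xi0.1 ^+ 2 + xi0.2 ^+ 2.
  by rewrite sqr_sqrtr /dot -?expr2// addr_ge0 ?sqr_ge0.
have nne : n != 0 by rewrite gt_eqF.
have cdn : cos de != 0 by rewrite gt_eqF.
have Dn : D != 0 by rewrite gt_eqF.
have cA : cos A = xi0.1 / n by rewrite e1 mulrAC mulfV ?mul1r.
have sA : sin A = xi0.2 / n by rewrite e2 mulrAC mulfV ?mul1r.
have E1 : D / (n * cos de) * cos (A + de) = xi.1.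
  rewrite cosD cA sA sd.
  have -> : D / (n * cos de) * (xi0.1 / n * cos de - xi0.2 / n * (X / D * cos de)) =
      (xi0.1 * D - xi0.2 * X) / n ^+ 2 by field; rewrite nne cdn Dn.
  rewrite n2 (_ : _ - _ = xi.1 * (xi0.1 ^+ 2 + xi0.2 ^+ 2)) -?n2 ?mulfK ?expf_neq0//.
  by rewrite n2 /D /X /dot; ring.
have E2 : D / (n * cos de) * sin (A + de) = xi.2.
  rewrite sinD cA sA sd.
  have -> : D / (n * cos de) * (xi0.2 / n * cos de + xi0.1 / n * (X / D * cos de)) =
      (xi0.2 * D + xi0.1 * X) / n ^+ 2 by field; rewrite nne cdn Dn.
  rewrite n2 (_ : _ + _ = xi.2 * (xi0.1 ^+ 2 + xi0.2 ^+ 2)) -?n2 ?mulfK ?expf_neq0//.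
  by rewrite n2 /D /X /dot; ring.
by rewrite E1 E2; case: (xi).
Qed.

Lemma slopeE xi0 : xi0 != 0 ->
  slope xi0 = if xi0.1 == 0 then +oo%E else (xi0.2 / xi0.1)%:E.
Proof.
move=> xn; have [n0 e1 e2] := Arg_polar xn; rewrite /slope.
have nn : enorm xi0 != 0 by rewrite gt_eqF.
have -> : (xi0.1 == 0) = (cos (Arg xi0) == 0) by rewrite [in LHS]e1 mulf_eq0 (negbTE nn).
case: eqVneq => // c0; congr EFin.
by rewrite [in RHS]e1 [in RHS]e2 /tan; field; rewrite nn c0.
Qed.

End cones.

(** * Microlocal regularity *)

Section microlocal.
Context {R : realType}.
Variable st : R -> R.
Hypothesis hst : smooth_step st.
Local Notation T1 := (measurableTypeR R).
Local Notation T2 := (measurableTypeR R * measurableTypeR R)%type.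
Local Notation P := (R^o * R^o)%type.
Local Notation int := (cintegral leb2 setT).
Local Notation cint := (cintegrable leb2 setT).
Implicit Types (xi : R * R) (b h phi : R * R -> R[i]) (g f : (R * R -> R[i]) -> R[i])
  (Om : set (R * R)).

Lemma near_box (Q : R * R -> Prop) (x0 : R * R) : (\forall x \near (x0 : P), Q x) ->
  exists r : R, 0 < r /\ forall x : R * R, mnorm (x - x0) <= r -> Q x.
Proof.
move=> /(@nbhs_ballP _ P)[d /= d0 H]; exists (d / 2); split=> [|x xr]; first by rewrite divr_gt0.
apply: H; rewrite -ball_normE /= -[`|_|]/(mnorm (x0 - x)) -mnormN opprB.
by rewrite (le_lt_trans xr)//; lra.
Qed.

Lemma mul_distr_local Om f phi (x0 : R * R) : cutoff (V := P) Om x0 phi -> exists r : R, 0 < r /\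
  forall psi, tst psi -> (forall x, r < mnorm (x - x0) -> psi x = 0) -> mul_distr phi f psi = f psi.
Proof.
move=> [_ /near_box[r [r0 H]]]; exists r; split=> // psi _ pz.
congr f; apply/funext => x; have [h|h] := leP (mnorm (x - x0)) r; first by rewrite H// mul1r.
by rewrite pz// mulr0.
Qed.

(** Both readings of g in the statement come down to the same two facts: g is temperate and equals f
    near x0. *)
Lemma tempered_version_local Om (x0 : R * R) f g : open Om -> Om x0 ->
  is_distribution (V := P) Om f -> tempered_version (V := P) Om x0 f g ->
  temperate g /\ exists r : R, 0 < r /\ forall psi, tst psi ->
    (forall x, r < mnorm (x - x0) -> psi x = 0) -> g psi = f psi.
Proof.
move=> oO Ox0 df [[tg ext]|[_ [phi cphi ->]]]; last first.
  split; last exact: mul_distr_local cphi.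
  exact: mul_distr_temperate df cphi.1.
split; first exact: tempered_temperate.
have [r [r0 H]] : exists r : R, 0 < r /\ forall x : R * R, mnorm (x - x0) <= r -> Om x.
  by apply: near_box; exact: open_nbhs_nbhs.
exists r; split=> // psi tpsi pz; apply: ext; apply: (tst_test_function tpsi _ H) => x.
by apply: contraNT; rewrite -ltNge => /pz ->.
Qed.

Lemma weight_comparable (m : R) xi :
  wt xi `^ (2 * m) <= 4 `^ `|m| * (1 + enorm xi ^+ 2) `^ m /\
  (1 + enorm xi ^+ 2) `^ m <= 4 `^ `|m| * wt xi `^ (2 * m).
Proof.
have w0 := wt_gt0 xi; have m0 := mnorm_ge0 xi.
have -> : wt xi `^ (2 * m) = (wt xi ^+ 2) `^ m by rewrite powRrM powR_mulrn// ltW.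
have h1 := mnorm_le_enorm xi; have h2 := enorm_le_mnorm xi.
have e1 : mnorm xi ^+ 2 <= enorm xi ^+ 2 by rewrite lerXn2r ?nnegrE ?sqrtr_ge0.
have e2 : enorm xi ^+ 2 <= (2 * mnorm xi) ^+ 2 by rewrite lerXn2r ?nnegrE ?sqrtr_ge0 ?mulr_ge0.
have en0 := sqr_ge0 (enorm xi); have c1 : (1 : R) <= 4 by rewrite ler1n.
have a1 : wt xi ^+ 2 <= 4 * (1 + enorm xi ^+ 2).
  by rewrite /wt; have := sqr_ge0 (1 - mnorm xi); nra.
have a2 : 1 + enorm xi ^+ 2 <= 4 * wt xi ^+ 2 by rewrite /wt; nra.
by split; apply: powR_comparable; rewrite ?exprn_gt0// ltr_wpDr.
Qed.

Lemma sector_le v (s1 r1 r2 : R) xi : r1 <= r2 -> sector v s1 r1 xi -> sector v s1 r2 xi.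
Proof. by move=> r12 h; apply: le_trans h _; rewrite ler_wpM2r. Qed.

(** Microregularity concerns a one-sided cone, whereas sectors are double: h is set to 0 off the
    half-plane of xi1, which changes nothing where the windows built from b live. *)
Lemma half_majorant v (m : R) Om f (x0 xi1 : R * R) b : is_distribution (V := P) Om f ->
  tst b -> gen_supp b -> xi1 != 0 ->
  (forall eta, b eta != 0 -> 0 < (coswap v xi1).1 * eta.1) ->
  sobolev_microregular m Om f x0 xi1 ->
  exists fp hp (r rho : R), [/\ 0 < r /\ 0 < rho, temperate fp,
    (forall psi, tst psi -> (forall x, r < mnorm (x - x0) -> psi x = 0) -> fp psi = f psi),
    (forall eta, sch eta -> cint (fun xi => hp xi * eta xi) /\
       fp (fourier2 eta) = int (fun xi => hp xi * eta xi)) &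
    forall rho', rho' <= rho -> let s1 := (coswap v xi1).2 / (coswap v xi1).1 in
    exists F : T2 -> \bar R, [/\ measurable_fun setT F, forall p, (0 <= F p)%E,
    (\int[leb2]_p F p < +oo)%E &
    forall a s, 0 < a -> a < 1 -> `|s| <= `|s1| + 1 ->
    (forall xi, slab v (a, s) xi -> sector v s1 rho' xi) ->
    ((a `^ (- (2 * m) - 3))%:E * \int[leb2]_xi (abs2 (hp xi * window b v a s xi))%:E <= F (a, s))%E]].
Proof.
move=> df tb gb xn bpos [phi [eps [h [cphi he rep fin]]]].
have [r [r0 Hr]] := mul_distr_local f cphi.
have [rho [rho0 Hrho]] := half_sector_sub_cone v xn he.
have repS eta : sch eta -> cint (fun xi => h xi * eta xi) /\
    mul_distr phi f (fourier2 eta) = int (fun xi => h xi * eta xi).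
  by move=> /schP/rep.
have ch : cmeas (h : T2 -> R[i]) by apply: (cmeas_of_local hst) => eta /repS[].
exists (mul_distr phi f), h, r, rho; split=> //.
  exact: mul_distr_temperate df cphi.1.
move=> rho' rr s1; pose A xi := 0 < (coswap v xi1).1 * (coswap v xi).1.
have mA : measurable_fun setT (A : T2 -> bool).
  have [m1 _] := @measurable_coswap R _ T2 v _ (@measurable_id _ T2 setT).
  by apply: measurable_fun_ltr; [exact: measurable_cst|exact: measurable_funM].
pose h' := restr A h.
have ch' : cmeas (h' : T2 -> R[i]) by apply: (cmeas_if mA ch); exact: cmeas_cst.
have S0 : 0 <= `|s1| + 1 by rewrite addr_ge0.
pose w (xi : T2) : R := (1 + enorm xi ^+ 2) `^ m * abs2 (h xi).
have w0 xi : 0 <= w xi by rewrite mulr_ge0 ?powR_ge0 ?abs2_ge0.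
have mw : measurable_fun setT (w : T2 -> T1).
  apply: measurable_funM; last exact: measurable_abs2.
  apply: (measurableT_comp (measurable_powR _)); apply: measurable_funD; first exact: measurable_cst.
  apply: measurable_funX; apply: measurable_sqrt.
  by apply: measurable_dot; exact: measurable_id.
pose B xi := sector v s1 rho' xi && A xi.
have mB : measurable_fun setT (B : T2 -> bool).
  by apply: measurable_and => //; exact: measurable_sector.
have fin' : (\int[leb2]_xi (if sector v s1 rho' xi then wt xi `^ (2 * m) * abs2 (h' xi) else 0)%:E < +oo)%E.
  pose wB (xi : T2) : R := if B xi then w xi else 0.
  have wB0 xi : 0 <= wB xi by rewrite /wB; case: ifP.
  have mwB : measurable_fun setT (wB : T2 -> T1).
    by apply: measurable_fun_ifT => //; exact: measurable_cst.
  have fB : (\int[leb2]_xi (wB xi)%:E < +oo)%E.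
    apply: le_lt_trans fin.
    apply: (@le_trans _ _ (\int[leb2]_(xi in cone xi1 eps) (wB xi)%:E)%E).
      apply: integral_le_restrict => xi; first by rewrite lee_fin.
      move=> nc; rewrite /wB ifN//; apply/negP => /andP[sx ax]; apply: nc; apply: Hrho => //.
      exact: sector_le rr sx.
    apply: ge0_le_integral_any => // xi _; rewrite lee_fin//; first exact: w0.
    by rewrite /wB; case: ifP => // _; exact: w0.
  apply: (@le_lt_trans _ _ (\int[leb2]_xi (4 `^ `|m| * wB xi)%:E)%E).
    apply: ge0_le_integral_any => // xi _; rewrite lee_fin.
    - by case: ifP => // _; rewrite mulr_ge0 ?powR_ge0 ?abs2_ge0.
    - by rewrite mulr_ge0 ?powR_ge0.
    case: ifPn => sx; last by rewrite mulr_ge0 ?powR_ge0.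
    rewrite /wB /B sx /= /h' /restr; case: ifP => ax; last first.
      by rewrite /abs2 /= expr0n addr0 !mulr0.
    by rewrite /w mulrA ler_wpM2r ?abs2_ge0//; exact: (weight_comparable m xi).1.
  rewrite (ge0_integral_scale leb2 (powR_ge0 _ _) mwB wB0).
  by apply: lte_mul_pinfty => //; rewrite lee_fin powR_ge0.
have [F [mF F0 Ffin HF]] := window_majorant tb gb S0 ch' fin'.
exists F; split=> // a s a0 a1 sS sec; apply: le_trans (HF a s a0 a1 sS sec).
rewrite le_eqVlt; apply/orP; left; apply/eqP; congr (_ * _)%E; apply: eq_integral => xi _.
have [->|wn] := eqVneq (window b v a s xi) 0; first by rewrite !mulr0.
rewrite /h' /restr ifT// /A; have : b (dil v a s xi) != 0.
  by apply: contraNN wn => /eqP e; rewrite /window e mulr0.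
by move=> /bpos; rewrite /dil /= mulrCA pmulr_rgt0.
Qed.

Lemma forward_microlocal v (m : R) Om f g (x0 xi1 : R * R) b : is_distribution (V := P) Om f ->
  temperate g -> (exists r : R, 0 < r /\ forall psi, tst psi ->
    (forall x, r < mnorm (x - x0) -> psi x = 0) -> g psi = f psi) ->
  tst b -> gen_supp b -> (coswap v xi1).1 != 0 ->
  sobolev_microregular m Om f x0 xi1 -> sobolev_microregular m Om f x0 (- xi1) ->
  exists r1 : R, 0 < r1 /\ forall (F : R -> R -> R * R -> R[i]) (c0 r' : R), 0 <= c0 -> 0 < r' -> r' <= r1 ->
    (forall a s t, 0 < a -> a < 1 -> abs2 (F a s t) <= c0 * abs2 (g (molecule b v a s t))) ->
    (shearlet_integral m F ((coswap v xi1).2 / (coswap v xi1).1)%R x0 r' < +oo)%E.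
Proof.
(* The statement is symmetric in xi1 and - xi1, which have the same slope. *)
wlog z0 : xi1 / 0 < (coswap v xi1).1.
  move=> H df tg loc tb gb zn m1 m2; have [h|h] := ltP 0 (coswap v xi1).1; first exact: H.
  have e : coswap v (- xi1) = (- (coswap v xi1).1, - (coswap v xi1).2) by case: (v).
  have := H (- xi1); rewrite e /= oppr_gt0 lt_neqAle zn h oppr_eq0 opprK invrN mulrNN.
  by move=> /(_ isT); apply.
move=> df tg [rg [rg0 Hg]] tb gb zn m1 m2.
have [bp [bm [[tbp tbm] [gbp gbm] bE bpos bneg]]] := gen_sign_split hst tb gb.
have xn : xi1 != 0 by apply: contraNneq zn => ->; case: (v).
have xn' : - xi1 != 0 by rewrite oppr_eq0.
have e : coswap v (- xi1) = (- (coswap v xi1).1, - (coswap v xi1).2) by case: (v).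
have bp1 eta : bp eta != 0 -> 0 < (coswap v xi1).1 * eta.1 by move=> /bpos h; rewrite mulr_gt0.
have bm1 eta : bm eta != 0 -> 0 < (coswap v (- xi1)).1 * eta.1.
  by move=> /bneg h; rewrite e /= nmulr_rgt0// oppr_lt0.
have [fp [hp [rp [rhop [[rp0 rhop0] tfp agp repp Fp]]]]] := half_majorant df tbp gbp xn bp1 m1.
have [fm [hm [rm [rhom [[rm0 rhom0] tfm agm repm Fm]]]]] := half_majorant df tbm gbm xn' bm1 m2.
(* Within 3 r of x0, the functional g and the two localizations all agree with f. *)
pose r := Num.min rg (Num.min rp rm) / 3; pose rho := Num.min rhop rhom.
have r0 : 0 < r by rewrite divr_gt0// !lt_min rg0 rp0.
have rho0 : 0 < rho by rewrite lt_min rhop0.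
have r3 : 3 * r = Num.min rg (Num.min rp rm) by rewrite /r mulrC divfK.
have rgE : 3 * r <= rg by rewrite r3 ge_min lexx.
have rpE : 3 * r <= rp by rewrite r3 !ge_min lexx orbT.
have rmE : 3 * r <= rm by rewrite r3 !ge_min lexx !orbT.
have s1E : (coswap v (- xi1)).2 / (coswap v (- xi1)).1 = (coswap v xi1).2 / (coswap v xi1).1.
  by rewrite e /= invrN mulrNN.
have hFp := Fp rho (_ : rho <= rhop); have hFm := Fm rho (_ : rho <= rhom).
rewrite /= s1E in hFm.
apply: (forward_bound hst rho0 r0 tbp tbm gbp gbm bE tg tfp tfm _ _ repp repm (hFp _) (hFm _)).
- move=> psi tpsi pz; rewrite (Hg psi tpsi); last by move=> x h; apply: pz; exact: le_lt_trans rgE h.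
  by rewrite (agp psi tpsi)// => x h; apply: pz; exact: le_lt_trans rpE h.
- move=> psi tpsi pz; rewrite (Hg psi tpsi); last by move=> x h; apply: pz; exact: le_lt_trans rgE h.
  by rewrite (agm psi tpsi)// => x h; apply: pz; exact: le_lt_trans rmE h.
- by rewrite ge_min lexx.
- by rewrite ge_min lexx orbT.
Qed.

(** For a cutoff phi supported where g and f agree, [interchange] says that [Ftr g phi] is the
    Fourier transform of phi f; a narrow cone lies in the sector of finite energy. *)
Lemma backward_microlocal v (m : R) Om f g (x0 xi1 : R * R) : open Om -> Om x0 ->
  temperate g -> (exists r : R, 0 < r /\ forall psi, tst psi ->
    (forall x, r < mnorm (x - x0) -> psi x = 0) -> g psi = f psi) ->
  (coswap v xi1).1 != 0 -> concentrated g x0 v ((coswap v xi1).2 / (coswap v xi1).1) (2 * m) ->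
  sobolev_microregular m Om f x0 xi1.
Proof.
move=> oO Ox0 tg [rg [rg0 Hg]] zn [rho [de [rho0 de0 Hc]]].
have xn : xi1 != 0 by apply: contraNneq zn => ->; case: (v).
have [rO [rO0 HO]] : exists r : R, 0 < r /\ forall x : R * R, mnorm (x - x0) <= r -> Om x.
  by apply: near_box; exact: open_nbhs_nbhs.
pose r := Num.min rg (Num.min de rO) / 3.
have r0 : 0 < r by rewrite divr_gt0// !lt_min rg0 de0.
have r3 : 3 * r = Num.min rg (Num.min de rO) by rewrite /r mulrC divfK.
have rgE : 3 * r <= rg by rewrite r3 ge_min lexx.
have deE : 3 * r <= de by rewrite r3 !ge_min lexx orbT.
have rOE : 3 * r <= rO by rewrite r3 !ge_min lexx !orbT.
pose phi := cut st x0 r; have tphi : tst phi by exact: cut_tst.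
have phiz (x : R * R) : 3 * r < mnorm (x - x0) -> phi x = 0 by move=> h; rewrite /phi cut0// ltW.
have fin : (sector_energy v ((coswap v xi1).2 / (coswap v xi1).1) rho (2 * m) (Ftr g phi) < +oo)%E.
  by apply: Hc => // x h; apply: phiz; exact: le_lt_trans h.
have [eps [he Hcone]] := cone_sub_sector xn zn rho0.
exists phi, eps, (Ftr g phi); split=> //.
- split.
    apply: (tst_test_function tphi _ HO) => x; apply: contraNT; rewrite -ltNge => h.
    by apply/eqP; apply: phiz; exact: le_lt_trans h.
  apply: filterS (near_mnorm_lt (x0 := x0) (x := x0) (r := r) _); last first.
    by rewrite subrr mnormE /= normr0 maxxx.
  by move=> x xr; rewrite /phi cut1// ltW.
- move=> eta /schP seta; have me := sch_moments seta.
  split; first exact: moments_cint (moments_Ftr tg tphi me).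
  rewrite -(interchange tg tphi me) /fourier_distr2 /mul_distr Hg//.
    exact: tstM tphi (csmooth_fourier2 me).
  by move=> x h; rewrite phiz ?mul0r//; exact: le_lt_trans h.
set s1 := _ / _ in fin Hcone.
pose X (xi : T2) : R := if sector v s1 rho xi then wt xi `^ (2 * m) * abs2 (Ftr g phi xi) else 0.
have X0 xi : 0 <= X xi by rewrite /X; case: ifP => // _; rewrite mulr_ge0 ?powR_ge0 ?abs2_ge0.
have mX : measurable_fun setT (X : T2 -> T1).
  apply: measurable_fun_ifT; [exact: measurable_sector| |exact: measurable_cst].
  by apply: measurable_funM; [exact: measurable_wt_powR|exact: measurable_abs2 (cmeas_Ftr tg tphi)].
apply: (@le_lt_trans _ _ (\int[leb2]_xi (4 `^ `|m| * X xi)%:E)%E).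
  apply: ge0_le_integral_any => // xi; rewrite ?lee_fin.
  - by move=> _; rewrite mulr_ge0 ?powR_ge0 ?abs2_ge0.
  - by move=> _; rewrite mulr_ge0 ?powR_ge0.
  move=> /Hcone sx; rewrite /X sx mulrA ler_wpM2r ?abs2_ge0//.
  exact: (weight_comparable m xi).2.
rewrite (ge0_integral_scale leb2 (powR_ge0 _ _) mX X0).
by apply: lte_mul_pinfty => //; rewrite lee_fin powR_ge0.
Qed.

End microlocal.

Theorem theorem3 (R : realType)
  (psi1 psi2 psi1h psi2h : R -> R[i]) (psi : R * R -> R[i])
  (hpsi1 : shearlet_C1 psi1 psi1h)
  (hpsi2 : shearlet_C2 psi2 psi2h)
  (hpsi : shearlet_psi psi1h psi2h psi)
  (m : R) (Om : set (R * R)) (Om_open : open Om) (Om_neq0 : Om !=set0)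
  (xi0 : R * R) (xi0_neq0 : xi0 != 0)
  (f : (R * R -> R[i]) -> R[i])
  (hf : is_distribution (V := (R^o * R^o)%type) Om f)
  (f_real : real_distribution (V := (R^o * R^o)%type) Om f)
  (x0 : R * R) (hx0 : sing_supp Om f x0)
  (g : (R * R -> R[i]) -> R[i])
  (hg : tempered_version (V := (R^o * R^o)%type) Om x0 f g) :
  (~ WF m Om f (x0, xi0) /\ ~ WF m Om f (x0, - xi0)) <->
  (exists r0 : R, 0 < r0 /\
    ((`|slope xi0| < 2%:E)%E ->
       (shearlet_integral m (SH psi g) (fine (slope xi0)) x0 r0 < +oo)%E) /\
    ((2^-1%:E < `|slope xi0|)%E ->
       (shearlet_integral m (SHv psi g) (slope_inv (slope xi0)) x0 r0
          < +oo)%E)).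
Proof.
have [Ox0 _] := hx0.
have [_ ip1 im1 t1 c1] := hpsi1; have [_ i2 t2 c2] := hpsi2; have [_ cr ci fpsi] := hpsi.
have [st hst] := smooth_step_exists t2 i2 c2.
have [/csmooth_onP sm1 _ _] := t1; have [/csmooth_onP sm2 _ _] := t2.
have supp1 x : psi1h x != 0 -> 2^-1 <= `|x| <= 2.
  move=> h; have : (`[-2, - 2^-1] `|` `[2^-1, 2])%classic x by apply: c1; exact: subset_closure.
  case; rewrite /= in_itv/= => /andP[l1 l2].
    by rewrite ler0_norm; [apply/andP; split; lra|lra].
  by rewrite ger0_norm; [apply/andP; split; lra|lra].
have supp2 x : psi2h x != 0 -> `|x| <= 1.
  move=> h; have : `[-1, 1]%classic x by apply: c2; exact: subset_closure.
  by rewrite /= in_itv/= ler_norml.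
pose b := shearlet_gen psi1h psi2h.
have tb : tst b by exact: (tst_shearlet_gen hst).
have gb : gen_supp b by exact: shearlet_gen_supp.
have [q0 nq0] : exists q0, psi2h q0 != 0.
  apply/not_existsP => H; have : (\int[leb1]_x (abs2 (psi2h x))%:E = 0)%E.
    by apply: integral0_eq => x _; have /negP/negPn/eqP -> := H x; rewrite /abs2 /= expr0n addr0.
  by rewrite i2 => -[/eqP]; rewrite oner_eq0.
(* The normalization in (C1) gives psi1h some mass on each half-line, so the windows see both signs
   of frequency. *)
have posA (sg : R) : (\int[leb1]_(a in `]0%R, +oo[) (abs2 (psi1h (sg * a)%R) / a)%:E = 1)%E ->
    exists A, 0 < A /\ psi1h (sg * A) != 0.
  move=> I; apply/not_existsP => H.
  have : (\int[leb1]_(a in `]0%R, +oo[) (abs2 (psi1h (sg * a)%R) / a)%:E = 0)%E.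
    apply: integral0_eq => a; rewrite /= in_itv/= andbT => a0.
    have /eqP -> : psi1h (sg * a) == 0 by apply/negPn/negP => h; exact: (H a).
    by rewrite /abs2 /= expr0n addr0 mul0r.
  by rewrite I => -[/eqP]; rewrite oner_eq0.
have gp : gen_pos b 1.
  have [|A [A0 nA]] := posA 1.
    by rewrite -[RHS]ip1; apply: eq_integral => a _; rewrite mul1r.
  by apply: (shearlet_gen_pos hst sm1 sm2 supp1 supp2 (normr1 R) A0 nA nq0).
have gm : gen_pos b (-1).
  have [|A [A0 nA]] := posA (-1).
    by rewrite -[RHS]im1; apply: eq_integral => a _; rewrite mulN1r.
  have n1 : `|-1| = 1 :> R by rewrite normrN normr1.
  by apply: (shearlet_gen_pos hst sm1 sm2 supp1 supp2 n1 A0 nA nq0).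
have [kap [k0 inv _]] := cut_kappa hst.
have tb0 := tst_shearlet_prod hst sm1 sm2 supp1 supp2.
have psiE := fourier_representative hst inv cr ci fpsi tb0.
have [tg loc] := tempered_version_local Om_open Ox0 hf hg.
(* The shearlet and molecule coefficients differ by the factor 1 / kap, so each bounds the other; v
   selects the horizontal or the vertical transform. *)
pose F (v : bool) := if v then SHv psi g else SH psi g.
have FE v a s t : 0 < a -> a < 1 -> F v a s t = (kap^-1)%:C * g (molecule b v a s t).
  move=> a0 a1; rewrite -(temperateZ _ tg (sch_molecule v s t tb a0 a1)).
  transitivity (pairing (V := (R^o * R^o)%type) g (if v then vshearlet psi a s t else shearlet psi a s t)).
    by rewrite /F; case: (v).
  rewrite /pairing; congr g; apply/funext => x.
  exact: shearlet_molecule k0 tb0 psiE a0 a1.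
have absE v a s t : 0 < a -> a < 1 -> abs2 (F v a s t) = kap^-1 ^+ 2 * abs2 (g (molecule b v a s t)).
  move=> a0 a1; rewrite FE// abs2M; congr (_ * _).
  by rewrite /abs2 /= expr0n addr0.
have upper v a s t : 0 < a -> a < 1 -> abs2 (F v a s t) <= kap^-1 ^+ 2 * abs2 (g (molecule b v a s t)).
  by move=> a0 a1; rewrite absE.
have lower v a s t : 0 < a -> a < 1 -> abs2 (g (molecule b v a s t)) <= kap ^+ 2 * abs2 (F v a s t).
  move=> a0 a1; rewrite absE// mulrA -exprMn mulfV ?gt_eqF// expr1n mul1r.
  by [].
have WFE xi : xi != 0 -> ~ WF m Om f (x0, xi) <-> sobolev_microregular m Om f x0 xi.
  move=> xn; split=> [H|H [_ _ /=]]; last by [].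
  by apply: contrapT => nm; apply: H; split.
have xN0 : - xi0 != 0 by rewrite oppr_eq0.
have WFp := WFE _ xi0_neq0; have WFm := WFE _ xN0.
have k20 : 0 <= kap^-1 ^+ 2 by exact: sqr_ge0.
have k2p : 0 < kap ^+ 2 by rewrite exprn_gt0.
have horiz : (`|slope xi0| < 2%:E)%E -> xi0.1 != 0 /\ fine (slope xi0) = xi0.2 / xi0.1.
  by rewrite slopeE//; case: eqP.
(* At infinite slope [slope_inv] is 0 by convention, which is xi0.1 / xi0.2 since then xi0.1 = 0. *)
have vert : (2^-1%:E < `|slope xi0|)%E -> xi0.2 != 0 /\ slope_inv (slope xi0) = xi0.1 / xi0.2.
  rewrite slopeE//; case: eqP => [x10 _|/eqP x1]; rewrite /=.
    split; last by rewrite x10 mul0r.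
    by apply: contraNneq xi0_neq0 => x20; rewrite [xi0]surjective_pairing x10 x20.
  rewrite lte_fin => h; split; last by rewrite invf_div.
  by apply: contraTneq h => ->; rewrite mul0r normr0 -leNgt invr_ge0.
split=> [[/WFp mp /WFm mm]|[r0 [r00 [H1 H2]]]].
  have fwd v : (coswap v xi0).1 != 0 -> exists r1 : R, 0 < r1 /\ forall r', 0 < r' -> r' <= r1 ->
      (shearlet_integral m (F v) ((coswap v xi0).2 / (coswap v xi0).1)%R x0 r' < +oo)%E.
    move=> zn; have [r1 [r10 H]] := forward_microlocal hst hf tg loc tb gb zn mp mm.
    by exists r1; split=> // r' r'0 r'1; apply: (H (F v) _ r' k20 r'0 r'1) => a s t; exact: upper.
  have [rh [rh0 Hh]] : exists r1 : R, 0 < r1 /\ forall r', 0 < r' -> r' <= r1 ->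
      (`|slope xi0| < 2%:E)%E -> (shearlet_integral m (SH psi g) (fine (slope xi0)) x0 r' < +oo)%E.
    have [/horiz[x1 ->]|nh] := pselect (`|slope xi0| < 2%:E)%E; last by exists 1.
    by have [r1 [r10 H]] := fwd false x1; exists r1; split=> // r' r'0 r'1 _; exact: H.
  have [rv [rv0 Hv]] : exists r1 : R, 0 < r1 /\ forall r', 0 < r' -> r' <= r1 ->
      (2^-1%:E < `|slope xi0|)%E ->
      (shearlet_integral m (SHv psi g) (slope_inv (slope xi0)) x0 r' < +oo)%E.
    have [/vert[x2 ->]|nv] := pselect (2^-1%:E < `|slope xi0|)%E; last by exists 1.
    by have [r1 [r10 H]] := fwd true x2; exists r1; split=> // r' r'0 r'1 _; exact: H.
  (* Each integral is finite for all small enough radii, so the smaller radius serves both. *)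
  exists (Num.min rh rv); have r0 : 0 < Num.min rh rv by rewrite lt_min rh0.
  by split=> //; split; [apply: Hh => //; rewrite ge_min lexx|apply: Hv => //; rewrite ge_min lexx orbT].
have bwd v : (coswap v xi0).1 != 0 ->
    (shearlet_integral m (F v) ((coswap v xi0).2 / (coswap v xi0).1)%R x0 r0 < +oo)%E ->
    sobolev_microregular m Om f x0 xi0 /\ sobolev_microregular m Om f x0 (- xi0).
  move=> zn fin; have cc := concentrated_of_shearlets hst tg tb gb gp gm r00 k2p (lower v) fin.
  have e : coswap v (- xi0) = (- (coswap v xi0).1, - (coswap v xi0).2) by case: (v).
  split; first exact: (backward_microlocal hst Om_open Ox0 tg loc zn cc).
  apply: (backward_microlocal (v := v) hst Om_open Ox0 tg loc).
    by rewrite e /= oppr_eq0.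
  by rewrite e /= invrN mulrNN.
suff micro : sobolev_microregular m Om f x0 xi0 /\ sobolev_microregular m Om f x0 (- xi0).
  exact: (conj (WFp.2 micro.1) (WFm.2 micro.2)).
(* The two ranges of slopes cover all directions: beyond slope 2, the vertical transform takes
   over. *)
have [hh|nh] := pselect (`|slope xi0| < 2%:E)%E.
  by have [x1 e] := horiz hh; apply: (bwd false x1); rewrite -[X in shearlet_integral _ _ X]e; exact: H1.
have hv : (2^-1%:E < `|slope xi0|)%E.
  apply: (@lt_le_trans _ _ 2%:E); first by rewrite lte_fin; lra.
  by rewrite leNgt; apply/negP.
by have [x2 e] := vert hv; apply: (bwd true x2); rewrite -[X in shearlet_integral _ _ X]e; exact: H2.
Qed.
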